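(* Let $d\in\{2,3\}$ and $Q=(0,1)^d$. Let $\mathcal{C}=\{c\}$ where $c$ is one of the corners of $Q$; let $\mathcal{E}$ be the set of edges of $Q$ adjacent to $c$ if $d=3$, and $\mathcal{E}=\emptyset$ if $d=2$. Let $C_f,A_f>0$ and let $\underline{\gamma}=\{\gamma_c\}$ with $\gamma_c>1$ if $d=2$, respectively $\underline{\gamma}=\{\gamma_c,\gamma_e:e\in\mathcal{E}\}$ with $\gamma_c>3/2$ and $\gamma_e>1$ for all $e\in\mathcal{E}$ if $d=3$. Then for every $f\in\mathcal{J}^\varpi_{\underline{\gamma}}(Q;\mathcal{C},\mathcal{E};C_f,A_f)$ and every $0<\epsilon<1$ there exists a ReLU neural network $\Phi_{\epsilon,f}$ such that $\|f-\mathrm{R}(\Phi_{\epsilon,f})\|_{H^1(Q)}\le\epsilon$. In addition, as $\epsilon\to0$: $\|\mathrm{R}(\Phi_{\epsilon,f})\|_{L^\infty(Q)}=\mathcal{O}(|\log\epsilon|^{2d})$, $\mathrm{size}(\Phi_{\epsilon,f})=\mathcal{O}(|\log\epsilon|^{2d+1})$ and $\mathrm{depth}(\Phi_{\epsilon,f})=\mathcal{O}(|\log\epsilon|\log(|\log\epsilon|))$.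
   Context: Neural networks: a NN $\Phi$ with input dimension $d$ and $L$ layers is $((A_1,b_1),\dots,(A_L,b_L))$, $A_\ell\in\mathbb{R}^{N_\ell\times N_{\ell-1}}$, $b_\ell\in\mathbb{R}^{N_\ell}$, $N_0=d$; its realization $\mathrm{R}(\Phi)$ maps $x$ to $x_L$ with $x_0=x$, $x_\ell=\varrho(A_\ell x_{\ell-1}+b_\ell)$ ($\ell<L$), $x_L=A_Lx_{L-1}+b_L$, $\varrho(t)=\max\{0,t\}$ componentwise; $\mathrm{depth}(\Phi)=L$, $\mathrm{size}(\Phi)$ = number of nonzero entries of all $A_\ell,b_\ell$. Weighted analytic class: for $c\in\mathcal{C}$, $e\in\mathcal{E}$ let $r_c(x)=|x-c|$, $r_e(x)=\mathrm{dist}(x,e)$, $\rho_{ce}=r_e/r_c$. Fix small $\hat\varepsilon>0$. If $d=3$: $\Omega_e=\{x\in Q:r_e<\hat\varepsilon, r_c>\hat\varepsilon\ \forall c\}$, $\Omega_c=\{x\in Q:r_c<\hat\varepsilon,\rho_{ce}>\hat\varepsilon\ \forall e\}$, $\Omega_{ce}=\{x\in Q:r_c<\hat\varepsilon,\rho_{ce}<\hat\varepsilon\}$; if $d=2$: $\Omega_c=\{x\in Q:r_c<\hat\varepsilon\}$. $\Omega_0=Q$ minus the closure of the union of all these sets. For an edge $e$ and $\alpha\in\mathbb{N}_0^3$, $\alpha_\parallel$ keeps only the component in the direction of $e$, $\alpha_\perp=\alpha-\alpha_\parallel$; $(x)_+=\max\{0,x\}$. $\mathcal{J}^\varpi_{\underline{\gamma}}(Q;\mathcal{C},\mathcal{E};C,A)$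 is the set of $v\in L^2(Q)$ such that for all $k\in\mathbb{N}_0$: $\sum_{|\alpha|=k}\|\partial^\alpha v\|_{L^2(\Omega_0)}\le CA^kk!$, $\sum_{|\alpha|=k}\|r_c^{(|\alpha|-\gamma_c)_+}\partial^\alpha v\|_{L^2(\Omega_c)}\le CA^kk!$ ($c\in\mathcal{C}$), $\sum_{|\alpha|=k}\|r_e^{(|\alpha_\perp|-\gamma_e)_+}\partial^\alpha v\|_{L^2(\Omega_e)}\le CA^kk!$ ($e\in\mathcal{E}$), $\sum_{|\alpha|=k}\|r_c^{(|\alpha|-\gamma_c)_+}\rho_{ce}^{(|\alpha_\perp|-\gamma_e)_+}\partial^\alpha v\|_{L^2(\Omega_{ce})}\le CA^kk!$ ($c\in\mathcal{C}$, $e\in\mathcal{E}$ abutting $c$). *)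

(* Defs.v *)
From HB Require Import structures.
From mathcomp Require Import all_boot all_order all_algebra.
From mathcomp Require Import all_classical all_reals all_analysis.

Set Implicit Arguments.
Unset Strict Implicit.
Unset Printing Implicit Defensive.

Import Order.TTheory GRing.Theory Num.Theory.
Import numFieldNormedType.Exports.
Local Open Scope ring_scope.
Local Open Scope classical_set_scope.

Inductive NN (R : Type) : nat -> nat -> Type :=
| NNlast (n0 n1 : nat) (A : 'M[R]_(n1, n0)) (b : 'cV[R]_n1) : NN R n0 n1
| NNcons (n0 n1 n2 : nat) (A : 'M[R]_(n1, n0)) (b : 'cV[R]_n1)
    (rest : NN R n1 n2) : NN R n0 n2.

Section NeuralNetworks.
Variable R : realType.

Definition relu_vec (m : nat) (x : 'cV[R]_m) : 'cV[R]_m :=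
  map_mx (fun t => Num.max 0 t) x.

Fixpoint realize (n0 n2 : nat) (Phi : NN R n0 n2) : 'cV[R]_n0 -> 'cV[R]_n2 :=
  match Phi in NN _ a b return 'cV[R]_a -> 'cV[R]_b with
  | NNlast _ _ A b => fun x => A *m x + b
  | NNcons _ _ _ A b rest => fun x => realize rest (relu_vec (A *m x + b))
  end.

Fixpoint nn_depth (n0 n2 : nat) (Phi : NN R n0 n2) : nat :=
  match Phi with
  | NNlast _ _ _ _ => 1
  | NNcons _ _ _ _ _ rest => (nn_depth rest).+1
  end.

Definition nnz_mx (m k : nat) (A : 'M[R]_(m, k)) : nat :=
  #|[pred ij : 'I_m * 'I_k | A ij.1 ij.2 != 0]|.

Fixpoint nn_size (n0 n2 : nat) (Phi : NN R n0 n2) : nat :=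
  match Phi with
  | NNlast _ _ A b => (nnz_mx A + nnz_mx b)%N
  | NNcons _ _ _ A b rest => (nnz_mx A + nnz_mx b + nn_size rest)%N
  end.

Definition realize1 (n : nat) (Phi : NN R n 1) (x : 'rV[R]_n) : R :=
  realize Phi x^T 0 0.

End NeuralNetworks.

(* Analysis on R^n.  Points of R^n are row vectors 'rV[R]_n.  Lebesgue       *)
(* measure on R^n is represented by a (product) measure [mu] on a measurable *)
(* type [P] together with the coordinate bijection [toV : P -> 'rV_n];       *)
(* integrals over D of F : 'rV_n -> _ are integrals of F \o toV over         *)
(* toV @^-1` D.  It is instantiated below with the product Lebesgue measures *)
(* on R * R (n = 2) and (R * R) * R (n = 3).                                 *)
Section Analysis.
Variable R : realType.
Context {d0 : measure_display} {P : measurableType d0}.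
Variable mu : {measure set P -> \bar R}.
Variable n : nat.
Variable toV : P -> 'rV[R]_n.

Local Notation V := 'rV[R]_n.

Definition eucl (x : V) : R := Num.sqrt (\sum_i (x 0 i) ^+ 2).

Definition cube : set V := [set x | forall i, 0 < x 0 i < 1].

Definition is_corner (c : V) : Prop := forall i, c 0 i = 0 \/ c 0 i = 1.

Definition partial (i : 'I_n) (phi : V -> R) : V -> R :=
  fun x => 'D_(delta_mx 0 i) phi x.

Definition partials (s : seq 'I_n) (phi : V -> R) : V -> R :=
  foldr partial phi s.

Definition mabs (alpha : 'I_n -> nat) : nat := (\sum_i alpha i)%N.

Definition mderiv (alpha : 'I_n -> nat) (phi : V -> R) : V -> R :=
  partials (flatten [seq nseq (alpha i) i | i <- enum 'I_n]) phi.

Definition smooth (phi : V -> R) : Prop :=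
  forall (s : seq 'I_n) (x : V), differentiable (partials s phi) x.

Definition test_fun (Om : set V) (phi : V -> R) : Prop :=
  smooth phi /\
  exists K : set V, [/\ compact K, K `<=` Om & forall x, ~ K x -> phi x = 0].

Definition measurable_on (Om : set V) (g : V -> R) : Prop :=
  measurable_fun (toV @^-1` Om) (g \o toV).

Definition loc_integrable (Om : set V) (g : V -> R) : Prop :=
  measurable_on Om g /\
  forall K : set V, compact K -> K `<=` Om ->
    mu.-integrable (toV @^-1` K) (EFin \o (g \o toV)).

Definition integ (Om : set V) (g : V -> R) : \bar R :=
  (\int[mu]_(p in toV @^-1` Om) (g (toV p))%:E)%E.

Definition weak_deriv (Om : set V) (v : V -> R) (alpha : 'I_n -> nat)
    (g : V -> R) : Prop :=
  [/\ loc_integrable Om v, loc_integrable Om g &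
   forall phi, test_fun Om phi ->
     integ Om (fun x => v x * mderiv alpha phi x) =
     (((-1) ^+ mabs alpha)%:E * integ Om (fun x => (g x * phi x)%R))%E ].

Definition L2 (Om : set V) (g : V -> R) : Prop :=
  measurable_on Om g /\ (integ Om (fun x => (g x ^+ 2)%R) < +oo)%E.

Definition wL2norm (Om : set V) (w g : V -> R) : \bar R :=
  Lnorm mu 2%:E (fun p => (\1_(toV @^-1` Om) p * (w (toV p) * g (toV p)))%:E).

Definition unit_mi (i : 'I_n) : 'I_n -> nat := fun j => nat_of_bool (j == i).

Definition H1_le (Om : set V) (g : V -> R) (eps : R) : Prop :=
  L2 Om g /\
  exists G : 'I_n -> V -> R,
    (forall i, weak_deriv Om g (unit_mi i) (G i)) /\
    (integ Om (fun x => (g x ^+ 2)%R) +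
       \sum_i integ Om (fun x => (G i x ^+ 2)%R)
       <= (eps ^+ 2)%:E)%E.

Variable E : finType.
Variable edge : E -> set V.
Variable edir : E -> 'I_n. (* direction (coordinate axis) of the edge *)

Definition r_c (c : V) (x : V) : R := eucl (x - c).
Definition r_e (e : E) (x : V) : R := inf [set eucl (x - y) | y in edge e].
Definition rho_ce (c : V) (e : E) (x : V) : R := r_e e x / r_c c x.

Definition Om_c (eh : R) (c : V) : set V :=
  [set x | cube x /\ r_c c x < eh /\ forall e, eh < rho_ce c e x].
Definition Om_e (eh : R) (c : V) (e : E) : set V :=
  [set x | cube x /\ r_e e x < eh /\ eh < r_c c x].
Definition Om_ce (eh : R) (c : V) (e : E) : set V :=
  [set x | cube x /\ r_c c x < eh /\ rho_ce c e x < eh].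
Definition Om_0 (eh : R) (c : V) : set V :=
  cube `\` closure (Om_c eh c `|` \bigcup_(e in [set: E]) Om_e eh c e
                    `|` \bigcup_(e in [set: E]) Om_ce eh c e).

Definition pos_part (t : R) : R := Num.max 0 t.

Definition mabs_perp (e : E) (alpha : 'I_n -> nat) : nat :=
  (mabs alpha - alpha (edir e))%N.

Definition sum_mi (k : nat) (F : ('I_n -> nat) -> \bar R) : \bar R :=
  (\sum_(a : {ffun 'I_n -> 'I_k.+1} | (\sum_i (a i : nat))%N == k)
     F (fun i => (a i : nat)))%E.

Definition Jclass (eh : R) (c : V) (gc : R) (ge : E -> R) (C A : R)
    (v : V -> R) : Prop :=
  L2 cube v /\
  exists D : ('I_n -> nat) -> V -> R,
    (forall alpha, weak_deriv cube v alpha (D alpha)) /\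
    forall k : nat,
      let bnd := (C * A ^+ k * k`!%:R)%:E in
      [/\ (sum_mi k (fun al => wL2norm (Om_0 eh c) (fun _ => 1%R) (D al))
             <= bnd)%E,
          (sum_mi k (fun al =>
             wL2norm (Om_c eh c)
               (fun x => (r_c c x `^ pos_part ((mabs al)%:R - gc))%R) (D al))
             <= bnd)%E,
          (forall e, sum_mi k (fun al =>
             wL2norm (Om_e eh c e)
               (fun x => (r_e e x `^ pos_part ((mabs_perp e al)%:R - ge e))%R)
               (D al)) <= bnd)%E &
          (forall e, sum_mi k (fun al =>
             wL2norm (Om_ce eh c e)
               (fun x => (r_c c x `^ pos_part ((mabs al)%:R - gc) *
                         rho_ce c e x `^ pos_part ((mabs_perp e al)%:R - ge e))%R)
               (D al)) <= bnd)%E].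

End Analysis.

Definition Thm43_statement (R : realType) {d0 : measure_display}
    {P : measurableType d0} (mu : {measure set P -> \bar R}) (n : nat)
    (toV : P -> 'rV[R]_n) (E : finType)
    (edges : 'rV[R]_n -> E -> set 'rV[R]_n) (edir : E -> 'I_n) (gc_min : R)
  : Prop :=
  forall c : 'rV[R]_n, is_corner c ->
  exists eh0 : R, 0 < eh0 /\
  forall eh : R, 0 < eh < eh0 ->
  forall (gc : R) (ge : E -> R) (Cf Af : R),
    0 < Cf -> 0 < Af -> gc_min < gc -> (forall e, 1 < ge e) ->
  forall f : 'rV[R]_n -> R,
    Jclass mu toV (edges c) edir eh c gc ge Cf Af f ->
  exists Phi : R -> NN R n 1,
    (forall eps : R, 0 < eps < 1 ->
       H1_le mu toV (@cube R n) (fun x => f x - realize1 (Phi eps) x) eps) /\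
    exists (K eps0 : R), 0 < eps0 /\
      forall eps : R, 0 < eps < eps0 ->
      [/\ forall x, cube x -> `|realize1 (Phi eps) x| <= K * `|ln eps| ^+ (2 * n),
          (nn_size (Phi eps))%:R <= K * `|ln eps| ^+ (2 * n).+1 &
          (nn_depth (Phi eps))%:R <= K * `|ln eps| * ln `|ln eps| ].

Section Instances.
Variable R : realType.

Definition leb2 := ((@lebesgue_measure R) \x (@lebesgue_measure R))%E.
Definition leb3 := (leb2 \x (@lebesgue_measure R))%E.

Definition toV2 (p : R * R) : 'rV[R]_2 :=
  \row_(i < 2) (if (i : nat) == 0%N then p.1 else p.2).
Definition toV3 (p : R * R * R) : 'rV[R]_3 :=
  \row_(i < 3) (if (i : nat) == 0%N then p.1.1
                else if (i : nat) == 1%N then p.1.2 else p.2).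

Definition no_edges (c : 'rV[R]_2) (e : void) : set 'rV[R]_2 := set0.
Definition no_edir (e : void) : 'I_2 := match e with end.

Definition edges3 (c : 'rV[R]_3) (i : 'I_3) : set 'rV[R]_3 :=
  [set y | 0 <= y 0 i <= 1 /\ forall j, j != i -> y 0 j = c 0 j].
Definition edir3 (i : 'I_3) : 'I_3 := i.

End Instances.

(* Main.v *)
(* Near the corner c write y_i = |x_i - c_i| and let mid y be the largest t such that all coordinates
   of y but one are at least t.  On boxes whose sides are small multiples of max(y_i, mid y) the weighted
   bounds control all derivatives of f in L^2 by C A^k k!; expanding in shifted Legendre polynomials
   turns this into pointwise bounds, |f| <= C and |grad f| <= C (mid y)^(de - 1) with de > 0, and shows
   that on every patch of the geometric mesh t_k = s^k tensor polynomials of degree N approximate f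
   and its gradient within 2^-N up to a power of the mesh size.  The patches with k_i <= l are glued with
   hat functions after clamping each y_i to [t_l, 1]; the strips y_i < t_l contribute O(t_l^de) to the
   H^1 error because (mid y)^2 >= y_1 ... y_d.  A ReLU network emulates the glued function by
   approximate multiplication: powers up to 2^q by repeated doubling, then tensor products.  With
   l, 2^q and the number m of layers per multiplication all of order |log eps|, the size is of order
   (l 2^q)^d m and the depth of order q m. *)
Require Import Defs.
From HB Require Import structures.
From mathcomp Require Import all_boot all_order all_algebra.
From mathcomp Require Import all_classical all_reals all_analysis.
From mathcomp Require Import measurable_realfun.
From mathcomp Require Import ring lra zify.
Set Implicit Arguments.
Unset Strict Implicit.
Unset Printing Implicit Defensive.
Import Order.TTheory GRing.Theory Num.Theory.
Import numFieldNormedType.Exports.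
Local Open Scope ring_scope.
Local Open Scope classical_set_scope.

(** * Lebesgue measure in coordinates *)

(** No smooth representative of f is ever constructed. Every statement about f holds almost
    everywhere, box by box; rational anchors keep the exceptional sets countable in number, and
    comparisons between polynomials pass from almost everywhere to everywhere by continuity. The
    weights, which differ from region to region, are first traded for one weight in M, the largest
    y_i, and m = mid y. All exponents are lowered to gamma_c = gmin + de and gamma_e = 1 + de with a
    single de in (0, 1/4]. From order two on these exponents compensate exactly the square root of
    the box volume that separates an L^2 bound from a pointwise one; bounds of order one and zero
    are then integrated from far away towards the corner. Across a thin strip the clamped
    approximant is constant, so only |grad f| <= C m^(de - 1) matters there, and its square is
    dominated by a product of integrable functions of one variable. Gradients of the network must be
    accurate too. Emulation errors are therefore measured together with Lipschitz constants along
    coordinate lines, and all intermediate values stay in [0, 1]; each multiplication then costs a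
    factor 6. *)

Section LebesgueModel.
Context {R : realType} {d : measure_display} {P : measurableType d}.

Definition below n (toV : P -> 'rV[R]_n) (b : 'I_n -> R) : set P :=
  [set p | forall i, toV p 0 i < b i].

(* [mu] is a copy, through the coordinates [toV], of Lebesgue measure on R^n. *)
Record leb_like (mu : {measure set P -> \bar R}) n (toV : P -> 'rV[R]_n) : Prop := LebLike {
  leb_meas : forall i, measurable_fun setT (fun p => toV p 0 i);
  leb_gen : @measurable _ P `<=` <<s [set A | exists b, A = below toV b] >>;
  leb_prod : forall (psi : 'I_n -> R -> R) (c : 'I_n -> R),
    (forall i, measurable_fun setT (psi i)) -> (forall i t, 0 <= psi i t) ->
    (forall i, \int[lebesgue_measure]_t (psi i t)%:E = (c i)%:E)%E ->
    (\int[mu]_p (\prod_i psi i (toV p 0%R i))%:E = (\prod_i c i)%:E)%E;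
  leb_shift : forall i (t : R), exists sh : P -> P,
    [/\ measurable_fun setT sh, forall p, toV (sh p) = toV p + t *: delta_mx 0 i &
     forall F : P -> \bar R, measurable_fun setT F -> (forall p, 0 <= F p)%E ->
       (\int[mu]_p F (sh p) = \int[mu]_p F p)%E] }.

End LebesgueModel.

Section LebesgueStep.
Context {R : realType}.

Lemma lebesgue_translation (t : R) (F : R -> \bar R) :
  measurable_fun setT F -> (forall x, 0 <= F x)%E ->
  (\int[lebesgue_measure]_x F (x + t)%R = \int[lebesgue_measure]_x F x)%E.
Proof.
move=> mF F0.
have mt : measurable_fun [set: measurableTypeR R]
  ((fun x => x + t) : _ -> measurableTypeR R).
  by apply: measurable_funD => //; exact: measurable_cst.
have := @ge0_integral_pushforward _ _ _ _ R _ mt lebesgue_measure setT F measurableT mF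
  (fun y _ => F0 y).
rewrite preimage_setT => <-.
apply: eq_measure_integral => //= A mA _; apply/esym.
apply: lebesgue_measure_unique => //= _ [[a b]] _ <-.
rewrite /pushforward /=.
rewrite [X in _ = lebesgue_measure X](_ : _ = `]a - t, b - t]); last first.
  have E (x : R) : (a < x + t <= b) = (a - t < x <= b - t) by rewrite ltrBlDr lerBrDr.
  by apply/seteqP; split => x; rewrite /= !in_itv/= E.
rewrite /= !lebesgue_measure_itv/= !lte_fin ltrD2r -!EFinD; case: ifP => // _.
by congr (_%:E); ring.
Qed.

Lemma leb_like1 (toV : R -> 'rV[R]_1) : (forall x, toV x 0 0 = x) ->
  leb_like (@lebesgue_measure R) toV.
Proof.
move=> toVE.
have E i x : toV x 0 i = x by rewrite (ord1 i).
split.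
- by move=> i; rewrite (_ : (fun _ => _) = id) //; apply/funext => x; exact: E.
- move=> A mA.
  have := mA; rewrite [measurable](@RGenInftyO.measurableE R).
  apply: sub_smallest2r; first exact: smallest_sigma_algebra.
  move=> _ [x ->] /=; exists (fun=> x).
  apply/seteqP; split => y /=; rewrite in_itv/=.
    by move=> xy i; rewrite E.
  by move/(_ 0); rewrite E.
- move=> psi c _ _ hc; rewrite big_ord1 -hc.
  by apply: eq_integral => x _; rewrite big_ord1 E.
- move=> i t; exists (fun x => x + t); split.
  + exact: measurable_funD.
  + by move=> p; apply/rowP => j; rewrite !mxE !E (ord1 i) (ord1 j) !eqxx mulr1.
  + by move=> F mF F0; exact: lebesgue_translation.
Qed.

End LebesgueStep.

Lemma ordnS_split n (i : 'I_n.+1) :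
  i = ord_max \/ exists j, i = widen_ord (leqnSn n) j.
Proof.
have := ltn_ord i; rewrite ltnS leq_eqVlt => /orP[/eqP e|lt].
  by left; exact/val_inj.
by right; exists (Ordinal lt); exact/val_inj.
Qed.

Section Step.
Context {R : realType} d (P : measurableType d)
  (mu : {sigma_finite_measure set P -> \bar R}) n
  (toV : P -> 'rV[R]_n) (toV' : P * R -> 'rV[R]_n.+1).
Hypothesis ht : forall p i, toV' p 0 (widen_ord (leqnSn n) i) = toV p.1 0 i.
Hypothesis hl : forall p, toV' p 0 ord_max = p.2.

Lemma below_step (b : 'I_n -> R) (y : R) :
  exists b', below toV' b' = below toV b `*` [set x | x < y].
Proof.
exists (fun i => if insub (val i) is Some j then b j else y).
apply/seteqP; split => [p hb|p [h1 h2] i] /=.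
  split=> [i|] /=.
    move: (hb (widen_ord (leqnSn n) i)); rewrite ht.
    rewrite insubT //= => h; suff -> : Sub (val i) h = i by [].
    exact/val_inj.
  by move: (hb ord_max); rewrite hl insubF//= ltnn.
case: (ordnS_split i) => [->|[j ->]].
  by rewrite hl insubF//= ltnn.
rewrite ht insubT //= => h; rewrite (_ : Sub _ _ = j); first exact: h1.
exact/val_inj.
Qed.

(** A cylinder over [below toV b] has no bound on its last coordinate; it is exhausted by the sets
    whose last bound is a natural number k, and cylinders over the last factor are treated likewise.
    For each factor, the sets whose cylinder is generated form a sigma-algebra. *)
Lemma leb_gen_step : @measurable _ P `<=` <<s [set A | exists b, A = below toV b] >> ->
  @measurable _ (P * R)%type `<=` <<s [set A | exists b, A = below toV' b] >>.
Proof.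
move=> hg; set G := (X in <<s X >>).
have sG : sigma_algebra setT <<s G >> by exact: smallest_sigma_algebra.
have [s0 sC sU] := sG.
have sCC (A : set (P * R)) : <<s G >> A -> <<s G >> (~` A).
  by move=> /sC; rewrite setTD.
have sI (A B : set (P * R)) : <<s G >> A -> <<s G >> B -> <<s G >> (A `&` B).
  exact: (@measurableI _ (g_sigma_algebraType G)).
have big (y : R) : exists k : nat, y < k%:R.
  exists (Num.trunc `|y|).+1; apply: (le_lt_trans (ler_norm y)); exact: truncnS_gt.
have hA (A : set P) : measurable A -> <<s G >> (A `*` [set: R]).
  move=> /hg; apply: (@smallest_sub _ _ _ [set A | <<s G >> (A `*` [set: R])]).
    split => /=; first by rewrite set0X.
      move=> C hC /=; rewrite setTD (_ : _ `*` _ = ~` (C `*` setT)); first exact: sCC.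
      by apply/seteqP; split=> -[x y] /=; [case=> h _ [h' _]|move=> h; split=> //; apply: contra_not h].
    move=> F hF /=; rewrite (_ : _ `*` _ = \bigcup_k (F k `*` setT)); first exact: sU.
    apply/seteqP; split=> -[x y] /=; first by case=> -[k _ Fk] _; exists k.
    by case=> k _ [Fk _]; split=> //; exists k.
  move=> _ [b ->] /=.
  rewrite (_ : _ `*` _ = \bigcup_(k : nat) (below toV b `*` [set x | x < k%:R])).
    apply: sU => k; apply: sub_sigma_algebra.
    by have [b' <-] := below_step b k%:R; exists b'.
  apply/seteqP; split=> -[x y] /=; last by case=> k _ [].
  by case=> hx _; have [k hk] := big y; exists k.
have hB (B : set R) : measurable B -> <<s G >> ([set: P] `*` B).
  rewrite [measurable](@RGenInftyO.measurableE R).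
  apply: (@smallest_sub _ _ _ [set B | <<s G >> ([set: P] `*` B)]).
    split => /=; first by rewrite setX0.
      move=> C hC /=; rewrite setTD (_ : _ `*` _ = ~` (setT `*` C)); first exact: sCC.
      by apply/seteqP; split=> -[x y] /=; [case=> _ h [_ h']|move=> h; split=> //; apply: contra_not h].
    move=> F hF /=; rewrite (_ : _ `*` _ = \bigcup_k (setT `*` F k)); first exact: sU.
    apply/seteqP; split=> -[x y] /=; first by case=> _ -[k _ Fk]; exists k.
    by case=> k _ [_ Fk]; split=> //; exists k.
  move=> _ [b ->] /=.
  rewrite (_ : _ `*` _ = \bigcup_(k : nat) (below toV (fun=> k%:R) `*` [set x | x < b])).
    apply: sU => k; apply: sub_sigma_algebra.
    by have [b' <-] := below_step (fun=> k%:R) b; exists b'.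
  apply/seteqP; split=> -[x y] /=; last by case=> k _ [_ /=]; rewrite in_itv.
  rewrite in_itv/= => -[_ yb]; have [k hk] := big (\sum_i `|toV x 0 i|); exists k => //.
  split=> //= i; apply: le_lt_trans hk; apply: le_trans (ler_norm _) _.
  by rewrite (bigD1 i)//= lerDl; apply: sumr_ge0.
rewrite measurable_prod_measurableType; apply: smallest_sub => // _ [A mA [B mB <-]].
rewrite (_ : A `*` B = (A `*` setT) `&` (setT `*` B)); last first.
  by apply/seteqP; split=> -[x y] /=; [case=> ? ?; split|case=> -[? _] [_ ?]; split].
by apply: sI; [exact: hA|exact: hB].
Qed.

(** Tonelli separates the new last coordinate from the others; for translations the order of
    integration is chosen so that the translated factor is integrated first. *)
Lemma leb_like_step : leb_like mu toV -> leb_like (mu \x @lebesgue_measure R)%E toV'.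
Proof.
move=> [hm hg hp hs]; split.
- move=> i; case: (ordnS_split i) => [->|[j ->]].
    rewrite (_ : (fun _ => _) = snd); first exact: measurable_snd.
    by apply/funext => p; rewrite hl.
  rewrite (_ : (fun _ => _) = (fun p => toV p 0 j) \o fst).
    by apply: measurableT_comp => //; exact: hm.
  by apply/funext => p; rewrite ht.
- exact: leb_gen_step.
- move=> psi c mpsi p0 pc.
  have c0 i : 0 <= c i.
    by rewrite -lee_fin -pc; apply: integral_ge0 => x _; rewrite lee_fin.
  pose psi' i := psi (widen_ord (leqnSn n) i).
  have E (p : P * R) : \prod_i psi i (toV' p 0%R i) =
     (\prod_i psi' i (toV p.1 0%R i)) * psi ord_max p.2.
    rewrite big_ord_recr/= hl; congr (_ * _); apply: eq_bigr => i _; by rewrite ht.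
  have mpr : measurable_fun setT (fun x : P => \prod_i psi' i (toV x 0%R i)).
    apply: measurable_prod => i _; apply: measurableT_comp; [exact: mpsi|exact: hm].
  have pr0 (x : P) : 0 <= \prod_i psi' i (toV x 0%R i) by apply: prodr_ge0 => i _; exact: p0.
  rewrite fubini_tonelli1; last 2 first.
  + apply/measurable_EFinP; rewrite (_ : (fun _ => _) = (fun p : P * R =>
      (\prod_i psi' i (toV p.1 0%R i)) * psi ord_max p.2)); last by apply/funext => p; rewrite E.
    apply: measurable_funM.
      exact: (measurableT_comp mpr measurable_fst).
    exact: (measurableT_comp (mpsi _) measurable_snd).
  + by move=> p; rewrite lee_fin; apply: prodr_ge0.
  have FE x : (fubini_F lebesgue_measure (fun p => (\prod_i psi i (toV' p 0%R i))%:E) x =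
      (\prod_i psi' i (toV x 0%R i))%:E * (c ord_max)%:E)%E.
    rewrite /fubini_F.
    under eq_integral => y _ do rewrite E/= EFinM.
    rewrite (@ge0_integralZl_EFin _ _ _ lebesgue_measure setT measurableT)//.
    - by rewrite pc.
    - by move=> y _; rewrite lee_fin.
    - by apply/measurable_EFinP; exact: mpsi.
  under eq_integral => x _ do rewrite FE.
  rewrite ge0_integralZr//; last 3 first.
  - exact/measurable_EFinP.
  - by move=> x _; rewrite lee_fin.
  - by rewrite lee_fin.
  have := hp psi' (fun i => c (widen_ord (leqnSn n) i)) (fun i => mpsi _) (fun i => p0 _) (fun i => pc _).
  by move=> ->; rewrite -EFinM [in RHS]big_ord_recr.
- move=> i t; case: (ordnS_split i) => [->|[j ->]].
    exists (fun p => (p.1, p.2 + t)); split.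
    + apply/measurable_fun_pairP; split; first exact: measurable_fst.
      by apply: measurable_funD => //; exact: measurable_snd.
    + move=> p; apply/rowP => j; rewrite !mxE.
      case: (ordnS_split j) => [->|[k ->]].
        by rewrite !hl !eqxx mulr1.
      rewrite !ht /= -val_eqE/= (ltn_eqF (ltn_ord k)) mulr0 addr0//.
    + move=> F mF F0.
      rewrite fubini_tonelli1//; last first.
        apply: (measurableT_comp mF); apply/measurable_fun_pairP; split; first exact: measurable_fst.
        by apply: measurable_funD => //; exact: measurable_snd.
      rewrite [RHS](fubini_tonelli1 F mF F0); apply: eq_integral => x _.
      rewrite /fubini_F /= (lebesgue_translation t (F := fun y => F (x, y)))//.
      exact: measurable_fun_pair2.
  have [sh [msh shE shI]] := hs j t.
  exists (fun p => (sh p.1, p.2)); split.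
  + apply/measurable_fun_pairP; split; last exact: measurable_snd.
    exact: (measurableT_comp msh measurable_fst).
  + move=> p; apply/rowP => k; rewrite !mxE.
    case: (ordnS_split k) => [->|[l ->]].
      by rewrite !hl /= eq_sym -val_eqE/= (ltn_eqF (ltn_ord j)) mulr0 addr0.
    by rewrite !ht /= shE !mxE.
  + move=> F mF F0.
    rewrite fubini_tonelli2//; last first.
      apply: (measurableT_comp mF); apply/measurable_fun_pairP; split; last exact: measurable_snd.
      exact: (measurableT_comp msh measurable_fst).
    rewrite [RHS](fubini_tonelli2 F mF F0); apply: eq_integral => y _.
    rewrite /fubini_G /= (shI (fun x => F (x, y)))//.
    exact: measurable_fun_pair1.
Qed.
End Step.

Lemma leb_like_eq (R : realType) d (P : measurableType d) (mu nu : {measure set P -> \bar R})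
    n (toV : P -> 'rV[R]_n) :
  (forall A, measurable A -> mu A = nu A) -> leb_like mu toV -> leb_like nu toV.
Proof.
move=> e [hm hg hp hs].
have ei (F : P -> \bar R) : (\int[nu]_p F p = \int[mu]_p F p)%E.
  by apply: eq_measure_integral => A mA _; rewrite e.
split => //.
- by move=> psi c mpsi p0 pc; rewrite ei; exact: hp.
- move=> i t; have [sh [h1 h2 h3]] := hs i t; exists sh; split => // F mF F0.
  by rewrite !ei; exact: h3.
Qed.

Lemma leb_like2 (R : realType) : leb_like (@leb2 R) (@toV2 R).
Proof.
have h1 : leb_like (@lebesgue_measure R) (fun x => \row_(i < 1) x).
  by apply: leb_like1 => x; rewrite mxE.
by apply: (leb_like_step _ _ h1) => [p i|p]; rewrite !mxE //= (ord1 i).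
Qed.

(** [leb_like_step] asks for a sigma-finite first factor. Products of exhausting sequences show that
    the product measure is one, and [m] is the same measure with this structure attached. *)
Lemma sigma_finite_prod (R : realType) d1 d2 (T1 : measurableType d1) (T2 : measurableType d2)
    (m1 : {sigma_finite_measure set T1 -> \bar R})
    (m2 : {sigma_finite_measure set T2 -> \bar R}) :
  exists m : {sigma_finite_measure set (T1 * T2)%type -> \bar R},
    forall A, m A = (m1 \x m2)%E A.
Proof.
have sf : sigma_finite setT (m1 \x m2)%E.
  have /sigma_finiteP[F [TF ndF Foo]] := sigma_finiteT m1.
  have /sigma_finiteP[G [TG ndG Goo]] := sigma_finiteT m2.
  exists (fun n => F n `*` G n).
    rewrite -setXTT TF TG predeqE => -[x y]; split.
      move=> [/= [n _ Fnx] [k _ Gky]]; exists (maxn n k) => //; split => /=.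
      - by move: x Fnx; exact/subsetPset/ndF/leq_maxl.
      - by move: y Gky; exact/subsetPset/ndG/leq_maxr.
    by move=> [n _ []/= ? ?]; split; exists n.
  move=> k; have [mF oF] := Foo k; have [mG oG] := Goo k; split; first exact: measurableX.
  by rewrite product_measure1E// lte_mul_pinfty// ge0_fin_numE.
pose sm := Measure_isSigmaFinite.Build _ _ _ (m1 \x m2)%E sf.
pose m : {sigma_finite_measure set (T1 * T2)%type -> \bar R} := HB.pack (m1 \x m2)%E sm.
by exists m.
Qed.

Lemma leb_like3 (R : realType) : leb_like (@leb3 R) (@toV3 R).
Proof.
have [m mE] := sigma_finite_prod (@lebesgue_measure R) (@lebesgue_measure R).
have H : leb_like m (@toV2 R) by apply: leb_like_eq (leb_like2 R) => A mA; exact/esym/mE.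
apply: leb_like_eq (@leb_like_step R _ _ m 2 (@toV2 R) (@toV3 R) _ _ H).
- by move=> A mA; apply: eq_measure_integral => B mB _; exact: mE.
- by move=> p i; rewrite !mxE; case: i => -[|[|]].
- by move=> p; rewrite !mxE.
Qed.

(** * Shifted Legendre polynomials *)

Section ShiftedLegendre.
Context {R : realType}.
Implicit Types p q : {poly R}.

(** Integration over [0, 1] is done algebraically. [prim] is the antiderivative vanishing at 0: its
    constant coefficient is p_0 / 0 = 0 by the convention on inverses, since [0.-1 = 0]. *)
Definition prim p : {poly R} := \poly_(i < (size p).+1) (p`_i.-1 / i%:R).
Definition Jint p : R := (prim p).[1].

Lemma coef_prim p i : (prim p)`_i = p`_i.-1 / i%:R.
Proof.
rewrite coef_poly; case: ltnP => // h; case: i h => [|i] h /=; first by rewrite invr0 mulr0.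
by rewrite nth_default ?mul0r// -ltnS.
Qed.

Lemma prim_linear a p q : prim (a *: p + q) = a *: prim p + prim q.
Proof. by apply/polyP => i; rewrite !(coefD, coefZ, coef_prim) mulrDl mulrA. Qed.

Lemma JintD p q : Jint (p + q) = Jint p + Jint q.
Proof. by rewrite /Jint -[p]scale1r prim_linear !scale1r hornerD. Qed.

Lemma JintZ a p : Jint (a *: p) = a * Jint p.
Proof.
rewrite /Jint -[a *: p]addr0 prim_linear hornerD hornerZ.
suff -> : prim 0 = 0 by rewrite horner0 addr0.
by apply/polyP => i; rewrite coef_prim coef0 mul0r coef0.
Qed.

Lemma JintB p q : Jint (p - q) = Jint p - Jint q.
Proof. by rewrite -scaleN1r JintD JintZ mulN1r. Qed.

Lemma Jint0 : Jint 0 = 0.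
Proof. by rewrite -(scale0r 0) JintZ mul0r. Qed.

Lemma Jint_sum I (r : seq I) (F : I -> {poly R}) :
  Jint (\sum_(i <- r) F i) = \sum_(i <- r) Jint (F i).
Proof.
elim: r => [|i r IH]; first by rewrite !big_nil Jint0.
by rewrite !big_cons JintD IH.
Qed.

Lemma deriv_prim p : prim (deriv p) = p - (p.[0])%:P.
Proof.
apply/polyP => -[|i]; rewrite coef_prim coefB coefC /=.
  by rewrite invr0 mulr0 horner_coef0 subrr.
by rewrite coef_deriv subr0 -[p`_i.+1 *+ _]mulr_natr mulfK// pnatr_eq0.
Qed.

Lemma Jint_deriv p : Jint (deriv p) = p.[1] - p.[0].
Proof. by rewrite /Jint deriv_prim hornerD hornerN hornerC. Qed.

Lemma Jint_by_parts p q : p.[0] = 0 -> p.[1] = 0 -> Jint ((deriv p) * q) = - Jint (p * (deriv q)).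
Proof.
move=> p0 p1; apply/eqP; rewrite -addr_eq0 -JintD -derivM Jint_deriv !hornerM p0 p1.
by rewrite !mul0r subrr.
Qed.

Lemma Jint_Xn i : Jint 'X^i = (i.+1%:R)^-1.
Proof.
have E : prim 'X^i = (i.+1%:R)^-1 *: 'X^(i.+1).
  apply/polyP => -[|j]; rewrite coef_prim coefZ !coefXn /=; first by rewrite invr0 mulr0 mulr0.
  by rewrite eqSS; case: eqP => [->|_]; rewrite ?mul1r ?mulr1 // mul0r mulr0.
by rewrite /Jint E hornerZ hornerXn expr1n mulr1.
Qed.

(** The k-th power vanishes to order k at both ends of [0, 1], so k integrations by parts leave no
    boundary term. *)
Definition wp : {poly R} := 'X * (1 - 'X).

Lemma size_wpn k : size (wp ^+ k) = (2 * k).+1.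
Proof.
have wE : wp = - ('X^2 - 'X) by rewrite /wp mulrBr mulr1 opprB.
have s2 : size wp = 3%N.
  by rewrite wE size_polyN size_polyDl ?size_polyN ?size_polyXn ?size_polyX.
have := size_exp wp k; rewrite s2 mulnC /= => <-; by rewrite prednK// lt0n size_poly_eq0 expf_neq0// -size_poly_eq0 s2.
Qed.

Lemma dvd_derivn k j (r : {poly R}) : (j <= k)%N -> exists q, (derivn j (wp ^+ k * r)) = wp ^+ (k - j) * q.
Proof.
elim: j k r => [|j IH] k r jk; first by exists r; rewrite subn0.
rewrite derivSn; have k0 : (0 < k)%N by exact: leq_ltn_trans jk.
have -> : deriv (wp ^+ k * r) = wp ^+ k.-1 * (k%:R *: ((deriv wp) * r) + wp * (deriv r)).
  rewrite derivM deriv_exp -[in X in _ + X](prednK k0) exprSr.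
  rewrite -mulrA mulrDr; congr (_ + _).
  by rewrite scaler_nat mulrnAl mulrnAr; congr (_ *+ _); ring.
have [q ->] := IH k.-1 (k%:R *: ((deriv wp) * r) + wp * (deriv r)) ltac:(lia).
by exists q; congr (_ ^+ _ * _); lia.
Qed.

Lemma wpn_vanish k j : (j < k)%N -> (derivn j (wp ^+ k)).[0] = 0 /\ (derivn j (wp ^+ k)).[1] = 0.
Proof.
move=> jk; have [q] := @dvd_derivn k j 1 (ltnW jk); rewrite mulr1 => ->.
rewrite !hornerM !horner_exp /wp !hornerM !hornerD !hornerN !hornerX !hornerC.
by rewrite subr0 mul0r subrr mulr0 !expr0n subn_eq0 leqNgt jk !mul0r.
Qed.

Lemma Jint_wpn_derivn k j q : (j <= k)%N ->
  Jint (derivn j (wp ^+ k) * q) = (-1) ^+ j * Jint (wp ^+ k * (derivn j q)).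
Proof.
elim: j q => [|j IH] q jk; first by rewrite mul1r.
have [h0 h1] := wpn_vanish jk.
rewrite derivnS Jint_by_parts// IH ?(ltnW jk)// exprS mulN1r mulNr.
by rewrite -derivSn.
Qed.

(** Rodrigues' formula for the Legendre polynomial of degree k on [0, 1], up to sign; [nderivn]
    contains the factor 1/k!. *)
Definition leg k : {poly R} := nderivn k (wp ^+ k).

Lemma legE k : k`!%:R *: leg k = (derivn k (wp ^+ k)).
Proof. by rewrite /leg scaler_nat nderivn_def. Qed.

Lemma size_leg k : (size (leg k) <= k.+1)%N.
Proof.
rewrite /leg; apply/leq_sizeP => j jk; rewrite coef_nderivn nth_default ?mul0rn//.
rewrite size_wpn; lia.
Qed.

Lemma leg_lead k : (leg k)`_k = (-1) ^+ k *+ 'C(2 * k, k).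
Proof.
rewrite /leg coef_nderivn addnn -mul2n; congr (_ *+ _).
have -> : (wp ^+ k)`_(2 * k) = lead_coef (wp ^+ k) by rewrite lead_coefE size_wpn.
rewrite lead_coef_exp; congr (_ ^+ _).
have wE : wp = - ('X^2 - 'X) by rewrite /wp mulrBr mulr1 opprB.
rewrite wE lead_coefN lead_coefDl ?lead_coefXn//.
by rewrite size_polyN size_polyXn size_polyX.
Qed.

Lemma Jint_leg_low k q : (size q <= k)%N -> Jint (leg k * q) = 0.
Proof.
move=> sq; have f0 : (k`!%:R : R) != 0 by rewrite pnatr_eq0 -lt0n fact_gt0.
apply: (mulfI f0); rewrite -JintZ scalerAl legE Jint_wpn_derivn//.
by rewrite derivn_poly0 ?mulr0 ?Jint0 ?mulr0.
Qed.

Lemma Jint_beta a b : Jint ('X^(a.+1) * (1 - 'X) ^+ b) =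
  a.+1%:R / (a + b + 2)%:R * Jint ('X^a * (1 - 'X) ^+ b).
Proof.
(* integrate the derivative of X^(a+1) (1-X)^(b+1) *)
have h : Jint (deriv ('X^(a.+1) * (1 - 'X) ^+ b.+1)) = 0.
  by rewrite Jint_deriv !hornerM !horner_exp !hornerD !hornerN !hornerX !hornerC subrr !expr0n/= mulr0 mul0r subr0.
move: h; rewrite derivM derivXn deriv_exp derivB derivC derivX sub0r /=.
have -> : ('X^a *+ a.+1 * (1 - 'X) ^+ b.+1 + 'X^(a.+1) * ((-1) * (1 - 'X) ^+ b *+ b.+1) : {poly R}) =
   (a.+1%:R : R) *: ('X^a * (1 - 'X) ^+ b) - ((a + b + 2)%:R : R) *: ('X^(a.+1) * (1 - 'X) ^+ b).
  rewrite !scaler_nat (exprS 'X a) (exprS (1 - 'X) b).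
  set A := 'X^a; set B := (1 - 'X) ^+ b.
  rewrite -(mulr_natl A) -(mulr_natl (-1 * B)) -(mulr_natl (A * B)) -(mulr_natl ('X * A * B)).
  have -> : ((a + b + 2)%:R : {poly R}) = a.+1%:R + b.+1%:R by rewrite -natrD; congr (_%:R); lia.
  by ring.
rewrite JintB !JintZ => /subr0_eq e.
by rewrite mulrAC e mulrAC mulfV ?mul1r// pnatr_eq0; lia.
Qed.

(** One step of the beta recursion multiplies the integral by (k+1)/(2(2k+3)), which is at least
    1/6, with equality at k = 0. *)
Lemma Jint_wpn_ge k : (6 ^- k : R) <= Jint (wp ^+ k).
Proof.
elim: k => [|k IH]; first by rewrite expr0 invr1 (_ : wp ^+ 0 = 'X^0) ?Jint_Xn ?invr1 ?expr0.
have -> : Jint (wp ^+ k.+1) = k.+1%:R / (k + k.+1 + 2)%:R * (k.+1%:R / (k + k + 2)%:R * Jint (wp ^+ k)).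
  rewrite /wp !exprMn Jint_beta; congr (_ * _).
  have -> : 'X^k * (1 - 'X) ^+ k.+1 = 'X^k * (1 - 'X) ^+ k - 'X^(k.+1) * (1 - 'X) ^+ k :> {poly R}.
    by rewrite (exprS 'X k) (exprS (1 - 'X) k); ring.
  rewrite JintB Jint_beta -[X in X - _]mul1r -mulrBl; congr (_ * _).
  rewrite (_ : (k + k + 2)%:R = k.+1%:R + k.+1%:R :> R); last by rewrite -natrD; congr (_%:R); lia.
  have x0 : 0 < k.+1%:R :> R by rewrite ltr0n.
  by set x := k.+1%:R in x0 *; field; apply: lt0r_neq0; lra.
rewrite exprS invfM.
have J0 : 0 <= Jint (wp ^+ k) by apply: le_trans IH; rewrite invr_ge0 exprn_ge0.
rewrite mulrA ler_pM ?invr_ge0 ?exprn_ge0//.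
rewrite mulf_div ler_pdivlMr; last by rewrite -natrM ltr0n; lia.
rewrite mulrC ler_pdivrMr// -!natrM ler_nat; lia.
Qed.

(** The exact value is 1/(2k+1). An exponential lower bound is enough, because it only has to
    compete with geometrically decaying moments. *)
Lemma Jint_leg_sqr k : (6 ^- k : R) <= Jint (leg k * leg k).
Proof.
have f0 : (k`!%:R : R) != 0 by rewrite pnatr_eq0 -lt0n fact_gt0.
have -> : Jint (leg k * leg k) = 'C(2 * k, k)%:R * Jint (wp ^+ k).
  apply: (mulfI f0); rewrite -JintZ scalerAl legE Jint_wpn_derivn//.
  have -> : derivn k (leg k) = (k`!%:R * ((-1) ^+ k *+ 'C(2 * k, k)))%:P.
    apply/polyP => i; rewrite coef_derivn coefC; case: i => [|i] /=.
      by rewrite addn0 leg_lead ffactnn mulr_natl.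
    by rewrite nth_default ?mul0rn//; apply: leq_trans (size_leg _) _; lia.
  rewrite [wp ^+ k * _]mulrC mul_polyC JintZ -[_ *+ 'C(_, _)]mulr_natr.
  have e : (-1) ^+ k * (-1) ^+ k = 1 :> R by rewrite -expr2 sqrr_sign.
  by rewrite -[RHS]mul1r -[X in _ = X * _]e; ring.
apply: le_trans (Jint_wpn_ge k) _; rewrite ler_peMl//.
  by apply: le_trans (Jint_wpn_ge k); rewrite invr_ge0 exprn_ge0.
by rewrite ler1n bin_gt0; lia.
Qed.

Lemma Jint_leg_orth j k : j != k -> Jint (leg j * leg k) = 0.
Proof.
rewrite neq_ltn => /orP[h|h]; last by apply: Jint_leg_low; apply: leq_trans (size_leg k) _.
by rewrite mulrC; apply: Jint_leg_low; apply: leq_trans (size_leg j) _.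
Qed.

Lemma leg_span q N : (size q <= N)%N -> exists b : nat -> R, q = \sum_(j < N) b j *: leg j.
Proof.
elim: N q => [|N IH] q sq.
  by exists (fun=> 0); rewrite big_ord0; apply/eqP; rewrite -size_poly_leq0.
have l0 : (leg N)`_N != 0 by rewrite leg_lead -mulr_natl mulf_neq0 ?expf_neq0 ?oppr_eq0 ?oner_eq0 // pnatr_eq0 -lt0n bin_gt0; lia.
have sz : (size (q - (q`_N / (leg N)`_N) *: leg N)%R <= N)%N.
  apply/leq_sizeP => j; rewrite leq_eqVlt => /orP[/eqP <-|Nj].
    by rewrite coefB coefZ divfK ?subrr.
  by rewrite coefB coefZ (nth_default _ (leq_trans sq Nj))
    (nth_default _ (leq_trans (size_leg N) Nj)) mulr0 subr0.
have [b hb] := IH _ sz.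
exists (fun j => if (j < N)%N then b j else q`_N / (leg N)`_N).
rewrite big_ord_recr/= ltnn; rewrite -[LHS](subrK ((q`_N / (leg N)`_N) *: leg N)) hb.
by congr (_ + _); apply: eq_bigr => j _; rewrite ltn_ord.
Qed.

Definition nrm1 p : R := \sum_(i < size p) `|p`_i|.

Lemma nrm1E p N : (size p <= N)%N -> nrm1 p = \sum_(i < N) `|p`_i|.
Proof.
move=> sN; rewrite /nrm1 (big_ord_widen _ (fun i => `|p`_i|) sN) [RHS](bigID (fun i : 'I_N => (i < size p)%N))/=.
by rewrite [X in _ = _ + X]big1 ?addr0// => i; rewrite -leqNgt => h; rewrite nth_default// normr0.
Qed.

Lemma nrm1_ge0 p : 0 <= nrm1 p.
Proof. by apply: sumr_ge0. Qed.

Lemma nrm1_horner p s : 0 <= s <= 1 -> `|p.[s]| <= nrm1 p.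
Proof.
move=> /andP[s0 s1]; rewrite horner_coef; apply: le_trans (ler_norm_sum _ _ _) _.
apply: ler_sum => i _; rewrite normrM -[leRHS]mulr1 ler_wpM2l// normrX exprn_ile1//.
by rewrite ger0_norm.
Qed.

Lemma nrm1_deriv p N : (size p <= N)%N -> nrm1 (deriv p) <= N%:R * nrm1 p.
Proof.
move=> sN; rewrite (@nrm1E (deriv p) N); last exact: leq_trans (size_poly _ _) (leq_trans (leq_pred _) sN).
rewrite (@nrm1E p N.+1) ?(leqW sN)// big_ord_recl/= mulrDr mulr_sumr.
apply: (@le_trans _ _ (\sum_(i < N) N%:R * `|p`_(bump 0 i)|)); last by rewrite lerDr mulr_ge0.
apply: ler_sum => i _; rewrite coef_deriv normrMn -[`|_| *+ _]mulr_natl /bump/= add1n ler_wpM2r// ler_nat.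
exact: ltn_ord.
Qed.

Lemma nrm1_nonneg p : (forall i, 0 <= p`_i) -> nrm1 p = p.[1].
Proof.
move=> h; rewrite /nrm1 horner_coef; apply: eq_bigr => i _.
by rewrite expr1n mulr1 ger0_norm.
Qed.

(* Replacing X(1-X) by X(1+X) bounds the coefficients without changing their moduli. *)
Lemma nrm1_wpn k : nrm1 (wp ^+ k) <= 2 ^+ k.
Proof.
pose w : {poly R} := 'X * (1 + 'X).
have w0 j i : 0 <= (w ^+ j)`_i.
  elim: j i => [|j IH] i; first by rewrite expr0 coef1 ler0n.
  rewrite exprS /w -mulrA coefXM mulrDl mul1r; case: ifP => // _.
  by rewrite coefD coefXM; case: ifP => _; rewrite ?addr0 ?addr_ge0.
have le j i : `|(wp ^+ j)`_i| <= (w ^+ j)`_i.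
  elim: j i => [|j IH] i; first by rewrite !expr0 coef1 normr_nat.
  rewrite !exprS /w /wp -!mulrA !coefXM; case: ifP => _; first by rewrite normr0.
  rewrite mulrBl mulrDl !mul1r coefB coefD !coefXM; apply: le_trans (ler_normB _ _) _.
  by apply: lerD => //; case: ifP => // _; rewrite normr0.
have sw : (size (wp ^+ k) <= maxn (size (wp ^+ k)) (size (w ^+ k)))%N by exact: leq_maxl.
have sw' : (size (w ^+ k) <= maxn (size (wp ^+ k)) (size (w ^+ k)))%N by exact: leq_maxr.
have -> : 2 ^+ k = nrm1 (w ^+ k).
  by rewrite nrm1_nonneg// horner_exp /w hornerM hornerD hornerX hornerC mul1r.
rewrite (nrm1E sw) (nrm1E sw'); apply: ler_sum => i _.
by rewrite [leRHS]ger0_norm.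
Qed.

(** Dividing by k! turns the derivative into binomial factors C(k+i, k) <= 2^(k+i) <= 4^k;
    [nrm1_wpn] gives the remaining 2^k. *)
Lemma nrm1_leg k : nrm1 (leg k) <= 8 ^+ k.
Proof.
rewrite (nrm1E (size_leg k)).
apply: (@le_trans _ _ (\sum_(i < k.+1) (4 ^+ k) * `|(wp ^+ k)`_(k + i)|)).
  apply: ler_sum => i _; rewrite /leg coef_nderivn normrMn -[`|_| *+ _]mulr_natl ler_wpM2r//.
  apply: (@le_trans _ _ ((2 ^ (k + i))%:R)).
    rewrite ler_nat -[2%N]/(1 + 1)%N Pascal.
    have ki : (k < (k + i).+1)%N by lia.
    by rewrite (bigD1 (Ordinal ki))//= !exp1n !muln1 leq_addr.
  rewrite natrX (_ : (4 : R) = 2 ^+ 2); last by ring.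
  by rewrite -exprM ler_weXn2l// ?ler1n//; have := ltn_ord i; lia.
rewrite -mulr_sumr (_ : (8 : R) = 4 * 2) ?[(4 * 2) ^+ k]exprMn; last by ring.
rewrite ler_wpM2l ?exprn_ge0//; apply: le_trans (nrm1_wpn k).
have s2 : (size (wp ^+ k) <= k + k.+1)%N by rewrite size_wpn; lia.
rewrite (nrm1E s2).
have -> : \sum_(i < k + k.+1) `|(wp ^+ k)`_i| = \sum_(i < k) `|(wp ^+ k)`_i| +
  \sum_(i < k.+1) `|(wp ^+ k)`_(k + i)| by rewrite big_split_ord.
by rewrite lerDr; apply: sumr_ge0.
Qed.

End ShiftedLegendre.

(** * Smooth cutoffs *)

Section SmoothFunctions.
Context {R : realType}.
Implicit Types (f g : R -> R) (x : R) (k : nat).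

(** Differentiable k times, without continuity of the last derivative; asked for all k, this is
    smoothness. *)
Fixpoint Ck k f : Prop :=
  if k is k'.+1 then (forall x, derivable f x 1) /\ Ck k' (derive1 f) else True.

Lemma CkW k f : Ck k.+1 f -> Ck k f.
Proof. by elim: k f => //= k IH f [h1 h2]; split => //; exact: IH. Qed.

Lemma derive1D f g : (forall x, derivable f x 1) -> (forall x, derivable g x 1) ->
  derive1 (f \+ g) = (derive1 f) \+ (derive1 g).
Proof. by move=> df dg; apply/funext => x; rewrite /= !derive1E deriveD. Qed.

Lemma derive1M f g : (forall x, derivable f x 1) -> (forall x, derivable g x 1) ->
  derive1 (f \* g) = ((derive1 f) \* g) \+ (f \* (derive1 g)).
Proof.
move=> df dg; apply/funext => x; rewrite /= !derive1E deriveM//= addrC.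
by congr (_ + _); rewrite mulrC.
Qed.

Lemma CkD k f g : Ck k f -> Ck k g -> Ck k (f \+ g).
Proof.
elim: k f g => //= k IH f g [df hf] [dg hg]; split; first by move=> x; exact: derivableD.
by rewrite derive1D//; exact: IH.
Qed.

Lemma CkM k f g : Ck k f -> Ck k g -> Ck k (f \* g).
Proof.
elim: k f g => [//|k IH] f g hf hg.
have [[df hf'] [dg hg']] := (hf, hg).
split; first by move=> x; exact: derivableM.
by rewrite derive1M//; apply: CkD; apply: IH => //; exact: CkW.
Qed.

Lemma Ck_cst k (c : R) : Ck k (cst c).
Proof.
elim: k c => //= k IH c; split; first by move=> x; exact: derivable_cst.
by rewrite (_ : derive1 (cst c) = cst 0)//; apply/funext => x; rewrite derive1E derive_cst.
Qed.

Lemma derive1_aff f (a b : R) : (forall x, derivable f x 1) ->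
  (forall x, derivable (fun x => f (a * x + b)) x 1) /\
  derive1 (fun x => f (a * x + b)) = (fun x => a * (derive1 f) (a * x + b)).
Proof.
move=> df.
have da x : is_derive x 1 (fun x => a * x + b) a.
  by apply: is_derive_eq; rewrite /GRing.scale/= mulr1 addr0.
have h x : is_derive x 1 (fun x => f (a * x + b)) (a * (derive1 f) (a * x + b)).
  have df' : is_derive (a * x + b) 1 f ((derive1 f) (a * x + b)).
    by rewrite derive1E; apply/derivableP.
  by have := @is_derive1_comp R f (fun x => a * x + b) x _ _ df' (da x); rewrite mulrC.
split; first by move=> x; have [] := h x.
by apply/funext => x; rewrite derive1E; apply: derive_val.
Qed.

Lemma Ck_aff k f (a b : R) : Ck k f -> Ck k (fun x => f (a * x + b)).
Proof.
elim: k f => //= k IH f [df hf]; have [h1 ->] := derive1_aff a b df; split => //.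
by apply: (CkM (f := cst a)); [exact: Ck_cst|exact: IH].
Qed.

Lemma Ck_inv k f : (forall x, 0 < f x) -> Ck k f -> Ck k (fun x => (f x)^-1).
Proof.
move=> f0; elim: k => [//|k IH] hf; have [df hf'] := hf.
have h x : is_derive x 1 (fun x => (f x)^-1) (- (f x)^-1 * (f x)^-1 * (derive1 f) x).
  have dfx : is_derive x 1 f ((derive1 f) x) by rewrite derive1E; apply/derivableP.
  have := @is_deriveV R f x ((derive1 f) x) 1 (lt0r_neq0 (f0 x)) dfx.
  by rewrite /GRing.scale/= expr2 invfM -[- (_ * _)]mulNr.
split; first by move=> x; have [] := h x.
rewrite (_ : derive1 _ = (cst (-1) \* ((fun x => (f x)^-1) \* (fun x => (f x)^-1))) \* (derive1 f)); last first.
  apply/funext => x; rewrite derive1E /=; rewrite -[RHS]/(-1 * ((f x)^-1 * (f x)^-1) * (derive1 f) x).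
  by rewrite mulN1r -mulNr; apply: derive_val.
by apply: CkM => //; apply: CkM; [exact: Ck_cst|apply: CkM; apply: IH; exact: CkW].
Qed.

(** The functions p(1/x) exp(-1/x), extended by 0, form a family closed under differentiation.
    Smoothness of exp(-1/x) then follows by induction over all p at once. *)
Definition flat (p : {poly R}) x : R :=
  if 0 < x then p.[x^-1] * expR (- x^-1) else 0.

(** Comes from exp(u) = exp(u/(N+1))^(N+1) >= (u/(N+1))^(N+1). *)
Lemma expR_beats N (u : R) : 0 < u -> u ^+ N * expR (- u) <= (N.+1%:R ^+ N.+1) / u.
Proof.
move=> u0; rewrite ler_pdivlMr// expRN mulrAC -exprSr ler_pdivrMr ?expR_gt0//.
have n0 : 0 < N.+1%:R :> R by rewrite ltr0n.
rewrite -ler_pdivrMl ?exprn_gt0// mulrC -expr_div_n.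
have -> : expR u = expR (u / N.+1%:R) ^+ N.+1.
  by rewrite -expRM_natl mulrC divfK// gt_eqF.
rewrite lerXn2r ?nnegrE ?divr_ge0 ?ltW ?expR_gt0//.
by apply: lt_le_trans (expR_ge1Dx _); rewrite ltrDr.
Qed.

Lemma poly_expR_bound (p : {poly R}) : exists K, 0 <= K /\
  forall u, 1 <= u -> `|p.[u] * expR (- u)| <= K / u.
Proof.
exists (nrm1 p * (size p).+1%:R ^+ (size p).+1); split.
  by rewrite mulr_ge0 ?nrm1_ge0// exprn_ge0.
move=> u u1; have u0 : 0 < u by exact: lt_le_trans u1.
rewrite normrM (ger0_norm (expR_ge0 _)).
have h : `|p.[u]| <= nrm1 p * u ^+ (size p).
  rewrite horner_coef /nrm1 mulr_suml; apply: le_trans (ler_norm_sum _ _ _) _.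
  apply: ler_sum => i _; rewrite normrM ler_wpM2l// normrX (ger0_norm (ltW u0)).
  by rewrite ler_weXn2l// ltnW.
apply: le_trans (ler_wpM2r (expR_ge0 _) h) _.
by rewrite -!mulrA ler_wpM2l ?nrm1_ge0//; exact: expR_beats.
Qed.

Lemma flat_derive (p : {poly R}) x :
  is_derive x 1 (flat p) (flat ('X^2 * (p - deriv p)) x).
Proof.
case: (ltgtP x 0) => [x0|x0|->].
- have E : flat ('X^2 * (p - deriv p)) x = 0 by rewrite /flat ltNge (ltW x0).
  rewrite E; apply: (near_eq_is_derive (f := cst 0)).
  near=> y; rewrite /flat; case: ifP => // y0; exfalso.
  have : y < 0 by near: y; exact: lt_nbhsl.
  by rewrite ltNge ltW.
- pose h y := p.[y^-1] * expR (- y^-1).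
  have dV : is_derive x 1 (fun y : R => y^-1) (- (x ^- 2)).
    have := @is_deriveV R id x 1 1 (lt0r_neq0 x0) (is_derive_id _ _).
    by rewrite /GRing.scale/= mulr1.
  have dp : is_derive x 1 (fun y => p.[y^-1]) ((deriv p).[x^-1] * - (x ^- 2)).
    by have := @is_derive1_comp R (horner p) (fun y => y^-1) x _ _ (is_derive_poly p x^-1) dV.
  have de : is_derive x 1 (fun y => expR (- y^-1)) (expR (- x^-1) * x ^- 2).
    have dN : is_derive x 1 (fun y : R => - y^-1) (x ^- 2).
      by have := @is_deriveN _ _ _ (fun y : R => y^-1) x 1 _ dV; rewrite opprK.
    by have := @is_derive1_comp R (@expR R) (fun y => - y^-1) x _ _ (is_derive_expR _) dN.
  have dh := @is_deriveM R R _ _ x 1 _ _ dp de.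
  apply: (near_eq_is_derive (f := h)).
  + near=> y; rewrite /flat /h; case: ifP => // /negP[].
    by near: y; exact: lt_nbhsr.
  + have -> : flat ('X^2 * (p - deriv p)) x =
      p.[x^-1] *: (expR (- x^-1) * x ^- 2) + expR (- x^-1) *: ((deriv p).[x^-1] * - x ^- 2).
      rewrite /flat x0 !hornerE /GRing.scale/= exprVn; ring.
    exact: dh.
- have -> : flat ('X^2 * (p - deriv p)) 0 = 0 by rewrite /flat ltxx.
  (* The extra factor ['X] is the division by h in the difference quotient at 0, taken at u = 1/h;
     the bound K / u = K h then tends to 0. *)
  have [K [K0 hK]] := poly_expR_bound ('X * p).
  have H : (fun h : R => h^-1 *: (flat p (h *: 1 + 0) - flat p 0)) @ 0^' --> (0 : R).
    apply/cvgrPdist_le => e e0; near=> h.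
    rewrite sub0r normrN /GRing.scale/= mulr1 addr0 [flat p 0]/flat ltxx subr0.
    apply: (@le_trans _ _ (K * `|h|)).
      rewrite /flat; case: ifP => [h0|]; last by rewrite mulr0 normr0 mulr_ge0.
      have h1 : `|h| <= 1 by near: h; exact: dnbhs0_le.
      have u1 : 1 <= h^-1 by rewrite -[1]invr1 lef_pV2 ?posrE// -(gtr0_norm h0).
      by have := hK _ u1; rewrite invrK hornerM hornerX -mulrA (gtr0_norm h0).
    apply: (@le_trans _ _ ((K + 1) * `|h|)); first by rewrite ler_wpM2r// lerDl.
    have k1 : 0 < K + 1 by rewrite ltr_wpDl.
    rewrite -ler_pdivlMl//; near: h; apply: dnbhs0_le.
    by rewrite mulr_gt0// invr_gt0 ltr_wpDl.
  apply: DeriveDef; last exact: cvg_lim H.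
  by apply/cvg_ex; exists 0.
Unshelve. all: by end_near.
Qed.

Lemma Ck_flat k p : Ck k (flat p).
Proof.
elim: k p => //= k IH p; split; first by move=> x; have [] := flat_derive p x.
rewrite (_ : derive1 _ = flat ('X^2 * (p - deriv p)))//.
by apply/funext => x; rewrite derive1E; have [_ ->] := flat_derive p x.
Qed.

Let E x := flat 1 x.

Lemma flat1_gt0 x : 0 < x -> 0 < E x.
Proof. by move=> x0; rewrite /E /flat x0 hornerC mul1r expR_gt0. Qed.

Lemma flat1_le0 x : x <= 0 -> E x = 0.
Proof. by move=> x0; rewrite /E /flat ltNge x0. Qed.

Definition smooth_step x : R := E x / (E x + E (1 - x)).

Let E_ge0 x : 0 <= E x.
Proof. by case: (ltP 0 x) => [/flat1_gt0/ltW|/flat1_le0 ->]. Qed.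

Let den_gt0 x : 0 < E x + E (1 - x).
Proof.
case: (ltP 0 x) => x0; first by rewrite ltr_pwDl// flat1_gt0.
by rewrite ltr_wpDl// flat1_gt0//; lra.
Qed.

Lemma smooth_step_Ck k : Ck k smooth_step.
Proof.
apply: (@CkM k E (fun x => (E x + E (1 - x))^-1)); first exact: Ck_flat.
apply: Ck_inv => //; apply: (@CkD k E (fun x => E (1 - x))); first exact: Ck_flat.
rewrite (_ : (fun x => _) = (fun x => E (-1 * x + 1))); first exact: (Ck_aff _ _ (Ck_flat _ _)).
by apply/funext => x; rewrite mulN1r addrC.
Qed.

Lemma smooth_step01 x : 0 <= smooth_step x <= 1.
Proof.
apply/andP; split; first by rewrite divr_ge0// ltW.
by rewrite ler_pdivrMr// mul1r lerDl.
Qed.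

Lemma smooth_step0 x : x <= 0 -> smooth_step x = 0.
Proof. by move=> x0; rewrite /smooth_step flat1_le0// mul0r. Qed.

Lemma smooth_step1 x : 1 <= x -> smooth_step x = 1.
Proof.
move=> x1; rewrite /smooth_step (@flat1_le0 (1 - x)) ?addr0; last by lra.
by rewrite divff// gt_eqF// flat1_gt0//; lra.
Qed.

Lemma continuous_derivable f : (forall x, derivable f x 1) -> continuous f.
Proof. by move=> df x; apply/differentiable_continuous/derivable1_diffP. Qed.

Lemma smooth_step_derive_bound : exists K, forall x, `|derive1 smooth_step x| <= K.
Proof.
have [_ [d1 _]] := smooth_step_Ck 2.
have c1 : continuous (derive1 smooth_step) by exact: continuous_derivable.
have d0 x : derivable smooth_step x 1 by have [] := smooth_step_Ck 1.
have [K hK] : exists K, forall x, x \in `[0, 1]%R -> `|derive1 smooth_step x| <= K.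
  have c : {within `[0, 1], continuous (fun x => `|derive1 smooth_step x|)}.
    apply: continuous_subspaceT => x; apply: continuous_comp; [exact: c1|exact: norm_continuous].
  by have [z _ hz] := EVT_max (@ler01 R) c; exists (`|derive1 smooth_step z|).
exists (Num.max K 0) => x.
case: (boolP (x \in `[0, 1]%R)) => [/hK h|]; first by rewrite le_max h.
rewrite in_itv/= => xn.
suff -> : derive1 smooth_step x = 0 by rewrite normr0 le_max lexx orbT.
have [c hc] : exists c, \near x, cst c x = smooth_step x.
  case: (ltP x 0) => x0.
    exists 0; near=> y; rewrite smooth_step0//; apply: ltW; near: y; exact: lt_nbhsl.
  have x1 : 1 < x by move: xn; rewrite x0 -ltNge.
  exists 1; near=> y; rewrite smooth_step1//; apply: ltW; near: y; exact: lt_nbhsr.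
by rewrite derive1E -(@near_eq_derive R R R _ _ _ 1 hc) derive_cst.
Unshelve. all: by end_near.
Qed.

End SmoothFunctions.

(** * Test functions that are products of functions of one variable *)

Section ProductTestFunctions.
Context {R : realType} {n : nat}.
Local Notation V := 'rV[R]_n.

Definition tensor (f : 'I_n -> R -> R) (x : V) : R := \prod_i f i (x 0 i).

Definition upd (f : 'I_n -> R -> R) (i : 'I_n) (g : R -> R) : 'I_n -> R -> R :=
  fun j => if j == i then g else f j.

Lemma tensor_upd f i g x :
  tensor (upd f i g) x = g (x 0 i) * \prod_(j | j != i) f j (x 0 j).
Proof.
rewrite /tensor (bigD1 i)//= /upd eqxx; congr (_ * _).
by apply: eq_bigr => j /negPf ->.
Qed.

Lemma tensorD1 f i x : tensor f x = f i (x 0 i) * \prod_(j | j != i) f j (x 0 j).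
Proof. by rewrite /tensor (bigD1 i). Qed.

Lemma differentiable_tensor (f : 'I_n -> R -> R) (x : V) : (forall i y, derivable (f i) y 1) -> differentiable (tensor f) x.
Proof.
move=> df; rewrite /tensor.
have h (r : seq 'I_n) : differentiable (fun x : V => \prod_(i <- r) f i (x 0 i)) x.
  elim: r => [|i r IH].
    rewrite (_ : (fun _ => _) = cst 1); first exact: differentiable_cst.
    by apply/funext => y; rewrite big_nil.
  rewrite (_ : (fun _ => _) = (f i \o (fun y : V => y 0 i)) * (fun y : V => \prod_(i <- r) f i (y 0 i))); last first.
    by apply/funext => y; rewrite big_cons.
  apply: differentiableM => //; apply: differentiable_comp; first exact: differentiable_coord.
  exact/derivable1_diffP.
exact: h.
Qed.

Lemma partial_tensor (f : 'I_n -> R -> R) i : (forall y, derivable (f i) y 1) ->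
  partial i (tensor f) = tensor (upd f i (derive1 (f i))).
Proof.
move=> df; apply/funext => x; rewrite /partial tensor_upd.
set c := \prod_(_ | _) _.
have cE (t : R) : tensor f (x + t *: delta_mx 0 i) = f i (x 0 i + t) * c.
  rewrite (tensorD1 _ i) !mxE !eqxx mulr1; congr (_ * _); apply: eq_bigr => j /negPf ji.
  by rewrite !mxE eqxx ji mulr0 addr0.
rewrite derive1E.
have h : (fun t : R => t^-1 *: (f i (t *: 1 + x 0 i) - f i (x 0 i))) @ 0^' --> 'D_1 (f i) (x 0 i).
  exact: df.
apply: cvg_lim => //.
have hc : (fun t : R => t^-1 *: (f i (t *: 1 + x 0 i) - f i (x 0 i)) * c) @ 0^' --> 'D_1 (f i) (x 0 i) * c.
  by apply: cvgM; [exact: h|exact: cvg_cst].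
apply: cvg_trans hc; apply: near_eq_cvg; near=> t.
rewrite /= [_ *: _ + x]addrC cE [tensor f x](_ : _ = f i (x 0 i) * c); last by rewrite (tensorD1 _ i).
by rewrite /GRing.scale/= mulr1 -mulrBl [t + _]addrC mulrA.
Unshelve. all: by end_near.
Qed.

Definition tderiv (a : 'I_n -> nat) (f : 'I_n -> R -> R) : 'I_n -> R -> R :=
  fun i => iter (a i) (@derive1 R R) (f i).

Lemma Ck_iter k j f : Ck (k + j) f -> Ck k (iter j (@derive1 R R) f).
Proof.
elim: j f => [|j IH] f; first by rewrite addn0.
by rewrite addnS iterSr => -[_]; exact: IH.
Qed.

Lemma partials_tensor f s : (forall i k, Ck k (f i)) ->
  partials s (tensor f) = tensor (tderiv (fun i => count_mem i s) f).
Proof.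
move=> hf; elim: s => [|j s IH]; first by congr tensor.
rewrite /= -/(partials s _) IH partial_tensor; last first.
  by move=> y; have [] := @Ck_iter 1 (count_mem j s) (f j) (hf _ _).
congr tensor; apply/funext => i; rewrite /upd /tderiv /=.
by case: eqP => [->|/eqP ji]; rewrite ?eqxx //= eq_sym (negPf ji) add0n.
Qed.

Lemma smooth_tensor f : (forall i k, Ck k (f i)) -> smooth (tensor f).
Proof.
move=> hf s x; rewrite partials_tensor//; apply: differentiable_tensor => i y.
by have [] := @Ck_iter 1 (count_mem i s) (f i) (hf _ _).
Qed.

Lemma mderiv_tensor a f : (forall i k, Ck k (f i)) ->
  mderiv a (tensor f) = tensor (tderiv a f).
Proof.
move=> hf; rewrite /mderiv partials_tensor//; congr tensor; apply/funext => i; rewrite /tderiv.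
congr iter; rewrite count_flatten -map_comp sumnE big_map.
rewrite big_enum/= (bigD1 i)//=.
rewrite count_nseq /= eqxx mul1n big1 ?addn0// => j /negPf ji.
by rewrite count_nseq /= ji.
Qed.

Lemma compact_box (a b : 'I_n -> R) : compact [set x : V | forall i, a i <= x 0 i <= b i].
Proof.
have -> : [set x : V | forall i, a i <= x 0 i <= b i] = [set x : V | forall i, `[a i, b i]%classic (x 0 i)].
  by apply/seteqP; split => x h i; have := h i; rewrite /= in_itv.
by apply: (@rV_compact R n (fun i => `[a i, b i]%classic)) => i; exact: segment_compact.
Qed.

Lemma test_fun_tensor f (Om : set V) (a b : 'I_n -> R) :
  (forall i k, Ck k (f i)) ->
  (forall i t, ~~ (a i <= t <= b i) -> f i t = 0) ->
  [set x : V | forall i, a i <= x 0 i <= b i] `<=` Om -> test_fun Om (tensor f).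
Proof.
move=> hf f0 sub; split; first exact: smooth_tensor.
exists [set x : V | forall i, a i <= x 0 i <= b i]; split => //; first exact: compact_box.
move=> x /existsNP[i /negP h]; rewrite (tensorD1 _ i) f0// mul0r//.
Qed.

End ProductTestFunctions.

(** * ReLU emulation of products *)

Section Networks.
Context {R : realType} {n : nat}.
Local Notation V := 'rV[R]_n.

(** Neurons of a layer are indexed by an arbitrary finite type, so that layers can be described by
    products and sums of types and counted by their cardinals. *)
Definition state (T : finType) (F : T -> V -> R) (x : V) : 'cV[R]_#|T| :=
  \col_i F (enum_val i) x.

(* Continuation-passing description of the first layers of a network: whatever
   network [rest] reads the values [F], it can be fed by [L] layers of total size [S]. *)
Definition computable (T : finType) (F : T -> V -> R) (L S : nat) : Prop :=
  forall m (rest : NN R #|T| m), exists Phi : NN R n m,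
    [/\ forall x, realize Phi x^T = realize rest (state F x),
        (nn_depth Phi <= L + nn_depth rest)%N & (nn_size Phi <= S + nn_size rest)%N].

Lemma nnz_col k (b : 'cV[R]_k) : (nnz_mx b <= k)%N.
Proof.
apply: leq_trans (max_card _) _; by rewrite card_prod !card_ord muln1.
Qed.

Lemma nnz_rows m k (q : nat) (A : 'M[R]_(m, k)) :
  (forall i, #|[pred j | A i j != 0%R]| <= q)%N -> (nnz_mx A <= m * q)%N.
Proof.
move=> h; rewrite /nnz_mx -sum1_card.
rewrite (eq_bigl (fun ij : 'I_m * 'I_k => true && (A ij.1 ij.2 != 0)))//.
rewrite -(pair_big_dep xpredT (fun i j => A i j != 0) (fun _ _ => 1%N))/=.
apply: leq_trans (_ : \sum_(i < m) q <= _)%N; last by rewrite sum_nat_const card_ord.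
by apply: leq_sum => i _; apply: leq_trans (h i); rewrite -sum1_card.
Qed.

Lemma computable_input (T : finType) (i : T -> 'I_n) (w b : T -> R) (F : T -> V -> R) :
  (forall t x, F t x = Num.max 0 (w t * x 0 (i t) + b t)) -> computable F 1 (2 * #|T|).
Proof.
move=> FE m rest.
exists (NNcons (\matrix_(k, j) (if j == i (enum_val k) then w (enum_val k) else 0))
  (\col_k b (enum_val k)) rest); split => //=.
  move=> x; congr (realize rest _); apply/colP => k; rewrite !mxE FE; congr (Num.max 0 (_ + _)).
  rewrite (bigD1 (i (enum_val k)))//= !mxE eqxx big1 ?addr0// => j /negPf jn.
  by rewrite !mxE jn mul0r.
rewrite leq_add2r mul2n -addnn leq_add//; last exact: nnz_col.
rewrite -[X in (_ <= X)%N]muln1; apply: nnz_rows => k.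
apply: (@leq_trans #|pred1 (i (enum_val k))|); last by rewrite card1.
by apply: subset_leq_card; apply/fintype.subsetP => j; rewrite !inE mxE; case: ifP => //; rewrite eqxx.
Qed.

(** A neuron is described by a list of weighted inputs, so the nonzero entries of its row are
    counted by the length of the list; weights of an input listed twice are added in the matrix. The
    extra unit in [q.+1] pays for the bias. *)
Lemma computable_layer (T T' : finType) (F : T -> V -> R) (F' : T' -> V -> R)
    (cmb : T' -> seq (R * T)) (b : T' -> R) q L S :
  computable F L S -> (forall t, size (cmb t) <= q)%N ->
  (forall t x, F' t x = Num.max 0 (\sum_(w <- cmb t) w.1 * F w.2 x + b t)) ->
  computable F' L.+1 (S + q.+1 * #|T'|).
Proof.
move=> hF sz FE m rest.
pose A := \matrix_(k < #|T'|, j < #|T|)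
  (\sum_(w <- cmb (enum_val k) | w.2 == enum_val j) w.1).
have [Phi [h1 h2 h3]] := hF _ (NNcons A (\col_k b (enum_val k)) rest).
exists Phi; split.
- move=> x; rewrite h1 /=; congr (realize rest _); apply/colP => k; rewrite !mxE FE.
  congr (Num.max 0 (_ + _)).
  under eq_bigr => j _ do rewrite !mxE mulr_suml.
  rewrite (exchange_big_dep xpredT)//=; apply: eq_bigr => w _.
  rewrite (big_pred1 (enum_rank w.2)); first by rewrite enum_rankK.
  move=> j /=; rewrite -[in RHS](enum_valK j) (inj_eq enum_rank_inj).
  by rewrite eq_sym.
- by apply: leq_trans h2 _ => /=; rewrite addSnnS.
- apply: leq_trans h3 _ => /=.
  suff: (nnz_mx A + nnz_mx (\col_(k < #|T'|) b (enum_val k)) <= q.+1 * #|T'|)%N by move=> h; rewrite -[leqRHS]addnA leq_add2l leq_add2r.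
  rewrite mulSn addnC leq_add//; first exact: nnz_col.
  rewrite mulnC; apply: nnz_rows => k.
  apply: leq_trans (sz (enum_val k)).
  apply: (@leq_trans #|[seq enum_rank w.2 | w <- cmb (enum_val k)]|).
    apply: subset_leq_card; apply/fintype.subsetP => j; rewrite !inE mxE => h.
    apply/negPn/negP => hn; move/negP: h; apply; apply/eqP.
    rewrite big_seq_cond big1// => w /andP[wi /eqP wE].
    by case/negP: hn; apply/mapP; exists w => //; rewrite wE enum_valK.
  by apply: leq_trans (card_size _) _; rewrite size_map.
Qed.

Lemma computable_output (T : finType) (F : T -> V -> R) (c : T -> R) L S :
  computable F L S -> exists Phi : NN R n 1,
    [/\ forall x, realize1 Phi x = \sum_t c t * F t x,
        (nn_depth Phi <= L.+1)%N & (nn_size Phi <= S + #|T|)%N].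
Proof.
move=> hF.
have [Phi [h1 h2 h3]] := hF _ (NNlast (\row_j c (enum_val j)) 0).
exists Phi; split.
- move=> x; rewrite /realize1 h1 /= !mxE addr0 (reindex (fun i : 'I_#|T| => enum_val i)) /=.
    by apply: eq_bigr => j _; rewrite !mxE.
  by exists enum_rank => i _; rewrite ?enum_rankK ?enum_valK.
- by rewrite addn1 in h2.
- apply: leq_trans h3 _; rewrite leq_add2l /=.
  rewrite [nnz_mx 0](_ : _ = 0%N) ?addn0; last first.
    by rewrite /nnz_mx; apply: eq_card0 => -[i j]; rewrite !inE mxE eqxx.
  apply: leq_trans (@nnz_rows _ _ #|T| _ _) _; last by rewrite mul1n.
  by move=> i; apply: leq_trans (max_card _) _; rewrite card_ord.
Qed.

End Networks.

(** * Approximate squaring and multiplication on [0, 1] *)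

Section ApproximateProduct.
Context {R : realType}.
Implicit Types t u : R.

(** [hat] is the tent map on [0, 1], written with a single ReLU because its argument is nonnegative.
    [sqm m] is the sawtooth form of the piecewise linear interpolant of t^2 at the multiples of
    2^-m. [mulm] is polarization: t u = ((t + u)/2)^2 - ((t - u)/2)^2. *)
Definition hat t := 2 * t - 4 * Num.max 0 (t - 1 / 2).
Definition sqm m t := t - \sum_(1 <= s < m.+1) iter s hat t / 4 ^+ s.
Definition mulm m t u := sqm m ((t + u) / 2) - sqm m (`|t - u| / 2).
Let W t := t * (1 - t).

Lemma hatE t : hat t = if t <= 1 / 2 then 2 * t else 2 - 2 * t.
Proof. by rewrite /hat; case: (leP t (1/2)) => h; case: (leP 0 (t - 1/2)) => h'; lra. Qed.

Lemma hat01 t : 0 <= t <= 1 -> 0 <= hat t <= 1.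
Proof. by rewrite hatE => /andP[? ?]; case: (leP t (1/2)) => ?; apply/andP; split; lra. Qed.

Lemma iter_hat01 s t : 0 <= t <= 1 -> 0 <= iter s hat t <= 1.
Proof. by move=> t01; elim: s => //= s IH; exact: hat01. Qed.

Lemma hat_lip t u : `|hat t - hat u| <= 2 * `|t - u|.
Proof.
rewrite !hatE; case: (leP t) => ?; case: (leP u) => ?;
by case: (ler0P (t - u)) => ?; rewrite ler_norml; apply/andP; split; lra.
Qed.

Lemma iter_hat_lip s t u : `|iter s hat t - iter s hat u| <= 2 ^+ s * `|t - u|.
Proof.
elim: s => [|s IH]; first by rewrite mul1r.
rewrite !iterS; apply: le_trans (hat_lip _ _) _.
by rewrite exprS -mulrA ler_pM2l.
Qed.

Lemma sqmS m t : sqm m.+1 t = sqm m t - iter m.+1 hat t / 4 ^+ m.+1.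
Proof. by rewrite /sqm big_nat_recr//= opprD addrA. Qed.

(* The identity W(t) = hat(t)/4 + W(hat t)/4 makes the error telescope. *)
Lemma sqmE m t : sqm m t = t ^+ 2 + W (iter m hat t) / 4 ^+ m.
Proof.
elim: m => [|m IH]; first by rewrite /sqm big_geq// /W /=; field.
have key u : W u = hat u / 4 + W (hat u) / 4.
  by rewrite /W hatE; case: leP => _; field.
rewrite sqmS IH iterS key [4 ^+ m.+1]exprS; set u := hat _; set v := _ ^+ m.
have v0 : v != 0 by rewrite /v expf_neq0.
by field.
Qed.

Lemma W01 t : 0 <= t <= 1 -> 0 <= W t <= 1 / 4.
Proof. by rewrite /W => /andP[? ?]; rewrite mulr_ge0 ?subr_ge0//=; have := sqr_ge0 (t - 1 / 2); rewrite expr2; lra. Qed.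

Lemma sqm_ge0 m t : 0 <= t <= 1 -> 0 <= sqm m t.
Proof.
move=> t01; rewrite sqmE addr_ge0 ?sqr_ge0// divr_ge0 ?exprn_ge0//.
by have /andP[] := W01 (iter_hat01 m t01).
Qed.

Lemma sqm_rec m t : sqm m.+1 t = t - hat t / 2 + sqm m (hat t) / 4.
Proof.
rewrite !sqmE iterSr [4 ^+ m.+1]exprS.
have v0 : (4 : R) ^+ m != 0 by rewrite expf_neq0.
set v := 4 ^+ m in v0 *; set w := W _.
by rewrite hatE; case: (leP t (1/2)) => _; field.
Qed.

(** Monotonicity keeps [mulm] in [0, 1], so products can be fed to further products without
    clipping. The induction goes through [sqm_rec] on the two halves of [0, 1]; on the right half
    [hat] reverses the order, and there the upper bound 2 (u - t) is what yields nonnegativity. *)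
Lemma sqm_mono m t u : 0 <= t -> t <= u -> u <= 1 ->
  0 <= sqm m u - sqm m t <= 2 * (u - t).
Proof.
elim: m t u => [|m IH] t u t0 tu u1.
  by rewrite !sqmE /W /=; apply/andP; split; lra.
wlog: t u t0 tu u1 / (u <= 1/2) || (1/2 <= t) => [hw|].
  case: (leP u (1/2)) => hu; first by apply: hw => //; rewrite hu.
  case: (leP (1/2) t) => ht; first by apply: hw => //; rewrite ht orbT.
  have /andP[a1 a2] := hw t (1/2) t0 (ltW ht) ltac:(lra) ltac:(by rewrite lexx).
  have /andP[b1 b2] := hw (1/2) u ltac:(lra) (ltW hu) u1 ltac:(by rewrite lexx orbT).
  by apply/andP; split; lra.
rewrite !sqm_rec !hatE => /orP[hu|ht].
  rewrite hu (le_trans tu hu).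
  have /andP[? ?] := IH (2 * t) (2 * u) ltac:(lra) ltac:(lra) ltac:(lra).
  by apply/andP; split; lra.
have E (v : R) : 1/2 <= v -> (if v <= 1/2 then 2 * v else 2 - 2 * v) = 2 - 2 * v.
  by move=> hv; case: leP => // hv'; lra.
rewrite !E//; last lra.
have /andP[? ?] := IH (2 - 2 * u) (2 - 2 * t) ltac:(lra) ltac:(lra) ltac:(lra).
by apply/andP; split; lra.
Qed.

Lemma mulm01 m t u : 0 <= t <= 1 -> 0 <= u <= 1 -> 0 <= mulm m t u <= 1.
Proof.
move=> /andP[t0 t1] /andP[u0 u1].
have hd : `|t - u| / 2 <= (t + u) / 2 by case: (ler0P (t - u)) => ?; lra.
have h0 : 0 <= `|t - u| / 2 by apply: divr_ge0.
have /andP[a _] := @sqm_mono m _ _ h0 hd ltac:(lra).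
have b := @sqm_ge0 m (`|t - u| / 2) ltac:(apply/andP; split; lra).
have /andP[c _] := @sqm_mono m ((t + u) / 2) 1 ltac:(lra) ltac:(lra) (lexx _).
have d : sqm m 1 = 1.
  rewrite sqmE expr1n; case: m {a b c} => [|m]; first by rewrite /W /=; lra.
  have -> : iter m.+1 hat 1 = 0.
    elim: m => [|m IH]; first by rewrite /= hatE; case: leP => ?; lra.
    by rewrite iterS IH hatE; case: leP => ?; lra.
  by rewrite /W mul0r mul0r addr0.
by rewrite /mulm; apply/andP; split; lra.
Qed.

Lemma sqm_err m t : 0 <= t <= 1 -> `|sqm m t - t ^+ 2| <= (1 / 2) ^+ m / 4.
Proof.
move=> t01; rewrite sqmE addrC addKr.
have /andP[a b] := W01 (iter_hat01 m t01).
rewrite ger0_norm ?divr_ge0 ?exprn_ge0//.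
apply: (@le_trans _ _ ((1/4) / 4 ^+ m)); first by rewrite ler_pM2r// invr_gt0 exprn_gt0.
rewrite [X in X <= _]mulrC div1r ler_wpM2r ?invr_ge0//.
by rewrite expr_div_n expr1n div1r lef_pV2 ?posrE ?exprn_gt0// lerXn2r ?nnegrE//; lra.
Qed.

(** By [sqmE] the error is W after m tent maps, divided by 4^m. The iterated tent map has slope 2^m
    and W has slope at most 1, so half of the digits are lost on derivatives: 2^-m remains. *)
Lemma sqm_err_lip m t u : 0 <= t <= 1 -> 0 <= u <= 1 ->
  `|(sqm m t - t ^+ 2) - (sqm m u - u ^+ 2)| <= (1 / 2) ^+ m * `|t - u|.
Proof.
move=> t01 u01; rewrite !sqmE ![_ + _ / _]addrC !addrK -mulrBl.
rewrite normrM [`|_^-1|]ger0_norm ?invr_ge0 ?exprn_ge0//.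
have /andP[a b] := iter_hat01 m t01; have /andP[c e] := iter_hat01 m u01.
have h := iter_hat_lip m t u.
have hW : `|W (iter m hat t) - W (iter m hat u)| <= `|iter m hat t - iter m hat u|.
  set p := iter m hat t in a b *; set q := iter m hat u in c e *.
  have -> : W p - W q = (p - q) * (1 - p - q) by rewrite /W; ring.
  rewrite normrM -[leRHS]mulr1 ler_wpM2l// ler_norml; apply/andP; split; lra.
rewrite ler_pdivrMr ?exprn_gt0//; apply: le_trans hW _; apply: le_trans h _.
rewrite mulrAC expr_div_n expr1n div1r.
have -> : (4 : R) ^+ m = 2 ^+ m * 2 ^+ m by rewrite -exprMn; congr (_ ^+ _); lra.
by rewrite mulKf ?expf_neq0.
Qed.

End ApproximateProduct.

(** * Propagation of values and slopes errors through one round of products *)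

Section ApproximatePrograms.
Context {R : realType} {n : nat}.
Local Notation V := 'rV[R]_n.
Implicit Types (F G : V -> R) (L e : R).

(** Only displacements along coordinate axes are controlled, because only partial derivatives enter
    the H^1 norm. *)
Definition lip_lines L F := forall x i t, `|F (x + t *: delta_mx 0 i) - F x| <= L * `|t|.

(* The W^(1,infinity) norm with derivatives scaled by 1/L. *)
Definition nrmW L e F := (forall x, `|F x| <= e) /\ lip_lines (L * e) F.

Lemma lip_linesW L L' F : L <= L' -> lip_lines L F -> lip_lines L' F.
Proof. by move=> LL h x i t; apply: le_trans (h x i t) _; rewrite ler_wpM2r. Qed.

Lemma lip_linesD L L' F G : lip_lines L F -> lip_lines L' G -> lip_lines (L + L') (F \+ G).
Proof.
move=> hF hG x i t; rewrite /= opprD addrACA mulrDl.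
by apply: le_trans (ler_normD _ _) _; apply: lerD.
Qed.

Lemma lip_linesN L F : lip_lines L F -> lip_lines L (\- F).
Proof. by move=> hF x i t; rewrite /= -opprD normrN. Qed.

Lemma lip_linesM L L' a b F G : (forall x, `|F x| <= a) -> (forall x, `|G x| <= b) ->
  lip_lines L F -> lip_lines L' G -> lip_lines (L * b + a * L') (F \* G).
Proof.
move=> Fa Gb hF hG x i t /=; set y := x + _.
have -> : F y * G y - F x * G x = (F y - F x) * G y + F x * (G y - G x) by ring.
apply: le_trans (ler_normD _ _) _; rewrite !normrM mulrDl; apply: lerD.
  by rewrite mulrAC; apply: ler_pM => //; exact: hF.
by rewrite -mulrA; apply: ler_pM => //; exact: hG.
Qed.

Lemma lip_lines_comp L K (g : R -> R) (D : R -> Prop) F :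
  0 <= K -> (forall x, D (F x)) ->
  (forall u v, D u -> D v -> `|g u - g v| <= K * `|u - v|) ->
  lip_lines L F -> lip_lines (K * L) (g \o F).
Proof.
move=> K0 DF hg hF x i t /=; apply: le_trans (hg _ _ (DF _) (DF _)) _.
by rewrite -mulrA ler_wpM2l//; exact: hF.
Qed.

Lemma nrmW_sum L (I : Type) (r : seq I) (c e : I -> R) (F : I -> V -> R) :
  (forall i, nrmW L (e i) (F i)) ->
  nrmW L (\sum_(i <- r) `|c i| * e i) (fun x => \sum_(i <- r) c i * F i x).
Proof.
move=> h; split=> [x|x i t].
  apply: le_trans (ler_norm_sum _ _ _) _; apply: ler_sum => i _.
  by rewrite normrM ler_wpM2l//; have [] := h i.
rewrite -sumrB mulr_sumr mulr_suml; apply: le_trans (ler_norm_sum _ _ _) _.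
apply: ler_sum => j _; rewrite -mulrBr normrM mulrCA -mulrA ler_wpM2l//.
by have [_] := h j; apply.
Qed.

(** The inherited errors contribute 2 e to the values and 5 L e to the slopes, the two squaring
    errors at most 4 L h to the slopes. The assumption e <= 1 enters by making F and G themselves
    Lipschitz with constant 2 L. *)
Lemma mulm_nrmW m L e F G v w : 0 <= L -> 0 <= e <= 1 ->
  (forall x, 0 <= F x <= 1) -> (forall x, 0 <= G x <= 1) ->
  (forall x, 0 <= v x <= 1) -> (forall x, 0 <= w x <= 1) ->
  lip_lines L v -> lip_lines L w ->
  nrmW L e (fun x => F x - v x) -> nrmW L e (fun x => G x - w x) ->
  nrmW L (6 * e + 4 * (1 / 2) ^+ m) (fun x => mulm m (F x) (G x) - v x * w x).
Proof.
move=> L0 /andP[e0 e1] hF hG hv hw lv lw [sF lF] [sG lG].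
have n1 (H : V -> R) : (forall x, 0 <= H x <= 1) -> forall x, `|H x| <= 1.
  by move=> h x; have /andP[a b] := h x; rewrite ger0_norm.
have lipF (H u : V -> R) : lip_lines L u -> lip_lines (L * e) (fun x => H x - u x) ->
    lip_lines (2 * L) H.
  move=> lu lH; have -> : H = (fun x => H x - u x) \+ u by apply/funext => x /=; rewrite subrK.
  apply: lip_linesW (lip_linesD lH lu).
  by rewrite mulr_natl mulr2n lerD2r ler_piMr.
have lF2 := lipF _ _ lv lF; have lG2 := lipF _ _ lw lG.
set h := (1 / 2) ^+ m; have h0 : 0 <= h by rewrite exprn_ge0// divr_ge0.
pose p x := (F x + G x) / 2; pose q x := `|F x - G x| / 2.
have p01 x : 0 <= p x <= 1.
  by have /andP[? ?] := hF x; have /andP[? ?] := hG x; apply/andP; split; rewrite /p; lra.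
have q01 x : 0 <= q x <= 1.
  have /andP[? ?] := hF x; have /andP[? ?] := hG x; apply/andP; rewrite /q.
  by case: (ler0P (F x - G x)) => ?; split; lra.
have lp : lip_lines (2 * L) p.
  move=> x i t; rewrite /p; set y := x + _.
  have := lF2 x i t; have := lG2 x i t; rewrite -/y => a b.
  rewrite (_ : _ - _ = ((F y - F x) + (G y - G x)) / 2); last by field.
  by rewrite normrM [`|2^-1|]ger0_norm ?invr_ge0// ler_pdivrMr//;
    apply: le_trans (ler_normD _ _) _; lra.
have lq : lip_lines (2 * L) q.
  move=> x i t; rewrite /q; set y := x + _.
  have := lF2 x i t; have := lG2 x i t; rewrite -/y => a b.
  rewrite -mulrBl normrM [`|2^-1|]ger0_norm ?invr_ge0// ler_pdivrMr//.
  apply: le_trans (ler_dist_dist _ _) _.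
  rewrite (_ : _ - _ = (F y - F x) - (G y - G x)); last by ring.
  by apply: le_trans (ler_normB _ _) _; lra.
pose E (u : R) := sqm m u - u ^+ 2.
have lE (r : V -> R) : (forall x, 0 <= r x <= 1) -> lip_lines (2 * L) r ->
    lip_lines (h * (2 * L)) (fun x => E (r x)).
  move=> r01 lr; apply: (lip_lines_comp (g := E) (D := fun u => 0 <= u <= 1)) => //.
  by move=> u u' hu hu'; exact: sqm_err_lip.
(* Exact polarization of F G leaves two terms for the inherited errors and two for the error E of
   the squaring network. *)
have dec : (fun x => mulm m (F x) (G x) - v x * w x) =
   (((fun x => F x - v x) \* G) \+ (v \* (fun x => G x - w x))) \+
   ((fun x => E (p x)) \+ (\- (fun x => E (q x)))).
  apply/funext => x /=; rewrite /mulm -/(p x) -/(q x) /E.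
  have -> : q x ^+ 2 = ((F x - G x) / 2) ^+ 2 by rewrite /q !expr_div_n real_normK ?num_real.
  by rewrite /p; field.
split.
  move=> x; rewrite (congr1 (fun f => f x) dec) /=.
  apply: le_trans (ler_normD _ _) _.
  have a1 : `|(F x - v x) * G x| <= e.
    by rewrite normrM -[leRHS]mulr1; apply: ler_pM => //; exact: n1.
  have a2 : `|v x * (G x - w x)| <= e.
    by rewrite normrM -[leRHS]mul1r; apply: ler_pM => //; exact: n1.
  have b1 := sqm_err m (p01 x); have b2 := sqm_err m (q01 x).
  have c1 := ler_normD ((F x - v x) * G x) (v x * (G x - w x)).
  have c2 := ler_normB (E (p x)) (E (q x)).
  by rewrite /E -/h in b1 b2 c2 *; lra.
rewrite dec.
have A := lip_linesM sF (n1 _ hG) lF lG2.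
have B := lip_linesM (n1 _ hv) sG lv lG.
have C := lE _ p01 lp; have D := lip_linesN (lE _ q01 lq).
apply: lip_linesW (lip_linesD (lip_linesD A B) (lip_linesD C D)).
by nra.
Qed.

(** The exact values v have a Lipschitz bound L fixed once for the whole computation. Errors are
    measured relative to v in the norm scaled by this L, so L does not grow with the number of
    rounds. *)
Definition approximated L (T : finType) (v : T -> V -> R) (d s : nat) e :=
  exists F : T -> V -> R, [/\ computable F d s,
    forall t x, 0 <= F t x <= 1, forall t x, 0 <= v t x <= 1, forall t, lip_lines L (v t)
    & forall t, nrmW L e (fun x => F t x - v t x)].

(** A missing second factor stands for 1: a value that is merely carried along passes through the
    same product layers as the others, which keeps all neurons in step. *)
Definition oapp1 (T : Type) (v : T -> V -> R) (o : option T) x : R :=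
  if o is Some t then v t x else 1.

(** The depth d + m + 3 counts one layer for means and differences, one that starts the iteration, m
    tent maps, and one for the difference of the two squares. *)
Lemma approx_product m L (T T' : finType) (v : T -> V -> R) d s e
    (f : T' -> T) (g : T' -> option T) :
  0 <= L -> 0 <= e <= 1 -> approximated L v d s e ->
  (forall t, lip_lines L (fun x => v (f t) x * oapp1 v (g t) x)) ->
  approximated L (fun t x => v (f t) x * oapp1 v (g t) x)
    (d + m + 3) (s + 24 * (m + 3) * #|T'|) (6 * e + 4 * (1 / 2) ^+ m).
Proof.
move=> L0 he [F [cF F01 v01 lv aF]] lv'.
pose a t x := F (f t) x; pose b t x := oapp1 F (g t) x.
have a01 t x : 0 <= a t x <= 1 by exact: F01.
have b01 t x : 0 <= b t x <= 1 by rewrite /b; case: (g t) => [u|] /=; rewrite ?F01// ler01 lexx.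
have w01 t x : 0 <= oapp1 v (g t) x <= 1 by case: (g t) => [u|] /=; rewrite ?v01// ler01 lexx.
pose ob (t : T') (c : R) : seq (R * T) := if g t is Some u then [:: (c, u)] else [::].
pose oc (t : T') (c : R) : R := if g t is Some _ then 0 else c.
have obE t c x : \sum_(w <- ob t c) w.1 * F w.2 x + oc t c = c * b t x.
  rewrite /ob /oc /b; case: (g t) => [u|] /=; first by rewrite big_seq1 addr0.
  by rewrite big_nil add0r mulr1.
(* Three neurons for each product: the mean, and the two positive parts whose sum is |a - b| / 2. *)
pose F1 (tj : T' * 'I_3) x : R := let: (t, j) := tj in
  if val j == 0%N then (a t x + b t x) / 2
  else if val j == 1%N then Num.max 0 ((a t x - b t x) / 2) else Num.max 0 ((b t x - a t x) / 2).
have c1 : computable F1 d.+1 (s + 3 * #|{: T' * 'I_3}|).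
  pose cf (tj : T' * 'I_3) : R * R := if val tj.2 == 0%N then (1/2, 1/2)
     else if val tj.2 == 1%N then (1/2, -(1/2)) else (-(1/2), 1/2).
  apply: (computable_layer (cmb := fun tj => ((cf tj).1, f tj.1) :: ob tj.1 (cf tj).2)
     (b := fun tj => oc tj.1 (cf tj).2) cF) => [[t j]|[t j] x] /=.
    by rewrite /ob; case: (g t).
  rewrite big_cons -addrA obE -/(a t x).
  have /andP[? ?] := a01 t x; have /andP[? ?] := b01 t x.
  rewrite /cf /=; case: ifP => _ /=; first by rewrite max_r; lra.
  by case: ifP => _ /=; congr (Num.max 0 _); lra.
pose u (t : T') (c : bool) x := if c then (a t x + b t x) / 2 else `|a t x - b t x| / 2.
have u01 t c x : 0 <= u t c x <= 1.
  have /andP[? ?] := a01 t x; have /andP[? ?] := b01 t x.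
  rewrite /u; case: c; first by apply/andP; split; lra.
  by case: (ler0P (a t x - b t x)) => ?; apply/andP; split; lra.
(* For both arguments of the squaring, three numbers are carried: the current iterate of [hat], its
   ReLU shifted by 1/2, from which the next iterate is a linear combination, and the partial sum
   [sqm k]. *)
pose St k (tcj : T' * bool * 'I_3) x : R := let: (t, c, j) := tcj in
  if val j == 0%N then iter k hat (u t c x)
  else if val j == 1%N then Num.max 0 (iter k hat (u t c x) - 1 / 2)
  else sqm k (u t c x).
have i1 : (1 < 3)%N by []. have i2 : (2 < 3)%N by [].
pose o0 : 'I_3 := ord0. pose o1 : 'I_3 := Ordinal i1. pose o2 : 'I_3 := Ordinal i2.
have c2 : computable (St 0%N) d.+2 (s + 3 * #|{: T' * 'I_3}| + 3 * #|{: T' * bool * 'I_3}|).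
  apply: (computable_layer (cmb := fun tcj => if tcj.1.2 then [:: (1, (tcj.1.1, o0))]
      else [:: (1, (tcj.1.1, o1)); (1, (tcj.1.1, o2))])
     (b := fun tcj => if val tcj.2 == 1%N then - (1/2) else 0) c1) => [[[t []] j]//|[[t c] j] x] /=.
  have -> : \sum_(w <- (if c then [:: (1, (t, o0))] else [:: (1, (t, o1)); (1, (t, o2))]))
      w.1 * F1 w.2 x = u t c x.
    rewrite /u; case: c; first by rewrite big_seq1 /= mul1r.
    rewrite !big_cons big_nil /= !mul1r addr0.
    case: (ler0P (a t x - b t x)) => h.
      by rewrite [Num.max 0 ((a t x - b t x) / 2)]max_l ?max_r; lra.
    by rewrite [Num.max 0 ((b t x - a t x) / 2)]max_l ?max_r; lra.
  have /andP[? ?] := u01 t c x.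
  case: ifP => [/eqP ->|_] /=; first by rewrite addr0 max_r.
  by case: ifP => _ //; rewrite addr0 max_r// /sqm big_geq// subr0.
have c3 k : computable (St k) (d.+2 + k)
    (s + 3 * #|{: T' * 'I_3}| + 3 * #|{: T' * bool * 'I_3}| + 4 * #|{: T' * bool * 'I_3}| * k).
  elim: k => [|k IH]; first by rewrite addn0 muln0 addn0.
  rewrite mulnS [(_ + 4 * _ * k)%N]addnC addnA addnS.
  (* The next iterate is 2 u - 4 max(0, u - 1/2), read off the first two neurons; the third neuron
     subtracts the same combination divided by 4^(k+1). *)
  apply: (computable_layer (cmb := fun tcj =>
      if val tcj.2 == 2%N then [:: (1, (tcj.1.1, tcj.1.2, o2));
         (- 2 / 4 ^+ k.+1, (tcj.1.1, tcj.1.2, o0)); (4 / 4 ^+ k.+1, (tcj.1.1, tcj.1.2, o1))]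
      else [:: (2, (tcj.1.1, tcj.1.2, o0)); (-4, (tcj.1.1, tcj.1.2, o1))])
     (b := fun tcj => if val tcj.2 == 1%N then - (1/2) else 0) IH) => [[[t c] j]|[[t c] j] x] /=.
    by case: ifP.
  have v0 : (4 : R) ^+ k.+1 != 0 by rewrite expf_neq0.
  have /andP[? ?] := iter_hat01 k.+1 (u01 t c x).
  have s0 := sqm_ge0 k.+1 (u01 t c x).
  case: j => -[|[|[|//]]] hj /=; rewrite !big_cons big_nil /= ?addr0.
  - by rewrite mulNr -/(hat (iter k hat (u t c x))) max_r.
  - by rewrite mulNr -/(hat (iter k hat (u t c x))).
  - rewrite -[RHS](_ : Num.max 0 (sqm k.+1 (u t c x)) = _); first by rewrite max_r.
    congr (Num.max 0 _); rewrite sqmS iterS /hat; set A := iter k hat _.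
    by set B := Num.max _ _; set w := 4 ^+ k.+1 in v0 *; field.
have c4 : computable (fun t x => mulm m (a t x) (b t x)) (d.+2 + m).+1
    (s + 3 * #|{: T' * 'I_3}| + 3 * #|{: T' * bool * 'I_3}| + 4 * #|{: T' * bool * 'I_3}| * m + 3 * #|T'|).
  apply: (computable_layer (cmb := fun t => [:: (1, (t, true, o2)); (-1, (t, false, o2))])
     (b := fun=> 0) (c3 m)) => // t x.
  rewrite !big_cons big_nil /= !addr0 mul1r mulN1r max_r//.
  by have /andP[] := @mulm01 _ m (a t x) (b t x) (F01 _ _) (b01 _ _).
exists (fun t x => mulm m (a t x) (b t x)); split.
- move=> k rest; have [Phi [h1 h2 h3]] := c4 k rest; exists Phi; split => //.
    by apply: leq_trans h2 _; lia.
  apply: leq_trans h3 _; rewrite !card_prod card_bool !card_ord; nia.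
- by move=> t x; apply: mulm01; [exact: F01|exact: b01].
- move=> t x; have /andP[? ?] := v01 (f t) x; have /andP[? ?] := w01 t x.
  by rewrite mulr_ge0//= mulr_ile1.
- exact: lv'.
- move=> t; apply: mulm_nrmW => //.
  + case: (g t) => [r|] /=; first exact: lv.
    by move=> x i h; rewrite subrr normr0 mulr_ge0.
  + exact: aF.
  + rewrite /b; case: (g t) => [r|] /=; first exact: aF.
    have /andP[e0 _] := he.
    by split=> [x|x i h]; rewrite !subrr normr0// !mulr_ge0.
Qed.

End ApproximatePrograms.

(** * Emulation of powers by doubling and of tensor products factor by factor *)

Section TensorPrograms.
Context {R : realType} {n' : nat}.
Local Notation n := n'.+1.
Local Notation V := 'rV[R]_n.

Lemma approxW L (T : finType) (v : T -> V -> R) d d' s s' e e' :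
  0 <= L -> (d <= d')%N -> (s <= s')%N -> e <= e' -> approximated L v d s e -> approximated L v d' s' e'.
Proof.
move=> L0 dd ss ee [F [cF h1 h2 h3 h4]]; exists F; split => //.
  move=> k rest; have [Phi [g1 g2 g3]] := cF k rest; exists Phi; split => //.
    by apply: leq_trans g2 _; rewrite leq_add2r.
  by apply: leq_trans g3 _; rewrite leq_add2r.
move=> t; have [a b] := h4 t; split => [x|]; first exact: le_trans (a x) ee.
by apply: lip_linesW b; rewrite ler_wpM2l.
Qed.

Lemma eq_approx L (T : finType) (v v' : T -> V -> R) d s e :
  (forall t x, v t x = v' t x) -> approximated L v d s e -> approximated L v' d s e.
Proof. by move=> h; have -> : v = v' by apply/funext => t; apply/funext => x. Qed.

Variables (l q m : nat) (L : R).
Variables (sg al : 'I_n -> 'I_l -> R -> R).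
Hypothesis L0 : 0 <= L.
Hypothesis sg01 : forall i k u, 0 <= sg i k u <= 1.
Hypothesis al01 : forall i k u, 0 <= al i k u <= 1.
Hypothesis sg_lip : forall i k j u v, (j <= 2 ^ q)%N ->
  `|sg i k u ^+ j - sg i k v ^+ j| <= L * `|u - v|.
Hypothesis al_lip : forall i k u v, `|al i k u - al i k v| <= L * `|u - v|.
Hypothesis as_lip : forall i k j u v, (j <= 2 ^ q)%N ->
  `|al i k u * sg i k u ^+ j - al i k v * sg i k v ^+ j| <= L * `|u - v|.

Let I := ('I_n * 'I_l)%type.
(** What is available after r rounds: the powers of each [sg] with exponents up to 2^r, and the
    functions [al], carried along. *)
Let Tp r := (I * 'I_(2 ^ r).+1 + I)%type.
Let Vp r (t : Tp r) (x : V) : R :=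
  match t with
  | inl (i, k, j) => sg i k (x 0 i) ^+ j
  | inr (i, k) => al i k (x 0 i)
  end.

Let lip1 (i : 'I_n) (f : R -> R) : (forall u v, `|f u - f v| <= L * `|u - v|) ->
  lip_lines L (fun x : V => f (x 0 i)).
Proof.
move=> h x j t; apply: le_trans (h _ _) _; rewrite ler_wpM2l// !mxE eqxx /=.
by rewrite addrAC subrr add0r; case: eqP => _; rewrite ?mulr1// mulr0 normr0.
Qed.

Let h2 : R := (1 / 2) ^+ m.
(** A supersolution, starting from 0, of the recursion e -> 6 e + 4 h of one round of products. *)
Let err j : R := (6 ^+ j - 1) * h2.

Let errS j : 6 * err j + 4 * h2 <= err j.+1.
Proof.
have h0 : 0 <= h2 by rewrite exprn_ge0// divr_ge0.
by rewrite /err exprS; nra.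
Qed.

Let err01 j : (6 ^ j <= 2 ^ m)%N -> 0 <= err j <= 1.
Proof.
move=> jm; have h0 : 0 < h2 by rewrite exprn_gt0// divr_gt0.
have e6 : 1 <= 6 ^+ j :> R by rewrite exprn_ege1// ler1n.
apply/andP; split; first by rewrite mulr_ge0 ?subr_ge0// ltW.
have : 6 ^+ j * h2 <= 1.
  rewrite /h2 expr_div_n expr1n div1r ler_pdivrMr ?exprn_gt0// mul1r.
  by rewrite -!natrX ler_nat.
by rewrite /err mulrBl mul1r; lra.
Qed.

(** An exponent is the sum of its upper and lower halves, so one round of products doubles the range
    of exponents; q rounds reach 2^q. *)
Lemma approx_powers d s : approximated L (Vp (r := 0)) d s 0 -> (6 ^ q <= 2 ^ m)%N ->
  forall r, (r <= q)%N ->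
  approximated L (Vp (r := r)) (d + r * (m + 3)) (s + r * (24 * (m + 3) * (n * l * (2 ^ q + 2)))) (err r).
Proof.
move=> h0 qm; elim=> [|r IH] rq.
  by apply: approxW h0; rewrite ?mul0n ?addn0// /err expr0 subrr mul0r.
have hup (j : 'I_(2 ^ r.+1).+1) : (uphalf j < (2 ^ r).+1)%N.
  move: (nat_of_ord j) (ltn_ord j) => {}j; rewrite !ltnS expnS uphalf_half => hj.
  by have := odd_double_half j; lia.
have hdn (j : 'I_(2 ^ r.+1).+1) : (j./2 < (2 ^ r).+1)%N.
  move: (nat_of_ord j) (ltn_ord j) => {}j; rewrite !ltnS expnS => hj.
  by have := odd_double_half j; lia.
pose f (t : Tp r.+1) : Tp r :=
  match t with inl (ik, j) => inl (ik, Ordinal (hup j)) | inr ik => inr ik end.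
pose g (t : Tp r.+1) : option (Tp r) :=
  match t with inl (ik, j) => Some (inl (ik, Ordinal (hdn j))) | inr ik => None end.
have E t x : Vp (f t) x * oapp1 (Vp (r := r)) (g t) x = Vp t x.
  case: t => [[[i k] j]|[i k]] /=; last by rewrite mulr1.
  by rewrite -exprD uphalf_half -addnA addnn odd_double_half.
have lv (t : Tp r.+1) : lip_lines L (fun x => Vp (f t) x * oapp1 (Vp (r := r)) (g t) x).
  rewrite (_ : (fun _ => _) = Vp t); last by apply/funext => x; rewrite E.
  case: t => [[[i k] j]|[i k]].
    apply: (@lip1 i (fun u => sg i k u ^+ j)) => u v; apply: sg_lip.
    have hj : (j <= 2 ^ r.+1)%N by rewrite -ltnS.
    by apply: leq_trans hj _; rewrite leq_pexp2l.
  by apply: (@lip1 i (al i k)) => u v; exact: al_lip.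
have e01 : 0 <= err r <= 1.
  by apply: err01; apply: leq_trans qm; rewrite leq_pexp2l// ltnW.
have := approx_product m L0 e01 (IH (ltnW rq)) lv.
move=> /(eq_approx E); apply: approxW => //; first by lia.
have : (2 ^ r.+1 <= 2 ^ q)%N by rewrite leq_pexp2l.
rewrite card_sum !card_prod !card_ord; move: (2 ^ r.+1)%N (2 ^ q)%N => A B AB.
have : (n * l * A.+1 + n * l <= n * l * (B + 2))%N.
  by rewrite -mulnSr leq_mul2l; apply/orP; right; lia.
move: (n * l * A.+1 + n * l)%N (n * l * (B + 2))%N => X Y XY.
by rewrite (mulSnr r) addnA leq_add2l leq_mul2l XY orbT.
Qed.

Let K := ('I_l * 'I_(2 ^ q).+1)%type.
Let u1 (i : 'I_n) (k : K) (x : V) : R := al i k.1 (x 0 i) * sg i k.1 (x 0 i) ^+ k.2.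
(** [inl phi] selects one factor for each coordinate and stands for the product over the coordinates
    below r; [inr] is a single factor kept for later rounds. The number (l (2^q + 1))^n of choices
    phi governs the size of the network. *)
Let Tt := ({ffun 'I_n -> K} + 'I_n * K)%type.
Let Vt (r : nat) (t : Tt) (x : V) : R :=
  match t with
  | inl phi => \prod_(i < n | (i < r)%N) u1 i (phi i) x
  | inr ik => u1 ik.1 ik.2 x
  end.

Let u101 i k x : 0 <= u1 i k x <= 1.
Proof.
have /andP[? ?] := sg01 i k.1 (x 0 i); have /andP[? ?] := al01 i k.1 (x 0 i).
by rewrite /u1 mulr_ge0 ?exprn_ge0//= mulr_ile1 ?exprn_ge0// exprn_ile1.
Qed.

Let u1_lip i k : lip_lines L (u1 i k).
Proof.
apply: (@lip1 i (fun u => al i k.1 u * sg i k.1 u ^+ k.2)) => u v; apply: as_lip.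
by have := ltn_ord k.2.
Qed.

(** Moving along axis j changes only the factor of index j, and the other factors lie in [0, 1];
    hence a product keeps the Lipschitz constant of one factor. *)
Let Vt_lip r t : lip_lines L (Vt r t).
Proof.
case: t => [phi|ik]; last exact: u1_lip.
move=> x j t; have u1E (i : 'I_n) : i != j -> u1 i (phi i) (x + t *: delta_mx 0 j) = u1 i (phi i) x.
  by move=> ij; rewrite /u1 !mxE eqxx /= (negPf ij) mulr0 addr0.
rewrite /Vt; case: (boolP (j < r)%N) => jr.
  rewrite !(bigD1 j jr)/=; set A := \prod_(_ | _) _; set B := \prod_(_ | _) _.
  have -> : A = B by apply: eq_bigr => i /andP[_ ij]; rewrite u1E.
  rewrite -mulrBl normrM -[leRHS]mulr1; apply: ler_pM => //; first exact: u1_lip.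
  have /andP[B0 B1] : 0 <= B <= 1.
    by apply: (big_ind (fun y => 0 <= y <= 1)); rewrite ?ler01 ?lexx// => y z /andP[? ?] /andP[? ?];
       rewrite mulr_ge0//= mulr_ile1.
  by rewrite ger0_norm.
rewrite (eq_bigr (fun i => u1 i (phi i) x)) ?subrr ?normr0 ?mulr_ge0// => i ir.
by rewrite u1E//; apply: contraNneq jr => <-.
Qed.

Let Tb := ('I_n * K)%type.

Lemma approx_tensor d s : approximated L (Vp (r := 0)) d s 0 -> (6 ^ (q + n.+1) <= 2 ^ m)%N ->
  approximated L (fun (phi : {ffun 'I_n -> 'I_l * 'I_(2 ^ q).+1}) (x : V) =>
      \prod_i (al i (phi i).1 (x 0 i) * sg i (phi i).1 (x 0 i) ^+ (phi i).2))
    (d + (q + n.+2) * (m + 3))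
    (s + 24 * (m + 3) * ((q + 1) * (n * l * (2 ^ q + 2)) +
       n.+1 * ((l * (2 ^ q + 1)) ^ n + n * l * (2 ^ q + 1))))
    (6 ^+ (q + n.+1) * (1 / 2) ^+ m).
Proof.
move=> h0 qm.
have le6 j : (j <= q + n.+1)%N -> (6 ^ j <= 2 ^ m)%N.
  by move=> hj; apply: leq_trans qm; rewrite leq_pexp2l.
have hA := approx_powers h0 (le6 q (leq_addr _ _)) (leqnn q).
pose fB (t : Tb) : Tp q := inr (t.1, t.2.1).
pose gB (t : Tb) : option (Tp q) := Some (inl (t.1, t.2.1, t.2.2)).
have lvB (t : Tb) : lip_lines L (fun x => Vp (fB t) x * oapp1 (Vp (r := q)) (gB t) x).
  exact: (@u1_lip t.1 t.2).
have hB := approx_product m L0 (err01 (le6 q (leq_addr _ _))) hA lvB.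
have {hB} hB : approximated L (fun (t : Tb) => u1 t.1 t.2) (d + (q + 1) * (m + 3))
    (s + (q + 1) * (24 * (m + 3) * (n * l * (2 ^ q + 2)))) (err (q + 1)).
  apply: approxW hB => //; first by lia.
    rewrite !card_prod !card_ord mulnDl mul1n addnA leq_add2l leq_mul2l; apply/orP; right.
    by rewrite addn2 mulnA !mulnS; lia.
  by rewrite addn1 errS.
have hC r : (r < n)%N -> approximated L (Vt r.+1) (d + (q + r.+2) * (m + 3))
    (s + (q + 1) * (24 * (m + 3) * (n * l * (2 ^ q + 2))) +
      r.+1 * (24 * (m + 3) * ((l * (2 ^ q + 1)) ^ n + n * l * (2 ^ q + 1)))) (err (q + r.+2)).
  have cT : #|{: Tt}| = ((l * (2 ^ q + 1)) ^ n + n * l * (2 ^ q + 1))%N.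
    by rewrite card_sum card_ffun !card_prod !card_ord addn1 mulnA.
  elim: r => [|r IH] rn.
    (* The product over the single coordinate 0 is the factor itself, passed through one round as a
       product with 1. *)
    pose f (t : Tt) : Tb := match t with inl phi => (ord0, phi ord0) | inr ik => ik end.
    pose g (t : Tt) : option Tb := None.
    have E t x : u1 (f t).1 (f t).2 x * oapp1 (fun t : Tb => u1 t.1 t.2) (g t) x = Vt 1 t x.
      rewrite mulr1; case: t => [phi|//] /=; rewrite (big_pred1 ord0)// => i.
      by rewrite /= ltnS leqn0 -val_eqE.
    have lv (t : Tt) : lip_lines L (fun x => u1 (f t).1 (f t).2 x * oapp1 (fun t : Tb => u1 t.1 t.2) (g t) x).
      by rewrite (_ : (fun _ => _) = Vt 1 t); [exact: Vt_lip|apply/funext => x; rewrite E].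
    have := approx_product m L0 (err01 (le6 (q + 1)%N ltac:(lia))) hB lv.
    move=> /(eq_approx E); apply: approxW => //; first by lia.
      by rewrite cT mul1n leq_add2l.
    by rewrite addn2 addn1 errS.
  pose f (t : Tt) : Tt := t.
  pose g (t : Tt) : option Tt := match t with
     inl phi => Some (inr (Ordinal rn, phi (Ordinal rn))) | inr _ => None end.
  have E t x : Vt r.+1 (f t) x * oapp1 (Vt r.+1) (g t) x = Vt r.+2 t x.
    case: t => [phi|ik] /=; last by rewrite mulr1.
    rewrite [RHS](bigD1 (Ordinal rn))//= mulrC; congr (_ * _); apply: eq_bigl => i.
    by rewrite -val_eqE /= [in RHS]ltnS andbC -ltn_neqAle.
  have lv (t : Tt) : lip_lines L (fun x => Vt r.+1 (f t) x * oapp1 (Vt r.+1) (g t) x).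
    by rewrite (_ : (fun _ => _) = Vt r.+2 t); [exact: Vt_lip|apply/funext => x; rewrite E].
  have := approx_product m L0 (err01 (le6 (q + r.+2)%N ltac:(lia))) (IH (ltnW rn)) lv.
  move=> /(eq_approx E); apply: approxW => //; first by lia.
    by rewrite cT -addnA leq_add2l -mulSnr.
  by rewrite !addnS errS.
have [F [cF F01 v01 lv aF]] := hC n' (ltnSn _).
exists (fun phi => F (inl phi)); split.
(* A last layer keeps the full products and drops the carried factors; the ReLU leaves them
   unchanged because they are nonnegative. *)
- have h := computable_layer (F' := fun phi => F (inl phi)) (cmb := fun phi => [:: (1, inl phi)])
    (b := fun=> 0) cF (fun=> leqnn 1%N) _.
  move=> k rest; have [|Phi [g1 g2 g3]] := h _ k rest.
    by move=> phi x; rewrite big_seq1 /= mul1r addr0 max_r//; have /andP[] := F01 (inl phi) x.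
  exists Phi; split => //; first by apply: leq_trans g2 _; nia.
  apply: leq_trans g3 _; rewrite leq_add2r card_ffun card_prod !card_ord.
  have gen (s1 q1 X n1 C W Y : nat) : (2 <= C)%N -> (Y <= W)%N ->
      (s1 + q1 * (C * X) + n1 * (C * W) + 2 * Y <= s1 + C * (q1 * X + n1.+1 * W))%N.
    move=> C2 YW; rewrite mulnDr [(C * (n1.+1 * W))%N]mulnCA [(C * (q1 * X))%N]mulnCA.
    have := leq_mul C2 YW; move: (C * X)%N (C * W)%N (2 * Y)%N => a b c cb.
    by move: (q1 * a)%N => z; rewrite (mulSnr n1); lia.
  by apply: gen; [lia|rewrite addn1 leq_addr].
- by move=> phi x; exact: F01.
- move=> phi x; have := v01 (inl phi) x; rewrite /= (eq_bigl xpredT)// => i.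
  by rewrite ltn_ord.
- move=> phi; have := lv (inl phi); rewrite (_ : Vt _ _ = (fun x => \prod_i u1 i (phi i) x))//.
  by apply/funext => x /=; apply: eq_bigl => i; rewrite ltn_ord.
- move=> phi; have [a b] := aF (inl phi).
  have E : (fun x => F (inl phi) x - \prod_i u1 i (phi i) x) = (fun x => F (inl phi) x - Vt n (inl phi) x).
    apply/funext => x /=; congr (_ - _); apply: eq_bigl => i; by rewrite ltn_ord.
  change (nrmW L (6 ^+ (q + n.+1) * (1 / 2) ^+ m) (fun x => F (inl phi) x - \prod_i u1 i (phi i) x)).
  rewrite E.
  have le : err (q + n.+1) <= 6 ^+ (q + n.+1) * (1 / 2) ^+ m.
    by rewrite /err ler_wpM2r ?exprn_ge0 ?divr_ge0// gerBl.
  split=> [x|]; first exact: le_trans (a x) le.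
  by apply: lip_linesW b; rewrite ler_wpM2l.
Qed.

End TensorPrograms.

(** * Polynomial expansion on a box *)

Section PowerIntegral.
Context {R : realType}.

Lemma integral_power (l r : R) k : l < r ->
  (\int[lebesgue_measure]_t ((\1_`]l, r[ t : R) * (((t - l) / (r - l)) ^+ k))%:E =
    ((r - l) / k.+1%:R)%:E)%E.
Proof.
move=> lr; have rl : 0 < r - l by rewrite subr_gt0.
pose F (t : R) : R := (r - l) / k.+1%:R * ((t - l) / (r - l)) ^+ k.+1.
have dF (t : R) : is_derive t 1 F (((t - l) / (r - l)) ^+ k).
  pose g (t : R) : R := (t - l) / (r - l).
  have dg : is_derive t 1 g (r - l)^-1.
    have h : is_derive t 1 ((r - l)^-1 \*: (id - cst l : R -> R)) ((r - l)^-1 *: (1 - 0)).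
      by apply: is_deriveZ.
    rewrite subr0 in h; rewrite (_ : g = (r - l)^-1 \*: (id - cst l : R -> R)); last first.
      by apply/funext => u; rewrite /g/= /GRing.scale/= mulrC.
    by rewrite /GRing.scale/= mulr1 in h.
  have -> : F = ((r - l) / k.+1%:R) \*: (g ^+ k.+1).
    by apply/funext => u; rewrite /F /= /GRing.scale/= exprfctE.
  apply: is_derive_eq.
  rewrite /GRing.scale/= -[g t]/((t - l) / (r - l)); set u := _ ^+ k.
  have : k.+1%:R != 0 :> R by rewrite pnatr_eq0.
  move: (k.+1%:R) (gt_eqF rl) => w rl0 w0.
  by field; rewrite rl0 w0.
have cF : continuous F.
  by move=> t; apply/differentiable_continuous/derivable1_diffP; case: (dF t).
have cf : continuous (fun t : R => ((t - l) / (r - l)) ^+ k).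
  move=> t; apply: (@continuous_comp _ _ _ (fun t : R => (t - l) / (r - l)) (fun u => u ^+ k)).
    by apply: cvgM; [apply: cvgB; [exact: cvg_id|exact: cvg_cst]|exact: cvg_cst].
  exact: exprn_continuous.
rewrite [LHS](_ : _ = (\int[lebesgue_measure]_(t in `[l, r]) (((t - l) / (r - l)) ^+ k)%:E)%E); last first.
  rewrite (_ : (fun t : R => _) = (fun t => (((t - l) / (r - l)) ^+ k)%:E) \_ `]l, r[); last first.
    apply/funext => t; rewrite patchE indicE; case: ifP => tI.
      by rewrite mul1r.
    by rewrite mul0r.
  rewrite -integral_mkcond; apply/esym/integral_itv_bndoo.
  apply/measurable_EFinP; apply: measurable_funTS; exact: continuous_measurable_fun.
rewrite (@continuous_FTC2 R _ F)//.
- rewrite -EFinB /F subrr mul0r expr0n /= mulr0 subr0 divff ?gt_eqF// expr1n mulr1//.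
- exact: continuous_subspaceT.
- split; first by move=> t _; case: (dF t).
    by apply: cvg_at_right_filter; exact: cF.
  by apply: cvg_at_left_filter; exact: cF.
- by move=> t _; rewrite derive1E; apply: derive_val.
Qed.

End PowerIntegral.

Section BoxIntegrals.
Context {R : realType} {d : measure_display} {P : measurableType d}.
Variables (mu : {measure set P -> \bar R}) (n : nat) (toV : P -> 'rV[R]_n).
Hypothesis H : leb_like mu toV.
Local Notation V := 'rV[R]_n.

Definition box (l r : 'I_n -> R) : set V := [set x | forall i, l i < x 0 i < r i].

Lemma meas_fin_all (F : 'I_n -> set P) : (forall i, measurable (F i)) ->
  measurable [set p | forall i, F i p].
Proof.
move=> h; rewrite (_ : [set _ | _] = \bigcap_(i in [set: 'I_n]) F i); last first.
  by apply/seteqP; split => p hp i => //; exact: hp.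
exact: fin_bigcap_measurable.
Qed.

Lemma meas_box l r : measurable (toV @^-1` box l r).
Proof.
rewrite (_ : _ @^-1` _ = [set p | forall i, ((fun p : P => toV p 0 i) @^-1` `]l i, r i[%classic) p]); last first.
  by apply/seteqP; split => p h i; have := h i; rewrite /= in_itv.
by apply: meas_fin_all => i; rewrite -[X in measurable X]setTI; apply: (leb_meas H i).
Qed.

Lemma meas_open (U : set V) : open U -> measurable (toV @^-1` U).
Proof.
move=> oU; pose Ix := ({ffun 'I_n -> rat} * {ffun 'I_n -> rat})%type.
pose bq (ab : Ix) := box (fun i => ratr (ab.1 i)) (fun i => ratr (ab.2 i)).
have -> : toV @^-1` U = \bigcup_(ab : Ix) (if pselect (bq ab `<=` U) then toV @^-1` bq ab else set0).
  apply/seteqP; split => [p Up|p [ab _]]; last by case: pselect => // h /h.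
  have /nbhs_ballP[e /= e0 he] : nbhs (toV p) U by exact: open_nbhs_nbhs.
  have ra i := rat_in_itvoo (ltac:(rewrite gtrBl//) : toV p 0 i - e < toV p 0 i).
  have rb i := rat_in_itvoo (ltac:(rewrite ltrDl//) : toV p 0 i < toV p 0 i + e).
  pose a : {ffun 'I_n -> rat} := [ffun i => projT1 (cid (ra i))].
  pose b : {ffun 'I_n -> rat} := [ffun i => projT1 (cid (rb i))].
  have aE i : toV p 0 i - e < ratr (a i) < toV p 0 i.
    by rewrite /a ffunE; case: cid => q /=; rewrite in_itv.
  have bE i : toV p 0 i < ratr (b i) < toV p 0 i + e.
    by rewrite /b ffunE; case: cid => q /=; rewrite in_itv.
  exists (a, b) => //; case: pselect => [_|[]] /=.
    by move=> i; have /andP[_ ->] := aE i; have /andP[-> _] := bE i.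
  move=> x hx; apply: he; split=> // i j; rewrite (ord1 i).
  have := hx j; have := aE j; have := bE j => /= /andP[_ b2] /andP[a1 _] /andP[x1 x2].
  rewrite /ball/= ltr_norml; apply/andP; split; lra.
apply: countable_bigcupT_measurable => [|ab]; first exact: countableP.
by case: pselect => /= _ //; exact: meas_box.
Qed.

Lemma meas_continuous (u : V -> R) : continuous u -> measurable_fun setT (u \o toV).
Proof.
move=> cu; apply: (measurability _ (RGenOpens.measurableE R)).
move=> _ [_ [a [b ->] <-]]; rewrite setTI comp_preimage; apply: meas_open.
by move/continuousP: cu; apply; exact: interval_open.
Qed.

Lemma meas_horner (q : {poly R}) (f : P -> R) : measurable_fun setT f ->
  measurable_fun setT (fun p => q.[f p]).
Proof.
move=> mf; rewrite (_ : (fun p => _) = (fun p => \sum_(i < size q) q`_i * f p ^+ i)).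
  apply: measurable_sum => i; apply: measurable_funM => //.
  exact: measurable_funX.
by apply/funext => p; rewrite horner_coef.
Qed.

Definition scoord (l r : 'I_n -> R) (p : P) (i : 'I_n) : R := (toV p 0 i - l i) / (r i - l i).

Lemma meas_scoord l r i : measurable_fun setT (fun p => scoord l r p i).
Proof.
by apply: measurable_funM => //; apply: measurable_funB => //; exact: leb_meas H i.
Qed.

Definition polprod (l r : 'I_n -> R) (q : 'I_n -> {poly R}) (p : P) : R := \prod_i (q i).[scoord l r p i].

Lemma meas_polprod l r q : measurable_fun setT (polprod l r q).
Proof. by apply: measurable_prod => i _; apply: meas_horner; exact: meas_scoord. Qed.

Section OneBox.
Variables (l r : 'I_n -> R).
Hypothesis lr : forall i, l i < r i.
Let B := toV @^-1` box l r.
Let mB : measurable B := meas_box l r.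

Definition boxvol : R := \prod_i (r i - l i).

Lemma boxvol_gt0 : 0 < boxvol.
Proof. by apply: prodr_gt0 => i _; rewrite subr_gt0. Qed.

Lemma scoord01 p i : B p -> 0 < scoord l r p i < 1.
Proof.
move=> /(_ i) /andP[h1 h2]; have rl : 0 < r i - l i by rewrite subr_gt0.
by rewrite /scoord divr_gt0 ?subr_gt0//= ltr_pdivrMr// mul1r ltrD2r.
Qed.

Lemma integral_monomial (k : 'I_n -> nat) :
  (\int[mu]_(p in B) (\prod_i scoord l r p i ^+ k i)%:E = (boxvol * \prod_i (k i).+1%:R^-1)%:E)%E.
Proof.
rewrite integral_mkcond /boxvol -big_split /=.
rewrite -(leb_prod H (psi := fun i t => (\1_`]l i, r i[ t : R) * (((t - l i) / (r i - l i)) ^+ k i))); first last.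
- by move=> i; exact: integral_power.
- move=> i t; rewrite indicE; case: (boolP (_ \in _)) => ti; last by rewrite mul0r.
  rewrite mul1r exprn_ge0//; move: ti; rewrite inE /= in_itv /= => /andP[? ?].
  by rewrite divr_ge0// subr_ge0 ltW//; apply: lt_trans (lr i).
- move=> i; apply: measurable_funM; first exact: measurable_indic.
  by apply: measurable_funX; apply: measurable_funM => //; exact: measurable_funB.
apply: eq_integral => p _; rewrite patchE; case: ifPn => hp.
  congr EFin; apply: eq_bigr => i _; rewrite indicE mem_set ?mul1r//.
  by move: hp; rewrite inE => /(_ i); rewrite /= in_itv.
have [i hi] : exists i, ~ (l i < toV p 0 i < r i).
  by apply/existsNP => h; move/negP: hp; apply; rewrite inE.
by rewrite (bigD1 i)//= indicE memNset ?mul0r// /= in_itv.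
Qed.

Lemma measure_box : mu B = boxvol%:E.
Proof.
have := integral_monomial (fun=> 0%N); rewrite [RHS](_ : _ = boxvol%:E); last first.
  by rewrite big1 ?mulr1// => i _; rewrite invr1.
move=> <-; rewrite -[LHS]mul1e -integral_cst//; apply: eq_integral => p _.
by rewrite /cst; congr EFin; rewrite big1// => i _; rewrite expr0.
Qed.

Lemma integrable_bounded (u : P -> R) C : measurable_fun B u -> (forall p, B p -> `|u p| <= C) ->
  mu.-integrable B (EFin \o u).
Proof.
move=> mu_ hC; apply: (@le_integrable _ _ _ mu B mB _ (cst C%:E)); first exact/measurable_EFinP.
  by move=> p Bp /=; rewrite lee_fin (le_trans (hC _ Bp))// ler_norm.
apply/integrableP; split; first exact: measurable_cst.
by rewrite integral_cst// measure_box; exact: ltry.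
Qed.

Lemma integrableMb (g u : P -> R) C : mu.-integrable B (EFin \o g) -> measurable_fun B u ->
  (forall p, B p -> `|u p| <= C) -> mu.-integrable B (EFin \o (fun p => g p * u p)).
Proof.
move=> ig mu_ hC; have mg := measurable_int _ ig.
apply: (@le_integrable _ _ _ mu B mB _ (fun p => (C%:E * (EFin \o g) p)%E)).
- by apply/measurable_EFinP; apply: measurable_funM => //; exact/measurable_EFinP.
- move=> p Bp; rewrite /comp -EFinM !abse_EFin lee_fin !normrM mulrC ler_wpM2r//.
  by rewrite (le_trans (hC _ Bp))// ler_norm.
exact: integrableZl.
Qed.

Lemma integrableZR (c : R) (g : P -> R) : mu.-integrable B (EFin \o g) ->
  mu.-integrable B (EFin \o (fun p => c * g p)).
Proof. by move=> ig; rewrite (_ : _ \o _ = (fun p => c%:E * (EFin \o g) p)%E)//; exact: integrableZl. Qed.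

Lemma polprod_bound q p : B p -> `|polprod l r q p| <= \prod_i nrm1 (q i).
Proof.
move=> Bp; rewrite normr_prod; apply: ler_prod => i _; rewrite normr_ge0 nrm1_horner//.
by have /andP[/ltW -> /ltW ->] := scoord01 i Bp.
Qed.

Lemma integrable_polprod q : mu.-integrable B (EFin \o polprod l r q).
Proof.
apply: integrable_bounded (@polprod_bound q).
by apply: measurable_funTS; exact: meas_polprod.
Qed.

Lemma integrableMpol g q : mu.-integrable B (EFin \o g) ->
  mu.-integrable B (EFin \o (fun p => g p * polprod l r q p)).
Proof.
move=> ig; apply: integrableMb (@polprod_bound q) => //.
by apply: measurable_funTS; exact: meas_polprod.
Qed.

Lemma Rintegral_sum (I : Type) (s : seq I) (F : I -> P -> R) :
  (forall i, mu.-integrable B (EFin \o F i)) ->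
  \int[mu]_(p in B) (\sum_(i <- s) F i p) = \sum_(i <- s) \int[mu]_(p in B) F i p.
Proof.
move=> iF; elim: s => [|i s IH].
  rewrite big_nil; transitivity (\int[mu]_(p in B) (cst (0 : R) p)).
    by apply: eq_Rintegral => p _; rewrite big_nil.
  by rewrite Rintegral_cst// mul0r.
rewrite big_cons -IH -RintegralD//; last first.
  rewrite (_ : _ \o _ = (fun p => \sum_(i <- s) (F i p)%:E)%E); last first.
    by apply/funext => p /=; rewrite sumEFin.
  by apply: integrable_sum => // j _; exact: iF.
by apply: eq_Rintegral => p _; rewrite big_cons.
Qed.

(** [leb_prod] speaks of nonnegative factors, so the product of polynomials is expanded into
    monomials in the rescaled coordinates, which are nonnegative on the box. *)
Lemma Rintegral_polprod q : \int[mu]_(p in B) polprod l r q p = boxvol * \prod_i Jint (q i).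
Proof.
pose N := (\max_i size (q i))%N.
have sq i : (size (q i) <= N)%N by exact: leq_bigmax.
have JE i : Jint (q i) = \sum_(j < N) (q i)`_j * j.+1%:R^-1.
  rewrite {1}[q i](_ : _ = \sum_(j < N) (q i)`_j *: 'X^j).
    by rewrite Jint_sum; apply: eq_bigr => j _; rewrite JintZ Jint_Xn.
  apply/polyP => j; rewrite coef_sum; case: (ltnP j N) => jN.
    rewrite (bigD1 (Ordinal jN))//= coefZ coefXn eqxx mulr1 big1 ?addr0// => k kj.
    rewrite coefZ coefXn [(j == _)](_ : _ = false) ?mulr0//.
    by apply: contraNF kj => /eqP kj; apply/eqP/val_inj.
  rewrite nth_default ?(leq_trans (sq i))// big1// => k _.
  by rewrite coefZ coefXn gtn_eqF ?mulr0// (leq_trans (ltn_ord k)).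
have polE p : polprod l r q p = \sum_(f : {ffun 'I_n -> 'I_N}) (\prod_i (q i)`_(f i)) * (\prod_i scoord l r p i ^+ f i).
  rewrite /polprod (eq_bigr (fun i => \sum_(j < N) (q i)`_j * scoord l r p i ^+ j)); last first.
    by move=> i _; apply: horner_coef_wide.
  by rewrite bigA_distr_bigA; apply: eq_bigr => f _; rewrite big_split.
have imon (f : {ffun 'I_n -> 'I_N}) : mu.-integrable B (EFin \o (fun p => \prod_i scoord l r p i ^+ f i)).
  rewrite (_ : (fun p => _) = polprod l r (fun i => 'X^(f i))); first exact: integrable_polprod.
  by apply/funext => p; apply: eq_bigr => i _; rewrite hornerXn.
under eq_Rintegral do rewrite polE.
rewrite Rintegral_sum; last by move=> f; exact: integrableZR.
rewrite (eq_bigr _ (fun i _ => JE i)) bigA_distr_bigA mulr_sumr; apply: eq_bigr => f _.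
rewrite RintegralZl// /Rintegral integral_monomial /= big_split /= mulrCA.
by [].
Qed.

End OneBox.
End BoxIntegrals.

(** * Cutoffs approaching the indicator of the unit interval *)

Section Cutoffs.
Context {R : realType}.

Lemma Ck_horner k (q : {poly R}) : Ck k (fun x => q.[x]).
Proof.
elim: k q => //= k IH q; split; first by move=> x; exact: derivable_horner.
rewrite [X in Ck k X](_ : _ = fun x => (deriv q).[x])//; apply/funext => x.
by rewrite derive1E (@derive_val _ _ _ _ _ _ _ (is_derive_poly q x)).
Qed.

Lemma smooth_step_flat (v : R) : v < 0 \/ 1 < v -> derive1 smooth_step v = 0.
Proof.
case=> v0; rewrite derive1E.
  rewrite (@near_eq_derive R R R smooth_step (cst 0) v 1) ?derive_cst//.
  by near=> u; apply: smooth_step0; apply: ltW; near: u; exact: lt_nbhsl.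
rewrite (@near_eq_derive R R R smooth_step (cst 1) v 1) ?derive_cst//.
by near=> u; apply: smooth_step1; apply: ltW; near: u; exact: lt_nbhsr.
Unshelve. all: by end_near. Qed.

(** Vanishes within distance 1/c of the ends of [0, 1] and equals 1 beyond distance 2/c. *)
Definition cutoff (c : R) (s : R) : R := smooth_step (c * s + - 1) * smooth_step (- c * s + (c - 1)).

Lemma Ck_cutoff k c : Ck k (cutoff c).
Proof.
apply: (@CkM R k (fun s => smooth_step (c * s + - 1)) (fun s => smooth_step (- c * s + (c - 1))));
  by apply: Ck_aff; exact: smooth_step_Ck.
Qed.

Lemma cutoff01 c s : 0 <= cutoff c s <= 1.
Proof.
have /andP[? ?] := smooth_step01 (c * s + - 1).
have /andP[? ?] := smooth_step01 (- c * s + (c - 1)).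
by rewrite /cutoff mulr_ge0//= mulr_ile1.
Qed.

Lemma cutoff_supp c s : 0 < c -> ~~ (1 / c <= s <= 1 - 1 / c) -> cutoff c s = 0.
Proof.
move=> c0; rewrite negb_and -!ltNge => /orP[h|h]; rewrite /cutoff.
  rewrite smooth_step0 ?mul0r//; move: h; rewrite ltr_pdivlMr// mulrC; lra.
rewrite (@smooth_step0 _ (- c * s + _)) ?mulr0//.
have : (1 - s) * c < 1 by rewrite -ltr_pdivlMr//; lra.
by lra.
Qed.

Lemma derive_cutoff c s : derive1 (cutoff c) s =
  c * derive1 smooth_step (c * s + - 1) * smooth_step (- c * s + (c - 1))
  - smooth_step (c * s + - 1) * (c * derive1 smooth_step (- c * s + (c - 1))).
Proof.
have ds (x : R) : derivable (@smooth_step R) x 1 by have [dx _] := @smooth_step_Ck R 1; exact: dx.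
have [d1 e1] := derive1_aff c (- 1) ds.
have [d2 e2] := derive1_aff (- c) (c - 1) ds.
set F := (fun x => _) in d1 e1; set G := (fun x => _) in d2 e2.
rewrite (_ : cutoff c = F \* G)// derive1M// e1 e2 /= /F /G.
by rewrite !mulNr !mulrN.
Qed.

Lemma cutoff1 c s : 2 < c * s -> 2 < c * (1 - s) -> cutoff c s = 1.
Proof. by move=> h1 h2; rewrite /cutoff !smooth_step1 ?mulr1//; lra. Qed.

Lemma derive_cutoff0 c s : 2 < c * s -> 2 < c * (1 - s) -> derive1 (cutoff c) s = 0.
Proof.
move=> h1 h2; rewrite derive_cutoff !smooth_step_flat ?mulr0 ?mul0r ?subrr//; right; lra.
Qed.

Lemma horner_vanish (q : {poly R}) s : q.[0] = 0 -> q.[1] = 0 -> 0 <= s <= 1 ->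
  `|q.[s]| <= nrm1 (deriv q) * s /\ `|q.[s]| <= nrm1 (deriv q) * (1 - s).
Proof.
move=> q0 q1 /andP[s0 s1].
have mvt (a b : R) : 0 <= a -> a <= b -> b <= 1 -> `|q.[b] - q.[a]| <= nrm1 (deriv q) * (b - a).
  move=> a0; rewrite le_eqVlt => /orP[/eqP <-|ab] b1; first by rewrite !subrr normr0 mulr0.
  have [|c] := @MVT _ (horner q) (horner (deriv q)) a b ab (fun x _ => is_derive_poly q x).
  - by apply: continuous_subspaceT => x; exact: continuous_horner.
  rewrite in_itv/= => /andP[ac cb] ->; rewrite normrM (gtr0_norm (_ : 0 < b - a)) ?subr_gt0//.
  rewrite ler_wpM2r ?subr_ge0 1?(ltW ab)// nrm1_horner// (ltW (le_lt_trans a0 ac))/= (ltW (lt_le_trans cb b1))//.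
split; first by have := mvt 0 s (lexx _) s0 s1; rewrite q0 !subr0.
by have := mvt s 1 s0 s1 (lexx _); rewrite q1 sub0r normrN.
Qed.

(** The derivative of the cutoff is of size c, but only in layers of width 2/c at the two ends,
    where q is of size 1/c since it vanishes at 0 and 1. The product is therefore bounded uniformly
    in c. *)
Lemma cutoff_layer (q : {poly R}) : q.[0] = 0 -> q.[1] = 0 ->
  exists K, forall c s, 1 <= c -> 0 <= s <= 1 -> `|q.[s] * derive1 (cutoff c) s| <= K.
Proof.
move=> q0 q1; have [K hK] := @smooth_step_derive_bound R.
have K0 : 0 <= K by apply: le_trans (hK 0).
pose D := nrm1 (deriv q); have D0 : 0 <= D by exact: nrm1_ge0.
exists (D * 2 * K + D * 2 * K) => c s c1 s01; have c0 : 0 < c by apply: lt_le_trans c1.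
have [b1 b2] := horner_vanish q0 q1 s01; rewrite -/D in b1 b2.
have half (w u : R) : `|q.[s]| <= D * w -> `|u| <= 1 ->  0 <= w ->
    `|q.[s] * (c * derive1 smooth_step (c * w + - 1) * u)| <= D * 2 * K.
  move=> hq hu w0; case: (leP (c * w + - 1) 1) => hw; last first.
    by rewrite smooth_step_flat ?mulr0 ?mul0r ?mulr0 ?normr0 ?mulr_ge0//; right.
  rewrite mulrA normrM -[leRHS]mulr1 ler_pM// mulrA normrM ler_pM// normrM (gtr0_norm c0).
  by rewrite (le_trans (ler_wpM2r (ltW c0) hq))// -mulrA ler_wpM2l//; lra.
rewrite derive_cutoff mulrBr (le_trans (ler_normB _ _))// lerD//.
  apply: half => //; last by case/andP: s01.
  by have /andP[? ?] := smooth_step01 (- c * s + (c - 1)); rewrite ger0_norm.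
rewrite [X in _ * X]mulrC (_ : - c * s + (c - 1) = c * (1 - s) + - 1); last by ring.
apply: half => //; last by case/andP: s01 => _; rewrite subr_ge0.
by have /andP[? ?] := smooth_step01 (c * s + - 1); rewrite ger0_norm.
Qed.

End Cutoffs.

(** * From test functions to polynomials that vanish on two opposite faces *)

Section IntegrationByParts.
Context {R : realType} {d : measure_display} {P : measurableType d}.
Variables (mu : {measure set P -> \bar R}) (n : nat) (toV : P -> 'rV[R]_n).
Hypothesis H : leb_like mu toV.
Variables (l r : 'I_n -> R).
Hypothesis lr : forall i, l i < r i.
Let B := toV @^-1` box l r.
Let mB : measurable B := meas_box H l r.

Lemma Rintegral_dominated (g : P -> R) (u : nat -> P -> R) (v : P -> R) C :
  mu.-integrable B (EFin \o g) -> (forall k, measurable_fun B (u k)) -> measurable_fun B v ->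
  (forall k p, B p -> `|u k p| <= C) -> (forall p, B p -> u k p @[k --> \oo] --> v p) ->
  \int[mu]_(p in B) (g p * u k p) @[k --> \oo] --> \int[mu]_(p in B) (g p * v p).
Proof.
move=> ig mu_ mv uC uv; have mg : measurable_fun B g by exact/measurable_EFinP/(measurable_int _ ig).
have [|||||ivf _ h] := @dominated_convergence _ _ R mu B mB (fun k p => (g p * u k p)%:E) (fun p => (g p * v p)%:E)
   (fun p => (C * `|g p|)%:E).
  - by move=> k; apply/measurable_EFinP; apply: measurable_funM.
  - by apply/measurable_EFinP; apply: measurable_funM.
  - apply: aeW => p Bp; apply: cvg_EFin; first exact: nearW.
    by apply: cvgM; [exact: cvg_cst|exact: uv].
  - apply: (@integrableZR _ _ _ mu n toV H l r C (fun p => `|g p|)).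
    by rewrite (_ : _ \o _ = (fun p => `|(EFin \o g) p|)%E)//; exact: integrable_abse.
  - apply: aeW => p k Bp; rewrite lee_fin normrM mulrC ler_wpM2r//; exact: uC.
have iv : mu.-integrable B (EFin \o (fun p => g p * v p)) by exact: ivf.
apply: (@fine_cvg R _ _ _ _ (\int[mu]_(p in B) (g p * v p))).
rewrite /Rintegral fineK; first exact: h.
exact: integrable_fin_num.
Qed.

(** The weak derivative relation tested only with products of smooth functions of one variable
    supported inside the box; polynomials times product cutoffs are of this form. *)
Definition parts_rel (i : 'I_n) (g gi : P -> R) := forall f : 'I_n -> R -> R,
  (forall j k, Ck k (f j)) ->
  (forall j, exists a b, [/\ l j < a, b < r j & forall t, ~~ (a <= t <= b) -> f j t = 0]) ->
  \int[mu]_(p in B) (g p * tensor (upd f i (derive1 (f i))) (toV p)) =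
  - \int[mu]_(p in B) (gi p * tensor f (toV p)).

(** Multiply by cutoffs and let them tend to 1. A derivative falls on a cutoff only in direction i,
    so only [q i] has to vanish at the ends, and [cutoff_layer] supplies the bound for dominated
    convergence. *)
Lemma parts_polprod i g gi (q : 'I_n -> {poly R}) :
  mu.-integrable B (EFin \o g) -> mu.-integrable B (EFin \o gi) -> parts_rel i g gi ->
  (q i).[0] = 0 -> (q i).[1] = 0 ->
  \int[mu]_(p in B) (g p * polprod toV l r (fun j => if j == i then deriv (q j) else q j) p) =
  - ((r i - l i) * \int[mu]_(p in B) (gi p * polprod toV l r q p)).
Proof.
move=> ig igi rel q0 q1.
have h0 j : 0 < r j - l j by rewrite subr_gt0.
pose a j := (r j - l j)^-1; pose b j := - l j / (r j - l j).
have ab j t : a j * t + b j = (t - l j) / (r j - l j) by rewrite /a /b mulrC mulrBl mulNr.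
pose c (k : nat) : R := k.+2%:R.
have c0 k : 0 < c k by rewrite ltr0n.
have c1 k : 1 <= c k by rewrite ler1n.
pose xi k j s := (q j).[s] * cutoff (c k) s.
have Cxi k j m : Ck m (xi k j).
  by apply: (@CkM R m (fun s => (q j).[s]) (cutoff (c k))); [exact: Ck_horner|exact: Ck_cutoff].
have dxi k j s : derive1 (xi k j) s = (deriv (q j)).[s] * cutoff (c k) s + (q j).[s] * derive1 (cutoff (c k)) s.
  rewrite (_ : xi k j = (fun s => (q j).[s]) \* cutoff (c k))// derive1M.
  - by rewrite /= derive1E (@derive_val _ _ _ _ _ _ _ (is_derive_poly (q j) s)).
  - by move=> x; exact: derivable_horner.
  - by move=> x; have [] := Ck_cutoff 1 (c k).
pose f k j t := xi k j (a j * t + b j).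
have Cf k j m : Ck m (f k j) by exact: Ck_aff.
have df k j : derive1 (f k j) = fun t => a j * derive1 (xi k j) (a j * t + b j).
  by have [] := @derive1_aff R (xi k j) (a j) (b j) (fun x => (Cxi k j 1%N).1 x).
have suppf k j : exists a b, [/\ l j < a, b < r j & forall t, ~~ (a <= t <= b) -> f k j t = 0].
  have e0 : 0 < (r j - l j) / c k by rewrite divr_gt0.
  exists (l j + (r j - l j) / c k), (r j - (r j - l j) / c k); split; [by rewrite ltrDl|by rewrite gtrBl|] => t ht.
  rewrite /f /xi cutoff_supp ?mulr0//; apply: contra ht; rewrite ab.
  rewrite ler_pdivlMr// ler_pdivrMr// => /andP[t1 t2]; apply/andP; split.
    by move: t1; rewrite div1r mulrC lerBrDl.
  move: t2; rewrite mulrBl div1r mul1r (mulrC _^-1); set w := _ / _; lra.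
pose s p j := scoord toV l r p j.
have s01 p j : B p -> 0 < s p j < 1 by move=> Bp; exact: (scoord01 lr j Bp).
have ms j : measurable_fun setT (fun p => s p j) by exact: (meas_scoord H).
pose U k p := \prod_j (if j == i then derive1 (xi k j) (s p j) else xi k j (s p j)).
pose W k p := \prod_j xi k j (s p j).
have mCk (f0 : R -> R) j : Ck 1 f0 -> measurable_fun setT (fun p => f0 (s p j)).
  move=> [df0 _]; apply: measurableT_comp (ms j); apply: continuous_measurable_fun.
  exact: continuous_derivable.
have mU k : measurable_fun setT (U k).
  apply: measurable_prod => j _; case: (j == i); last exact: mCk.
  by apply: mCk; have [] := Cxi k j 2%N.
have mW k : measurable_fun setT (W k) by apply: measurable_prod => j _; exact: mCk.
have [K hK] := cutoff_layer q0 q1.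
have K0 : 0 <= K by apply: le_trans (hK 1 0 _ _) => //; rewrite lexx ler01.
have xiB k j p : B p -> `|xi k j (s p j)| <= nrm1 (q j).
  move=> Bp; have /andP[/ltW x0 /ltW x1] := s01 p j Bp; have /andP[y0 y1] := cutoff01 (c k) (s p j).
  by rewrite normrM (ger0_norm y0) -[leRHS]mulr1 ler_pM// nrm1_horner// x0.
have UB k p : B p -> `|U k p| <= \prod_j (if j == i then nrm1 (deriv (q j)) + K else nrm1 (q j)).
  move=> Bp; rewrite normr_prod; apply: ler_prod => j _; rewrite normr_ge0/=; case: eqP => [->|_]; last exact: xiB.
  have /andP[/ltW x0 /ltW x1] := s01 p i Bp; have /andP[y0 y1] := cutoff01 (c k) (s p i).
  rewrite dxi (le_trans (ler_normD _ _))// lerD//; last by apply: hK => //; rewrite x0.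
  by rewrite normrM (ger0_norm y0) -[leRHS]mulr1 ler_pM// nrm1_horner// x0.
have WB k p : B p -> `|W k p| <= \prod_j nrm1 (q j).
  by move=> Bp; rewrite normr_prod; apply: ler_prod => j _; rewrite normr_ge0/= xiB.
have ev p j : B p -> \forall k \near \oo, 2 < c k * s p j /\ 2 < c k * (1 - s p j).
  move=> Bp; have /andP[x0 x1] := s01 p j Bp; have y0 : 0 < 1 - s p j by rewrite subr_gt0.
  near=> k; have kc : k%:R <= c k by rewrite ler_nat; lia.
  split; [rewrite -(ltr_pdivrMr _ _ x0)|rewrite -(ltr_pdivrMr _ _ y0)];
  by apply: lt_le_trans kc; near: k; exact: nbhs_infty_gtr.
have evall p : B p -> \forall k \near \oo, forall j, 2 < c k * s p j /\ 2 < c k * (1 - s p j).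
  by move=> Bp; apply: filter_forall => j; exact: ev.
(* At an interior point all cutoffs are eventually 1 with derivative 0, so the sequence is
   eventually constant. *)
have cvU p : B p -> U k p @[k --> \oo] --> polprod toV l r (fun j => if j == i then deriv (q j) else q j) p.
  move=> Bp; apply: cvg_near_cst; near=> k.
  have {}ev j : 2 < c k * s p j /\ 2 < c k * (1 - s p j) by move: j; near: k; exact: evall.
  apply: eq_bigr => j _; have [e1 e2] := ev j.
  by case: (j == i); rewrite ?dxi /xi cutoff1// ?derive_cutoff0// ?mulr0 mulr1 ?addr0.
have cvW p : B p -> W k p @[k --> \oo] --> polprod toV l r q p.
  move=> Bp; apply: cvg_near_cst; near=> k.
  have {}ev j : 2 < c k * s p j /\ 2 < c k * (1 - s p j) by move: j; near: k; exact: evall.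
  by apply: eq_bigr => j _; have [e1 e2] := ev j; rewrite /xi cutoff1// mulr1.
have cU := Rintegral_dominated ig (fun k => measurable_funTS (mU k)) (measurable_funTS (meas_polprod H l r _)) UB cvU.
have cW := Rintegral_dominated igi (fun k => measurable_funTS (mW k)) (measurable_funTS (meas_polprod H l r _)) WB cvW.
have relk k : \int[mu]_(p in B) (g p * U k p) = - ((r i - l i) * \int[mu]_(p in B) (gi p * W k p)).
  have := rel (f k) (Cf k) (suppf k).
  rewrite (_ : (fun p => gi p * tensor (f k) (toV p)) = (fun p => gi p * W k p)); last first.
    by apply/funext => p; congr (_ * _); apply: eq_bigr => j _; rewrite /f ab.
  rewrite (_ : (fun p => g p * tensor _ (toV p)) = (fun p => a i * (g p * U k p))); last first.
    apply/funext => p; rewrite mulrCA; congr (_ * _); rewrite tensor_upd /U [in RHS](bigD1 i)//= eqxx df ab mulrA.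
    by congr (_ * _); apply: eq_bigr => j /negPf ->; rewrite /f ab.
  rewrite RintegralZl//; last exact: (integrableMb H ig (measurable_funTS (mU k)) (UB k)).
  move=> h; have a0 : a i != 0 by rewrite invr_eq0 gt_eqF.
  by apply: (mulfI a0); rewrite h mulrN mulrA /a mulVf ?mul1r// gt_eqF.
apply: (cvg_unique _ cU) => //.
rewrite /= (_ : (fun k => \int[mu]_(p in B) (g p * U k p)) = (fun k => - ((r i - l i) * \int[mu]_(p in B) (gi p * W k p)))); last first.
  by apply/funext => k; exact: relk.
by apply: cvgN; apply: cvgM; [exact: cvg_cst|exact: cW].
Unshelve. all: by end_near.
Qed.

End IntegrationByParts.

(** * Polynomial approximation of indicators, and completeness of polynomials *)

Section StepPolynomials.
Context {R : realType}.

Lemma bernoulli_ge (y : R) k : 0 <= y -> 1 + k%:R * y <= (1 + y) ^+ k.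
Proof.
move=> y0; elim: k => [|k IH]; first by rewrite mul0r addr0 expr0.
have k0 : 0 <= k%:R :> R by [].
by rewrite exprS -natr1; nra.
Qed.

Lemma bernoulli_sub (x : R) k : 0 <= x <= 1 -> 1 - k%:R * x <= (1 - x) ^+ k.
Proof.
move=> /andP[x0 x1]; elim: k => [|k IH]; first by rewrite mul0r subr0 expr0.
have k0 : 0 <= k%:R :> R by [].
have : 0 <= (1 - x) ^+ k by rewrite exprn_ge0// subr_ge0.
by rewrite exprS -natr1; nra.
Qed.

Lemma bernoulli_inv (x : R) k : 0 <= x <= 1 -> (1 - x) ^+ k * (1 + k%:R * x) <= 1.
Proof.
move=> /andP[x0 x1]; have h : 0 <= (1 - x) ^+ k by rewrite exprn_ge0// subr_ge0.
apply: le_trans (ler_wpM2l h (bernoulli_ge k x0)) _.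
by rewrite -exprMn exprn_ile1//; nra.
Qed.

(** With u = (1 + s - b)/2, the quantity k 4^k u^(2k) = k (2u)^(2k) tends to 0 when s < b and to
    infinity when s >= b. Bernoulli's inequality turns this into convergence to the indicator of s <
    b, boundedly on (0, 1). *)
Definition step_poly (b : R) k : {poly R} :=
  (1 - (2^-1 *: ('X + (1 - b)%:P)) ^+ (2 * k)) ^+ (k * 4 ^ k).

Lemma step_polyE b k s : (step_poly b k).[s] = (1 - ((1 + s - b) / 2) ^+ (2 * k)) ^+ (k * 4 ^ k).
Proof.
rewrite /step_poly !hornerE; congr ((1 - _ ^+ _) ^+ _).
by rewrite /=; lra.
Qed.

Lemma step_poly01 b k s : 0 < s < 1 -> 0 < b < 1 -> 0 <= (step_poly b k).[s] <= 1.
Proof.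
move=> /andP[s0 s1] /andP[b0 b1].
have u0 : 0 <= (1 + s - b) / 2 by lra.
have u1 : (1 + s - b) / 2 <= 1 by lra.
have x0 : 0 <= ((1 + s - b) / 2) ^+ (2 * k) by rewrite exprn_ge0.
have x1 : ((1 + s - b) / 2) ^+ (2 * k) <= 1 by rewrite exprn_ile1.
by rewrite step_polyE exprn_ge0 ?subr_ge0// exprn_ile1 ?subr_ge0// gerBl.
Qed.

Lemma cvg_inv_nat (c : R) : c * k.+1%:R^-1 @[k --> \oo] --> 0.
Proof.
rewrite -[X in _ --> X](mulr0 c); apply: cvgM; first exact: cvg_cst.
exact: cvg_harmonic.
Qed.

Lemma step_poly_cvg b s : 0 < s < 1 -> 0 < b < 1 ->
  (step_poly b k).[s] @[k --> \oo] --> ((s < b)%R%:R : R).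
Proof.
move=> s01 b01; have /andP[s0 s1] := s01; have /andP[b0 b1] := b01.
set u := (1 + s - b) / 2.
have u0 : 0 < u by rewrite /u; lra.
have u1 : u <= 1 by rewrite /u; lra.
have x01 k : 0 <= u ^+ (2 * k) <= 1 by rewrite exprn_ge0 ?(ltW u0)//= exprn_ile1// (ltW u0).
have mx k : (k * 4 ^ k)%:R * u ^+ (2 * k) = k%:R * ((2 * u) ^+ k) ^+ 2.
  have E : 4 ^+ k = 2 ^+ (2 * k) :> R by rewrite exprM; congr (_ ^+ _); ring.
  by rewrite -exprM (mulnC k 2) natrM natrX -mulrA E -exprMn.
case: (ltP s b) => sb.
- have w1 : 2 * u < 1 by rewrite /u; lra.
  pose y := (2 * u)^-1 - 1; have w0 : 0 < 2 * u by lra.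
  have y0 : 0 < y by rewrite /y subr_gt0 invf_gt1.
  have wk k : (2 * u) ^+ k * (1 + k%:R * y) <= 1.
    have := bernoulli_ge k (ltW y0); rewrite /y addrCA subrr addr0 exprVn => h.
    by rewrite -ler_pdivlMl ?exprn_gt0// mulr1.
  apply: (@squeeze_cvgr _ _ _ _ (fun k => 1 - (y ^- 2) * k.+1%:R^-1 * 4) (fun=> 1)); last exact: cvg_cst.
    near=> k.
    have k1 : (0 < k)%N by near: k; exact: nbhs_infty_gt.
    have /andP[_ ->] := step_poly01 k s01 b01; rewrite andbT step_polyE -/u.
    apply: le_trans (bernoulli_sub _ (x01 k)); rewrite lerD2l lerN2 mx.
    have W0 : 0 <= (2 * u) ^+ k by rewrite exprn_ge0// ltW.
    have := wk k; move: ((2 * u) ^+ k) W0 => W W0 hW.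
    have k0 : 1 <= k%:R :> R by rewrite ler1n.
    have Wy : W * (k%:R * y) <= 1 by nra.
    have : (W * (k%:R * y)) ^+ 2 <= 1 by rewrite expr_le1// !mulr_ge0// ltW.
    rewrite -[k.+1%:R]natr1 -invfM [_^-1 * 4]mulrC ler_pdivlMr; last first.
      by rewrite mulr_gt0 ?exprn_gt0//; lra.
    have : 0 <= W ^+ 2 * y ^+ 2 by rewrite -exprMn sqr_ge0.
    rewrite !exprMn; move: (W ^+ 2) (y ^+ 2) (k%:R) k0 => W2 y2 k0 hk h1 h2.
    by nra.
  rewrite -[X in _ --> X]subr0; apply: cvgB; first exact: cvg_cst.
  rewrite -[X in _ --> X](mul0r 4); apply: cvgM; last exact: cvg_cst.
  exact: cvg_inv_nat.
- have w1 : 1 <= 2 * u by rewrite /u; lra.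
  apply: (@squeeze_cvgr _ _ _ _ (fun=> 0) (fun k => 1 * k.+1%:R^-1)); first last.
  + exact: cvg_inv_nat.
  + exact: cvg_cst.
  near=> k; have /andP[-> _] /= := step_poly01 k s01 b01; rewrite step_polyE -/u.
  have := bernoulli_inv (k * 4 ^ k) (x01 k); rewrite mx ler_pdivlMr ?ltr0n// => h.
  apply: le_trans h; rewrite ler_wpM2l ?exprn_ge0 ?subr_ge0//; first by case/andP: (x01 k).
  by rewrite -natr1 addrC lerD2l ler_peMr// !exprn_ege1.
Unshelve. all: by end_near.
Qed.

End StepPolynomials.

Section Completeness.
Context {R : realType} {d : measure_display} {P : measurableType d}.
Variables (mu : {measure set P -> \bar R}) (n : nat) (toV : P -> 'rV[R]_n).
Hypothesis H : leb_like mu toV.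
Variables (l r : 'I_n -> R).
Hypothesis lr : forall i, l i < r i.
Let B := toV @^-1` box l r.
Let mB : measurable B := meas_box H l r.

Lemma meas_below b : measurable (below toV b).
Proof.
rewrite (_ : below toV b = [set p | forall i, ((fun p : P => toV p 0 i) @^-1` `]-oo, b i[%classic) p]); last first.
  by apply/seteqP; split => p h i; have := h i; rewrite /= in_itv.
by apply: meas_fin_all => i; rewrite -[X in measurable X]setTI; apply: (leb_meas H i).
Qed.

Lemma measurable_belowE : @measurable _ P = <<s [set A | exists b, A = below toV b] >>.
Proof.
apply/seteqP; split; first exact: leb_gen H.
apply: smallest_sub; first by split; [exact: measurable0|by move=> A mA; rewrite setTD; exact: measurableC|by move=> F mF; exact: bigcupT_measurable].
by move=> _ [b ->]; exact: meas_below.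
Qed.

(** Products of [step_poly] converge boundedly to the indicator of [below toV b], so g integrates to
    0 over these sets. They are stable under intersection and generate the sigma-algebra, so a
    Dynkin argument reaches all measurable sets. *)
Lemma complete_polprod (g : P -> R) : mu.-integrable B (EFin \o g) ->
  (forall q : 'I_n -> {poly R}, \int[mu]_(p in B) (g p * polprod toV l r q p) = 0) ->
  ae_eq mu B (EFin \o g) (cst 0%E).
Proof.
move=> ig g0.
have gbelow b : \int[mu]_(p in B `&` below toV b) g p = 0.
  rewrite Rintegral_mkcondr.
  case: (pselect (exists i, b i <= l i)) => [[i bi]|bl].
    transitivity (\int[mu]_(p in B) (cst (0 : R) p)); last by rewrite Rintegral_cst// mul0r.
    apply: eq_Rintegral => p; rewrite inE => Bp; rewrite patchE memNset// => /(_ i).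
    by have /andP[h _] := Bp i; move=> /(lt_trans h); rewrite ltNge bi.
  have {}bl i : l i < b i by rewrite ltNge; apply/negP => h; apply: bl; exists i.
  pose be i := (b i - l i) / (r i - l i).
  pose q k i := if r i <= b i then 1 else step_poly (be i) k.
  have be01 i : ~~ (r i <= b i) -> 0 < be i < 1.
    rewrite -ltNge => h; have rl : 0 < r i - l i by rewrite subr_gt0.
    by rewrite /be divr_gt0 ?subr_gt0//= ltr_pdivrMr// mul1r ltrD2r.
  have h1 := @Rintegral_dominated _ _ _ mu n toV H l r g (fun k p => polprod toV l r (q k) p) (\1_(below toV b)) 1
    ig (fun k => measurable_funTS (meas_polprod H l r _)) (measurable_funTS (measurable_indic (meas_below b))).
  have {}h1 := h1 _ _.
  rewrite (_ : _ \_ _ = (fun p => g p * \1_(below toV b) p)); last first.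
    by apply/funext => p; rewrite patchE indicE; case: ifP; rewrite ?mulr1 ?mulr0.
  apply: (cvg_unique _ (h1 _ _)) => //.
  - move=> k p Bp; rewrite normr_prod; apply: prodr_ile1 => i _; rewrite normr_ge0/= /q.
    case: ifPn => h; first by rewrite hornerE normr1.
    have /andP[x0 x1] := step_poly01 k (scoord01 lr i Bp) (be01 i h).
    by rewrite ger0_norm.
  - move=> p Bp.
    have -> : \1_(below toV b) p = \prod_i (((toV p 0 i < b i)%R : bool)%:R : R).
      rewrite indicE; case: (boolP (p \in _)) => hp.
        by rewrite big1// => i _; move: hp; rewrite inE => /(_ i) ->.
      have [i hi] : exists i, ~~ (toV p 0 i < b i).
        apply: contrapT => h; move/negP: hp; apply; rewrite inE => i.
        by apply: contrapT => /negP hi; apply: h; exists i.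
      by rewrite (bigD1 i)//= (negPf hi) mul0r.
    apply: cvg_big => //; first exact: mul_continuous.
    move=> i _; case: (boolP (r i <= b i)) => h.
      have -> : toV p 0 i < b i by have /andP[_ x] := Bp i; exact: lt_le_trans h.
      rewrite (_ : (fun k => (q k i).[_]) = cst 1); first exact: cvg_cst.
      by apply/funext => k; rewrite /q h hornerE.
    rewrite (_ : (fun k => (q k i).[_]) = (fun k => (step_poly (be i) k).[scoord toV l r p i])); last first.
      by apply/funext => k; rewrite /q (negPf h).
    have := step_poly_cvg (scoord01 lr i Bp) (be01 i h); rewrite /scoord /be.
    by rewrite ltr_pM2r ?invr_gt0 ?subr_gt0// ltrD2r.
  - rewrite (_ : (fun k => _) = cst 0); first exact: cvg_cst.
    by apply/funext => k; exact: g0.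
have gmeas (A : set P) : measurable A -> \int[mu]_(p in B `&` A) g p = 0.
  move=> mA; have sA : <<s [set A | exists b, A = below toV b] >> A by rewrite -measurable_belowE.
  have iBA (A0 : set P) : measurable A0 -> mu.-integrable (B `&` A0) (EFin \o g).
    move=> ?; apply: (@integrableS _ _ _ _ B) => //; exact: measurableI.
  pattern A; apply: (dynkin_induction measurable_belowE) sA.
  - move=> _ _ [b1 ->] [b2 ->]; exists (fun i => Num.min (b1 i) (b2 i)).
    apply/seteqP; split => p /=; first by move=> [h1 h2] i; rewrite lt_min h1 h2.
    by move=> h; split => i; have := h i; rewrite lt_min => /andP[].
  - rewrite setIT; rewrite -[RHS](g0 (fun=> 1)); apply: eq_Rintegral => p _.
    by rewrite /polprod big1 ?mulr1// => i _; rewrite hornerE.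
  - by move=> _ [b ->].
  - move=> S mS hS; have h : \int[mu]_(p in B) g p = 0.
      rewrite -[RHS](g0 (fun=> 1)); apply: eq_Rintegral => p _.
      by rewrite /polprod big1 ?mulr1// => i _; rewrite hornerE.
    have := @Rintegral_setU _ _ _ mu (B `&` S) (B `&` ~` S) g.
    rewrite -setIUr setUv setIT h hS add0r => <- //; [exact: measurableI|by apply: measurableI => //; exact: measurableC|].
    by apply/disj_setPS => p [[_ ?] [_ ?]].
  - move=> F mF tF hF; rewrite setI_bigcupr /Rintegral integral_bigcup.
    + rewrite eseries0// => k _ _; have := hF k; rewrite /Rintegral => h.
      rewrite -[LHS]fineK ?h//; apply: integrable_fin_num; first exact: measurableI.
      exact: iBA.
    + by apply: trivIset_setIl.
    + by move=> k; exact: measurableI.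
    + by rewrite -setI_bigcupr; apply: iBA; exact: bigcup_measurable.
apply: (integral_ae_eq mB ig) => //.
move=> E EB mE; rewrite integral0.
have := gmeas E mE; rewrite (setIidr EB) /Rintegral => h.
rewrite -[LHS]fineK ?h//; apply: integrable_fin_num => //.
exact: (@integrableS _ _ _ _ B).
Qed.

End Completeness.

Section BoxSums.
Context {R : realType} {n : nat}.
Implicit Types (F : ('I_n -> nat) -> R).

Lemma sum_ffun_widen F N K : (0 < N)%N -> (N <= K)%N ->
  \sum_(f : {ffun 'I_n -> 'I_K} | [forall i, (f i < N)%N]) F (fun i => f i : nat) =
  \sum_(f : {ffun 'I_n -> 'I_N}) F (fun i => f i : nat).
Proof.
case: N => [//|N] _ NK.
pose h (f : {ffun 'I_n -> 'I_N.+1}) : {ffun 'I_n -> 'I_K} := [ffun i => widen_ord NK (f i)].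
pose g (f : {ffun 'I_n -> 'I_K}) : {ffun 'I_n -> 'I_N.+1} := [ffun i => inord (f i)].
rewrite (reindex_onto h g) /=.
  apply: eq_big => f; last by move=> _; congr F; apply/funext => i; rewrite ffunE.
  apply/andP; split; first by apply/forallP => i; rewrite ffunE /=.
  by apply/eqP/ffunP => i; rewrite !ffunE /= inord_val.
move=> f /forallP hf; apply/ffunP => i; rewrite !ffunE; apply/val_inj => /=.
by rewrite inordK.
Qed.

Lemma sum_geom_half K : \sum_(k < K) (2^-1 : R) ^+ k <= 2.
Proof.
suff : \sum_(k < K) (2^-1 : R) ^+ k = 2 - 2 * 2^-1 ^+ K.
  by move=> ->; rewrite gerBl mulr_ge0// exprn_ge0.
elim: K => [|K IH]; first by rewrite big_ord0 expr0; ring.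
by rewrite big_ord_recr/= IH exprS; field.
Qed.

Lemma sum_box_half K : \sum_(f : {ffun 'I_n -> 'I_K}) \prod_i (2^-1 : R) ^+ (f i) <= 2 ^+ n.
Proof.
rewrite -(bigA_distr_bigA (fun (i : 'I_n) (k : 'I_K) => (2^-1 : R) ^+ k)).
rewrite -[X in _ <= _ ^+ X]card_ord -prodr_const; apply: ler_prod => i _.
by rewrite sum_geom_half sumr_ge0// => k _; rewrite exprn_ge0.
Qed.

(** Half of the decay 4^-|f| is spent on the factor 2^-N of the tail, the other half remains
    summable over all multi-indices. *)
Lemma quarter_tail (f : 'I_n -> nat) N i : (N <= f i)%N ->
  \prod_i (4^-1 : R) ^+ (f i) <= 2^-1 ^+ N * \prod_i 2^-1 ^+ (f i).
Proof.
move=> Nf; have -> : \prod_i (4^-1 : R) ^+ (f i) = \prod_i 2^-1 ^+ (f i) * \prod_i 2^-1 ^+ (f i).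
  rewrite -big_split; apply: eq_bigr => j _ /=; rewrite -exprMn; congr (_ ^+ _); by field.
have p0 : 0 <= \prod_i (2^-1 : R) ^+ (f i) by apply: prodr_ge0 => k _; rewrite exprn_ge0.
rewrite ler_wpM2r// (bigD1 i)//= -[leRHS]mulr1 ler_pM// ?exprn_ge0//.
- by apply: prodr_ge0 => k _; rewrite exprn_ge0.
- by rewrite ler_wiXn2l// invf_le1// ler1n.
- by apply: prodr_ile1 => k _; rewrite exprn_ge0//= exprn_ile1// invf_le1// ler1n.
Qed.

Lemma geometric_limit (u : nat -> R) (C : R) :
  (forall N K, (0 < N)%N -> (N <= K)%N -> `|u K - u N| <= C * 2^-1 ^+ N) ->
  exists v, u k @[k --> \oo] --> v /\ forall N, (0 < N)%N -> `|v - u N| <= C * 2^-1 ^+ N.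
Proof.
move=> h; have C0 : 0 <= C.
  by have := h 1%N 1%N isT (leqnn _); rewrite subrr normr0 pmulr_lge0// exprn_gt0.
have cu : cvg (u k @[k --> \oo]).
  apply/cauchy_cvgP/cauchy_exP => e e0.
  have hN : \forall N \near \oo, C * 2^-1 ^+ N < e.
    have : C * 2^-1 ^+ N @[N --> \oo] --> C * 0.
      by apply: cvgM; [exact: cvg_cst|apply: cvg_expr; rewrite ger0_norm// invf_lt1// ltr1n].
    by rewrite mulr0 => /cvgr_lt; apply.
  near \oo => N.
  exists (u N); suff: \forall k \near \oo, ball (u N) e (u k) by [].
  near=> k; rewrite -ball_normE /= distrC.
  apply: (@le_lt_trans _ _ (C * 2^-1 ^+ N)); last by near: N.
  by apply: h; [near: N; exact: nbhs_infty_gt|near: k; exact: nbhs_infty_ge].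
exists (lim (u k @[k --> \oo])); split; first exact: cu.
move=> N N0; have h1 : `|u k - u N| @[k --> \oo] --> `|lim (u k @[k --> \oo]) - u N|.
  by apply: cvg_norm; apply: cvgB => //; exact: cvg_cst.
apply: (ler_cvg_to h1 (cvg_cst (C * 2^-1 ^+ N))).
by near=> k; apply: h => //; near: k; exact: nbhs_infty_ge.
Unshelve. all: by end_near.
Qed.

End BoxSums.

(** * Legendre expansion of a function that has only weak derivatives *)

Section LocalExpansion.
Context {R : realType} {d : measure_display} {P : measurableType d}.
Variables (mu : {measure set P -> \bar R}) (n : nat) (toV : P -> 'rV[R]_n).
Hypothesis H : leb_like mu toV.
Variables (l r : 'I_n -> R).
Hypothesis lr : forall i, l i < r i.
Let B := toV @^-1` box l r.
Let mB : measurable B := meas_box H l r.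
Let h i : R := r i - l i.
Let h0 i : 0 < h i. Proof. by rewrite subr_gt0. Qed.
Let vol : R := boxvol l r.
Let vol0 : 0 < vol := boxvol_gt0 lr.

Definition inc (a : 'I_n -> nat) (i : 'I_n) : 'I_n -> nat := fun j => (a j + (j == i))%N.

Variables (G : ('I_n -> nat) -> P -> R) (M th : R).
Hypothesis iG : forall a, mu.-integrable B (EFin \o G a).
Hypothesis rel : forall a i, parts_rel mu toV l r i (G a) (G (inc a i)).
Hypothesis M0 : 0 <= M.
Hypothesis th0 : 0 <= th.
Hypothesis GM : forall a, (exists i, a i != 0%N) ->
  \int[mu]_(p in B) `|G a p| <= M * vol * \prod_i ((a i)`!%:R * (th / h i) ^+ (a i)).

Lemma wp01 (s : R) : 0 <= s <= 1 -> 0 <= (wp : {poly R}).[s] <= 1.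
Proof. by move=> /andP[s0 s1]; rewrite /wp !hornerE; apply/andP; split; nra. Qed.

(** Induction on the number of derivatives still carried by the polynomials. Each step moves one of
    them to [G]; the polynomial in that direction vanishes at both ends because it has been
    differentiated fewer than [a i] times. *)
Lemma iterated_parts (a : 'I_n -> nat) k (b : 'I_n -> nat) :
  (forall i, (b i <= a i)%N) -> (\sum_i (a i - b i))%N = k ->
  `|\int[mu]_(p in B) (G b p * polprod toV l r (fun i => derivn (a i - b i) (wp ^+ a i)) p)| =
  (\prod_i h i ^+ (a i - b i)) * `|\int[mu]_(p in B) (G a p * polprod toV l r (fun i => wp ^+ a i) p)|.
Proof.
elim: k b => [|k IH] b ba sb.
  have -> : b = a.
    apply/funext => i; apply/eqP; rewrite eqn_leq ba /= -subn_eq0.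
    by have /eqP := sb; rewrite sum_nat_eq0 => /forallP/(_ i).
  rewrite big1 ?mul1r; last by move=> i _; rewrite subnn.
  rewrite (_ : (fun i => derivn (a i - a i) _) = (fun i => wp ^+ a i))//.
  by apply/funext => i; rewrite subnn.
have [i bi] : exists i, (b i < a i)%N.
  apply: contrapT => hn; move: sb; rewrite big1// => i _; apply/eqP; rewrite subn_eq0 leqNgt.
  by apply/negP => hi; apply: hn; exists i.
have ba' j : (inc b i j <= a j)%N by rewrite /inc; case: eqP => [->|_]; rewrite ?addn1 ?addn0.
have E (j : 'I_n) : (a j - b j)%N = ((a j - inc b i j) + (j == i))%N.
  by rewrite /inc; case: eqP => [->|_] /=; lia.
have sb' : (\sum_j (a j - inc b i j))%N = k.
  apply/eqP; rewrite -eqSS -sb (eq_bigr _ (fun j _ => E j)) big_split /= -addn1 eqn_add2l.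
  by rewrite (bigD1 i)//= eqxx big1 // => j /negPf ->.
have lt_i : (a i - inc b i i < a i)%N by rewrite /inc eqxx; lia.
have [v0 v1] := @wpn_vanish R _ _ lt_i.
have := @parts_polprod _ _ _ mu n toV H l r lr i (G b) (G (inc b i))
  (fun j => derivn (a j - inc b i j) (wp ^+ a j)) (iG _) (iG _) (rel b i) v0 v1.
rewrite (_ : (fun j => if j == i then _ else _) = (fun j => derivn (a j - b j) (wp ^+ a j))); last first.
  by apply/funext => j; rewrite [in RHS]E; case: eqP => _; rewrite ?addn1 ?addn0.
move=> ->; rewrite normrN normrM (gtr0_norm (h0 i)) IH// mulrA; congr (_ * _).
rewrite [in RHS](eq_bigr _ (fun j _ => congr1 (fun k => h j ^+ k) (E j))).
rewrite (eq_bigr (fun j => h j ^+ (a j - inc b i j) * h j ^+ (j == i))); last by move=> j _; rewrite exprD.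
rewrite big_split /= mulrC; congr (_ * _).
by rewrite (bigD1 i)//= eqxx expr1 big1 ?mulr1// => j /negPf ->.
Qed.

Let Lp (a : 'I_n -> nat) : P -> R := polprod toV l r (fun i => leg (a i)).

(** All derivatives of Rodrigues' formula are moved to [G]. The factorials in the bound on [G a]
    cancel the 1/a! of the formula, and the powers of the side lengths cancel as well: analyticity
    becomes the geometric decay th^|a|. *)
Lemma leg_moment (a : 'I_n -> nat) : (exists i, a i != 0%N) ->
  `|\int[mu]_(p in B) (G (fun=> 0%N) p * Lp a p)| <= M * vol * \prod_i th ^+ (a i).
Proof.
move=> a0; have F0 : 0 < \prod_i (a i)`!%:R :> R by apply: prodr_gt0 => i _; rewrite ltr0n fact_gt0.
rewrite -(ler_pM2l F0) -[X in X * `|_|](gtr0_norm F0) -normrM -RintegralZl//; last exact: integrableMpol.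
rewrite (_ : (fun p => _ * (G _ p * Lp a p)) =
   (fun p => G (fun=> 0%N) p * polprod toV l r (fun i => derivn (a i - 0) (wp ^+ a i)) p)); last first.
  apply/funext => p; rewrite mulrCA; congr (_ * _); rewrite -big_split; apply: eq_bigr => i _ /=.
  by rewrite subn0 -legE hornerZ.
rewrite (iterated_parts (fun i => leq0n (a i)) erefl).
under eq_bigr do rewrite subn0.
have le1 : `|\int[mu]_(p in B) (G a p * polprod toV l r (fun i => wp ^+ a i) p)| <= \int[mu]_(p in B) `|G a p|.
  have ii := integrableMpol H lr (fun i => wp ^+ a i) (iG a).
  apply: le_trans (le_normr_Rintegral mB ii) _; apply: le_Rintegral => //.
  - exact: (integrable_norm ii).
  - exact: (integrable_norm (iG a)).
  move=> p Bp; rewrite normrM -[leRHS]mulr1 ler_wpM2l// normr_prod prodr_ile1// => i _.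
  have /andP[/ltW s0 /ltW s1] := scoord01 lr i Bp.
  have /andP[w0 w1] := @wp01 (scoord toV l r p i) (introT andP (conj s0 s1)).
  by rewrite normr_ge0/= horner_exp normrX exprn_ile1// ger0_norm.
have hp : 0 <= \prod_i h i ^+ a i by apply: prodr_ge0 => i _; rewrite exprn_ge0// ltW.
apply: le_trans (ler_wpM2l hp (le_trans le1 (GM a0))) _.
rewrite mulrCA [leRHS]mulrCA ler_wpM2l ?mulr_ge0// ?(ltW vol0)// -!big_split /= le_eqVlt; apply/orP; left.
apply/eqP/eq_bigr => i _; rewrite mulrCA -exprMn; congr (_ * _ ^+ _).
by rewrite mulrCA divff ?mulr1// gt_eqF.
Qed.

Let Jl (a : 'I_n -> nat) : R := \prod_i Jint (leg (a i) * leg (a i)).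
Let Jl0 a : 0 < Jl a.
Proof. by apply: prodr_gt0 => i _; apply: lt_le_trans (Jint_leg_sqr _); rewrite invr_gt0 exprn_gt0. Qed.

Definition leg_coef (a : 'I_n -> nat) : R :=
  (\int[mu]_(p in B) (G (fun=> 0%N) p * Lp a p)) / (vol * Jl a).

Lemma leg_coef_le (a : 'I_n -> nat) : (exists i, a i != 0%N) ->
  `|leg_coef a| <= M * \prod_i (6 * th) ^+ (a i).
Proof.
move=> a0; rewrite /leg_coef normrM normfV (gtr0_norm (mulr_gt0 vol0 (Jl0 a))) ler_pdivrMr ?mulr_gt0//.
apply: le_trans (leg_moment a0) _; rewrite mulrACA ler_wpM2l ?mulr_ge0 ?(ltW vol0)//.
rewrite /Jl -big_split /=; apply: ler_prod => i _; rewrite exprn_ge0//= exprMn mulrAC.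
have := @Jint_leg_sqr R (a i); move=> hJ.
by rewrite -[leLHS]mul1r ler_wpM2r ?exprn_ge0// -ler_pdivrMl ?exprn_gt0// mulr1.
Qed.

(** Stated for an abstract family so that it serves both the Legendre series and the series of its
    termwise derivatives. *)
Lemma expansion (E : ('I_n -> nat) -> P -> R) (C C0 : R) :
  (forall a, measurable_fun setT (E a)) -> (forall p, B p -> `|E (fun=> 0%N) p| <= C0) -> 0 <= C ->
  (forall a p, (exists i, a i != 0%N) -> B p -> `|E a p| <= C * \prod_i 4^-1 ^+ (a i)) ->
  let S K p := \sum_(f : {ffun 'I_n -> 'I_K}) E (fun i => f i : nat) p in
  exists v : P -> R, [/\ measurable_fun B v,
    forall N p, (0 < N)%N -> B p -> `|v p - S N p| <= C * 2 ^+ n * 2^-1 ^+ N,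
    forall p, B p -> `|v p| <= C0 + C * 2 ^+ n &
    forall g, mu.-integrable B (EFin \o g) ->
      \int[mu]_(p in B) (g p * S k.+1 p) @[k --> \oo] --> \int[mu]_(p in B) (g p * v p)].
Proof.
move=> mE E0 C_0 EC S.
have tail N K p : (0 < N)%N -> (N <= K)%N -> B p -> `|S K p - S N p| <= C * 2 ^+ n * 2^-1 ^+ N.
  move=> N0 NK Bp; rewrite /S -(sum_ffun_widen (fun a => E a p) N0 NK) (bigID (fun f : {ffun 'I_n -> 'I_K} => [forall i, (f i < N)%N]))/=.
  rewrite addrAC subrr add0r (le_trans (ler_norm_sum _ _ _))//.
  apply: (@le_trans _ _ (\sum_(f : {ffun 'I_n -> 'I_K}) C * 2^-1 ^+ N * \prod_i 2^-1 ^+ (f i))).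
    rewrite [leRHS](bigID (fun f : {ffun 'I_n -> 'I_K} => [forall i, (f i < N)%N]))/= -[leLHS]add0r lerD//.
      by apply: sumr_ge0 => f _; rewrite !mulr_ge0// ?prodr_ge0// => *; rewrite exprn_ge0.
    apply: ler_sum => f /forallPn[i]; rewrite -leqNgt => Nf.
    have := @quarter_tail R n (fun i => f i : nat) N i Nf => /(ler_wpM2l C_0); rewrite mulrA; apply: le_trans.
    by apply: EC => //; exists i; rewrite -lt0n (leq_trans N0).
  rewrite -mulr_sumr -!mulrA ler_wpM2l// mulrC ler_wpM2r ?exprn_ge0//; exact: sum_box_half.
have lim_ p : exists v, B p -> S k p @[k --> \oo] --> v /\ forall N, (0 < N)%N -> `|v - S N p| <= C * 2 ^+ n * 2^-1 ^+ N.
  case: (pselect (B p)) => Bp; last by exists 0.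
  have [v hv] := @geometric_limit R (fun k => S k p) (C * 2 ^+ n) (fun N K N0 NK => tail N K p N0 NK Bp).
  by exists v.
have [v hv] := choice lim_.
have mS K : measurable_fun setT (S K) by apply: measurable_sum => f; exact: mE.
have S1 p : B p -> `|S 1%N p| <= C0.
  move=> Bp; rewrite /S (big_pred1 [ffun=> ord0]); last first.
    by move=> f /=; apply/esym/eqP/ffunP => i; rewrite ffunE ord1.
  by rewrite (_ : (fun i => _) = (fun=> 0%N)) ?E0//; apply/funext => i; rewrite ffunE.
have S1B k p : B p -> `|S k.+1 p| <= C0 + C * 2 ^+ n.
  move=> Bp; rewrite -[S _ _](subrK (S 1%N p)) addrC (le_trans (ler_normD _ _))// lerD ?S1//.
  apply: le_trans (tail 1%N k.+1 p isT isT Bp) _; rewrite -[leRHS]mulr1 ler_wpM2l ?mulr_ge0 ?exprn_ge0//.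
  by rewrite expr1 invf_le1// ler1n.
have cv p : B p -> S k.+1 p @[k --> \oo] --> v p.
  by move=> Bp; have [h1 _] := hv p Bp; rewrite (cvg_shiftS (fun k => S k p)).
have mv : measurable_fun B v.
  apply: (@measurable_fun_cvg _ _ _ B (fun k => S k.+1)) => // k; exact: measurable_funTS.
exists v; split=> //.
- by move=> N p N0 Bp; have [_ h1] := hv p Bp; exact: h1.
- move=> p Bp; apply: (ler_cvg_to (cvg_norm (cv p Bp)) (cvg_cst (C0 + C * 2 ^+ n))).
  by apply: nearW => k; exact: S1B.
- move=> g ig; apply: (@Rintegral_dominated _ _ _ mu n toV H l r g (fun k => S k.+1) v (C0 + C * 2 ^+ n)) => //.
  by move=> k; exact: measurable_funTS.
Qed.

Hypothesis hth : th <= 384^-1.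

Let zn : 'I_n -> nat := fun=> 0%N.
Let dq (i : 'I_n) (q : 'I_n -> {poly R}) : 'I_n -> {poly R} := fun j => if j == i then deriv (q j) else q j.
Let lg (a : 'I_n -> nat) : 'I_n -> {poly R} := fun i => leg (a i).

Lemma polprodM (q1 q2 : 'I_n -> {poly R}) p :
  polprod toV l r q1 p * polprod toV l r q2 p = polprod toV l r (fun i => q1 i * q2 i) p.
Proof. by rewrite /polprod -big_split; apply: eq_bigr => i _; rewrite hornerM. Qed.

Lemma leg_moment_orth (a b : 'I_n -> nat) : a <> b ->
  \int[mu]_(p in B) (Lp a p * Lp b p) = 0.
Proof.
move=> ab; under eq_Rintegral do rewrite polprodM.
rewrite (Rintegral_polprod H lr) [X in _ * X](_ : _ = 0) ?mulr0//.
have [i hi] : exists i, a i != b i.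
  by apply: contrapT => hn; apply: ab; apply/funext => i; apply: contrapT => /eqP hi; apply: hn; exists i.
by rewrite (bigD1 i)//= Jint_leg_orth// mul0r.
Qed.

Lemma leg_moment_sqr (a : 'I_n -> nat) : \int[mu]_(p in B) (Lp a p * Lp a p) = vol * Jl a.
Proof. by under eq_Rintegral do rewrite polprodM; rewrite (Rintegral_polprod H lr). Qed.

Let T a p := leg_coef a * Lp a p.
Let T' i a p := leg_coef a * (h i)^-1 * polprod toV l r (dq i (lg a)) p.

(** The origin of 384 = 6 * 16 * 4: a factor 6 from the norms of the Legendre polynomials, 16 from
    the size of these polynomials and of their derivatives, and a ratio 1/4 left for convergence. *)
Let small (c : R) (a : 'I_n -> nat) (q : 'I_n -> {poly R}) p : (exists i, a i != 0%N) -> B p -> 0 <= c ->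
  (forall i, nrm1 (q i) <= 16 ^+ (a i)) ->
  `|leg_coef a * c * polprod toV l r q p| <= M * c * \prod_i 4^-1 ^+ (a i).
Proof.
move=> a0 Bp c0 hq; rewrite normrM [`|leg_coef a * c|]normrM (ger0_norm c0).
have h1 : `|polprod toV l r q p| <= \prod_i 16 ^+ (a i).
  apply: le_trans (polprod_bound lr q Bp) _; apply: ler_prod => i _.
  by rewrite nrm1_ge0 hq.
apply: le_trans (ler_pM _ _ (ler_wpM2r c0 (leg_coef_le a0)) h1) _ => //; first by rewrite mulr_ge0.
rewrite -!mulrA ler_wpM2l// mulrCA ler_wpM2l// -big_split; apply: ler_prod => i _ /=.
rewrite -exprMn exprn_ge0 ?mulr_ge0//=; apply: lerXn2r; rewrite ?nnegrE ?mulr_ge0//.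
by have := hth; lra.
Qed.

Let nrm_leg k : nrm1 (leg k : {poly R}) <= 16 ^+ k.
Proof. by apply: le_trans (nrm1_leg k) _; apply: lerXn2r; rewrite ?nnegrE// ler_nat. Qed.

Let nrm_dleg k : nrm1 (deriv (leg k) : {poly R}) <= 16 ^+ k.
Proof.
apply: le_trans (nrm1_deriv (size_leg k)) _.
have h1 : k.+1%:R <= 2 ^+ k :> R by rewrite -natrX ler_nat ltn_expl.
by apply: le_trans (ler_pM _ _ h1 (nrm1_leg k)) _ => //; [exact: nrm1_ge0|rewrite -exprMn -natrM].
Qed.

(** The sum v of the series has the same Legendre moments as [G zn]; Legendre products span all
    polynomials, so completeness identifies the two. *)
Lemma expand_G : exists v : P -> R, [/\ measurable_fun B v, forall p, B p -> `|v p| <= `|leg_coef zn| + M * 2 ^+ n,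
    forall N p, (0 < N)%N -> B p ->
      `|v p - \sum_(f : {ffun 'I_n -> 'I_N}) T (fun i => f i : nat) p| <= M * 2 ^+ n * 2^-1 ^+ N,
    forall g, mu.-integrable B (EFin \o g) ->
      \int[mu]_(p in B) (g p * \sum_(f : {ffun 'I_n -> 'I_k.+1}) T (fun i => f i : nat) p) @[k --> \oo]
         --> \int[mu]_(p in B) (g p * v p) &
    ae_eq mu B (EFin \o G zn) (EFin \o v)].
Proof.
have mT a : measurable_fun setT (T a) by apply: measurable_funM => //; exact: (meas_polprod H).
have T0 p : B p -> `|T (fun=> 0%N) p| <= `|leg_coef zn|.
  move=> Bp; rewrite normrM -[leRHS]mulr1 ler_wpM2l// (le_trans (polprod_bound lr _ Bp))//.
  by apply: prodr_ile1 => i _; rewrite nrm1_ge0 nrm1_leg.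
have TM a p : (exists i, a i != 0%N) -> B p -> `|T a p| <= M * \prod_i 4^-1 ^+ (a i).
  move=> a0 Bp; have := @small 1 a (lg a) p a0 Bp ler01 (fun i => nrm_leg (a i)).
  by rewrite !mulr1.
have [v [mv vT vB vint]] := expansion mT T0 M0 TM.
exists v; split=> //.
have iv : mu.-integrable B (EFin \o v) by exact: (integrable_bounded H lr mv vB).
have iT a : mu.-integrable B (EFin \o T a) by apply: integrableZR => //; exact: (integrable_polprod H lr).
have momE b : \int[mu]_(p in B) (v p * Lp b p) = \int[mu]_(p in B) (G zn p * Lp b p).
  under eq_Rintegral do rewrite mulrC.
  have iLb : mu.-integrable B (EFin \o Lp b) by exact: (integrable_polprod H lr).
  apply: (cvg_unique _ (vint _ iLb)) => //.
  apply: cvg_near_cst; near=> k.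
  have bk : [forall i, (b i < k.+1)%N].
    apply/forallP => i; rewrite ltnS; apply: (@leq_trans (\max_i b i)%N); first exact: leq_bigmax.
    by near: k; exact: nbhs_infty_ge.
  under eq_Rintegral do rewrite mulr_sumr.
  rewrite (@Rintegral_sum _ _ _ mu n toV H l r)//; last first.
    move=> f; rewrite (_ : (fun p => _) = (fun p => T (fun i => f i : nat) p * Lp b p)); last by apply/funext => p; rewrite mulrC.
    exact: (integrableMpol H lr).
  pose bf : {ffun 'I_n -> 'I_k.+1} := [ffun i => inord (b i)].
  have bfE : (fun i => bf i : nat) = b by apply/funext => i; rewrite ffunE inordK//; exact: (forallP bk i).
  rewrite (bigD1 bf)//= big1 ?addr0.
    rewrite bfE /T; under eq_Rintegral do rewrite mulrCA.
    rewrite RintegralZl//; last exact: (integrableMpol H lr).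
    by rewrite leg_moment_sqr /leg_coef mulrVK// unitfE gt_eqF// mulr_gt0.
  move=> f fb; rewrite /T; under eq_Rintegral do rewrite mulrCA.
  rewrite RintegralZl//; last exact: (integrableMpol H lr).
  rewrite leg_moment_orth ?mulr0// => E; move/eqP: fb; apply.
  by apply/ffunP => i; apply/val_inj; rewrite ffunE /= E inord_val.
have iD : mu.-integrable B (EFin \o (fun p => G zn p - v p)).
  rewrite (_ : _ \o _ = (EFin \o G zn) \- (EFin \o v))%E//; exact: integrableB.
have := complete_polprod H lr iD.
have hq q : \int[mu]_(p in B) ((G zn p - v p) * polprod toV l r q p) = 0.
  pose K := (\max_i size (q i)).+1.
  have sq i : (size (q i) <= K)%N by apply: leqW; exact: leq_bigmax.
  have [b hb] := choice (fun i => leg_span (sq i)).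
  have E p : polprod toV l r q p = \sum_(f : {ffun 'I_n -> 'I_K}) (\prod_i b i (f i)) * Lp (fun i => f i : nat) p.
    rewrite /polprod (eq_bigr (fun i => \sum_(j < K) b i j * (leg j).[scoord toV l r p i])).
      by rewrite bigA_distr_bigA; apply: eq_bigr => f _; rewrite big_split.
    by move=> i _; rewrite {1}(hb i) horner_sum; apply: eq_bigr => j _; rewrite hornerZ.
  under eq_Rintegral do rewrite E mulr_sumr.
  rewrite (@Rintegral_sum _ _ _ mu n toV H l r)//; last first.
    move=> f; rewrite (_ : (fun p => _) = (fun p => (\prod_i b i (f i)) * ((G zn p - v p) * Lp (fun i => f i : nat) p))).
      by apply: integrableZR => //; exact: (integrableMpol H lr).
    by apply/funext => p; rewrite mulrCA.
  rewrite big1// => f _; under eq_Rintegral do rewrite mulrCA.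
  rewrite RintegralZl//; last exact: (integrableMpol H lr).
  under eq_Rintegral do rewrite mulrBl.
  rewrite RintegralB//; [|exact: (integrableMpol H lr)..].
  by rewrite momE subrr mulr0.
move=> /(_ hq) [A [mA A0 hA]]; exists A; split=> //; apply: subset_trans hA => p /= hp Bh; apply: hp => Bp.
by have := Bh Bp; rewrite /= => -[/eqP]; rewrite subr_eq0 => /eqP ->.
Unshelve. all: by end_near.
Qed.

(** Moments of the weak derivative are known only against polynomials vanishing at both ends in
    direction i. Completeness is therefore applied to the difference multiplied by [wp] in the
    rescaled coordinate i, which has no zero inside the box. *)
Lemma expand_dG i : exists v : P -> R,
    (forall N p, (0 < N)%N -> B p ->
      `|v p - \sum_(f : {ffun 'I_n -> 'I_N}) T' i (fun i => f i : nat) p| <= M * (h i)^-1 * 2 ^+ n * 2^-1 ^+ N) /\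
    ae_eq mu B (EFin \o G (inc zn i)) (EFin \o v).
Proof.
have hi0 : 0 <= (h i)^-1 by rewrite invr_ge0 ltW.
have mT a : measurable_fun setT (T' i a) by apply: measurable_funM => //; exact: (meas_polprod H).
have TB a p : B p -> `|T' i a p| <= `|leg_coef a * (h i)^-1| * \prod_j nrm1 (dq i (lg a) j).
  by move=> Bp; rewrite normrM ler_wpM2l//; exact: (polprod_bound lr).
have nrm_dq a j : nrm1 (dq i (lg a) j) <= 16 ^+ (a j).
  by rewrite /dq /lg; case: eqP => _; [exact: nrm_dleg|exact: nrm_leg].
have TM a p : (exists i, a i != 0%N) -> B p -> `|T' i a p| <= M * (h i)^-1 * \prod_i 4^-1 ^+ (a i).
  by move=> a0 Bp; exact: small.
have [v' [mv' vT' vB' vint']] := expansion mT (TB zn) (mulr_ge0 M0 hi0) TM.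
exists v'; split; first exact: vT'.
have [v [mv vB _ vint Gv]] := expand_G.
have iv : mu.-integrable B (EFin \o v) by exact: (integrable_bounded H lr mv vB).
have iv' : mu.-integrable B (EFin \o v') by exact: (integrable_bounded H lr mv' vB').
have iT a : mu.-integrable B (EFin \o T a) by apply: integrableZR => //; exact: (integrable_polprod H lr).
have iT' a : mu.-integrable B (EFin \o T' i a) by apply: integrableZR => //; exact: (integrable_polprod H lr).
have mom (q : 'I_n -> {poly R}) : (q i).[0] = 0 -> (q i).[1] = 0 ->
   \int[mu]_(p in B) (v' p * polprod toV l r q p) = \int[mu]_(p in B) (G (inc zn i) p * polprod toV l r q p).
  move=> q0 q1; have hi : h i != 0 by rewrite gt_eqF.
  have := parts_polprod H lr (iG zn) (iG _) (rel zn i) q0 q1.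
  rewrite -/(dq i q) -[r i - l i]/(h i) => e1.
  have e2 : \int[mu]_(p in B) (G zn p * polprod toV l r (dq i q) p) = \int[mu]_(p in B) (v p * polprod toV l r (dq i q) p).
    rewrite /Rintegral; congr fine; apply: ae_eq_integral => //.
    - exact: (measurable_int _ (integrableMpol H lr _ (iG zn))).
    - exact: (measurable_int _ (integrableMpol H lr _ iv)).
    have [A [mA A0 hA]] := Gv; exists A; split=> //; apply: subset_trans hA => p /= hp Bh; apply: hp => Bp.
    by have := Bh Bp => -[->].
  have ipol q' : mu.-integrable B (EFin \o polprod toV l r q') by exact: (integrable_polprod H lr).
  have c1 := vint _ (ipol (dq i q)); have c2 := vint' _ (ipol q).
  (* Every term of the series satisfies the relation exactly, by algebraic integration by parts;
     partial sums and then the limit inherit it. *)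
  have e3 a : \int[mu]_(p in B) (polprod toV l r (dq i q) p * T a p) = - (h i * \int[mu]_(p in B) (polprod toV l r q p * T' i a p)).
    rewrite /T /T'; under eq_Rintegral do rewrite mulrCA polprodM.
    rewrite RintegralZl// (Rintegral_polprod H lr).
    under [in RHS]eq_Rintegral do rewrite mulrCA polprodM.
    rewrite RintegralZl// (Rintegral_polprod H lr).
    rewrite [X in _ * (_ * X) = _](_ : _ = - \prod_j Jint (q j * dq i (lg a) j)); first by field.
    rewrite [LHS](bigD1 i)//= [in RHS](bigD1 i)//= /dq /lg eqxx.
    rewrite -mulNr Jint_by_parts//; congr (_ * _); apply: eq_bigr => j /negPf ji.
    by rewrite ji.
  have e4 k : \int[mu]_(p in B) (polprod toV l r (dq i q) p * \sum_(f : {ffun 'I_n -> 'I_k.+1}) T (fun i => f i : nat) p) =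
     - (h i * \int[mu]_(p in B) (polprod toV l r q p * \sum_(f : {ffun 'I_n -> 'I_k.+1}) T' i (fun i => f i : nat) p)).
    under eq_Rintegral do rewrite mulr_sumr.
    rewrite (@Rintegral_sum _ _ _ mu n toV H l r)//; last first.
      move=> f; rewrite (_ : (fun p => _) = (fun p => T (fun i => f i : nat) p * polprod toV l r (dq i q) p)).
        exact: (integrableMpol H lr).
      by apply/funext => p; rewrite mulrC.
    under [in RHS]eq_Rintegral do rewrite mulr_sumr.
    rewrite (@Rintegral_sum _ _ _ mu n toV H l r)//; last first.
      move=> f; rewrite (_ : (fun p => _) = (fun p => T' i (fun i => f i : nat) p * polprod toV l r q p)).
        exact: (integrableMpol H lr).
      by apply/funext => p; rewrite mulrC.
    by rewrite mulr_sumr -sumrN; apply: eq_bigr => f _; exact: e3.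
  have e5 : \int[mu]_(p in B) (polprod toV l r (dq i q) p * v p) = - (h i * \int[mu]_(p in B) (polprod toV l r q p * v' p)).
    apply: (cvg_unique _ c1) => //=.
    rewrite (_ : (fun k : nat => \int[mu]_(p in B) _) = (fun k => - (h i * \int[mu]_(p in B) (polprod toV l r q p * \sum_(f : {ffun 'I_n -> 'I_k.+1}) T' i (fun i => f i : nat) p)))).
      by apply: cvgN; apply: cvgM; [exact: cvg_cst|exact: c2].
    by apply/funext => k; exact: e4.
  apply: (mulfI hi); apply: oppr_inj; rewrite -e1 e2.
  under [in RHS]eq_Rintegral do rewrite mulrC.
  rewrite e5; congr (- (_ * _)); apply: eq_Rintegral => p _; exact: mulrC.
have iD : mu.-integrable B (EFin \o (fun p => G (inc zn i) p - v' p)).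
  rewrite (_ : _ \o _ = (EFin \o G (inc zn i)) \- (EFin \o v'))%E//; exact: integrableB.
pose wi : 'I_n -> {poly R} := fun j => if j == i then wp else 1.
have iW := integrableMpol H lr wi iD.
have [|A [mA A0 hA]] := complete_polprod H lr iW.
  move=> q; pose q' j := wi j * q j.
  have [q0 q1] : (q' i).[0] = 0 /\ (q' i).[1] = 0.
    by rewrite /q' /wi eqxx !hornerE subrr; split; ring.
  under eq_Rintegral do rewrite -mulrA polprodM mulrBl.
  rewrite RintegralB//; [|exact: (integrableMpol H lr)..].
  by rewrite mom// subrr.
exists A; split=> //; apply: subset_trans hA => p /= hp Bh; apply: hp => Bp.
have := Bh Bp; rewrite /= => -[/eqP]; rewrite mulf_eq0 => /orP[|].
  by rewrite subr_eq0 => /eqP ->.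
have /andP[s0 s1] := scoord01 lr i Bp.
rewrite /polprod (bigD1 i)//= /wi eqxx big1 ?mulr1; last by move=> j /negPf ->; rewrite hornerE.
by rewrite /wp !hornerE mulf_eq0 subr_eq0 (gt_eqF s0) (gt_eqF s1).
Qed.

Definition monomials (N : nat) (c : {ffun 'I_n -> 'I_N} -> R) (p : P) : R :=
  \sum_f c f * polprod toV l r (fun i => 'X^(f i)) p.

Definition dmonomials (N : nat) (c : {ffun 'I_n -> 'I_N} -> R) (i : 'I_n) (p : P) : R :=
  \sum_f c f * (h i)^-1 * polprod toV l r (dq i (fun i => 'X^(f i))) p.

(* The Legendre coefficients of a function are integrals of its derivatives against powers of
   X(1 - X), so they decay geometrically although only weak derivatives are available. *)
Theorem local_expansion N : (0 < N)%N -> exists c : {ffun 'I_n -> 'I_N} -> R,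
  [/\ \sum_f `|c f| <= `|\int[mu]_(p in B) G zn p| / vol + M * 2 ^+ n,
    \forall p \ae mu, B p -> `|G zn p - monomials c p| <= M * 2 ^+ n * 2^-1 ^+ N &
    forall i, \forall p \ae mu, B p -> `|G (inc zn i) p - dmonomials c i p| <= M * (h i)^-1 * 2 ^+ n * 2^-1 ^+ N].
Proof.
move=> N0; pose c (g : {ffun 'I_n -> 'I_N}) : R :=
  \sum_(f : {ffun 'I_n -> 'I_N}) leg_coef (fun i => f i : nat) * \prod_i (leg (f i))`_(g i).
have szl (f : {ffun 'I_n -> 'I_N}) i : (size (leg (f i) : {poly R}) <= N)%N.
  by apply: leq_trans (size_leg _) _; exact: ltn_ord.
(* Change of basis from Legendre products to monomials under any family X of linear functionals; it
   is used with evaluation, and with evaluation of the derivative in direction i. *)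
have cE (X : 'I_n -> {poly R} -> R) : (forall i, X i 0 = 0) -> (forall i q1 q2, X i (q1 + q2) = X i q1 + X i q2) ->
    (forall i a q, X i (a *: q) = a * X i q) ->
    \sum_g c g * \prod_i X i 'X^(g i) = \sum_(f : {ffun 'I_n -> 'I_N}) leg_coef (fun i => f i : nat) * \prod_i X i (leg (f i)).
  move=> X0 XD XZ; under eq_bigr do rewrite mulr_suml.
  rewrite exchange_big; apply: eq_bigr => f _ /=.
  rewrite [in RHS](eq_bigr (fun i => \sum_(j < N) (leg (f i))`_j * X i 'X^j)); last first.
    move=> i _; have -> : X i (leg (f i)) = X i (\sum_(j < N) (leg (f i))`_j *: 'X^j).
      congr X; apply/polyP => j; rewrite coef_sum; case: (ltnP j N) => jN.
        rewrite (bigD1 (Ordinal jN))//= coefZ coefXn eqxx mulr1 big1 ?addr0// => k kj.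
        rewrite coefZ coefXn [(j == _)](_ : _ = false) ?mulr0//.
        by apply: contraNF kj => /eqP kj; apply/eqP/val_inj.
      rewrite nth_default ?(leq_trans (szl f i))// big1// => k _.
      by rewrite coefZ coefXn gtn_eqF ?mulr0// (leq_trans (ltn_ord k)).
    rewrite (big_morph (X i) (XD i) (X0 i)); apply: eq_bigr => j _; exact: XZ.
  rewrite bigA_distr_bigA mulr_sumr; apply: eq_bigr => g _.
  by rewrite big_split mulrA.
exists c; split.
- apply: (@le_trans _ _ (\sum_(f : {ffun 'I_n -> 'I_N}) `|leg_coef (fun i => f i : nat)| * \prod_i nrm1 (leg (f i)))).
    apply: (@le_trans _ _ (\sum_(g : {ffun 'I_n -> 'I_N}) \sum_(f : {ffun 'I_n -> 'I_N}) `|leg_coef (fun i => f i : nat)| * \prod_i `|(leg (f i))`_(g i)|)).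
      apply: ler_sum => g _; apply: le_trans (ler_norm_sum _ _ _) _; apply: ler_sum => f _.
      by rewrite normrM normr_prod.
    rewrite exchange_big; apply: ler_sum => f _ /=; rewrite -mulr_sumr ler_wpM2l//.
    under [leRHS]eq_bigr do rewrite (nrm1E (szl f _)).
    by rewrite bigA_distr_bigA.
  pose f0 : {ffun 'I_n -> 'I_N} := [ffun=> Ordinal N0].
  have f0E : (fun i => f0 i : nat) = zn by apply/funext => i; rewrite ffunE.
  rewrite (bigD1 f0)//= lerD//.
    have leg0 : leg 0 = 1 :> {poly R} by rewrite /leg expr0 nderivn0.
    have J1 : Jl zn = 1 by rewrite /Jl big1// => i _; rewrite leg0 mulr1 -[1]/('X^0) Jint_Xn invr1.
    rewrite -[leRHS]mulr1; apply: ler_pM => //.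
    + by apply: prodr_ge0 => i _; exact: nrm1_ge0.
    + rewrite f0E /leg_coef J1 mulr1 normrM normfV (gtr0_norm vol0) le_eqVlt; apply/orP; left; apply/eqP.
      congr (`|_| / _); apply: eq_Rintegral => p _.
      by rewrite /Lp /polprod big1 ?mulr1// => i _; rewrite leg0 hornerE.
    + apply: prodr_ile1 => i _; rewrite ffunE /= nrm1_ge0/=; exact: (nrm1_leg 0).
  apply: (@le_trans _ _ (\sum_(f : {ffun 'I_n -> 'I_N} | f != f0) M * \prod_i 2^-1 ^+ (f i))).
    apply: ler_sum => f ff0.
    have fn0 : exists i, (f i : nat) != 0%N.
      apply: contrapT => hn; move/eqP: ff0; apply; apply/ffunP => i; apply/val_inj; rewrite ffunE /=.
      by apply/eqP; apply: contrapT => /negP hi; apply: hn; exists i.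
    have b1 : \prod_i nrm1 (leg (f i) : {poly R}) <= \prod_i 16 ^+ (f i).
      by apply: ler_prod => i _; rewrite nrm1_ge0 nrm_leg.
    apply: le_trans (ler_pM _ _ (leg_coef_le fn0) b1) _ => //.
      by apply: prodr_ge0 => i _; exact: nrm1_ge0.
    rewrite -mulrA ler_wpM2l// -big_split; apply: ler_prod => i _ /=.
    rewrite -exprMn exprn_ge0 ?mulr_ge0//=; apply: lerXn2r; rewrite ?nnegrE ?mulr_ge0//.
    by have := hth; lra.
  rewrite -mulr_sumr ler_wpM2l// (le_trans _ (@sum_box_half R n N))// [leRHS](bigD1 f0)//= lerDr.
  by apply: prodr_ge0 => i _; rewrite exprn_ge0.
- have [v [_ _ vT _ [A [mA A0 hA]]]] := expand_G.
  exists A; split=> //; apply: subset_trans hA => p /= hp Bh; apply: hp => Bp.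
  have /= [->] := Bh Bp.
  rewrite (_ : monomials c p = \sum_(f : {ffun 'I_n -> 'I_N}) T (fun i => f i : nat) p); first exact: vT.
  have := cE (fun i q => q.[scoord toV l r p i]); apply=> *; rewrite ?horner0 ?hornerD ?hornerZ//.
- move=> i; have [v [vT [A [mA A0 hA]]]] := expand_dG i.
  exists A; split=> //; apply: subset_trans hA => p /= hp Bh; apply: hp => Bp.
  have /= [->] := Bh Bp.
  rewrite (_ : dmonomials c i p = \sum_(f : {ffun 'I_n -> 'I_N}) T' i (fun i => f i : nat) p); first exact: vT.
  rewrite /dmonomials /T'.
  under eq_bigr do rewrite mulrAC. under [in RHS]eq_bigr do rewrite mulrAC.
  rewrite -!mulr_suml; congr (_ * _).
  have := cE (fun j q => (if j == i then deriv q else q).[scoord toV l r p j]); apply=> [j|j q1 q2|j a q].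
  + by case: ifP => _; rewrite ?deriv0 horner0.
  + by case: ifP => _; rewrite ?derivD hornerD.
  + by case: ifP => _; rewrite ?derivZ hornerZ.
Qed.

End LocalExpansion.

(** * Weighted bounds from the analytic class *)

Section NullSets.
Context {R : realType} {d : measure_display} {P : measurableType d}.
Variables (mu : {measure set P -> \bar R}) (n : nat) (toV : P -> 'rV[R]_n).
Hypothesis H : leb_like mu toV.

Lemma sum_cst_ge0 k (x : \bar R) : (0 <= x)%E -> (\sum_(i < k) x = k%:R%:E * x)%E.
Proof.
move=> x0; elim: k => [|k IH]; first by rewrite big_ord0 mul0e.
by rewrite big_ord_recr /= IH -natr1 EFinD ge0_muleDl ?mul1e// lee_fin.
Qed.

(* A bounded set meeting every line of direction i at most once has infinitely many disjoint
   translates of equal measure inside a box. *)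
Lemma null_lines (S : set P) i : measurable S -> (forall p, S p -> cube (toV p)) ->
  (forall p q t, S p -> S q -> 0 < t -> toV q = toV p + t *: delta_mx 0 i -> False) -> mu S = 0%E.
Proof.
move=> mS Sc disj.
have [sh hsh] := choice (leb_shift H i).
have msh t : measurable_fun setT (sh t) by have [] := hsh t.
have shE t p : toV (sh t p) = toV p + t *: delta_mx 0 i by have [_ h _] := hsh t.
have inv t : mu (sh t @^-1` S) = mu S.
  have [_ _ h] := hsh t.
  have m1 A : measurable A -> mu A = (\int[mu]_p (\1_A p)%:E)%E.
    by move=> mA; rewrite integral_indic// setIT.
  rewrite (m1 S)// (m1 (sh t @^-1` S)); last by rewrite -[X in measurable X]setTI; exact: msh.
  rewrite -(h (fun p => (\1_S p)%:E)); last 2 first.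
  - by apply/measurable_EFinP; exact: measurable_indic.
  - by move=> p; rewrite lee_fin.
  by apply: eq_integral => p _; rewrite !indicE.
have aux (a b : R) (s : bool) : 0 <= b -> b < 1 -> 0 < a + b * s%:R < 1 -> -1 < a < 1.
  by case: s => /=; rewrite ?mulr1 ?mulr0 => b0 b1 /andP[h1 h2]; apply/andP; split; lra.
have lr (j : 'I_n) : (-1 : R) < 1 by rewrite -subr_gt0 opprK addr_gt0.
set bx := toV @^-1` box (fun=> -1) (fun=> 1).
have mbx : measurable bx by exact: (meas_box H).
have bound N : (N.+1%:R%:E * mu S <= (boxvol (fun=> -1) (fun _ : 'I_n => 1))%:E)%E.
  pose t (k : 'I_N.+1) : R := k%:R / N.+1%:R.
  have t01 k : 0 <= t k < 1.
    by rewrite /t divr_ge0//= ltr_pdivrMr ?ltr0n// mul1r ltr_nat.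
  pose F k := sh (t k) @^-1` S.
  have mF k : measurable (F k) by rewrite /F -[X in measurable X]setTI; exact: msh.
  have tF : trivIset [set: 'I_N.+1] F.
    have meet (j k : 'I_N.+1) : (j < k)%N -> F j `&` F k !=set0 -> False.
      move=> jk [p [Fj Fk]]; apply: (disj _ _ (t k - t j) Fj Fk).
        by rewrite subr_gt0 ltr_pM2r ?invr_gt0 ?ltr0n// ltr_nat.
      by rewrite !shE -addrA -scalerDl addrC [t j + _]addrC subrK addrC.
    move=> j k _ _ h; case: (ltngtP j k) => jk; [by case: (meet _ _ jk h)| |exact: val_inj].
    by case: (meet _ _ jk); rewrite setIC.
  have := measure_bigsetU_ord mu xpredT mF tF.
  rewrite (eq_bigr (fun=> mu S)) => [|k _]; last exact: inv.
  rewrite sum_cst_ge0 ?measure_ge0// => <-.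
  rewrite -(measure_box H lr) -/bx; apply: le_measure; rewrite ?inE//.
    by apply: bigsetU_measurable.
  rewrite -bigcup_mkord_ord => p [k _ /Sc cp] j.
  have := cp j; rewrite shE !mxE eqxx /=; have /andP[t0 t1] := t01 (inord k).
  exact: aux.
have v0 : 0 < boxvol (fun=> -1) (fun _ : 'I_n => 1) :> R by exact: boxvol_gt0.
have mS0 : (0 <= mu S)%E := measure_ge0 mu S.
move: (mu S) mS0 bound => -[m m0|_|//] bound.
- congr EFin; apply/eqP; rewrite eq_le -!lee_fin m0 andbT lee_fin leNgt; apply/negP => m1.
  have [N hN] : exists N, boxvol (fun=> -1) (fun _ : 'I_n => 1) / m < N%:R.
    by exists (Num.truncn (boxvol (fun=> -1) (fun _ : 'I_n => 1) / m)).+1; apply: truncnS_gt.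
  have := bound N; rewrite -EFinM lee_fin leNgt => /negP; apply.
  rewrite -ltr_pdivrMr// (lt_trans hN)// ltr_nat//.
- by have := bound 0%N; rewrite mul1e leye_eq.
Qed.

End NullSets.

Section Chain.
Context {R : realType} {d : measure_display} {P : measurableType d}.
Variables (mu : {measure set P -> \bar R}) (n : nat) (toV : P -> 'rV[R]_n).
Hypothesis H : leb_like mu toV.
Local Notation V := 'rV[R]_n.
Variables (f : V -> R) (D : ('I_n -> nat) -> V -> R).
Hypothesis wD : forall alpha, weak_deriv mu toV (@cube R n) f alpha (D alpha).

(** [D] at order 0 is tied to f only through integrals; putting f itself there makes the expansion
    speak of f directly. *)
Definition chain (a : 'I_n -> nat) : V -> R := if [forall i, a i == 0%N] then f else D a.

Lemma tderiv_upd a i (g : 'I_n -> R -> R) : tderiv a (upd g i (derive1 (g i))) = tderiv (inc a i) g.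
Proof.
apply/funext => j; rewrite /tderiv /upd /inc; case: eqP => [->|_]; last by rewrite addn0.
by rewrite addn1 iterSr.
Qed.

Lemma integ_tensor l r (g : V -> R) (u : 'I_n -> R -> R) : (forall i, 0 <= l i) -> (forall i, r i <= 1) ->
  (forall j, exists a b, [/\ l j < a, b < r j & forall t, ~~ (a <= t <= b) -> u j t = 0]) ->
  integ mu toV (@cube R n) (fun x => g x * tensor u x) =
  (\int[mu]_(p in toV @^-1` box l r) (g (toV p) * tensor u (toV p))%:E)%E.
Proof.
move=> l0 r1 hu; rewrite /integ integral_mkcond [RHS]integral_mkcond; apply: eq_integral => p _.
have u0 : ~ box l r (toV p) -> tensor u (toV p) = 0.
  move=> /existsNP[i hi]; have [a [b [la br ui]]] := hu i.
  rewrite (tensorD1 u i) ui ?mul0r//; apply/negP => /andP[h1 h2]; apply: hi.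
  by rewrite (lt_le_trans la h1) (le_lt_trans h2 br).
rewrite !patchE; case: (boolP (p \in toV @^-1` box l r)) => hb.
  rewrite mem_set//= => i; move: hb; rewrite inE => /(_ i) /andP[h1 h2].
  by rewrite (le_lt_trans (l0 i) h1) (lt_le_trans h2 (r1 i)).
rewrite u0 ?mulr0; first by case: ifP.
by move=> hb'; move/negP: hb; apply; rewrite inE.
Qed.

Lemma signK k (X : \bar R) : (((-1) ^+ k)%:E * (((-1) ^+ k)%:E * X) = X)%E.
Proof. by rewrite muleA -EFinM -exprD addnn -mul2n exprM sqrrN !expr1n mul1e. Qed.

Lemma mabs_inc (a : 'I_n -> nat) i : mabs (inc a i) = (mabs a).+1.
Proof.
rewrite /mabs /inc big_split /= -addn1; congr addn.
by rewrite (bigD1 i)//= eqxx big1// => j /negPf ->.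
Qed.

Lemma tensor_test l r (u : 'I_n -> R -> R) : (forall i, 0 <= l i) -> (forall i, r i <= 1) ->
  (forall j k, Ck k (u j)) ->
  (forall j, exists a b, [/\ l j < a, b < r j & forall t, ~~ (a <= t <= b) -> u j t = 0]) ->
  test_fun (@cube R n) (tensor u).
Proof.
move=> l0 r1 Cu hu; have [a ha] := choice hu; have [b hb] := choice ha.
apply: (@test_fun_tensor _ _ u _ a b) => //.
  by move=> j t; have [_ _] := hb j; exact.
move=> x hx i; have [h1 h2 _] := hb i; have /andP[x1 x2] := hx i.
by rewrite (le_lt_trans (l0 i) (lt_le_trans h1 x1)) (le_lt_trans x2 (lt_le_trans h2 (r1 i))).
Qed.

(** Both [D a] and [D (inc a i)] are derivatives of f. Testing the first with the i-th partial
    derivative of u and the second with u leads to the same integral of f, up to sign. *)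
Lemma chain_parts_rel l r a i : (forall i, 0 <= l i) -> (forall i, r i <= 1) ->
  parts_rel mu toV l r i (chain a \o toV) (chain (inc a i) \o toV).
Proof.
move=> l0 r1 u Cu hu; pose u' := upd u i (derive1 (u i)).
have Cu' j k : Ck k (u' j) by rewrite /u' /upd; case: eqP => // _; have [] := Cu i k.+1.
have hu' j : exists a b, [/\ l j < a, b < r j & forall t, ~~ (a <= t <= b) -> u' j t = 0].
  have [x [y [h1 h2 h3]]] := hu j; rewrite /u' /upd; case: eqP => [ji|_]; last by exists x, y.
  exists x, y; split=> // t ht; rewrite -ji derive1E.
  rewrite (@near_eq_derive R R R (u j) (cst 0) t 1) ?derive_cst//.
  move: ht; rewrite negb_and -!ltNge => /orP[ht|ht].
    by near=> z; apply: h3; rewrite negb_and -ltNge; apply/orP; left; near: z; exact: lt_nbhsl.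
  by near=> z; apply: h3; rewrite negb_and -!ltNge; apply/orP; right; near: z; exact: lt_nbhsr.
have ta := tensor_test l0 r1 Cu hu; have ta' := tensor_test l0 r1 Cu' hu'.
have ci : chain (inc a i) = D (inc a i).
  by rewrite /chain; case: forallP => // /(_ i); rewrite /inc eqxx addn1.
have [_ _ w1] := wD (inc a i); have := w1 _ ta; rewrite mderiv_tensor// mabs_inc => e1.
have e2 : integ mu toV (@cube R n) (fun x => chain a x * tensor u' x) =
   (- integ mu toV (@cube R n) (fun x => (chain (inc a i) x * tensor u x)%R))%E.
  rewrite ci /chain; case: forallP => a0.
    have a0' : a = fun=> 0%N by apply/funext => j; exact/eqP.
    have -> : u' = tderiv (inc a i) u.
      by rewrite -tderiv_upd a0' /tderiv /=.
    by rewrite e1 a0' /mabs big1// expr1 EFinN mulN1e.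
  have [_ _ w0] := wD a; have := w0 _ ta'; rewrite mderiv_tensor// tderiv_upd e1 => e3.
  rewrite -[LHS](signK (mabs a)) -e3 exprS EFinM -muleA muleCA signK.
  by rewrite EFinN mulN1e.
rewrite (integ_tensor _ l0 r1 hu') (integ_tensor _ l0 r1 hu) in e2.
by rewrite /Rintegral e2 fineN.
Unshelve. all: by end_near.
Qed.

End Chain.

(** * The regions around the corner and the edges cover almost every point *)

Section Regions.
Context {R : realType} {d : measure_display} {P : measurableType d}.
Variables (mu : {measure set P -> \bar R}) (n : nat) (toV : P -> 'rV[R]_n.+2).
Hypothesis H : leb_like mu toV.
Local Notation V := 'rV[R]_n.+2.
Variables (E : finType) (edge : E -> set V) (edir : E -> 'I_n.+2) (c : V) (eh : R).
Hypothesis eh0 : 0 < eh.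
Hypothesis cc : is_corner c.

Definition rcE (x : V) : R := Num.sqrt (\sum_i (x 0 i - c 0 i) ^+ 2).
(** Distance to the whole line through c in the direction of e; on the cube it agrees with the
    distance to the edge by [edgeE]. *)
Definition reE (e : E) (x : V) : R := Num.sqrt (\sum_(i | i != edir e) (x 0 i - c 0 i) ^+ 2).

Hypothesis edgeE : forall e x, cube x -> r_e edge e x = reE e x.

Lemma r_cE x : r_c c x = rcE x.
Proof. by rewrite /r_c /eucl /rcE; congr Num.sqrt; apply: eq_bigr => i _; rewrite !mxE. Qed.

Lemma cubeP2 (x : V) i : cube x -> 0 < (x 0 i - c 0 i) ^+ 2 < 1.
Proof.
move=> /(_ i) /andP[x0 x1]; have [-> | ->] := cc i; apply/andP; split; nra.
Qed.

Lemma rcE_gt0 x : cube x -> 0 < rcE x.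
Proof.
move=> cx; rewrite sqrtr_gt0 (bigD1 ord0)//= ltr_pwDl//; first by have /andP[] := cubeP2 ord0 cx.
by apply: sumr_ge0 => i _; rewrite sqr_ge0.
Qed.

Lemma rho_ceE e x : cube x -> (rho_ce edge c e x < eh) = (reE e x < eh * rcE x) /\
   (eh < rho_ce edge c e x) = (eh * rcE x < reE e x).
Proof.
move=> cx; rewrite /rho_ce r_cE edgeE//; have r0 := rcE_gt0 cx.
by rewrite ltr_pdivrMr// ltr_pdivlMr.
Qed.

Lemma continuous_sqdist (Q : pred 'I_n.+2) : continuous (fun x : V => Num.sqrt (\sum_(i | Q i) (x 0 i - c 0 i) ^+ 2)).
Proof.
move=> x; apply: (@continuous_comp _ _ _ (fun x : V => \sum_(i | Q i) (x 0 i - c 0 i) ^+ 2) Num.sqrt); last exact: sqrt_continuous.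
elim: (index_enum _) => [|i s IH].
  rewrite (_ : (fun x => _) = cst 0); first exact: cst_continuous.
  by apply/funext => z; rewrite big_nil.
rewrite (_ : (fun x => _) = (fun x : V => (if Q i then (x 0 i - c 0 i) ^+ 2 else 0) + \sum_(j <- s | Q j) (x 0 j - c 0 j) ^+ 2)); last first.
  by apply/funext => z; rewrite big_cons; case: ifP => // _; rewrite add0r.
apply: continuousD => //; case: (Q i); last exact: cst_continuous.
apply: (@continuous_comp _ _ _ (fun x : V => x 0 i - c 0 i) (fun y => y ^+ 2)); last exact: exprn_continuous.
by apply: (@continuousB _ _ _ (fun x : V => x 0 i) (cst (c 0 i))); [exact: coord_continuous|exact: cst_continuous].
Qed.

Lemma continuous_rcE : continuous rcE. Proof. exact: continuous_sqdist. Qed.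
Lemma continuous_reE e : continuous (reE e). Proof. exact: continuous_sqdist. Qed.

Lemma measurable_rcE : measurable_fun setT (rcE \o toV).
Proof. exact: (meas_continuous H continuous_rcE). Qed.
Lemma measurable_reE e : measurable_fun setT (reE e \o toV).
Proof. exact: (meas_continuous H (@continuous_reE e)). Qed.

Definition region := (bool + E * bool)%type.

Definition reg_set (r : region) : set V :=
  match r with
  | inl true => Om_0 edge eh c
  | inl false => Om_c edge eh c
  | inr (e, true) => Om_e edge eh c e
  | inr (e, false) => Om_ce edge eh c e
  end.

Lemma measurable_cube : measurable (toV @^-1` @cube R n.+2).
Proof. exact: (meas_box H (fun=> 0) (fun=> 1)). Qed.

Lemma Om_cE : Om_c edge eh c = [set x | cube x /\ rcE x < eh /\ forall e, eh * rcE x < reE e x].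
Proof.
apply/seteqP; split => x [cx [h1 h2]]; split=> //; rewrite r_cE in h1 *; split=> // e;
  by have := h2 e; have [_ ->] := rho_ceE e cx.
Qed.

Lemma Om_eE e : Om_e edge eh c e = [set x | cube x /\ reE e x < eh /\ eh < rcE x].
Proof. by apply/seteqP; split => x [cx [h1 h2]]; split=> //; move: h1 h2; rewrite edgeE// r_cE. Qed.

Lemma Om_ceE e : Om_ce edge eh c e = [set x | cube x /\ rcE x < eh /\ reE e x < eh * rcE x].
Proof. by apply/seteqP; split => x [cx [h1 h2]]; split=> //; move: h1 h2; rewrite r_cE; have [-> _] := rho_ceE e cx. Qed.

Let mlt (f g : P -> R) : measurable_fun setT f -> measurable_fun setT g -> measurable [set p | f p < g p].
Proof.
by move=> mf mg; have := measurable_fun_ltr mf mg => /(_ measurableT [set true]); rewrite setTI; apply.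
Qed.

Lemma measurable_reg r : measurable (toV @^-1` reg_set r).
Proof.
have mc := measurable_rcE; have me := measurable_reE.
have mec : measurable_fun setT (fun p => eh * rcE (toV p)) by apply: measurable_funM => //; exact: mc.
case: r => [[]|[e []]] /=.
- rewrite /Om_0; set K := closure _; rewrite (_ : _ @^-1` _ = (toV @^-1` @cube R n.+2) `\` (toV @^-1` K))//; apply: measurableD; first exact: measurable_cube.
  rewrite (_ : toV @^-1` K = ~` (toV @^-1` (~` K))); last by rewrite preimage_setC setCK.
  by apply: measurableC; apply: (meas_open H); apply: closed_openC; exact: closed_closure.
- rewrite Om_cE (_ : _ @^-1` _ = toV @^-1` @cube R n.+2 `&` [set p | rcE (toV p) < eh] `&` \bigcap_(e in [set: E]) [set p | eh * rcE (toV p) < reE e (toV p)]).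
    apply: measurableI.
      by apply: measurableI; [exact: measurable_cube|apply: mlt => //; exact: mc].
    by apply: fin_bigcap_measurable => // e _; apply: mlt; [exact: mec|exact: me].
  by apply/seteqP; split => p /=; [move=> [? [? h]]; split=> // e _; exact: h|move=> [[? ?] h]; split=> //; split=> // e; exact: h].
- rewrite Om_eE (_ : _ @^-1` _ = toV @^-1` @cube R n.+2 `&` ([set p | reE e (toV p) < eh] `&` [set p | eh < rcE (toV p)]))//.
  by apply: measurableI; [exact: measurable_cube|apply: measurableI; [apply: mlt => //; exact: me|apply: mlt => //; exact: mc]].
- rewrite Om_ceE (_ : _ @^-1` _ = toV @^-1` @cube R n.+2 `&` ([set p | rcE (toV p) < eh] `&` [set p | reE e (toV p) < eh * rcE (toV p)]))//.
  by apply: measurableI; [exact: measurable_cube|apply: measurableI; [apply: mlt => //; exact: mc|apply: mlt; [exact: me|exact: mec]]].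
Qed.

Definition generic (x : V) := [/\ rcE x != eh, forall e, reE e x != eh & forall e, reE e x != eh * rcE x].

Lemma ltr_near (u v : V -> R) x : {for x, continuous u} -> {for x, continuous v} -> u x != v x ->
  \forall z \near x, (u z < v z)%R = (u x < v x)%R.
Proof.
move=> cu cv; have FF := nbhs_filter (x : V); rewrite neq_lt => /orP[h|h]; rewrite ?h ?(ltNge (u x)) ?(ltW h)/=.
  have hw : v x - u x > 0 by rewrite subr_gt0.
  have cw : {for x, continuous (v \- u)} := continuousB cv cu.
  have := (@cvgr_gt _ _ _ _ _ _ cw 0 hw).
  by move=> /(_ FF); apply: (@filterS _ _ FF) => z; rewrite /= subr_gt0 => ->.
have hw : u x - v x > 0 by rewrite subr_gt0.
have cw : {for x, continuous (u \- v)} := continuousB cu cv.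
have := (@cvgr_gt _ _ _ _ _ _ cw 0 hw).
by move=> /(_ FF); apply: (@filterS _ _ FF) => z; rewrite /= subr_gt0 => h2; apply/negbTE; rewrite -leNgt ltW.
Qed.

(** Near a generic point the inequalities that define the regions keep their truth values. If x is
    not in [Om_0] it is a limit of points of the other regions, so it already satisfies the
    inequalities of one of them. *)
Lemma region_cover x : cube x -> generic x -> exists r, reg_set r x.
Proof.
move=> cx [g1 g2 g3].
case: (pselect (closure (Om_c edge eh c `|` \bigcup_(e in [set: E]) Om_e edge eh c e
                    `|` \bigcup_(e in [set: E]) Om_ce edge eh c e) x)) => clx; last first.
  by exists (inl true); split.
have FF := nbhs_filter (x : V).
have ccst (a : R) : {for x, continuous ((fun=> a) : V -> R)} by exact: cst_continuous.
have crc : {for x, continuous rcE} by exact: continuous_rcE.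
have cehrc : {for x, continuous (fun z => eh * rcE z)} by apply: (@continuousM _ _ (cst eh) rcE); [exact: cst_continuous|exact: continuous_rcE].
have nb : \forall z \near x, [/\ (rcE z < eh) = (rcE x < eh), (eh < rcE z) = (eh < rcE x),
    (forall e, (reE e z < eh) = (reE e x < eh)), (forall e, (reE e z < eh * rcE z) = (reE e x < eh * rcE x)) &
    (forall e, (eh * rcE z < reE e z) = (eh * rcE x < reE e x))].
  have n1 := @ltr_near rcE (fun=> eh) x crc (ccst eh) g1.
  have n2 := @ltr_near (fun=> eh) rcE x (ccst eh) crc (ltac:(by rewrite eq_sym)).
  have n3 : \forall z \near x, forall e, (reE e z < eh) = (reE e x < eh).
    by apply: (@filter_forall _ _ _ _ FF) => e; apply: (@ltr_near (reE e) (fun=> eh)) => //; exact: continuous_reE.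
  have n4 : \forall z \near x, forall e, (reE e z < eh * rcE z) = (reE e x < eh * rcE x).
    by apply: (@filter_forall _ _ _ _ FF) => e; apply: (@ltr_near (reE e) (fun z => eh * rcE z)) => //; exact: continuous_reE.
  have n5 : \forall z \near x, forall e, (eh * rcE z < reE e z) = (eh * rcE x < reE e x).
    by apply: (@filter_forall _ _ _ _ FF) => e; apply: (@ltr_near (fun z => eh * rcE z) (reE e)) => //; [exact: continuous_reE|rewrite eq_sym].
  by near=> z; split; near: z.
have [z [[[hz|[e _ hz]]|[e _ hz]] [h1 h2 h3 h4 h5]]] := clx _ nb.
- move: hz; rewrite Om_cE => -[_ [z1 z2]]; exists (inl false); rewrite /= Om_cE; split=> //.
  by rewrite -h1; split=> // e; rewrite -h5.
- move: hz; rewrite Om_eE => -[_ [z1 z2]]; exists (inr (e, true)); rewrite /= Om_eE; split=> //.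
  by rewrite -h2 -h3.
- move: hz; rewrite Om_ceE => -[_ [z1 z2]]; exists (inr (e, false)); rewrite /= Om_ceE; split=> //.
  by rewrite -h1 -h4.
Unshelve. all: by end_near.
Qed.

(** Each exceptional equation meets the lines of a suitable axis direction at most once in the cube:
    r_c = eh along any axis, r_e = eh across the edge, and r_e = eh r_c along the edge, where r_e is
    constant and r_c strictly monotone. *)
Lemma generic_ae : \forall p \ae mu, cube (toV p) -> generic (toV p).
Proof.
have mc := measurable_rcE; have me := measurable_reE.
have mec : measurable_fun setT (fun p => eh * rcE (toV p)) by apply: measurable_funM => //; exact: mc.
have meq (f g : P -> R) : measurable_fun setT f -> measurable_fun setT g -> measurable [set p | f p = g p].
  move=> mf mg; rewrite (_ : [set p | _] = ~` ([set p | f p < g p] `|` [set p | g p < f p])).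
    by apply: measurableC; apply: measurableU; exact: mlt.
  apply/seteqP; split => p /=; first by move=> -> [|]; rewrite ltxx.
  by move=> /not_orP[/negP h1 /negP h2]; apply/eqP; rewrite eq_le !leNgt h1 h2.
have strict x y i t : cube x -> cube y -> 0 < t -> y = x + t *: delta_mx 0 i ->
    (y 0 i - c 0 i) ^+ 2 <> (x 0 i - c 0 i) ^+ 2 /\ forall j, j != i -> y 0 j = x 0 j.
  move=> cx cy t0 yx; split; last by move=> j ji; rewrite yx !mxE eqxx (negPf ji) mulr0 addr0.
  have yi : y 0 i = x 0 i + t by rewrite yx !mxE !eqxx mulr1.
  have /andP[x0 x1] := cx i; have /andP[y0 y1] := cy i; rewrite yi in y0 y1 *.
  by have [-> | ->] := cc i; apply/eqP; rewrite eqf_sqr negb_or; apply/andP; split; apply/eqP; lra.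
have sqE (Q : pred 'I_n.+2) x : Num.sqrt (\sum_(i | Q i) (x 0 i - c 0 i) ^+ 2) ^+ 2 = \sum_(i | Q i) (x 0 i - c 0 i) ^+ 2.
  by rewrite sqr_sqrtr// sumr_ge0// => i _; rewrite sqr_ge0.
have null (S : set P) i : measurable S -> (forall p q t, cube (toV p) -> cube (toV q) -> S p -> S q -> 0 < t ->
     toV q = toV p + t *: delta_mx 0 i -> False) -> mu (toV @^-1` @cube R n.+2 `&` S) = 0%E.
  move=> mS h; apply: (null_lines H (i := i)); first by apply: measurableI => //; exact: measurable_cube.
    by move=> p [].
  by move=> p q t [cp Sp] [cq Sq]; exact: h.
pose N1 := toV @^-1` @cube R n.+2 `&` [set p | rcE (toV p) = eh].
pose N2 e := toV @^-1` @cube R n.+2 `&` [set p | reE e (toV p) = eh].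
pose N3 e := toV @^-1` @cube R n.+2 `&` [set p | reE e (toV p) = eh * rcE (toV p)].
have n1 : mu N1 = 0%E.
  apply: (null _ ord0); first by apply: meq.
  move=> p q t cp cq Sp Sq t0 pq; have [h1 h2] := strict _ _ _ _ cp cq t0 pq; apply: h1.
  have : rcE (toV q) ^+ 2 = rcE (toV p) ^+ 2 by rewrite Sp Sq.
  rewrite !sqE (bigD1 ord0)//= [RHS](bigD1 ord0)//=.
  by rewrite (eq_bigr (fun i => (toV p 0 i - c 0 i) ^+ 2)) => [/addIr//|i i0]; rewrite h2.
have n2 e : mu (N2 e) = 0%E.
  have [i ie] : exists i : 'I_n.+2, i != edir e.
    by case: (eqVneq (edir e) ord0) => [->|h]; [exists ord_max|exists ord0; rewrite eq_sym].
  apply: (null _ i); first exact: (meq _ _ (me e) (measurable_cst eh)).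
  move=> p q t cp cq Sp Sq t0 pq; have [h1 h2] := strict _ _ _ _ cp cq t0 pq; apply: h1.
  have : reE e (toV q) ^+ 2 = reE e (toV p) ^+ 2 by rewrite Sp Sq.
  rewrite !sqE (bigD1 i)//= [RHS](bigD1 i)//=.
  by rewrite (eq_bigr (fun i => (toV p 0 i - c 0 i) ^+ 2)) => [/addIr//|j /andP[_ ji]]; rewrite h2.
have n3 e : mu (N3 e) = 0%E.
  apply: (null _ (edir e)); first exact: (meq _ _ (me e) mec).
  move=> p q t cp cq Sp Sq t0 pq; have [h1 h2] := strict _ _ _ _ cp cq t0 pq; apply: h1.
  have rE : reE e (toV q) = reE e (toV p).
    by rewrite /reE; congr Num.sqrt; apply: eq_bigr => j je; rewrite h2.
  have rr : rcE (toV q) = rcE (toV p).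
    by apply: (mulfI (x := eh)); rewrite ?gt_eqF// -Sq -Sp.
  have : rcE (toV q) ^+ 2 = rcE (toV p) ^+ 2 by rewrite rr.
  rewrite !sqE (bigD1 (edir e))//= [RHS](bigD1 (edir e))//=.
  by rewrite (eq_bigr (fun i => (toV p 0 i - c 0 i) ^+ 2)) => [/addIr//|j je]; rewrite h2.
have ae1 (S : set P) : measurable S -> mu (toV @^-1` @cube R n.+2 `&` S) = 0%E -> \forall p \ae mu, cube (toV p) -> ~ S p.
  move=> mS h; exists (toV @^-1` @cube R n.+2 `&` S); split=> //.
    by apply: measurableI => //; exact: measurable_cube.
  by move=> p /= /not_implyP[cp /contrapT Sp].
have a1 := ae1 _ (meq _ _ mc (measurable_cst eh)) n1.
have a2 e := ae1 _ (meq _ _ (me e) (measurable_cst eh)) (n2 e).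
have a3 e := ae1 _ (meq _ _ (me e) mec) (n3 e).
have b2 : \forall p \ae mu, forall e, cube (toV p) -> ~ (reE e (toV p) = eh) by exact: filter_forall.
have b3 : \forall p \ae mu, forall e, cube (toV p) -> ~ (reE e (toV p) = eh * rcE (toV p)) by exact: filter_forall.
near=> p => cp; split.
- by apply/eqP; move: cp; near: p; exact: a1.
- by move=> e; apply/eqP; move: e cp; near: p; exact: b2.
- by move=> e; apply/eqP; move: e cp; near: p; exact: b3.
Unshelve. all: by end_near.
Qed.

End Regions.

Section WeightedBounds.
Context {R : realType} {d : measure_display} {P : measurableType d}.
Variables (mu : {measure set P -> \bar R}) (n : nat) (toV : P -> 'rV[R]_n.+2).
Hypothesis H : leb_like mu toV.
Local Notation V := 'rV[R]_n.+2.
Variables (E : finType) (edge : E -> set V) (edir : E -> 'I_n.+2) (c : V) (eh : R).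
Hypothesis eh0 : 0 < eh.
Hypothesis cc : is_corner c.
Hypothesis edgeE : forall e x, cube x -> r_e edge e x = reE edir c e x.
Variables (gc : R) (ge : E -> R) (Cf Af : R).
Hypothesis Cf0 : 0 < Cf.
Hypothesis Af0 : 0 < Af.
Variable D : ('I_n.+2 -> nat) -> V -> R.
Hypothesis mD : forall a, measurable_on toV (@cube R n.+2) (D a).

Definition reg_wt (r : region E) (a : 'I_n.+2 -> nat) (x : V) : R :=
  match r with
  | inl true => 1
  | inl false => rcE c x `^ pos_part ((mabs a)%:R - gc)
  | inr (e, true) => reE edir c e x `^ pos_part ((mabs_perp edir e a)%:R - ge e)
  | inr (e, false) => rcE c x `^ pos_part ((mabs a)%:R - gc) *
       (reE edir c e x / rcE c x) `^ pos_part ((mabs_perp edir e a)%:R - ge e)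
  end.

Lemma reg_wt_ge0 r a x : 0 <= reg_wt r a x.
Proof. by case: r => [[]|[e []]] //=; rewrite ?mulr_ge0// powR_ge0. Qed.

Definition bnd (k : nat) : R := Cf * Af ^+ k * k`!%:R.

Lemma bnd_ge0 k : 0 <= bnd k.
Proof. by rewrite !mulr_ge0 ?exprn_ge0// ltW. Qed.

Hypothesis JD : forall k : nat,
      [/\ (sum_mi k (fun al => wL2norm mu toV (Om_0 edge eh c) (fun _ => 1%R) (D al)) <= (bnd k)%:E)%E,
          (sum_mi k (fun al => wL2norm mu toV (Om_c edge eh c)
               (fun x => (r_c c x `^ pos_part ((mabs al)%:R - gc))%R) (D al)) <= (bnd k)%:E)%E,
          (forall e, sum_mi k (fun al => wL2norm mu toV (Om_e edge eh c e)
               (fun x => (r_e edge e x `^ pos_part ((mabs_perp edir e al)%:R - ge e))%R) (D al)) <= (bnd k)%:E)%E &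
          (forall e, sum_mi k (fun al => wL2norm mu toV (Om_ce edge eh c e)
               (fun x => (r_c c x `^ pos_part ((mabs al)%:R - gc) *
                         rho_ce edge c e x `^ pos_part ((mabs_perp edir e al)%:R - ge e))%R) (D al)) <= (bnd k)%:E)%E].

Lemma term_le_sum (F : ('I_n.+2 -> nat) -> \bar R) a : (forall b, 0 <= F b)%E -> (F a <= sum_mi (mabs a) F)%E.
Proof.
move=> F0; have ak i : (a i < (mabs a).+1)%N by rewrite ltnS /mabs (bigD1 i)//= leq_addr.
pose f : {ffun 'I_n.+2 -> 'I_(mabs a).+1} := [ffun i => inord (a i)].
have fE : (fun i => f i : nat) = a by apply/funext => i; rewrite ffunE inordK.
rewrite /sum_mi (bigD1 f)/=; last by apply/eqP; rewrite -[RHS]/(\sum_i a i)%N; apply: eq_bigr => i _; rewrite ffunE inordK.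
by rewrite fE leeDl// sume_ge0.
Qed.

Let regF (r : region E) a (p : P) : R := \1_(toV @^-1` reg_set edge c eh r) p * (reg_wt r a (toV p) * D a (toV p)).

Lemma reg_set_cube r x : reg_set edge c eh r x -> cube x.
Proof. by case: r => [[]|[e []]] /= []. Qed.

Lemma regF_int r a : (\int[mu]_p (regF r a p ^+ 2)%:E <= (bnd (mabs a) ^+ 2)%:E)%E.
Proof.
have main (w : V -> R) : (forall x, reg_set edge c eh r x -> w x = reg_wt r a x) ->
    (wL2norm mu toV (reg_set edge c eh r) w (D a) <= (bnd (mabs a))%:E)%E ->
    (\int[mu]_p (regF r a p ^+ 2)%:E <= (bnd (mabs a) ^+ 2)%:E)%E.
  move=> hw hb.
  have := @gt0_ler_poweR R 2 (ler0n _ 2) _ _ _ _ hb.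
  rewrite /wL2norm poweR_Lnorm ?pnatr_eq0// poweR_EFin powR_mulrn ?bnd_ge0// => h.
  apply: le_trans (h _ _).
  - rewrite le_eqVlt; apply/orP; left; apply/eqP/eq_integral => p _.
    rewrite abse_EFin poweR_EFin powR_mulrn// real_normK ?num_real//.
    rewrite /regF indicE; case: (boolP (p \in _)) => hp; last by rewrite !mul0r.
    by rewrite hw//; move: hp; rewrite inE.
  - by rewrite in_itv/= leey Lnorm_ge0.
  - by rewrite in_itv/= leey lee_fin bnd_ge0.
have [J0 Jc Je Jce] := JD (mabs a).
case: r main => [[]|[e []]] main.
- by apply: (main (fun=> 1)) => //; apply: le_trans J0; apply: (term_le_sum (F := fun al => wL2norm mu toV _ _ (D al))) => b; exact: Lnorm_ge0.
- apply: (main (fun x => (r_c c x `^ pos_part ((mabs a)%:R - gc)))) => [x _|]; first by rewrite r_cE.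
  apply: le_trans Jc; apply: (term_le_sum (F := fun al => wL2norm mu toV _ (fun x => (r_c c x `^ pos_part ((mabs al)%:R - gc))%R) (D al))) => b; exact: Lnorm_ge0.
- apply: (main (fun x => (r_e edge e x `^ pos_part ((mabs_perp edir e a)%:R - ge e)))) => [x [cx _]|]; first by rewrite edgeE.
  apply: le_trans (Je e); apply: (term_le_sum (F := fun al => wL2norm mu toV _ (fun x => (r_e edge e x `^ pos_part ((mabs_perp edir e al)%:R - ge e))%R) (D al))) => b; exact: Lnorm_ge0.
- apply: (main (fun x => (r_c c x `^ pos_part ((mabs a)%:R - gc) *
                         rho_ce edge c e x `^ pos_part ((mabs_perp edir e a)%:R - ge e)))) => [x [cx _]|].
    by rewrite /rho_ce (edgeE e cx) (r_cE c x).
  apply: le_trans (Jce e); apply: (term_le_sum (F := fun al => wL2norm mu toV _ (fun x => (r_c c x `^ pos_part ((mabs al)%:R - gc) *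
                         rho_ce edge c e x `^ pos_part ((mabs_perp edir e al)%:R - ge e))%R) (D al))) => b; exact: Lnorm_ge0.
Qed.

Lemma measurable_reg_wt r a : measurable_fun setT (reg_wt r a \o toV).
Proof.
have mc : measurable_fun setT (rcE c \o toV) by exact: (measurable_rcE H c).
have me e : measurable_fun setT (reE edir c e \o toV) by exact: (measurable_reE H edir c e).
have mp (f : P -> R) s : measurable_fun setT f -> measurable_fun setT (fun p => f p `^ s).
  by move=> mf; apply: (measurableT_comp (measurable_powR s) mf).
case: r => [[]|[e []]] /=; first exact: measurable_cst.
- exact: mp.
- by apply: (mp (reE edir c e \o toV)); exact: me.
apply: measurable_funM; first exact: mp.
apply: (mp (fun p => reE edir c e (toV p) / rcE c (toV p))).
apply: measurable_funM; first exact: me.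
rewrite (_ : (fun p => _) = (fun p => rcE c (toV p) `^ (-1))); first exact: mp.
by apply/funext => p; rewrite powR_inv1// sqrtr_ge0.
Qed.

Lemma measurable_regF r a : measurable_fun setT (regF r a).
Proof.
have mr := measurable_reg H eh cc edgeE r.
rewrite (_ : regF r a = (fun p => reg_wt r a (toV p) * D a (toV p)) \_ (toV @^-1` reg_set edge c eh r)).
  apply/(measurable_restrictT _ _).1 => //.
  apply: measurable_funM; first by apply: measurable_funTS; exact: measurable_reg_wt.
  apply: measurable_funS (mD a); first exact: (measurable_cube H).
  by move=> p; exact: reg_set_cube.
by apply/funext => p; rewrite /regF indicE patchE; case: ifP; rewrite ?mul1r ?mul0r.
Qed.

Variables (W : ('I_n.+2 -> nat) -> V -> R) (C0 : R).
Hypothesis C00 : 0 <= C0.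
Hypothesis hW : forall r x a, reg_set edge c eh r x -> 1 <= C0 ^+ mabs a * W a x * reg_wt r a x.

(** Almost every point of the box lies in some region, where [hW] makes the unweighted derivative at
    most C0^|a| w times the weighted one. Summing the squares over all regions avoids any choice of
    region. *)
Lemma weighted_L2 l r a w : (forall i, l i < r i) -> (forall i, 0 <= l i) -> (forall i, r i <= 1) -> 0 <= w ->
  (forall x, box l r x -> W a x <= w) ->
  (\int[mu]_(p in toV @^-1` box l r) (D a (toV p) ^+ 2)%:E <=
    ((#|{: region E}|%:R * (C0 ^+ mabs a * w) * bnd (mabs a)) ^+ 2)%:E)%E.
Proof.
move=> lr l0 r1 w0 Ww; set B := toV @^-1` box l r; set K := C0 ^+ mabs a * w.
have mB : measurable B by exact: (meas_box H).
have Bc p : B p -> cube (toV p).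
  by move=> Bp i; have /andP[h1 h2] := Bp i; rewrite (le_lt_trans (l0 i) h1) (lt_le_trans h2 (r1 i)).
have K0 : 0 <= K by rewrite mulr_ge0// exprn_ge0.
have mDB : measurable_fun B (fun p => D a (toV p)).
  by apply: measurable_funS (mD a) => //; exact: (measurable_cube H).
have mF2 s : measurable_fun setT (fun p => (regF s a p ^+ 2)%:E).
  by apply/measurable_EFinP; apply: measurable_funX; exact: measurable_regF.
have mKF s : measurable_fun B (fun p => ((K ^+ 2)%:E * (regF s a p ^+ 2)%:E)%E).
  apply: measurable_funTS; apply: emeasurable_funM => //.
apply: (@le_trans _ _ (\int[mu]_(p in B) (\sum_(s <- enum {: region E}) (K ^+ 2)%:E * (regF s a p ^+ 2)%:E))%E).
  apply: ae_ge0_le_integral => //.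
  - by move=> p _; rewrite lee_fin sqr_ge0.
  - by apply/measurable_EFinP; exact: measurable_funX.
  - by move=> p _; apply: sume_ge0 => s _; rewrite -EFinM lee_fin mulr_ge0 ?sqr_ge0.
  - by apply: emeasurable_sum => s; exact: mKF.
  apply: filterS (generic_ae H edir eh0 cc) => p gp Bp.
  have [s hs] := region_cover cc edgeE (Bc p Bp) (gp (Bc p Bp)).
  rewrite big_enum/= (bigD1 s)//=; apply: (@le_trans _ _ ((K ^+ 2)%:E * (regF s a p ^+ 2)%:E)%E); last first.
    by rewrite leeDl// sume_ge0// => t _; rewrite -EFinM lee_fin mulr_ge0 ?sqr_ge0.
  rewrite -EFinM lee_fin -exprMn /regF indicE mem_set// mul1r mulrA.
  rewrite -[leLHS]real_normK ?num_real// -[leRHS]real_normK ?num_real//.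
  apply: lerXn2r; rewrite ?nnegrE// normrM -[leLHS]mul1r ler_wpM2r//.
  apply: le_trans (hW a hs) _; apply: le_trans _ (ler_norm _).
  by rewrite ler_wpM2r ?reg_wt_ge0// ler_wpM2l ?exprn_ge0// Ww.
rewrite ge0_integral_sum//; last by move=> s p _; rewrite -EFinM lee_fin mulr_ge0 ?sqr_ge0.
apply: (@le_trans _ _ (\sum_(s <- enum {: region E}) ((K * bnd (mabs a)) ^+ 2)%:E)%E).
  apply: lee_sum => s _; rewrite ge0_integralZl_EFin ?sqr_ge0//; last 2 first.
  - by move=> p _; rewrite lee_fin sqr_ge0.
  - exact: measurable_funTS.
  rewrite [X in (_ <= X)%E](_ : _ = (K ^+ 2)%:E * (bnd (mabs a) ^+ 2)%:E)%E; last by rewrite -EFinM -exprMn.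
  apply: lee_wpmul2l; first by rewrite lee_fin sqr_ge0.
  apply: le_trans (regF_int s a); apply: ge0_subset_integral => //.
  by move=> p _; rewrite lee_fin sqr_ge0.
rewrite big_enum/= sumEFin lee_fin sumr_const -mulrA [leRHS]exprMn -[leLHS]mulr_natl.
by rewrite ler_wpM2r ?sqr_ge0// expr2 -natrM ler_nat; case: #|_| => // k; rewrite leq_pmulr.
Qed.

End WeightedBounds.

(** * One weight expressed through the distances to the faces at the corner *)

Section CornerGeometry.
Context {R : realType} {n : nat}.
Local Notation V := 'rV[R]_n.+2.
Implicit Types (y : 'I_n.+2 -> R).

Definition cdist (c x : V) (i : 'I_n.+2) : R := `|x 0 i - c 0 i|.

(* The largest t such that all coordinates but one are at least t: the larger coordinate when
   n = 2, the middle one when n = 3. *)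
Definition mid y : R := \big[Num.max/0]_i \big[Num.min/1]_(j | j != i) y j.

Lemma mid_max y i t : t <= 1 -> (forall j, j != i -> t <= y j) -> t <= mid y.
Proof.
move=> t1 h; apply: (@le_trans _ _ (\big[Num.min/1]_(j | j != i) y j)); last exact: le_bigmax_cond.
by apply/bigmin_geP; split.
Qed.

Lemma mid_att y : (forall i, 0 <= y i) -> exists i, forall j, j != i -> mid y <= y j.
Proof.
move=> y0; have h0 (i : 'I_n.+2) : true -> 0 <= \big[Num.min/1]_(j | j != i) y j.
  by move=> _; apply/bigmin_geP; split.
have [i _ hi] := @eq_bigmax _ _ _ 0 ord0 xpredT _ isT h0.
by exists i => j ji; rewrite /mid hi; exact: bigmin_le_cond.
Qed.

Lemma mid_gt0 y : (forall i, 0 < y i) -> 0 < mid y.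
Proof.
move=> y0; apply: (@lt_le_trans _ _ (\big[Num.min/1]_j y j)).
  by apply/bigmin_gtP; split.
apply: (@mid_max y ord0); first by have /bigmin_geP[] := lexx (\big[Num.min/1]_j y j).
by move=> j _; exact: bigmin_le_cond.
Qed.

Lemma mid_le1 y : (forall i, 0 <= y i) -> (forall i, y i <= 1) -> mid y <= 1.
Proof.
move=> y0 y1; have [i hi] := mid_att y0.
have [j ji] : exists j : 'I_n.+2, j != i.
  by case: (eqVneq i ord0) => [->|h]; [exists ord_max|exists ord0; rewrite eq_sym].
exact: le_trans (hi j ji) (y1 j).
Qed.

Lemma le_mid y z : (forall i, 0 <= y i) -> (forall i, y i <= 1) -> (forall i, y i <= z i) -> mid y <= mid z.
Proof.
move=> y0 y1 yz; have [i hi] := mid_att y0; apply: (@mid_max z i); first exact: mid_le1.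
by move=> j ji; apply: le_trans (hi j ji) (yz j).
Qed.

Definition side y i : R := Num.max (y i) (mid y).

End CornerGeometry.

Section Weights.
Context {R : realType}.

Lemma powR_expR (x p : R) : 0 < x -> x `^ p = expR (p * ln x).
Proof. by move=> x0; rewrite /powR gt_eqF. Qed.

Lemma exprn_expR (x : R) k : 0 < x -> x ^+ k = expR (k%:R * ln x).
Proof. by move=> x0; rewrite expRM_natl lnK. Qed.

(** Logarithm of M^((k - gc)_+) (m/M)^((k_perp - ge)_+), where U = ln M, V0 = ln m and ge = 1 + de.
    Taking logarithms makes all weight comparisons linear in U and V0. *)
Definition wexp (U V0 de gc : R) (k kp : nat) : R :=
  pos_part (k%:R - gc) * U + pos_part (kp%:R - (1 + de)) * (V0 - U).

Lemma pos_part_ge0 (t : R) : 0 <= pos_part t.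
Proof. by rewrite /pos_part le_max lexx. Qed.

Lemma pos_part_nat_le k (g : R) : 0 <= g -> pos_part (k%:R - g) <= k%:R.
Proof. by move=> g0; rewrite /pos_part ge_max ler0n/= gerBl. Qed.

Lemma pos_part_id (t : R) : 0 <= t -> pos_part t = t.
Proof. by move=> t0; rewrite /pos_part max_r. Qed.

Lemma pos_part_0 (t : R) : t <= 0 -> pos_part t = 0.
Proof. by move=> t0; rewrite /pos_part max_l. Qed.

Lemma ler_pos_part (s t : R) : s <= t -> pos_part s <= pos_part t.
Proof. by move=> st; rewrite /pos_part ge_max !le_max lexx st orbT. Qed.

(** Half of U + V0 + V0 is the logarithm of the square root of the volume M m m. If k_perp >= 2 the
    two sides differ by (b - b_perp)(V0 - U) <= 0. If k_perp <= 1 the second positive part vanishes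
    and they differ by (b + a_perp - 1 - de)(V0 - U) <= 0. *)
Lemma wexp3_bound (U V0 de : R) (b a bp ap : nat) : V0 <= U -> U <= 0 -> 0 < de -> de <= 4^-1 ->
  (2 <= b)%N -> (bp <= b)%N -> (ap <= a)%N ->
  - wexp U V0 de (3 / 2 + de) (b + a) (bp + ap) <=
  2^-1 * (U + V0 + V0) + (de - b%:R) * V0 - ((a - ap)%:R * U + ap%:R * V0).
Proof.
move=> VU U0 d0 d4 b2 bpb apa; rewrite /wexp.
have kc : 0 <= (b + a)%:R - (3 / 2 + de).
  have : 2 <= (b + a)%:R :> R by rewrite ler_nat (leq_trans b2)// leq_addr.
  lra.
rewrite (pos_part_id kc) !natrD natrB//.
have hb : 2 <= b%:R :> R by rewrite ler_nat.
have hbp : bp%:R <= b%:R :> R by rewrite ler_nat.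
have hap : 0 <= ap%:R :> R by [].
have hbp0 : 0 <= bp%:R :> R by [].
case: (leqP 2 (bp + ap)%N) => h.
  have hk : 2 <= bp%:R + ap%:R :> R by rewrite -natrD ler_nat.
  rewrite pos_part_id; last by lra.
  nra.
have hk : bp%:R + ap%:R <= 1 :> R by rewrite -natrD (ler_nat R _ 1).
rewrite pos_part_0; last by lra.
nra.
Qed.

Lemma wexp_low (U V0 de gc : R) (k kp : nat) : V0 <= U -> U <= 0 -> 0 <= de -> 0 <= gc -> (kp <= k)%N ->
  - wexp U V0 de gc k kp <= - ((k - kp)%:R * U + kp%:R * V0).
Proof.
move=> VU U0 d0 g0 kpk; rewrite /wexp natrB// lerN2.
have h1 := pos_part_nat_le k g0.
have h2 : pos_part (kp%:R - (1 + de)) <= kp%:R by apply: pos_part_nat_le; lra.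
have : k%:R * U <= pos_part (k%:R - gc) * U by rewrite ler_wnM2r.
have : kp%:R * (V0 - U) <= pos_part (kp%:R - (1 + de)) * (V0 - U) by rewrite ler_wnM2r// subr_le0.
by rewrite mulrBl mulrBr; lra.
Qed.

Lemma wexp_le0 (U V0 de gc : R) (k kp : nat) : V0 <= U -> U <= 0 -> wexp U V0 de gc k kp <= 0.
Proof.
move=> VU U0; rewrite /wexp.
have h1 : pos_part (k%:R - gc) * U <= 0 by rewrite mulr_ge0_le0 ?pos_part_ge0.
have h2 : pos_part (kp%:R - (1 + de)) * (V0 - U) <= 0 by rewrite mulr_ge0_le0 ?pos_part_ge0// subr_le0.
lra.
Qed.

End Weights.

Section WeightBounds.
Context {R : realType}.

(** The square root of the product of the sides is the price of passing from an L^2 bound on a box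
    with these sides to a pointwise bound; what remains for |b| >= 2 is mid^(de - |b|). The second
    bound has no such gain but holds at every order. *)
Definition weight_bounds n (c : 'rV[R]_n.+2) (W : ('I_n.+2 -> nat) -> 'rV[R]_n.+2 -> R) (de : R) : Prop :=
  (forall x a b, cube x -> (2 <= mabs b)%N -> W (fun i => b i + a i)%N x <=
     Num.sqrt (\prod_i side (cdist c x) i) * mid (cdist c x) `^ (de - (mabs b)%:R) * \prod_i (side (cdist c x) i)^-1 ^+ a i) /\
  (forall x a, cube x -> W a x <= \prod_i (side (cdist c x) i)^-1 ^+ a i).

Lemma cdist01 n (c x : 'rV[R]_n.+2) i : is_corner c -> cube x -> 0 < cdist c x i < 1.
Proof.
move=> cc cx; have /andP[x0 x1] := cx i; rewrite /cdist; have [-> | ->] := cc i.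
  by rewrite subr0 gtr0_norm// x0.
by rewrite distrC gtr0_norm ?subr_gt0//; apply/andP; split; lra.
Qed.

(* [expR] form of M^-(k - gc)_+ (m/M)^-(k_perp - ge)_+, for M = y is the largest coordinate. *)
Definition weight n (c : 'rV[R]_n.+2) (gc de : R) (a : 'I_n.+2 -> nat) (x : 'rV[R]_n.+2) : R :=
  let y := cdist c x in let im := [arg max_(i > ord0) y i]%O in
  expR (- wexp (ln (y im)) (ln (mid y)) de gc (mabs a) (mabs a - a im)).

Lemma expR_prod (I : finType) (u : I -> R) : \prod_i expR (u i) = expR (\sum_i u i).
Proof. by rewrite (big_morph expR (@expRD R) (@expR0 R)). Qed.

Lemma prod_invX n (s : 'I_n -> R) (a : 'I_n -> nat) : (forall i, 0 < s i) ->
  \prod_i (s i)^-1 ^+ a i = expR (- \sum_i (a i)%:R * ln (s i)).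
Proof.
move=> s0; rewrite -sumrN -expR_prod; apply: eq_bigr => i _.
by rewrite exprn_expR ?invr_gt0// lnV ?posrE// mulrN.
Qed.

Lemma ord3_third (a b : 'I_3) : a != b -> exists k : 'I_3, [/\ k != a, k != b & forall i, i != k -> i = a \/ i = b].
Proof.
rewrite -val_eqE /= => ab; have := ltn_ord a; have := ltn_ord b => b3 a3.
have k3 : (3 - a - b < 3)%N by lia.
exists (Ordinal k3); split; rewrite -?val_eqE /=; try lia.
move=> i; rewrite -val_eqE /= => ik; have i3 := ltn_ord i.
have : (nat_of_ord i = a \/ nat_of_ord i = b)%N by lia.
by case=> h; [left|right]; apply: val_inj.
Qed.

Lemma ord2_other (a b i : 'I_2) : a != b -> i != b -> i = a.
Proof.
rewrite -!val_eqE /= => ab ib; apply: val_inj => /=.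
have := ltn_ord a; have := ltn_ord b; have := ltn_ord i; lia.
Qed.

Section OnePoint.
Variables (n : nat) (c x : 'rV[R]_n.+2).
Hypothesis cc : is_corner c.
Hypothesis cx : cube x.
Let y := cdist c x.
Let im : 'I_n.+2 := [arg max_(i > ord0) y i]%O.

Lemma cdist_max i : y i <= y im.
Proof. by rewrite /im; case: arg_maxP => // j _; apply. Qed.

Lemma cdist_gt0 i : 0 < y i. Proof. by have /andP[] := cdist01 i cc cx. Qed.
Lemma cdist_lt1 i : y i < 1. Proof. by have /andP[] := cdist01 i cc cx. Qed.

Lemma mid_cdist_gt0 : 0 < mid y. Proof. by apply: mid_gt0 => i; exact: cdist_gt0. Qed.

Lemma mid_le_max : mid y <= y im.
Proof.
have [i hi] := mid_att (fun i => ltW (cdist_gt0 i)).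
have [j ji] : exists j : 'I_n.+2, j != i.
  by case: (eqVneq i ord0) => [->|h]; [exists ord_max|exists ord0; rewrite eq_sym].
exact: le_trans (hi j ji) (cdist_max j).
Qed.

Lemma ln_mid_max : ln (mid y) <= ln (y im) /\ ln (y im) <= 0.
Proof.
split; first by rewrite ler_ln ?posrE ?cdist_gt0 ?mid_cdist_gt0// mid_le_max.
by apply: ln_le0; exact/ltW/cdist_lt1.
Qed.

Lemma side_gt0 i : 0 < side y i.
Proof. by rewrite lt_max cdist_gt0. Qed.

Hypothesis smid : forall i, i != im -> side y i = mid y.

Lemma side_max : side y im = y im.
Proof. by rewrite /side max_l// mid_le_max. Qed.

Lemma sum_ln_side (a : 'I_n.+2 -> nat) : \sum_i (a i)%:R * ln (side y i) =
  (mabs a - (mabs a - a im))%:R * ln (y im) + (mabs a - a im)%:R * ln (mid y).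
Proof.
have ai : (a im <= mabs a)%N by rewrite /mabs (bigD1 im)//= leq_addr.
rewrite subKn// (bigD1 im)//= side_max; congr (_ + _).
rewrite (eq_bigr (fun i => (a i)%:R * ln (mid y))); last by move=> i ii; rewrite smid.
by rewrite -mulr_suml -natr_sum; congr (_%:R * _); rewrite /mabs [in RHS](bigD1 im)//= addKn.
Qed.

Lemma prod_side : \prod_i side y i = expR (ln (y im) + n.+1%:R * ln (mid y)).
Proof.
rewrite (bigD1 im)//= side_max expRD lnK ?posrE ?cdist_gt0//; congr (_ * _).
rewrite (eq_bigr (fun=> mid y)); last by move=> i ii; rewrite smid.
by rewrite prodr_const -exprn_expR ?mid_cdist_gt0//; congr (_ ^+ _); rewrite cardC1 card_ord.
Qed.

Lemma weight_low gc de a : 0 <= gc -> 0 <= de -> weight c gc de a x <= \prod_i (side y i)^-1 ^+ a i.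
Proof.
move=> g0 d0; rewrite (prod_invX _ side_gt0) /weight ler_expR sum_ln_side.
by have [h1 h2] := ln_mid_max; apply: wexp_low => //; exact: leq_subr.
Qed.

(** Logarithms reduce the claim to its first hypothesis, an inequality between exponents; it is the
    only place where the dimension and the value of gamma_c enter. *)
Lemma weight_high gc de (a b : 'I_n.+2 -> nat) :
  (forall U V0, V0 <= U -> U <= 0 -> (n = 0%N -> U = V0) ->
   forall bp ap, (bp <= mabs b)%N -> (ap <= mabs a)%N ->
   - wexp U V0 de gc (mabs b + mabs a) (bp + ap) <=
   2^-1 * (U + n.+1%:R * V0) + (de - (mabs b)%:R) * V0 - ((mabs a - ap)%:R * U + ap%:R * V0)) ->
  (n = 0%N -> y im = mid y) ->
  weight c gc de (fun i => b i + a i)%N x <=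
     Num.sqrt (\prod_i side y i) * mid y `^ (de - (mabs b)%:R) * \prod_i (side y i)^-1 ^+ a i.
Proof.
move=> h n0; rewrite (prod_invX _ side_gt0) powR_expR ?mid_cdist_gt0// prod_side sum_ln_side.
have -> : Num.sqrt (expR (ln (y im) + n.+1%:R * ln (mid y))) = expR (2^-1 * (ln (y im) + n.+1%:R * ln (mid y))).
  set z := _ + _; rewrite -[X in expR X](_ : 2%:R * (2^-1 * z) = z); last by field.
  by rewrite expRM_natl sqrtr_sqr ger0_norm ?expR_ge0//; congr expR; field.
rewrite -!expRD /weight ler_expR.
have [h1 h2] := ln_mid_max.
have bi : (b im <= mabs b)%N by rewrite /mabs (bigD1 im)//= leq_addr.
have ai : (a im <= mabs a)%N by rewrite /mabs (bigD1 im)//= leq_addr.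
have -> : mabs (fun i => b i + a i)%N = (mabs b + mabs a)%N by rewrite /mabs big_split.
have -> : (mabs b + mabs a - (b im + a im) = (mabs b - b im) + (mabs a - a im))%N by lia.
by apply: h => //; [move=> e; congr ln; exact: n0|exact: leq_subr|exact: leq_subr].
Qed.

End OnePoint.

Lemma side2 (c x : 'rV[R]_2) (cc : is_corner c) (cx : cube x) :
  let y := cdist c x in let im := [arg max_(i > ord0) y i]%O in
  y im = mid y /\ forall i, i != im -> side y i = mid y.
Proof.
move=> y im; have ym : y im = mid y.
  apply/eqP; rewrite eq_le (mid_le_max cc cx) andbT.
  have [k kim] : exists k : 'I_2, im != k.
    by case: (eqVneq im ord0) => [->|h]; [exists ord_max|exists ord0].
  apply: (@mid_max _ _ y k); first exact/ltW/(cdist_lt1 cc cx).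
  by move=> j jk; rewrite (ord2_other kim jk).
split=> // i ii; rewrite /side max_r// -ym; exact: cdist_max.
Qed.

Lemma side3 (c x : 'rV[R]_3) (cc : is_corner c) (cx : cube x) :
  let y := cdist c x in let im := [arg max_(i > ord0) y i]%O in
  (forall i, i != im -> side y i = mid y) /\ exists2 j, j != im & mid y <= y j.
Proof.
move=> y im; split.
  move=> i ii; rewrite /side max_r//.
  have [k [k1 k2 hk]] := ord3_third ii.
  apply: (@mid_max _ _ y k); first exact/ltW/(cdist_lt1 cc cx).
  move=> j jk; have [-> //|->] := hk j jk; exact: cdist_max.
have [i hi] := mid_att (fun i => ltW (cdist_gt0 cc cx i)).
have [j [ji jm]] : exists j, j != i /\ j != im.
  case: (eqVneq i im) => [->|h]; last by have [k [k1 k2 _]] := ord3_third h; exists k.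
  by case: (eqVneq im ord0) => [->|h]; [exists ord_max|exists ord0; rewrite eq_sym].
by exists j => //; apply: hi.
Qed.

Lemma weight_bounds2 (c : 'rV[R]_2) de : is_corner c -> 0 < de <= 4^-1 -> weight_bounds c (weight c (1 + de) de) de.
Proof.
move=> cc /andP[d0 d4]; split=> [x a b cx b2|x a cx]; have [ym sm] := side2 cc cx.
  apply: weight_high => // U V0 _ _ /(_ erefl) -> bp ap hbp hap; rewrite /wexp subrr mulr0 addr0.
  have hb : 2 <= (mabs b)%:R :> R by rewrite ler_nat.
  have ha : 0 <= (mabs a)%:R :> R by [].
  rewrite natrD pos_part_id; last by lra.
  by rewrite natrB// le_eqVlt; apply/orP; left; apply/eqP; field.
by apply: weight_low => //; lra.
Qed.

Lemma weight_bounds3 (c : 'rV[R]_3) de : is_corner c -> 0 < de <= 4^-1 -> weight_bounds c (weight c (3 / 2 + de) de) de.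
Proof.
move=> cc /andP[d0 d4]; split=> [x a b cx b2|x a cx]; have [sm _] := side3 cc cx.
  apply: weight_high => // U V0 VU U0 _ bp ap hbp hap.
  apply: le_trans (wexp3_bound VU U0 d0 d4 b2 hbp hap) _.
  by rewrite le_eqVlt; apply/orP; left; apply/eqP; ring.
by apply: weight_low => //; lra.
Qed.

Section RegionWeights.
Variables (n : nat) (c x : 'rV[R]_n.+2) (E : finType) (edge : E -> set 'rV[R]_n.+2) (edir : E -> 'I_n.+2).
Hypothesis n2 : (n <= 2)%N.
Hypothesis cc : is_corner c.
Hypothesis cx : cube x.
Hypothesis edgeE : forall e x, cube x -> r_e edge e x = reE edir c e x.
Let y := cdist c x.
Let im : 'I_n.+2 := [arg max_(i > ord0) y i]%O.
Hypothesis im2 : E -> exists2 j, j != im & mid y <= y j.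

Let sqE i : (x 0 i - c 0 i) ^+ 2 = y i ^+ 2.
Proof. by rewrite /y /cdist real_normK ?num_real. Qed.

Lemma reE_ge e j : j != edir e -> y j <= reE edir c e x.
Proof.
move=> je; rewrite -[leLHS]ger0_norm ?(ltW (cdist_gt0 cc cx j))// -sqrtr_sqr ler_wsqrtr//.
rewrite (bigD1 j)//= sqE lerDl sumr_ge0// => i _; exact: sqr_ge0.
Qed.

Lemma rcE_ge j : y j <= rcE c x.
Proof.
rewrite -[leLHS]ger0_norm ?(ltW (cdist_gt0 cc cx j))// -sqrtr_sqr ler_wsqrtr//.
rewrite (bigD1 j)//= sqE lerDl sumr_ge0// => i _; exact: sqr_ge0.
Qed.

Lemma rcE_le : rcE c x <= 2 * y im.
Proof.
have y0 : 0 <= y im by exact: ltW (cdist_gt0 cc cx im).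
rewrite -[leRHS]ger0_norm ?mulr_ge0// -sqrtr_sqr ler_wsqrtr//.
apply: (@le_trans _ _ (\sum_(i < n.+2) y im ^+ 2)).
  apply: ler_sum => i _; rewrite sqE; apply: lerXn2r; rewrite ?nnegrE ?(ltW (cdist_gt0 cc cx _))//.
  exact: cdist_max.
rewrite sumr_const card_ord exprMn -[leLHS]mulr_natl ler_wpM2r ?sqr_ge0// -natrX ler_nat.
by rewrite (leq_trans (_ : _ <= 4)%N).
Qed.

(** Compares the weight in M and m with the one prescribed in each region, using M <= r_c <= 2 M and
    lower bounds of r_e by M or m. Lowering the exponents to g0 and 1 + de only makes the common
    weight smaller, as M and m/M are at most 1. *)
Lemma region_weight (eh gc de g0 : R) (ge : E -> R) (r : region E) (a : 'I_n.+2 -> nat) :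
  0 < eh <= 2^-1 -> 0 <= de -> 0 <= g0 -> g0 <= gc -> (forall e, 1 + de <= ge e) ->
  reg_set edge c eh r x -> 1 <= (2 / eh) ^+ mabs a * weight c g0 de a x * reg_wt edir c gc ge r a x.
Proof.
move=> /andP[eh0 eh2] d0 g00 gg gd hr.
have C00 : 0 < 2 / eh by rewrite divr_gt0.
set k := mabs a; set w := wexp (ln (y im)) (ln (mid y)) de g0 k (k - a im).
have Mgt : 0 < y im := cdist_gt0 cc cx im.
have mgt : 0 < mid y := mid_cdist_gt0 cc cx.
suff h : expR w <= (2 / eh) ^+ k * reg_wt edir c gc ge r a x.
  by rewrite /weight -/y -/im -/k -/w mulrAC expRN ler_pdivlMr ?expR_gt0// mul1r.
rewrite exprn_expR//; have [VU U0] := ln_mid_max cc cx.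
rewrite -/y -/im in VU U0; set U := ln (y im) in w VU U0 *; set V0 := ln (mid y) in w VU *.
have k0 : 0 <= k%:R :> R by [].
have lnC : ln 2 <= ln (2 / eh) by rewrite ler_ln ?posrE// ler_peMr// invf_ge1//; lra.
have ln2 : 0 <= ln (2 : R) by apply: ln_ge0; rewrite ler1n.
have w0 : w <= 0 by apply: wexp_le0.
pose p := pos_part (k%:R - gc); pose p' := pos_part (k%:R - g0).
have pp : p <= p' by apply: ler_pos_part; rewrite lerD2l lerN2.
have p0 : 0 <= p by exact: pos_part_ge0.
pose q e := pos_part ((mabs_perp edir e a)%:R - ge e).
have q0 e : 0 <= q e by exact: pos_part_ge0.
have qk e : q e <= k%:R.
  apply: (@le_trans _ _ (mabs_perp edir e a)%:R); last by rewrite ler_nat leq_subr.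
  by apply: pos_part_nat_le; apply: le_trans (gd e); lra.
pose q' := pos_part ((k - a im)%:R - (1 + de)).
have q'0 : 0 <= q' by exact: pos_part_ge0.
have qq e : edir e = im -> q e <= q'.
  by move=> ei; apply: ler_pos_part; rewrite /mabs_perp ei lerD2l lerN2.
have q'k : q' <= k%:R.
  apply: (@le_trans _ _ (k - a im)%:R); last by rewrite ler_nat leq_subr.
  by apply: pos_part_nat_le; lra.
have wE : w = p' * U + q' * (V0 - U) by [].
have rc0 : 0 < rcE c x by exact: (rcE_gt0 cc cx).
have lnrc : U <= ln (rcE c x) by rewrite ler_ln ?posrE//; exact: rcE_ge.
have pU : p' * U <= p * ln (rcE c x).
  apply: (@le_trans _ _ (p * U)); last by rewrite ler_wpM2l.
  by rewrite ler_wnM2r.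
have qV : q' * (V0 - U) <= 0 by rewrite mulr_ge0_le0// subr_le0.
case: r hr => [[]|[e []]] hr /=.
- rewrite mulr1 ler_expR (le_trans w0)// mulr_ge0//; lra.
- rewrite powR_expR// -expRD ler_expR -/p wE.
  have kl : 0 <= k%:R * ln (2 / eh) by rewrite mulr_ge0//; lra.
  lra.
- move: hr; rewrite /= /Om_e /= edgeE// r_cE => -[_ [re_lt rc_gt]].
  have re0 : 0 < reE edir c e x.
    have [j je] : exists j : 'I_n.+2, j != edir e.
      by case: (eqVneq (edir e) ord0) => [->|h]; [exists ord_max|exists ord0; rewrite eq_sym].
    by apply: lt_le_trans (reE_ge je); exact: cdist_gt0.
  (* In [Om_e] the corner is farther than eh, so M >= eh/2 and powers of M up to order k cost at
     most (2/eh)^k. *)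
  have lnU : - U <= ln (2 / eh).
    rewrite -lnV ?posrE// ler_ln ?posrE ?invr_gt0// -[leRHS]invrK lef_pV2 ?posrE ?invr_gt0// invf_div.
    rewrite ler_pdivrMr// mulrC; apply: le_trans rcE_le; exact: ltW.
  rewrite powR_expR// -expRD ler_expR -/(q e).
  have kU : - (k%:R * U) <= k%:R * ln (2 / eh) by rewrite -mulrN ler_wpM2l.
  case: (eqVneq (edir e) im) => ei; last first.
    have lnre : U <= ln (reE edir c e x) by rewrite ler_ln ?posrE//; apply: reE_ge; rewrite eq_sym.
    have : q e * U <= q e * ln (reE edir c e x) by rewrite ler_wpM2l.
    have : k%:R * U <= q e * U by rewrite ler_wnM2r.
    lra.
  have [j ji jm] := im2 e.
  have lnre : V0 <= ln (reE edir c e x).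
    by rewrite ler_ln ?posrE//; apply: le_trans jm _; apply: reE_ge; rewrite ei.
  have h1 : q e * V0 <= q e * ln (reE edir c e x) by rewrite ler_wpM2l.
  have V00 : V0 <= 0 by lra.
  have h2 : q' * V0 <= q e * V0 by rewrite ler_wnM2r// qq.
  have h3 : k%:R * U <= q' * U by rewrite ler_wnM2r.
  have h4 : p' * U <= 0 by rewrite mulr_ge0_le0// pos_part_ge0.
  by rewrite wE mulrBr; lra.
- move: hr; rewrite /= /Om_ce /= r_cE => -[_ [rc_lt]]; have [-> _] := rho_ceE eh cc edgeE e cx => re_lt.
  (* An edge seen under a small angle must point in the direction of the largest coordinate:
     otherwise r_e >= M >= r_c / 2 >= eh r_c. *)
  have ei : edir e = im.
    apply/eqP; apply: contraTT re_lt => ei; rewrite -leNgt.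
    apply: (@le_trans _ _ (y im)); last by apply: reE_ge; rewrite eq_sym.
    have := rcE_le; nra.
  have [j ji jm] := im2 e.
  have re_m : mid y <= reE edir c e x by apply: le_trans jm _; apply: reE_ge; rewrite ei.
  have re0 : 0 < reE edir c e x by exact: lt_le_trans re_m.
  rewrite !powR_expR ?divr_gt0// -!expRD ler_expR -/p -/(q e) lnM ?posrE ?invr_gt0// lnV ?posrE//.
  have l1 : V0 <= ln (reE edir c e x) by rewrite ler_ln ?posrE.
  have l2 : ln (rcE c x) <= ln 2 + U by rewrite -lnM ?posrE// ler_ln ?posrE ?mulr_gt0//; exact: rcE_le.
  have h1 : q e * (V0 - U - ln 2) <= q e * (ln (reE edir c e x) - ln (rcE c x)) by rewrite ler_wpM2l//; lra.
  have h2 : q' * (V0 - U) <= q e * (V0 - U) by rewrite ler_wnM2r ?subr_le0// qq.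
  have h3 : q e * ln 2 <= k%:R * ln 2 by rewrite ler_wpM2r.
  have h4 : k%:R * ln 2 <= k%:R * ln (2 / eh) by rewrite ler_wpM2l.
  by rewrite mulrBr in h1; rewrite wE; lra.
Qed.

End RegionWeights.

Lemma edges3E (c : 'rV[R]_3) e x : is_corner c -> cube x -> r_e (@edges3 R c) e x = reE edir3 c e x.
Proof.
move=> cc cx; pose z : 'rV[R]_3 := \row_j (if j == e then x 0 e else c 0 j).
have zE : edges3 c e z.
  split; first by rewrite mxE eqxx; have /andP[/ltW -> /ltW ->] := cx e.
  by move=> j /negPf je; rewrite mxE je.
have ez : eucl (x - z) = reE edir3 c e x.
  rewrite /eucl /reE; congr Num.sqrt; rewrite (bigD1 e)//= !mxE eqxx subrr expr0n add0r.
  by apply: eq_bigr => j /negPf je; rewrite !mxE je.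
have lb t : edges3 c e t -> reE edir3 c e x <= eucl (x - t).
  move=> [_ ht]; rewrite /eucl /reE ler_wsqrtr// [leRHS](bigD1 e)//= -[leLHS]add0r lerD ?sqr_ge0//.
  by apply: ler_sum => j je; rewrite !mxE ht.
apply/eqP; rewrite eq_le; apply/andP; split.
  rewrite -ez; apply: ge_inf; last by exists z.
  by exists (reE edir3 c e x) => _ [t ht <-]; exact: lb.
apply: lb_le_inf; first by exists (eucl (x - z)); exists z.
by move=> _ [t ht <-]; exact: lb.
Qed.

End WeightBounds.

(** * Pointwise regularity *)

Section Factorials.

Lemma fact_addn_le a b : ((a + b)`! <= 2 ^ (a + b) * a`! * b`!)%N.
Proof.
rewrite -(@bin_fact (a + b) a) ?leq_addr// addKn mulnA leq_mul2r leq_mul2r.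
apply/orP; right; apply/orP; right.
have ha : (a < (a + b).+1)%N by rewrite ltnS leq_addr.
rewrite -[X in (_ <= X ^ _)%N]/(1 + 1)%N expnDn (bigD1 (Ordinal ha))//=.
by rewrite !exp1n !muln1 leq_addr.
Qed.

Lemma fact_sum_le (I : Type) (s : seq I) (a : I -> nat) :
  ((\sum_(i <- s) a i)`! <= 2 ^ (size s * \sum_(i <- s) a i) * \prod_(i <- s) (a i)`!)%N.
Proof.
elim: s => [|i s IH]; first by rewrite !big_nil.
rewrite !big_cons /=; set S := \sum_(j <- s) _ in IH *; set Q := \prod_(j <- s) _ in IH *.
apply: leq_trans (fact_addn_le _ _) _.
apply: (@leq_trans (2 ^ (a i + S) * (a i)`! * (2 ^ (size s * S) * Q))%N).
  by rewrite leq_mul2l IH orbT.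
have he : (2 ^ (a i + S) * 2 ^ (size s * S) <= 2 ^ ((size s).+1 * (a i + S)))%N.
  by rewrite -expnD leq_pexp2l// mulSn leq_add2l leq_mul2l leq_addl orbT.
have -> : (2 ^ (a i + S) * (a i)`! * (2 ^ (size s * S) * Q) = 2 ^ (a i + S) * 2 ^ (size s * S) * ((a i)`! * Q))%N by rewrite mulnACA.
by rewrite leq_mul2r he orbT.
Qed.

End Factorials.

Section Regularity.
Context {R : realType} {d : measure_display} {P : measurableType d}.
Variables (mu : {measure set P -> \bar R}) (n : nat) (toV : P -> 'rV[R]_n.+2).
Hypothesis H : leb_like mu toV.
Local Notation V := 'rV[R]_n.+2.

(** Cauchy-Schwarz through the pointwise inequality |g| <= g^2/(2t) + t/2; t = b / sqrt(vol)
    balances the two terms after integration. *)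
Lemma L1_of_L2 (l r : 'I_n.+2 -> R) (g : P -> R) b : (forall i, l i < r i) -> 0 < b ->
  measurable_fun (toV @^-1` box l r) g ->
  (\int[mu]_(p in toV @^-1` box l r) (g p ^+ 2)%:E <= (b ^+ 2)%:E)%E ->
  mu.-integrable (toV @^-1` box l r) (EFin \o g) /\
  \int[mu]_(p in toV @^-1` box l r) `|g p| <= b * Num.sqrt (boxvol l r).
Proof.
move=> lr b0 mg hb; set B := toV @^-1` box l r; have mB : measurable B := meas_box H l r.
have v0 := boxvol_gt0 lr; set t := b / Num.sqrt (boxvol l r).
have sv0 : 0 < Num.sqrt (boxvol l r) by rewrite sqrtr_gt0.
have t0 : 0 < t by rewrite divr_gt0.
have ig2 : mu.-integrable B (EFin \o (fun p => g p ^+ 2)).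
  apply/integrableP; split; first by apply/measurable_EFinP; exact: measurable_funX.
  under eq_integral do rewrite /= ger0_norm ?sqr_ge0//.
  exact: le_lt_trans hb (ltry _).
have i1 : mu.-integrable B (EFin \o (fun p => g p ^+ 2 / (2 * t) + t / 2)).
  rewrite (_ : _ \o _ = (EFin \o (fun p => ((2 * t)^-1 * g p ^+ 2)%R)) \+ (EFin \o (fun=> (t / 2)%R)))%E; last first.
    by apply/funext => p /=; rewrite EFinD mulrC.
  apply: integrableD => //; first exact: (integrableZR H).
  by apply: (integrable_bounded H lr (C := t / 2)) => // p _; rewrite ger0_norm// divr_ge0// ltW.
have pw p : `|g p| <= g p ^+ 2 / (2 * t) + t / 2.
  have e : `|g p| ^+ 2 = g p ^+ 2 by rewrite real_normK ?num_real.
  rewrite -e -subr_ge0; set w := `|g p|.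
  have -> : w ^+ 2 / (2 * t) + t / 2 - w = (w - t) ^+ 2 / (2 * t) by field; rewrite gt_eqF.
  by rewrite divr_ge0 ?sqr_ge0// mulr_ge0// ltW.
have ig : mu.-integrable B (EFin \o g).
  apply: le_integrable i1 => //; first exact/measurable_EFinP.
  by move=> p _; rewrite /= lee_fin (le_trans (pw p))// ler_norm.
split=> //.
have h1 : \int[mu]_(p in B) `|g p| <= \int[mu]_(p in B) (g p ^+ 2 / (2 * t) + t / 2).
  by apply: le_Rintegral => //; exact: (integrable_norm ig).
apply: le_trans h1 _; rewrite RintegralD//; last 2 first.
- rewrite (_ : (fun p => _) = (fun p => (2 * t)^-1 * g p ^+ 2)); last by apply/funext => p; rewrite mulrC.
  exact: (integrableZR H).
- by apply: (integrable_bounded H lr (C := t / 2)) => // p _; rewrite ger0_norm// divr_ge0// ltW.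
rewrite Rintegral_cst// (measure_box H lr) /=.
under eq_Rintegral do rewrite mulrC.
rewrite RintegralZl//.
have h2 : \int[mu]_(p in B) (g p ^+ 2) <= b ^+ 2.
  rewrite /Rintegral -lee_fin fineK//; exact: integrable_fin_num.
apply: (@le_trans _ _ ((2 * t)^-1 * b ^+ 2 + t / 2 * boxvol l r)).
  by rewrite lerD2r ler_wpM2l// invr_ge0 mulr_ge0// ltW.
have ve : boxvol l r = Num.sqrt (boxvol l r) ^+ 2 by rewrite sqr_sqrtr// ltW.
rewrite [in leLHS]ve /t; move: (Num.sqrt _) sv0 => w w0.
by rewrite le_eqVlt; apply/orP; left; apply/eqP; field; rewrite !gt_eqF.
Qed.

Variables (c : V) (f : V -> R) (D : ('I_n.+2 -> nat) -> V -> R).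
Hypothesis cc : is_corner c.
Hypothesis wD : forall alpha, weak_deriv mu toV (@cube R n.+2) f alpha (D alpha).
Hypothesis fL2 : L2 mu toV (@cube R n.+2) f.

Local Notation ch := (chain f D).

Lemma osc_box l r (b : 'I_n.+2 -> nat) M th : (forall i, l i < r i) -> (forall i, 0 <= l i) -> (forall i, r i <= 1) ->
  0 <= M -> 0 <= th <= 384^-1 ->
  (forall a, mu.-integrable (toV @^-1` box l r) (EFin \o (ch (fun j => b j + a j)%N \o toV))) ->
  (forall a, (exists i, a i != 0%N) -> \int[mu]_(p in toV @^-1` box l r) `|ch (fun j => b j + a j)%N (toV p)| <=
     M * boxvol l r * \prod_i ((a i)`!%:R * (th / (r i - l i)) ^+ a i)) ->
  forall N, (0 < N)%N -> exists k : {ffun 'I_n.+2 -> 'I_N} -> R,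
  [/\ \sum_f `|k f| <= `|\int[mu]_(p in toV @^-1` box l r) ch b (toV p)| / boxvol l r + M * 2 ^+ n.+2,
    \forall p \ae mu, (toV @^-1` box l r) p -> `|ch b (toV p) - monomials toV l r k p| <= M * 2 ^+ n.+2 * 2^-1 ^+ N &
    forall i, \forall p \ae mu, (toV @^-1` box l r) p -> `|ch (inc b i) (toV p) - dmonomials toV l r k i p| <= M * (r i - l i)^-1 * 2 ^+ n.+2 * 2^-1 ^+ N].
Proof.
move=> lr l0 r1 M0 /andP[th0 th1] ig hM N N0.
have rel a i : parts_rel mu toV l r i (ch (fun j => b j + a j)%N \o toV) (ch (fun j => b j + inc a i j)%N \o toV).
  have -> : (fun j => b j + inc a i j)%N = inc (fun j => b j + a j)%N i.
    by apply/funext => j; rewrite /inc addnA.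
  exact: (chain_parts_rel wD).
have [k [k1 k2 k3]] := local_expansion H lr ig rel M0 th0 hM th1 N0.
have b0 : (fun j => b j + 0)%N = b by apply/funext => j; rewrite addn0.
exists k; split.
- by move: k1; rewrite /comp b0.
- by move: k2; rewrite /comp b0.
- by move=> i; have := k3 i; rewrite (_ : (fun j => b j + inc _ i j)%N = inc b i).
Qed.

Lemma osc_box1 l r (b : 'I_n.+2 -> nat) M th : (forall i, l i < r i) -> (forall i, 0 <= l i) -> (forall i, r i <= 1) ->
  0 <= M -> 0 <= th <= 384^-1 ->
  (forall a, mu.-integrable (toV @^-1` box l r) (EFin \o (ch (fun j => b j + a j)%N \o toV))) ->
  (forall a, (exists i, a i != 0%N) -> \int[mu]_(p in toV @^-1` box l r) `|ch (fun j => b j + a j)%N (toV p)| <=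
     M * boxvol l r * \prod_i ((a i)`!%:R * (th / (r i - l i)) ^+ a i)) ->
  exists k, `|k| <= `|\int[mu]_(p in toV @^-1` box l r) ch b (toV p)| / boxvol l r + M * 2 ^+ n.+2 /\
    \forall p \ae mu, (toV @^-1` box l r) p -> `|ch b (toV p) - k| <= M * 2 ^+ n.+2.
Proof.
move=> lr l0 r1 M0 th01 ig hM; have [k [k1 k2 _]] := osc_box lr l0 r1 M0 th01 ig hM (ltnSn 0).
pose f0 : {ffun 'I_n.+2 -> 'I_1} := [ffun=> ord0].
have p1 : xpredT =1 pred1 f0.
  by move=> g; apply/esym/eqP/ffunP => i; rewrite ffunE ord1.
exists (k f0); split; first by move: k1; rewrite (big_pred1 f0).
apply: filterS k2 => p + Bp => /(_ Bp); rewrite /monomials (big_pred1 f0)//.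
rewrite /polprod big1 ?mulr1; last by move=> i _; rewrite ffunE hornerE.
have h1 : 2^-1 <= 1 :> R by lra.
by move=> h; apply: le_trans h _; apply: ler_piMr => //; rewrite mulr_ge0 ?exprn_ge0.
Qed.

(* Boxes given by the distances to the faces through the corner. *)
Definition xl (u v : 'I_n.+2 -> R) (i : 'I_n.+2) : R := if c 0 i == 0 then u i else 1 - v i.
Definition xr (u v : 'I_n.+2 -> R) (i : 'I_n.+2) : R := if c 0 i == 0 then v i else 1 - u i.

Lemma xr_xl u v i : xr u v i - xl u v i = v i - u i.
Proof. by rewrite /xr /xl; case: eqP => // _; ring. Qed.

Lemma c1_of i : c 0 i != 0 -> c 0 i = 1.
Proof. by have [-> | ->] := cc i; rewrite ?eqxx. Qed.

Lemma ybox_in u v x : (forall i, 0 <= u i) -> (forall i, v i <= 1) -> box (xl u v) (xr u v) x ->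
  cube x /\ forall i, u i < cdist c x i < v i.
Proof.
move=> u0 v1 hx.
have h i : 0 < x 0 i < 1 /\ u i < cdist c x i < v i.
  have := hx i; have := u0 i; have := v1 i; rewrite /xl /xr /cdist; case: eqP => [->|/eqP /c1_of ->] vi ui /andP[h1 h2].
    rewrite subr0 gtr0_norm ?h1 ?h2; last by apply: le_lt_trans h1.
    by rewrite (le_lt_trans ui h1) (lt_le_trans h2 vi).
  rewrite distrC gtr0_norm; last by lra.
  by split; apply/andP; split; lra.
by split=> i; have [] := h i.
Qed.

Lemma in_ybox u v x : cube x -> (forall i, u i < cdist c x i < v i) -> box (xl u v) (xr u v) x.
Proof.
move=> cx h i; have := h i; have /andP[x0 x1] := cx i; rewrite /xl /xr /cdist; case: eqP => [->|/eqP /c1_of ->].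
  by rewrite subr0 gtr0_norm.
by rewrite distrC gtr0_norm ?subr_gt0// => /andP[h1 h2]; apply/andP; split; lra.
Qed.

Lemma xl_ge0 u v i : (forall i, 0 <= u i) -> (forall i, v i <= 1) -> 0 <= xl u v i.
Proof. by move=> u0 v1; rewrite /xl; case: eqP => // _; rewrite subr_ge0. Qed.

Lemma xr_le1 u v i : (forall i, 0 <= u i) -> (forall i, v i <= 1) -> xr u v i <= 1.
Proof. by move=> u0 v1; rewrite /xr; case: eqP => // _; rewrite gerBl. Qed.

Lemma xl_lt_xr u v i : (forall i, u i < v i) -> xl u v i < xr u v i.
Proof. by move=> uv; rewrite -subr_gt0 xr_xl subr_gt0. Qed.

Lemma ybox_vol u v : boxvol (xl u v) (xr u v) = \prod_i (v i - u i).
Proof. by apply: eq_bigr => i _; rewrite xr_xl. Qed.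

(* The box of sides [h] whose near corner is [q], pushed back into the cube. *)
Definition anchor (q h : 'I_n.+2 -> R) (i : 'I_n.+2) : R := Num.min (q i) (1 - h i).

Definition abox (q h : 'I_n.+2 -> R) : set V :=
  box (xl (anchor q h) (fun i => anchor q h i + h i)) (xr (anchor q h) (fun i => anchor q h i + h i)).

Lemma abox_in q h x : (forall i, 0 < q i) -> (forall i, h i <= 2^-1) -> (forall i, q i < 1) -> abox q h x ->
  cube x /\ forall i, [/\ q i / 2 <= cdist c x i, cdist c x i <= q i + h i & anchor q h i < cdist c x i].
Proof.
move=> q0 h2 q1 hx.
have u0 i : 0 <= anchor q h i.
  by rewrite /anchor le_min; have := q0 i; have := h2 i => *; apply/andP; split; lra.
have v1 i : anchor q h i + h i <= 1.
  have : anchor q h i <= 1 - h i by rewrite /anchor ge_min lexx orbT.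
  lra.
have [cx hh] := ybox_in u0 v1 hx; split=> // i; have /andP[h1' h3] := hh i; split=> //.
  apply: ltW; apply: le_lt_trans h1'; rewrite /anchor le_min; have := q0 i; have := h2 i; have := q1 i => *.
  by apply/andP; split; lra.
have : anchor q h i <= q i by rewrite /anchor ge_min lexx.
lra.
Qed.

End Regularity.

(** * Pointwise bounds for derivatives of order at least two *)

Section Regularity2.
Context {R : realType} {d : measure_display} {P : measurableType d}.
Variables (mu : {measure set P -> \bar R}) (n : nat) (toV : P -> 'rV[R]_n.+2).
Hypothesis H : leb_like mu toV.
Local Notation V := 'rV[R]_n.+2.
Variables (c : V) (f : V -> R) (D : ('I_n.+2 -> nat) -> V -> R).
Hypothesis cc : is_corner c.
Hypothesis wD : forall alpha, weak_deriv mu toV (@cube R n.+2) f alpha (D alpha).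
Hypothesis fL2 : L2 mu toV (@cube R n.+2) f.
Variables (W : ('I_n.+2 -> nat) -> V -> R) (K A de : R).
Hypothesis K0 : 0 < K.
Hypothesis A1 : 1 <= A.
Hypothesis de01 : 0 < de <= 4^-1.
Hypothesis HW : weight_bounds c W de.
Hypothesis HL2 : forall l r a w, (forall i, l i < r i) -> (forall i, 0 <= l i) -> (forall i, r i <= 1) -> 0 <= w ->
  (forall x, box l r x -> W a x <= w) ->
  (\int[mu]_(p in toV @^-1` box l r) (D a (toV p) ^+ 2)%:E <= ((K * A ^+ mabs a * (mabs a)`!%:R * w) ^+ 2)%:E)%E.

Local Notation ch := (chain f D).
Local Notation y := (cdist c).

(** The anchor q lies slightly closer to the corner than x: no coordinate is halved, and the gap is
    so small that a box anchored at q with sides at least ka mid q contains x. *)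
Definition near_pt (ka : R) (q : 'I_n.+2 -> R) (x : V) : Prop :=
  cube x /\ forall i, Num.max (y x i / 2) (y x i - ka * mid (y x) / 8) < q i < y x i.

(** Bounds hold almost everywhere on each box, with an exceptional set depending on the box. Anchors
    with rational coordinates suffice to reach every point, and there are countably many of them. *)
Lemma near_cover ka (Q : V -> Prop) : 0 < ka ->
  (forall q, (forall i, 0 < q i < 1) -> \forall p \ae mu, near_pt ka q (toV p) -> Q (toV p)) ->
  \forall p \ae mu, cube (toV p) -> Q (toV p).
Proof.
move=> ka0 hQ; pose qq (k : nat) (i : 'I_n.+2) : R :=
  if unpickle k is Some g then ratr ((g : {ffun 'I_n.+2 -> rat}) i) else 0.
have hk k : \forall p \ae mu, (forall i, 0 < qq k i < 1) -> near_pt ka (qq k) (toV p) -> Q (toV p).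
  have [h|h] := pselect (forall i, 0 < qq k i < 1); last by apply: aeW => p /h.
  by apply: filterS (hQ _ h) => p hp _.
have := ae_foralln hk; apply: filterS => p hp cp.
have ex i : exists q : rat, Num.max (y (toV p) i / 2) (y (toV p) i - ka * mid (y (toV p)) / 8) < ratr q < y (toV p) i.
  have lt : Num.max (y (toV p) i / 2) (y (toV p) i - ka * mid (y (toV p)) / 8) < y (toV p) i.
    rewrite gt_max; apply/andP; split.
      by rewrite ltr_pdivrMr// ltr_pMr ?ltr1n// (cdist_gt0 cc cp).
    by rewrite ltrBlDr ltrDl divr_gt0// mulr_gt0// mid_cdist_gt0.
  have [q] := rat_in_itvoo lt; rewrite in_itv/= => hq.
  by exists q.
have [g hg] := choice ex; pose g' : {ffun 'I_n.+2 -> rat} := [ffun i => g i].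
have e : qq (pickle g') = fun i => ratr (g i).
  by apply/funext => i; rewrite /qq pickleK ffunE.
apply: (hp (pickle g')); rewrite e; last by split.
move=> i; have /andP[h1 h2] := hg i; apply/andP; split.
  apply: le_lt_trans h1; rewrite le_max; apply/orP; left.
  by rewrite divr_ge0// ltW// (cdist_gt0 cc cp).
by apply: lt_trans h2 _; exact: (cdist_lt1 cc cp).
Qed.

Lemma near_mid ka q x : 0 <= ka -> near_pt ka q x -> (1 - ka / 8) * mid (y x) <= mid q.
Proof.
move=> ka0 [cx hx]; have m0 := mid_cdist_gt0 cc cx.
have [i hi] := mid_att (fun i => ltW (cdist_gt0 cc cx i)).
have m1 : mid (y x) <= 1 by apply: mid_le1 => j; apply: ltW; [exact: cdist_gt0|exact: cdist_lt1].
have km0 : 0 <= ka * mid (y x) by rewrite mulr_ge0// ltW.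
apply: (@mid_max _ _ q i); first by lra.
move=> j /hi hj; have /andP[+ _] := hx j; rewrite gt_max => /andP[_ /ltW].
by apply: le_trans; lra.
Qed.

Lemma near_mid2 ka q x : 0 <= ka <= 1 -> near_pt ka q x -> mid (y x) / 2 <= mid q.
Proof.
move=> /andP[ka0 ka1] h; apply: le_trans (near_mid ka0 h).
have [cx _] := h; have m0 := mid_cdist_gt0 cc cx.
by rewrite mulrC ler_wpM2r ?ltW//; lra.
Qed.

Lemma near_abox ka q h x : 0 < ka <= 1 -> near_pt ka q x -> (forall i, ka * mid q <= h i <= 2^-1) -> abox c q h x.
Proof.
move=> /andP[ka0 ka1] hx hh; have [cx hq] := hx.
have m2 : mid (y x) / 2 <= mid q by apply: near_mid2 hx; rewrite ltW.
have m0 := mid_cdist_gt0 cc cx.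
have kk : ka * (mid (y x) / 2) <= ka * mid q by rewrite ler_pM2l.
have km0 : 0 < ka * mid (y x) by rewrite mulr_gt0.
apply: in_ybox => // i; have /andP[+ h2] := hq i; rewrite gt_max => /andP[_ h1].
have := cdist_lt1 cc cx i; have /andP[h3 h4] := hh i => y1.
rewrite /anchor; apply/andP; split; first by apply: le_lt_trans h2; rewrite ge_min lexx.
by rewrite -ltrBlDr lt_min; apply/andP; split; lra.
Qed.

Lemma mid_half (q z : 'I_n.+2 -> R) : (forall i, 0 < q i < 1) -> (forall i, q i / 2 <= z i) -> mid q / 2 <= mid z.
Proof.
move=> q01 qz; have q0 i : 0 <= q i by have /andP[/ltW] := q01 i.
have [i hi] := mid_att q0.
have m1 : mid q <= 1 by apply: mid_le1 => // j; have /andP[_ /ltW] := q01 j.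
have mm : 0 < mid q by apply: mid_gt0 => j; have /andP[] := q01 j.
apply: (@mid_max _ _ z i); first by lra.
by move=> j /hi hj; apply: le_trans (qz j); rewrite ler_wpM2r.
Qed.

Lemma ex_le_mid (q : 'I_n.+2 -> R) (k : 'I_n.+2) : (forall i, 0 < q i < 1) -> exists2 j, j != k & q j <= mid q.
Proof.
move=> q01; apply: contrapT => hn.
have hq j : j != k -> mid q < q j.
  by move=> jk; rewrite ltNge; apply/negP => h; apply: hn; exists j.
have : mid q < \big[Num.min/1]_(j | j != k) q j.
  apply/bigmin_gtP; split=> //.
  have [j jk] : exists j : 'I_n.+2, j != k.
    by case: (eqVneq k ord0) => [->|h]; [exists ord_max|exists ord0; rewrite eq_sym].
  by apply: lt_trans (hq j jk) _; have /andP[] := q01 j.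
apply/negP; rewrite -leNgt /mid.
exact: (@le_bigmax_cond _ _ _ 0 k xpredT (fun i => \big[Num.min/1]_(j | j != i) q j)).
Qed.

Lemma mid_double (q z : 'I_n.+2 -> R) : (forall i, 0 < q i < 1) -> (forall i, z i <= 2 * side q i) -> mid z <= 2 * mid q.
Proof.
move=> q01 zq; have m0 : 0 < mid q by apply: mid_gt0 => j; have /andP[] := q01 j.
rewrite {1}/mid; apply/bigmax_leP; split; first by rewrite mulr_ge0// ltW.
move=> k _; have [j jk hj] := ex_le_mid k q01.
apply: (@le_trans _ _ (z j)); first exact: bigmin_le_cond.
apply: le_trans (zq j) _.
by rewrite ler_pM2l// /side max_r.
Qed.

Lemma powR_half (m m' : R) b : 0 < m -> m / 2 <= m' -> (0 < b)%N -> m' `^ (de - b%:R) <= 2 ^+ b * m `^ (de - b%:R).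
Proof.
move=> m0 hm b0; have /andP[d0 d1] := de01.
have b1 : 1 <= b%:R :> R by rewrite ler1n.
have m20 : 0 < m / 2 by rewrite divr_gt0.
have m'0 : 0 < m' := lt_le_trans m20 hm.
have e : forall t : R, 0 < t -> t `^ (de - b%:R) = (t^-1) `^ (b%:R - de).
  by move=> t t0; rewrite !powR_expR ?invr_gt0// lnV ?posrE//; congr expR; ring.
rewrite !e// -(powR_mulrn b (ler0n _ 2)).
apply: (@le_trans _ _ ((m / 2)^-1 `^ (b%:R - de))).
  apply: ge0_ler_powR; rewrite ?nnegrE ?invr_ge0 ?(ltW m'0) ?(ltW m20)//; first by lra.
  by rewrite lef_pV2.
rewrite invf_div powRM ?invr_ge0 ?(ltW m0)// ler_wpM2r ?powR_ge0//.
by rewrite ler_powR ?ler1n//; lra.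
Qed.

(** The factorial of the total order splits into a product of factorials at an exponential cost,
    which is absorbed into the base A. *)
Lemma fact_mult_le (a : 'I_n.+2 -> nat) b :
  A ^+ (b + mabs a) * (b + mabs a)`!%:R <= (2 * A) ^+ b * b`!%:R * \prod_i ((a i)`!%:R * (2 ^+ n.+3 * A) ^+ a i).
Proof.
have A0 : 0 <= A by apply: le_trans A1.
have h : ((b + mabs a)`! <= 2 ^ (b + mabs a) * b`! * (2 ^ (n.+2 * mabs a) * \prod_i (a i)`!))%N.
  apply: leq_trans (fact_addn_le _ _) _; rewrite leq_mul2l; apply/orP; right.
  have := fact_sum_le (index_enum 'I_n.+2) a.
  by rewrite (_ : size _ = n.+2)// -sum1_size sum1_card card_ord.
apply: (@le_trans _ _ (A ^+ (b + mabs a) * (2 ^+ (b + mabs a) * b`!%:R * (2 ^+ (n.+2 * mabs a) * \prod_i (a i)`!%:R)))).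
  rewrite ler_wpM2l ?exprn_ge0//.
  by rewrite -natr_prod -!natrX -!natrM ler_nat.
rewrite le_eqVlt; apply/orP; left; apply/eqP.
have e : (2 ^+ n.+3 * A) ^+ mabs a = \prod_i (2 ^+ n.+3 * A) ^+ a i :> R by rewrite /mabs expr_sum.
rewrite big_split/= -e (exprMn b 2 A) (exprMn (mabs a) (2 ^+ n.+3) A) -(exprM 2 n.+3) (exprD A) (exprD 2).
rewrite (_ : (2 : R) ^+ (n.+3 * mabs a) = 2 ^+ mabs a * 2 ^+ (n.+2 * mabs a)); last by rewrite -exprD -mulSn.
by move: (2 ^+ (n.+2 * mabs a)) (\prod_(i < n.+2) _) => u v; ring.
Qed.

Lemma meas_chain a : measurable_fun (toV @^-1` (@cube R n.+2)) (ch a \o toV).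
Proof.
rewrite /chain; case: ifP => _; first by have [] := fL2.
by have [_ [+ _] _] := wD a.
Qed.

Lemma box_sub_cube l r : (forall i, 0 <= l i) -> (forall i, r i <= 1) -> box l r `<=` (@cube R n.+2).
Proof.
move=> l0 r1 x bx i; have /andP[h1 h2] := bx i.
by rewrite (le_lt_trans (l0 i) h1) (lt_le_trans h2 (r1 i)).
Qed.

Lemma meas_chain_box l r a : (forall i, 0 <= l i) -> (forall i, r i <= 1) ->
  measurable_fun (toV @^-1` box l r) (ch a \o toV).
Proof.
move=> l0 r1; apply: measurable_funS (meas_chain a); first exact: (measurable_cube H).
by move=> p; exact: box_sub_cube.
Qed.

Lemma L1_weight l r a w : (forall i, l i < r i) -> (forall i, 0 <= l i) -> (forall i, r i <= 1) -> 0 < w ->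
  (forall x, box l r x -> W a x <= w) -> mabs a != 0%N ->
  mu.-integrable (toV @^-1` box l r) (EFin \o (ch a \o toV)) /\
  \int[mu]_(p in toV @^-1` box l r) `|ch a (toV p)| <= K * A ^+ mabs a * (mabs a)`!%:R * w * Num.sqrt (boxvol l r).
Proof.
move=> lr l0 r1 w0 Ww a0; have A0 : 0 < A by apply: lt_le_trans A1.
apply: (L1_of_L2 H lr); first by rewrite !mulr_gt0 ?exprn_gt0// ltr0n fact_gt0.
  exact: meas_chain_box.
rewrite (_ : ch a = D a); first exact: HL2 (ltW w0) Ww.
rewrite /chain; case: ifP => // /forallP h; case/negP: a0; rewrite /mabs sum_nat_eq0.
by apply/forallP => i; apply/implyP => _; exact: h.
Qed.

Lemma osc_sup l r (b : 'I_n.+2 -> nat) M th m : (forall i, l i < r i) -> (forall i, 0 <= l i) -> (forall i, r i <= 1) ->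
  0 <= M -> 0 <= th <= 384^-1 ->
  (forall a, mu.-integrable (toV @^-1` box l r) (EFin \o (ch (fun j => b j + a j)%N \o toV))) ->
  (forall a, (exists i, a i != 0%N) -> \int[mu]_(p in toV @^-1` box l r) `|ch (fun j => b j + a j)%N (toV p)| <=
     M * boxvol l r * \prod_i ((a i)`!%:R * (th / (r i - l i)) ^+ a i)) ->
  `|\int[mu]_(p in toV @^-1` box l r) ch b (toV p)| <= m * boxvol l r ->
  \forall p \ae mu, (toV @^-1` box l r) p -> `|ch b (toV p)| <= m + M * 2 ^+ n.+3.
Proof.
move=> lr l0 r1 M0 th01 ig hM hm; have [k [k1 k2]] := osc_box1 H wD lr l0 r1 M0 th01 ig hM.
have v0 := boxvol_gt0 lr.
have hk : `|k| <= m + M * 2 ^+ n.+2 by apply: le_trans k1 _; rewrite lerD2r ler_pdivrMr.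
apply: filterS k2 => p hp /hp h; have := ler_normD (ch b (toV p) - k) k; rewrite subrK => h'.
apply: le_trans h' _; rewrite (exprS _ n.+2).
have -> : m + M * (2 * 2 ^+ n.+2) = M * 2 ^+ n.+2 + (m + M * 2 ^+ n.+2) by ring.
exact: lerD.
Qed.

Lemma boxvol_scaled (q h : 'I_n.+2 -> R) :
  boxvol (xl c (anchor q h) (fun i => anchor q h i + h i)) (xr c (anchor q h) (fun i => anchor q h i + h i)) = \prod_i h i.
Proof. by rewrite ybox_vol; apply: eq_bigr => i _; ring. Qed.

Section Abox.
Variables (q h : 'I_n.+2 -> R).
Hypothesis q01 : forall i, 0 < q i < 1.
Hypothesis h01 : forall i, 0 < h i <= 2^-1.

Local Notation l := (xl c (anchor q h) (fun i => anchor q h i + h i)).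
Local Notation r := (xr c (anchor q h) (fun i => anchor q h i + h i)).

Lemma anchor_ge0 i : 0 <= anchor q h i.
Proof. by rewrite le_min; have /andP[? ?] := q01 i; have /andP[? ?] := h01 i; apply/andP; split; lra. Qed.

Lemma anchor_le1 i : anchor q h i + h i <= 1.
Proof. by rewrite -lerBrDr ge_min lexx orbT. Qed.

Lemma abox_l0 i : 0 <= l i. Proof. by apply: xl_ge0; [exact: anchor_ge0|exact: anchor_le1]. Qed.
Lemma abox_r1 i : r i <= 1. Proof. by apply: xr_le1; [exact: anchor_ge0|exact: anchor_le1]. Qed.
Lemma abox_lr i : l i < r i.
Proof. by apply: xl_lt_xr => j; rewrite ltrDl; have /andP[] := h01 j. Qed.
Lemma abox_size i : r i - l i = h i. Proof. by rewrite xr_xl; ring. Qed.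

Lemma abox_near x : box l r x -> cube x /\ forall i, [/\ q i / 2 <= y x i, y x i <= q i + h i & anchor q h i < y x i].
Proof.
by apply: (abox_in cc) => i; [have /andP[] := q01 i|have /andP[] := h01 i|have /andP[] := q01 i].
Qed.

End Abox.

Lemma theta_ex : exists th : R, [/\ 0 < th, th <= 384^-1 & th <= 1].
Proof.
exists (384^-1); split; [by rewrite invr_gt0 ltr0n|exact: lexx|].
by rewrite invf_le1 ?ltr0n// ler1n.
Qed.

(** On a box with sides ka max(q_i, mid q), the square root of the product of the sides in
    [weight_bounds] and the square root of the volume from [L1_of_L2] combine into the volume. The
    mean of the derivative is thus of order mid^(de - |b|), and its oscillation is controlled in the
    same way by the derivatives above it. *)
Lemma high_order : exists K1 A1', [/\ 0 < K1, 1 <= A1' & forall b, (2 <= mabs b)%N ->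
  \forall p \ae mu, cube (toV p) -> `|ch b (toV p)| <= K1 * A1' ^+ mabs b * (mabs b)`!%:R * mid (y (toV p)) `^ (de - (mabs b)%:R)].
Proof.
have A0 : 0 < A by apply: lt_le_trans A1.
have A8 : 1 <= 8 * A by rewrite mulr_ege1// ler1n.
have [th [th0 thE th1]] := theta_ex.
(* With sides h_i = ka side_i, the growth (2^(n+3) A)^|a| of the constants together with (2 /
   side_i)^(a_i) becomes exactly (th / h_i)^(a_i). *)
pose ka : R := th / (2 ^+ n.+3 * A * 2).
have e0 : 0 < 2 ^+ n.+3 * A * 2 by apply: mulr_gt0 => //; apply: mulr_gt0 => //; apply: exprn_gt0.
have ka0 : 0 < ka by apply: divr_gt0.
have ka2 : ka <= 2^-1.
  rewrite /ka ler_pdivrMr//.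
  have h1 : 1 <= 2 ^+ n.+3 * A by rewrite mulr_ege1// exprn_ege1// ler1n.
  lra.
(* Sides taken at points of the box are at most twice those at q, while the volume is ka^(n+2) times
   the product of the latter; S is the square root of the ratio. *)
pose S := Num.sqrt ((2 / ka) ^+ n.+2).
have S0 : 0 < S by rewrite sqrtr_gt0 exprn_gt0// divr_gt0.
pose C := K * S * (1 + 2 ^+ n.+3).
have C0 : 0 < C.
  by apply: mulr_gt0; [exact: mulr_gt0|apply: addr_gt0 => //; apply: exprn_gt0].
exists C, (8 * A); split => //.
move=> b b2; set bb := mabs b in b2 *.
apply: (@near_cover ka (fun x => `|ch b x| <= C * (8 * A) ^+ bb * bb`!%:R * mid (y x) `^ (de - bb%:R)) ka0) => q q01.
have m0 : 0 < mid q by apply: mid_gt0 => i; have /andP[] := q01 i.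
have s0 i : 0 < side q i by rewrite lt_max m0 orbT.
have m1 : mid q <= 1 by apply: mid_le1 => i; have /andP[/ltW ? /ltW ?] := q01 i.
have s1 i : side q i <= 1 by rewrite ge_max m1 andbT; have /andP[_ /ltW] := q01 i.
pose h i := ka * side q i.
have h01 i : 0 < h i <= 2^-1.
  rewrite mulr_gt0//=; apply: le_trans ka2; rewrite ler_piMr// ltW//.
set l := xl c (anchor q h) (fun i => anchor q h i + h i); set r := xr c (anchor q h) (fun i => anchor q h i + h i).
have lr : forall i, l i < r i := abox_lr q h01; have l0 := abox_l0 q01 h01; have r1 := abox_r1 q01 h01.
have rl i : r i - l i = h i by exact: abox_size.
have vE : boxvol l r = ka ^+ n.+2 * \prod_i side q i.
  by rewrite /l /r boxvol_scaled big_split/= prodr_const cardT size_enum_ord.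
have v0 := boxvol_gt0 lr.
set G := mid q `^ (de - bb%:R).
have G0 : 0 < G by rewrite powR_gt0.
have hbox x : box l r x -> cube x /\ [/\ mid q / 2 <= mid (y x) & forall i, side q i / 2 <= side (y x) i <= 2 * side q i].
  move=> /(abox_near q01 h01)[cx hx]; split=> //.
  have mh : mid q / 2 <= mid (y x) by apply: mid_half => // i; have [] := hx i.
  have yz i : y x i <= 2 * side q i.
    have [_ + _] := hx i; have : q i <= side q i by rewrite le_max lexx.
    have : h i <= side q i by rewrite ler_piMl// ?ltW//; lra.
    lra.
  have md : mid (y x) <= 2 * mid q by exact: mid_double.
  split=> // i; apply/andP; split.
    rewrite {1}/side maxr_pMl//.
    by rewrite ge_max !le_max mh orbT andbT; have [-> _ _] := hx i.
  rewrite ge_max yz/=; apply: le_trans md _; rewrite ler_pM2l// le_max lexx orbT//.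
pose w (a : 'I_n.+2 -> nat) := S * Num.sqrt (boxvol l r) * (2 ^+ bb * G) * \prod_i (2 / side q i) ^+ a i.
have pa0 (a : 'I_n.+2 -> nat) : 0 < \prod_i (2 / side q i) ^+ a i.
  by apply: prodr_gt0 => i _; rewrite exprn_gt0// divr_gt0.
have sv0 : 0 < Num.sqrt (boxvol l r) by rewrite sqrtr_gt0.
have t0 : 0 < 2 ^+ bb :> R by exact: exprn_gt0.
have w0 a : 0 < w a by apply: mulr_gt0 => //; apply: mulr_gt0; [exact: mulr_gt0|exact: mulr_gt0].
have Ww a x : box l r x -> W (fun i => b i + a i)%N x <= w a.
  move=> /hbox[cx [mh sh]]; apply: le_trans (HW.1 x a b cx b2) _.
  have sx0 i : 0 < side (y x) i by exact: side_gt0.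
  rewrite /w; apply: ler_pM; rewrite ?mulr_ge0 ?sqrtr_ge0 ?powR_ge0//.
  - by apply: prodr_ge0 => i _; rewrite exprn_ge0// invr_ge0 ltW.
  - apply: ler_pM; rewrite ?sqrtr_ge0 ?powR_ge0//.
      have p0 : 0 <= (2 / ka) ^+ n.+2 by rewrite exprn_ge0// divr_ge0// ltW.
      rewrite /S -(sqrtrM _ p0); apply: ler_wsqrtr; rewrite vE mulrA -exprMn divfK ?gt_eqF//.
      have -> : 2 ^+ n.+2 * \prod_i side q i = \prod_i (2 * side q i) by rewrite big_split/= prodr_const cardT size_enum_ord.
      by apply: ler_prod => i _; have /andP[_ ->] := sh i; rewrite ltW.
    by apply: powR_half => //; exact: leq_trans b2.
  - apply: ler_prod => i _; rewrite exprn_ge0 ?invr_ge0 ?(ltW (sx0 i))//=.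
    apply: lerXn2r; rewrite ?nnegrE ?invr_ge0 ?divr_ge0 ?(ltW (sx0 i)) ?(ltW (s0 i))//.
    by rewrite -invf_div lef_pV2 ?posrE ?divr_gt0//; have /andP[] := sh i.
have mb0 a : mabs (fun i => b i + a i)%N = (bb + mabs a)%N by rewrite /mabs big_split.
pose M := K * S * (4 * A) ^+ bb * bb`!%:R * G.
have M0 : 0 <= M by rewrite !mulr_ge0 ?exprn_ge0 ?mulr_ge0// ltW.
have th01 : 0 <= th <= 384^-1 by rewrite thE (ltW th0).
have hL a : mu.-integrable (toV @^-1` box l r) (EFin \o (ch (fun j => b j + a j)%N \o toV)) /\
  \int[mu]_(p in toV @^-1` box l r) `|ch (fun j => b j + a j)%N (toV p)| <=
    M * boxvol l r * \prod_i ((a i)`!%:R * (th / (r i - l i)) ^+ a i).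
  have nz : mabs (fun i => b i + a i)%N != 0%N by rewrite mb0 -lt0n (leq_trans _ (leq_addr _ _))// (leq_trans _ b2).
  have [i1 i2] := L1_weight lr l0 r1 (w0 a) (Ww a) nz; split=> //; apply: le_trans i2 _; rewrite mb0.
  have -> : K * A ^+ (bb + mabs a) * (bb + mabs a)`!%:R * w a * Num.sqrt (boxvol l r) =
     K * S * boxvol l r * (2 ^+ bb * G) * \prod_i (2 / side q i) ^+ a i * (A ^+ (bb + mabs a) * (bb + mabs a)`!%:R).
    have ve : boxvol l r = Num.sqrt (boxvol l r) ^+ 2 by rewrite sqr_sqrtr// ltW.
    by rewrite /w {3}ve; ring.
  have c0 : 0 <= K * S * boxvol l r * (2 ^+ bb * G) * \prod_i (2 / side q i) ^+ a i.
    by rewrite !mulr_ge0 ?exprn_ge0 ?(ltW K0) ?(ltW S0) ?(ltW v0) ?(ltW G0) ?(ltW (pa0 a)).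
  apply: le_trans (ler_wpM2l c0 (fact_mult_le a bb)) _.
  rewrite le_eqVlt; apply/orP; left; apply/eqP.
  have -> : \prod_i ((a i)`!%:R * (th / (r i - l i)) ^+ a i) =
    \prod_i (2 / side q i) ^+ a i * \prod_i ((a i)`!%:R * (2 ^+ n.+3 * A) ^+ a i).
    rewrite -big_split/=; apply: eq_bigr => i _; rewrite mulrCA -exprMn rl; congr (_ * _ ^+ _).
    have -> : th = ka * (2 ^+ n.+3 * A * 2) by rewrite /ka divfK// gt_eqF// !mulr_gt0// exprn_gt0.
    by rewrite /h; field; rewrite !gt_eqF.
  rewrite /M !exprMn (_ : 4 = 2 * 2 :> R); last by ring.
  by rewrite exprMn; move: (2 ^+ bb) (\prod_i _) (\prod_i _) => t1 t2 t3; ring.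
have bE : (fun j => b j + 0)%N = b by apply/funext => j; rewrite addn0.
have hm : `|\int[mu]_(p in toV @^-1` box l r) ch b (toV p)| <= M * boxvol l r.
  have [ig0 h0] := hL (fun=> 0%N); move: ig0 h0; rewrite bE big1 ?mulr1 => [ig0 h0|i _]; last by rewrite fact0 expr0 mulr1.
  by apply: le_trans h0; apply: le_normr_Rintegral => //; exact: (meas_box H).
have := osc_sup lr l0 r1 M0 th01 (fun a => (hL a).1) (fun a _ => (hL a).2) hm.
apply: filterS => p hp hn; have [cx hx] := hn.
have Bp : box l r (toV p).
  apply: near_abox hn _; first by apply/andP; split; lra.
  move=> i; have /andP[_ ->] := h01 i; rewrite andbT ler_pM2l// le_max lexx orbT//.
apply: le_trans (hp Bp) _.
have mq : mid (y (toV p)) / 2 <= mid q by apply: near_mid2 hn; apply/andP; split; lra.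
have mp0 := mid_cdist_gt0 cc cx.
have hG : G <= 2 ^+ bb * mid (y (toV p)) `^ (de - bb%:R) by apply: powR_half => //; exact: leq_trans b2.
have -> : M + M * 2 ^+ n.+3 = C * (4 * A) ^+ bb * bb`!%:R * G by rewrite /M /C; ring.
apply: (@le_trans _ _ (C * (4 * A) ^+ bb * bb`!%:R * (2 ^+ bb * mid (y (toV p)) `^ (de - bb%:R)))).
  by rewrite ler_wpM2l// !mulr_ge0 ?exprn_ge0 ?mulr_ge0// ltW.
rewrite le_eqVlt; apply/orP; left; apply/eqP.
have -> : (8 * A) ^+ bb = (4 * A) ^+ bb * 2 ^+ bb by rewrite -exprMn; congr (_ ^+ _); ring.
by ring.
Qed.

End Regularity2.

(** * Derivatives of order zero and one, integrated from far away towards the corner *)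

Section Regularity3.
Context {R : realType} {d : measure_display} {P : measurableType d}.
Variables (mu : {measure set P -> \bar R}) (n : nat) (toV : P -> 'rV[R]_n.+2).
Hypothesis H : leb_like mu toV.
Local Notation V := 'rV[R]_n.+2.
Variables (c : V) (f : V -> R) (D : ('I_n.+2 -> nat) -> V -> R).
Hypothesis cc : is_corner c.
Hypothesis wD : forall alpha, weak_deriv mu toV (@cube R n.+2) f alpha (D alpha).
Hypothesis fL2 : L2 mu toV (@cube R n.+2) f.
Variables (W : ('I_n.+2 -> nat) -> V -> R) (K A de : R).
Hypothesis K0 : 0 < K.
Hypothesis A1 : 1 <= A.
Hypothesis de01 : 0 < de <= 4^-1.
Hypothesis HW : weight_bounds c W de.
Hypothesis HL2 : forall l r a w, (forall i, l i < r i) -> (forall i, 0 <= l i) -> (forall i, r i <= 1) -> 0 <= w ->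
  (forall x, box l r x -> W a x <= w) ->
  (\int[mu]_(p in toV @^-1` box l r) (D a (toV p) ^+ 2)%:E <= ((K * A ^+ mabs a * (mabs a)`!%:R * w) ^+ 2)%:E)%E.

Local Notation ch := (chain f D).
Local Notation y := (cdist c).

Lemma ae_box_ex l r (Q : P -> Prop) : (forall i, l i < r i) -> (\forall p \ae mu, Q p) ->
  exists2 p, (toV @^-1` box l r) p & Q p.
Proof.
move=> lr [N [mN N0 hN]]; apply: contrapT => hn.
have v0 := boxvol_gt0 lr.
have sub : toV @^-1` box l r `<=` N.
  by move=> p Bp; apply: hN => Qp; apply: hn; exists p.
have : (mu (toV @^-1` box l r) <= mu N)%E by apply: le_measure => //; rewrite inE//; exact: (meas_box H).
by rewrite N0 (measure_box H lr) lee_fin leNgt v0.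
Qed.

Lemma f_mean : exists2 L, 0 < L & forall l r, (forall i, l i < r i) -> (forall i, 0 <= l i) -> (forall i, r i <= 1) ->
  mu.-integrable (toV @^-1` box l r) (EFin \o (f \o toV)) /\
  \int[mu]_(p in toV @^-1` box l r) `|f (toV p)| <= L * Num.sqrt (boxvol l r).
Proof.
have [mf fi] := fL2; set I := integ _ _ _ _ in fi.
have I0 : (0 <= I)%E by apply: integral_ge0 => p _; rewrite lee_fin sqr_ge0.
have If : I \is a fin_num by rewrite ge0_fin_numE.
exists (Num.sqrt (fine I + 1)); first by rewrite sqrtr_gt0 ltr_wpDl// fine_ge0.
move=> l r lr l0 r1; have f0 : 0 <= fine I by apply: fine_ge0.
have sub : toV @^-1` box l r `<=` toV @^-1` (@cube R n.+2) by move=> p; exact: box_sub_cube.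
apply: (L1_of_L2 H lr (g := f \o toV)).
- by rewrite sqrtr_gt0 ltr_wpDl.
- by apply: measurable_funS mf => //; exact: (measurable_cube H).
rewrite sqr_sqrtr; last by rewrite addr_ge0.
apply: (@le_trans _ _ I); last by rewrite -[I]fineK// lee_fin lerDl.
apply: ge0_subset_integral => //; [exact: (meas_box H)|exact: (measurable_cube H)| |].
- by apply/measurable_EFinP; exact: measurable_funX.
- by move=> p _; rewrite lee_fin sqr_ge0.
Qed.

Lemma mean_bound (a : 'I_n.+2 -> nat) ta : 0 < ta -> exists2 L, 0 < L & forall l r, (forall i, l i < r i) ->
  (forall i, 0 <= l i) -> (forall i, r i <= 1) -> (forall x, box l r x -> ta <= mid (y x)) ->
  mu.-integrable (toV @^-1` box l r) (EFin \o (ch a \o toV)) /\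
  \int[mu]_(p in toV @^-1` box l r) `|ch a (toV p)| <= L * Num.sqrt (boxvol l r).
Proof.
move=> t0; have A0 : 0 < A by apply: lt_le_trans A1.
have [a0|a0] := eqVneq (mabs a) 0%N.
  have [L L0 hL] := f_mean; exists L => // l r lr l0 r1 _.
  have -> : ch a = f.
    rewrite /chain; case: ifP => // /negP[]; apply/forallP => i.
    by move/eqP: a0; rewrite /mabs sum_nat_eq0 => /forallP/(_ i).
  exact: hL.
pose w : R := \prod_i ta^-1 ^+ a i.
have w0 : 0 < w by apply: prodr_gt0 => i _; rewrite exprn_gt0// invr_gt0.
exists (K * A ^+ mabs a * (mabs a)`!%:R * w).
  by do 3 (apply: mulr_gt0 => //); rewrite ?exprn_gt0// ltr0n fact_gt0.
move=> l r lr l0 r1 hm; apply: (L1_weight H wD fL2 K0 A1 HL2) => // x bx.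
have cx : cube x := box_sub_cube l0 r1 bx.
apply: le_trans (HW.2 x a cx) _; apply: ler_prod => i _.
have s0 : 0 < side (y x) i by exact: side_gt0.
rewrite exprn_ge0 ?invr_ge0 ?(ltW s0)//=.
apply: lerXn2r; rewrite ?nnegrE ?invr_ge0 ?(ltW s0) ?(ltW t0)// lef_pV2// /side le_max.
by rewrite (hm x bx) orbT.
Qed.

Lemma powR_compare (t m s : R) : 0 < t -> t / 4 <= m -> m <= t -> -1 <= s <= 1 -> m `^ s <= 4 * t `^ s.
Proof.
move=> t0 h1 h2 /andP[s1 s2]; have t40 : 0 < t / 4 by rewrite divr_gt0.
have m0 : 0 < m := lt_le_trans t40 h1.
rewrite !powR_expR// -[4]lnK ?posrE// -expRD ler_expR.
have l1 : ln m <= ln t by rewrite ler_ln ?posrE.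
have l2 : ln t - ln 4 <= ln m by rewrite -ln_div ?posrE// ler_ln ?posrE.
have -> : s * ln m = s * (ln m - ln t) + s * ln t by ring.
rewrite lerD2r; nra.
Qed.

Section LowBox.
Variables (b : 'I_n.+2 -> nat) (K1 A2 : R).
Hypothesis K10 : 0 < K1.
Hypothesis A21 : 1 <= A2.
Hypothesis hhi : forall g, (mabs b < mabs g)%N -> \forall p \ae mu, cube (toV p) ->
  `|ch g (toV p)| <= K1 * A2 ^+ mabs g * (mabs g)`!%:R * mid (y (toV p)) `^ (de - (mabs g)%:R).
Variables (th : R).
Hypothesis th0 : 0 < th.
Hypothesis th1 : th <= 384^-1.

(** The factor 2 beside A2 pays, for each derivative, for the estimate mid (y x) >= mid q / 2 on the
    box. *)
Definition ka : R := th / (2 ^+ n.+3 * (2 * A2)).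

Lemma ka_gt0 : 0 < ka.
Proof.
apply: divr_gt0 => //; have A20 : 0 < A2 by apply: lt_le_trans A21.
by apply: mulr_gt0; [exact: exprn_gt0|exact: mulr_gt0].
Qed.

Hypothesis ka2 : ka <= 2^-1.

Variable q : 'I_n.+2 -> R.
Hypothesis q01 : forall i, 0 < q i < 1.

Definition hq (i : 'I_n.+2) : R := ka * mid q.

Lemma midq_gt0 : 0 < mid q. Proof. by apply: mid_gt0 => i; have /andP[] := q01 i. Qed.

Lemma midq_le1 : mid q <= 1.
Proof. by apply: mid_le1 => i; have /andP[/ltW ? /ltW ?] := q01 i. Qed.

Lemma hq01 i : 0 < hq i <= 2^-1.
Proof.
rewrite /hq; have k0 := ka_gt0; rewrite mulr_gt0 ?midq_gt0//=; apply: le_trans ka2.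
by rewrite ler_piMr ?midq_le1// ltW.
Qed.

Let l := xl c (anchor q hq) (fun i => anchor q hq i + hq i).
Let r := xr c (anchor q hq) (fun i => anchor q hq i + hq i).

Lemma low_mid x : box l r x -> cube x /\ mid q / 2 <= mid (y x).
Proof.
move=> /(abox_near cc q01 hq01)[cx hx]; split=> //.
by apply: mid_half => // i; have [] := hx i.
Qed.

Lemma low_lr i : l i < r i. Proof. exact: abox_lr hq01 i. Qed.
Lemma low_l0 i : 0 <= l i. Proof. exact: abox_l0 q01 hq01 i. Qed.
Lemma low_r1 i : r i <= 1. Proof. exact: abox_r1 q01 hq01 i. Qed.

Definition lowM : R := K1 * (4 * A2) ^+ mabs b * (mabs b)`!%:R * mid q `^ (de - (mabs b)%:R).

Lemma lowM_ge0 : 0 <= lowM.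
Proof.
have A20 : 0 < A2 by apply: lt_le_trans A21.
by rewrite /lowM !mulr_ge0 ?powR_ge0 ?exprn_ge0 ?mulr_ge0// ltW.
Qed.

(** Unlike in [high_order], the derivatives of higher order are already bounded pointwise. Cubes of
    side ka mid q replace the elongated boxes, and the integrals are estimated by suprema. *)
Lemma low_L1 (a : 'I_n.+2 -> nat) :
  mu.-integrable (toV @^-1` box l r) (EFin \o (ch (fun j => b j + a j)%N \o toV)) /\
  ((exists i, a i != 0%N) -> \int[mu]_(p in toV @^-1` box l r) `|ch (fun j => b j + a j)%N (toV p)| <=
     lowM * boxvol l r * \prod_i ((a i)`!%:R * (th / (r i - l i)) ^+ a i)).
Proof.
have lr := low_lr; have l0 := low_l0; have r1 := low_r1.
have rl i : r i - l i = hq i by exact: abox_size.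
have m0 := midq_gt0; have A20 : 0 < A2 by apply: lt_le_trans A21.
have mB : measurable (toV @^-1` box l r) by exact: (meas_box H).
have m20 : 0 < mid q / 2 by rewrite divr_gt0.
have [L _ hL] := mean_bound (fun j => b j + a j)%N m20.
have [ig _] := hL l r lr l0 r1 (fun x bx => (low_mid bx).2); split=> // -[i0 ai0].
have mb0 : mabs (fun i => b i + a i)%N = (mabs b + mabs a)%N by rewrite /mabs big_split.
have a0 : (0 < mabs a)%N by rewrite /mabs (bigD1 i0)//= addn_gt0 lt0n ai0.
have hg : (mabs b < mabs (fun i => b i + a i))%N by rewrite mb0 -addn1 leq_add2l.
pose C := K1 * ((2 * A2) ^+ (mabs b + mabs a) * (mabs b + mabs a)`!%:R) * (mid q `^ (de - (mabs b)%:R) * \prod_i (mid q)^-1 ^+ a i).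
have hC : \forall p \ae mu, (toV @^-1` box l r) p -> `|ch (fun j => b j + a j)%N (toV p)| <= C.
  apply: filterS (hhi hg) => p hp Bp; have [cx mh] := low_mid Bp.
  apply: le_trans (hp cx) _; rewrite mb0.
  have h1 := powR_half de01 m0 mh (leq_trans a0 (leq_addl (mabs b) _)).
  have c0 : 0 <= K1 * A2 ^+ (mabs b + mabs a) * (mabs b + mabs a)`!%:R by rewrite !mulr_ge0 ?exprn_ge0// ltW.
  apply: le_trans (ler_wpM2l c0 h1) _.
  rewrite le_eqVlt; apply/orP; left; apply/eqP; rewrite /C.
  have -> : \prod_i (mid q)^-1 ^+ a i = (mid q)^-1 ^+ mabs a by rewrite /mabs expr_sum.
  have -> : mid q `^ (de - (mabs b + mabs a)%:R) = mid q `^ (de - (mabs b)%:R) * (mid q)^-1 ^+ mabs a.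
    rewrite !powR_expR// exprn_expR ?invr_gt0// lnV ?posrE// -expRD natrD; congr expR; ring.
  by rewrite exprMn; move: (mabs b + mabs a)%N => k; ring.
have v0 := boxvol_gt0 lr.
have C0 : 0 <= C.
  rewrite /C !mulr_ge0 ?powR_ge0 ?exprn_ge0 ?mulr_ge0 ?(ltW K10) ?(ltW A20)//.
  by apply: prodr_ge0 => i _; rewrite exprn_ge0// invr_ge0 ltW.
have h1 : \int[mu]_(p in toV @^-1` box l r) `|ch (fun j => b j + a j)%N (toV p)| <= C * boxvol l r.
  have iC : mu.-integrable (toV @^-1` box l r) (EFin \o (fun=> C)).
    by apply: (integrable_bounded H lr (C := C)) => // p _; rewrite ger0_norm.
  have e : \int[mu]_(p in toV @^-1` box l r) C = C * boxvol l r by rewrite Rintegral_cst// (measure_box H lr).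
  rewrite -e /Rintegral; apply: fine_le.
  - by apply: integrable_fin_num => //; exact: (integrable_norm ig).
  - exact: integrable_fin_num.
  apply: ae_ge0_le_integral => //.
  have := integrable_norm ig => /integrableP[+ _]; exact.
apply: le_trans h1 _.
have A22 : 1 <= 2 * A2 by rewrite mulr_ege1// ler1n.
have := fact_mult_le A22 a (mabs b) => h2.
have p0 : 0 <= \prod_i (mid q)^-1 ^+ a i by apply: prodr_ge0 => i _; rewrite exprn_ge0// invr_ge0 ltW.
have c0 : 0 <= K1 * (mid q `^ (de - (mabs b)%:R) * \prod_i (mid q)^-1 ^+ a i) * boxvol l r.
  by rewrite !mulr_ge0 ?powR_ge0// ltW.
apply: (@le_trans _ _ (K1 * (mid q `^ (de - (mabs b)%:R) * \prod_i (mid q)^-1 ^+ a i) * boxvol l r *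
    ((2 * A2) ^+ (mabs b + mabs a) * (mabs b + mabs a)`!%:R))).
  by rewrite le_eqVlt; apply/orP; left; apply/eqP; rewrite /C; ring.
apply: le_trans (ler_wpM2l c0 h2) _.
rewrite le_eqVlt; apply/orP; left; apply/eqP.
have -> : \prod_i ((a i)`!%:R * (th / (r i - l i)) ^+ a i) =
    \prod_i (mid q)^-1 ^+ a i * \prod_i ((a i)`!%:R * (2 ^+ n.+3 * (2 * A2)) ^+ a i).
  rewrite -big_split/=; apply: eq_bigr => i _; rewrite mulrCA -exprMn rl; congr (_ * _ ^+ _).
  have thE : th = ka * (2 ^+ n.+3 * (2 * A2)).
    by rewrite /ka divfK// gt_eqF//; apply: mulr_gt0; [exact: exprn_gt0|exact: mulr_gt0].
  by rewrite {1}thE /hq; have k0 := ka_gt0; field; rewrite !gt_eqF.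
rewrite /lowM (_ : 4 = 2 * 2 :> R); last by ring.
by rewrite -(mulrA 2 2 A2); move: (\prod_i _) (\prod_i _) => t1 t2; ring.
Qed.

Lemma low_sup m : `|\int[mu]_(p in toV @^-1` box l r) ch b (toV p)| <= m * boxvol l r ->
  \forall p \ae mu, (toV @^-1` box l r) p -> `|ch b (toV p)| <= m + lowM * 2 ^+ n.+3.
Proof.
move=> hm; apply: (osc_sup H wD (th := th) low_lr low_l0 low_r1) => //.
- exact: lowM_ge0.
- by rewrite ltW.
- by move=> a; have [] := low_L1 a.
- by move=> a ha; have [_] := low_L1 a; apply.
Qed.

Lemma low_osc : exists k, \forall p \ae mu, (toV @^-1` box l r) p -> `|ch b (toV p) - k| <= lowM * 2 ^+ n.+2.
Proof.
have [|a|a ha|k [_ hk]] := osc_box1 H wD (b := b) (th := th) low_lr low_l0 low_r1 lowM_ge0.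
- by rewrite ltW.
- by have [] := low_L1 a.
- by have [_] := low_L1 a; apply.
by exists k.
Qed.

Let u i := anchor q hq i + hq i / 2.
Let v i := anchor q hq i + hq i.
Let l' := xl c u v.
Let r' := xr c u v.

Lemma sub_box_mid x : box l' r' x -> box l r x /\ Num.min (mid q + ka * mid q / 2) 2^-1 <= mid (y x).
Proof.
have h0 i : 0 < hq i by have /andP[] := hq01 i.
have u0 i : 0 <= u i by rewrite /u addr_ge0 ?(anchor_ge0 q01 hq01)// divr_ge0// ltW.
move=> bx; have [cx hx] := ybox_in cc u0 (anchor_le1 q hq) bx; split.
  apply: in_ybox => // i; have /andP[h1 h2] := hx i; rewrite h2 andbT; apply: lt_trans h1.
  by rewrite /u ltrDl divr_gt0.
have q0 i : 0 <= q i by have /andP[/ltW] := q01 i.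
have [i hi] := mid_att q0.
apply: (@mid_max _ _ _ i).
  by rewrite ge_min; apply/orP; right; rewrite invf_le1// ler1n.
move=> j /hi hj; have /andP[/ltW h1 _] := hx j; apply: le_trans h1.
have e : hq j = ka * mid q by [].
have := (andP (hq01 j)).2; rewrite -!e; have := h0 j.
by rewrite /u /anchor ge_min; case: (leP (q j) (1 - hq j)) => h h1 h2; apply/orP; [left|right]; lra.
Qed.

(** The part of the box beyond the midpoint of every side lies at larger mid, where the bound [Phi]
    is known. Comparing with one point there carries [Phi] to the whole box at the price of one
    oscillation. *)
Lemma low_step ta Phi : 0 < ta -> ta <= 2^-1 -> ta <= (1 + ka / 2) * mid q ->
  (\forall p \ae mu, cube (toV p) -> ta <= mid (y (toV p)) -> `|ch b (toV p)| <= Phi) ->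
  \forall p \ae mu, (toV @^-1` box l r) p -> `|ch b (toV p)| <= Phi + lowM * 2 ^+ n.+3.
Proof.
move=> t0 t2 tq hPhi; have [k hk] := low_osc.
have h0 i : 0 < hq i by have /andP[] := hq01 i.
have lr' i : l' i < r' i by apply: xl_lt_xr => j; rewrite /u /v ltrD2l ltr_pdivrMr// ltr_pMr// ltr1n.
have [p Bp [h1 h2]] := ae_box_ex lr' (filterI hPhi hk).
have [Bp' mp] := sub_box_mid Bp.
have hk' : `|k| <= Phi + lowM * 2 ^+ n.+2.
  have cp : cube (toV p) := (low_mid Bp').1.
  have := h1 cp; have := h2 Bp'; rewrite distrC => g2 g1.
  have tm : ta <= mid (y (toV p)).
    by apply: le_trans mp; rewrite le_min t2 andbT; apply: le_trans tq _; rewrite mulrDl mul1r lerD2l mulrAC.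
  have := ler_normD (k - ch b (toV p)) (ch b (toV p)); rewrite subrK => g3.
  by apply: le_trans g3 _; rewrite addrC; apply: lerD => //; exact: g1.
apply: filterS hk => p' hp /hp g; have := ler_normD (ch b (toV p') - k) k; rewrite subrK => g'.
apply: le_trans g' _; have -> : Phi + lowM * 2 ^+ n.+3 = lowM * 2 ^+ n.+2 + (Phi + lowM * 2 ^+ n.+2).
  by rewrite (exprS _ n.+2); ring.
exact: lerD.
Qed.

End LowBox.

(* The oscillations over a chain of boxes of doubling size leading away from the corner add up to
   a geometric series. *)
Lemma low_order (b : 'I_n.+2 -> nat) (K1 A2 : R) : (mabs b <= 1)%N -> 0 < K1 -> 1 <= A2 ->
  (forall g, (mabs b < mabs g)%N -> \forall p \ae mu, cube (toV p) ->
    `|ch g (toV p)| <= K1 * A2 ^+ mabs g * (mabs g)`!%:R * mid (y (toV p)) `^ (de - (mabs g)%:R)) ->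
  exists2 C, 0 < C & \forall p \ae mu, cube (toV p) -> `|ch b (toV p)| <= C * (1 + mid (y (toV p)) `^ (de - (mabs b)%:R)).
Proof.
move=> b1 K10 A21 hhi; have [th [th0 thE th1]] := @theta_ex R.
have A20 : 0 < A2 by apply: lt_le_trans A21.
set s := de - (mabs b)%:R; have /andP[d0 d1] := de01.
have s1 : -1 <= s <= 1.
  have : (mabs b)%:R <= 1 :> R by rewrite (ler_nat _ _ 1).
  have : 0 <= (mabs b)%:R :> R by rewrite ler0n.
  by rewrite /s => *; apply/andP; split; lra.
(* s is de or de - 1. If s were 0, every level would contribute equally and the sum would grow with
   the number of levels. *)
have sn0 : s != 0.
  rewrite /s; case: (mabs b) b1 => [|[|//]] _; first by rewrite subr0 gt_eqF.
  by rewrite lt_eqF// subr_lt0; lra.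
pose k := ka A2 th; have k0 : 0 < k := ka_gt0 A21 th0.
have k2 : k <= 2^-1.
  have T1 : 1 <= 2 ^+ n.+3 * A2 by rewrite mulr_ege1// exprn_ege1// ler1n.
  rewrite /k /ka ler_pdivrMr; last by apply: mulr_gt0; [exact: exprn_gt0|exact: mulr_gt0].
  rewrite mulrCA mulKf//; exact: le_trans th1 T1.
have k1 : 0 < k <= 1 by rewrite k0 (le_trans k2)// invf_le1// ler1n.
have k1' : 0 <= k <= 1 by have /andP[/ltW -> ->] := k1.
pose B0 := K1 * (4 * A2) ^+ mabs b * (mabs b)`!%:R * 2 ^+ n.+3.
have B00 : 0 < B0.
  apply: mulr_gt0; last exact: exprn_gt0.
  apply: mulr_gt0; last by rewrite ltr0n fact_gt0.
  by apply: mulr_gt0 => //; apply: exprn_gt0; exact: mulr_gt0.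
have lowME q : lowM b K1 A2 q * 2 ^+ n.+3 = B0 * mid q `^ s by rewrite /lowM /B0 -/s; ring.
have h18 : 0 < 8^-1 :> R by rewrite invr_gt0.
have [L L0 hL] := mean_bound b h18.
pose Phi0 := L / Num.sqrt ((k / 4) ^+ n.+2) + B0 * 4.
have base : \forall p \ae mu, cube (toV p) -> 2^-1 <= mid (y (toV p)) -> `|ch b (toV p)| <= Phi0.
  apply: (near_cover cc (ka := k) (Q := fun x => 2^-1 <= mid (y x) -> `|ch b x| <= Phi0) k0) => q q01.
  have [q4|q4] := ltP (mid q) 4^-1.
    apply: aeW => p hn hm; have := near_mid2 cc k1' hn; lra.
  have hbx := abox_near cc q01 (hq01 A21 th0 k2 q01).
  set l := xl _ _ _ in hbx; set r := xr _ _ _ in hbx.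
  have [i1 i2] : mu.-integrable (toV @^-1` box l r) (EFin \o (ch b \o toV)) /\
      \int[mu]_(p in toV @^-1` box l r) `|ch b (toV p)| <= L * Num.sqrt (boxvol l r).
    apply: hL; [exact: (low_lr A21 th0 k2 q01)|exact: (low_l0 A21 th0 k2 q01)|exact: (low_r1 A21 th0 k2 q01)|].
    by move=> x bx; have [_ hm] := low_mid A21 th0 k2 q01 bx; lra.
  have v0 := boxvol_gt0 (low_lr A21 th0 k2 q01); rewrite -/l -/r in v0.
  have hm : `|\int[mu]_(p in toV @^-1` box l r) ch b (toV p)| <= (L / Num.sqrt (boxvol l r)) * boxvol l r.
    apply: (@le_trans _ _ (L * Num.sqrt (boxvol l r))).
      by apply: le_trans i2; apply: le_normr_Rintegral => //; exact: (meas_box H).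
    have sv0 : 0 < Num.sqrt (boxvol l r) by rewrite sqrtr_gt0.
    have ve : boxvol l r = Num.sqrt (boxvol l r) ^+ 2 by rewrite sqr_sqrtr// ltW.
    rewrite {3}ve; move: (Num.sqrt (boxvol l r)) sv0 => w w0.
    by rewrite le_eqVlt; apply/orP; left; apply/eqP; field; rewrite gt_eqF.
  have := low_sup K10 A21 hhi th0 thE k2 q01 hm.
  apply: filterS => p hp hn hm2.
  have Bp : box l r (toV p).
    apply: near_abox hn _ => // i; rewrite lexx /=.
    by have /andP[] := hq01 A21 th0 k2 q01 i.
  apply: le_trans (hp Bp) _; rewrite lowME /Phi0; apply: lerD.
    have a1 : 0 < Num.sqrt ((k / 4) ^+ n.+2) by rewrite sqrtr_gt0 exprn_gt0// divr_gt0.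
    have a2 : Num.sqrt ((k / 4) ^+ n.+2) <= Num.sqrt (boxvol l r).
      apply: ler_wsqrtr; rewrite boxvol_scaled prodr_const cardT size_enum_ord; apply: lerXn2r.
      - by rewrite nnegrE divr_ge0// ltW.
      - by rewrite nnegrE mulr_ge0// ltW// midq_gt0.
      - by rewrite ler_pM2l.
    by rewrite ler_pM2l// lef_pV2 ?posrE// sqrtr_gt0.
  have q4' : 1 / 4 <= mid q by rewrite div1r.
  rewrite ler_pM2l//; have := powR_compare ltr01 q4' (midq_le1 q01) s1.
  by rewrite powR1 mulr1.
(* This ratio of consecutive levels satisfies sg <= (1 + k/2)(1 - k/8): up to 1 - k/8 is lost
   between a point and its anchor, and the far part of the box gains 1 + k/2. *)
pose sg := 1 + k / 4.
have sg1 : 1 < sg by rewrite /sg ltrDl divr_gt0.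
have sg0 : 0 < sg by apply: lt_trans sg1.
pose tau i : R := sg^-1 ^+ i / 2.
have tau0 i : 0 < tau i by rewrite divr_gt0// exprn_gt0// invr_gt0.
have tau2 i : tau i <= 2^-1.
  by rewrite /tau -[leRHS]mul1r ler_wpM2r// exprn_ile1// ?invr_ge0 ?(ltW sg0)// invf_le1// ltW.
have tauS i : tau i.+1 = tau i / sg by rewrite /tau exprS; ring.
pose Phi m := Phi0 + B0 * 4 * \sum_(i < m) tau i `^ s.
have step m : \forall p \ae mu, cube (toV p) -> tau m <= mid (y (toV p)) -> `|ch b (toV p)| <= Phi m.
  elim: m => [|m IH].
    by apply: filterS base => p; rewrite /tau /Phi big_ord0 mulr0 addr0 expr0 div1r.
  apply: (near_cover cc (ka := k) (Q := fun x => tau m.+1 <= mid (y x) -> `|ch b x| <= Phi m.+1) k0) => q q01.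
  have PhiS : Phi m.+1 = Phi m + B0 * 4 * tau m `^ s by rewrite /Phi big_ord_recr/= mulrDr addrA.
  have [q4|q4] := ltP (mid q) ((1 - k / 8) * tau m.+1).
    apply: aeW => p hn hm; exfalso; have := near_mid cc (ltW k0) hn.
    rewrite leNgt => /negP; apply; apply: lt_le_trans q4 _.
    by rewrite ler_pM2l//; lra.
  have tq : tau m <= (1 + k / 2) * mid q.
    have e : tau m = sg * tau m.+1 by rewrite tauS mulrC divfK// gt_eqF.
    have h1 : sg <= (1 + k / 2) * (1 - k / 8) by rewrite /sg; nra.
    rewrite e; apply: (@le_trans _ _ ((1 + k / 2) * (1 - k / 8) * tau m.+1)); first by rewrite ler_wpM2r// ltW.
    by rewrite -mulrA ler_wpM2l// addr_ge0// divr_ge0// ltW.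
  have [q5|q5] := ltP (tau m) (mid q).
    apply: filterS IH => p hp [cx hn] _; rewrite PhiS.
    apply: le_trans (hp cx _) _; last by rewrite lerDl mulr_ge0 ?powR_ge0// mulr_ge0// ltW.
    apply: le_trans (ltW q5) _; apply: le_mid => i; [by have /andP[/ltW] := q01 i|by have /andP[_ /ltW] := q01 i|].
    by have /andP[_ /ltW] := hn i.
  have := low_step K10 A21 hhi th0 thE k2 q01 (tau0 m) (tau2 m) tq IH.
  apply: filterS => p hp hn hm2.
  apply: le_trans (hp _) _.
    apply: near_abox hn _ => // i; rewrite lexx /=.
    by have /andP[] := hq01 A21 th0 k2 q01 i.
  rewrite lowME PhiS lerD2l -mulrA ler_pM2l//; apply: powR_compare => //.
  have t0 := tau0 m; apply: (@le_trans _ _ (tau m / (1 + k / 2))).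
    by rewrite ler_pM2l// lef_pV2 ?posrE//; lra.
  have k3 : 0 < 1 + k / 2 by rewrite addr_gt0// divr_gt0.
  by rewrite ler_pdivrMr// mulrC.
pose X := sg^-1 `^ s; have X0 : 0 < X by rewrite powR_gt0// invr_gt0.
have tauX i : tau i `^ s = 2^-1 `^ s * X ^+ i.
  rewrite /tau /X !powR_expR ?invr_gt0//; last exact: tau0.
  rewrite -expRM_natl -expRD lnM ?posrE ?exprn_gt0 ?invr_gt0//.
  rewrite -[ln (_ ^+ i)]mul1r exprn_expR ?invr_gt0// expRK; congr expR; ring.
have X1 : X != 1.
  rewrite /X powR_expR ?invr_gt0// -[1]expR0 (inj_eq (@expR_inj R)) mulf_neq0//.
  by rewrite ln_eq0 ?invr_gt0// invr_eq1 gt_eqF.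
have h2s : 2^-1 `^ s <= 4 by have := @powR_compare 1 2^-1 s ltr01; rewrite powR1 mulr1; apply=> //; lra.
(* A geometric sum is at most (next term + first term) / |X - 1| whether the terms grow (s < 0) or
   decay (s > 0), so both orders are covered by one argument. *)
have sumX m : \sum_(i < m) tau i `^ s <= (tau m `^ s + 4) / `|X - 1|.
  under eq_bigr do rewrite tauX.
  have X1' : X - 1 != 0 by rewrite subr_eq0.
  rewrite -mulr_sumr ler_pdivlMr ?normr_gt0// tauX -[X in _ * X * _]ger0_norm; last first.
    by apply: sumr_ge0 => i _; rewrite exprn_ge0// ltW.
  rewrite -mulrA [X in _ * X]mulrC -normrM -subrX1.
  have := ler_normB (X ^+ m) 1; rewrite normr1 (ger0_norm (exprn_ge0 m (ltW X0))) => h.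
  have p0 : 0 <= 2^-1 `^ s :> R by rewrite powR_ge0.
  apply: le_trans (ler_wpM2l p0 h) _; rewrite mulrDr mulr1 lerD2l//.
pose C := Phi0 + B0 * 4 * 4 / `|X - 1|.
have nX0 : 0 < `|X - 1| by rewrite normr_gt0 subr_eq0.
have Phi00 : 0 < Phi0.
  by apply: addr_gt0; [rewrite divr_gt0// sqrtr_gt0 exprn_gt0// divr_gt0|rewrite mulr_gt0].
have C1 : 0 < B0 * 4 * 4 / `|X - 1| by rewrite divr_gt0// mulr_gt0// mulr_gt0.
have C0 : 0 < C by apply: addr_gt0.
exists C => //.
have := ae_foralln step; apply: filterS => p hp cx.
have m0 := mid_cdist_gt0 cc cx; set mx := mid (y (toV p)) in m0 *.
have m1 : mx <= 1 by apply: mid_le1 => i; apply: ltW; [exact: cdist_gt0|exact: cdist_lt1].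
have exm : exists m, tau m <= mx.
  have sgi : `|sg^-1| < 1 by rewrite ger0_norm ?invr_ge0 ?(ltW sg0)// invf_lt1.
  have /cvgrPdist_le/(_ _ m0) [m _ hm] := cvg_expr sgi; exists m.
  have := hm m (leqnn m); rewrite /= sub0r normrN ger0_norm ?exprn_ge0 ?invr_ge0 ?(ltW sg0)// => h.
  apply: le_trans h; rewrite /tau ler_pdivrMr// ler_peMr ?ler1n// exprn_ge0// invr_ge0 ltW//.
have [m hm min] := ex_minnP exm.
apply: le_trans (hp m cx hm) _.
case: m hm min => [|m] hm min.
  rewrite /Phi big_ord0 mulr0 addr0; apply: (@le_trans _ _ (C * 1)); first by rewrite mulr1 lerDl ltW.
  by rewrite ler_pM2l// lerDl powR_ge0.
have lm : mx < tau m by rewrite ltNge; apply/negP => /min; rewrite ltnn.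
have hts : tau m.+1 `^ s <= 4 * mx `^ s.
  apply: powR_compare => //; rewrite ler_pdivrMr//; apply: (le_trans (ltW lm)).
  by rewrite -[leLHS](@divfK _ sg) ?gt_eqF// -tauS ler_wpM2l ?(ltW (tau0 _))// /sg; lra.
apply: (@le_trans _ _ (Phi0 + B0 * 4 * ((4 * mx `^ s + 4) / `|X - 1|))).
  rewrite lerD2l; apply: ler_wpM2l; first by rewrite mulr_ge0// ltW.
  apply: le_trans (sumX m.+1) _.
  by rewrite ler_pM2r ?invr_gt0// lerD2r.
have -> : C * (1 + mx `^ s) = Phi0 + Phi0 * mx `^ s + B0 * 4 * ((4 * mx `^ s + 4) / `|X - 1|) by rewrite /C; ring.
by rewrite lerD2r lerDl mulr_ge0 ?powR_ge0// ltW.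
Qed.

End Regularity3.

Section Regularity4.
Context {R : realType} {d : measure_display} {P : measurableType d}.
Variables (mu : {measure set P -> \bar R}) (n : nat) (toV : P -> 'rV[R]_n.+2).
Hypothesis H : leb_like mu toV.
Local Notation V := 'rV[R]_n.+2.
Variables (c : V) (f : V -> R) (D : ('I_n.+2 -> nat) -> V -> R).
Hypothesis cc : is_corner c.
Hypothesis wD : forall alpha, weak_deriv mu toV (@cube R n.+2) f alpha (D alpha).
Hypothesis fL2 : L2 mu toV (@cube R n.+2) f.
Variables (W : ('I_n.+2 -> nat) -> V -> R) (K A de : R).
Hypothesis K0 : 0 < K.
Hypothesis A1 : 1 <= A.
Hypothesis de01 : 0 < de <= 4^-1.
Hypothesis HW : weight_bounds c W de.
Hypothesis HL2 : forall l r a w, (forall i, l i < r i) -> (forall i, 0 <= l i) -> (forall i, r i <= 1) -> 0 <= w ->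
  (forall x, box l r x -> W a x <= w) ->
  (\int[mu]_(p in toV @^-1` box l r) (D a (toV p) ^+ 2)%:E <= ((K * A ^+ mabs a * (mabs a)`!%:R * w) ^+ 2)%:E)%E.

Local Notation ch := (chain f D).
Local Notation y := (cdist c).
Local Notation zn := (fun _ : 'I_n.+2 => 0%N).

(** [low_order] is applied twice: to the gradient, from derivatives of order at least two, and then
    to f, from the gradient bound just found. For f the exponent is de > 0 and mid <= 1, hence plain
    boundedness. *)
Lemma low_regularity : exists2 C, 0 < C & \forall p \ae mu, cube (toV p) ->
  `|f (toV p)| <= C /\ forall i, `|D (unit_mi i) (toV p)| <= C * mid (y (toV p)) `^ (de - 1).
Proof.
have [K1 [A2 [K10 A21 hi]]] := high_order H cc wD fL2 K0 A1 de01 HW HL2.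
have /andP[d0 d1] := de01.
have mu1 (i : 'I_n.+2) : mabs (unit_mi i) = 1%N.
  by rewrite /mabs (bigD1 i)//= big1 ?addn0 /unit_mi ?eqxx// => j /negPf ->.
have chu (i : 'I_n.+2) : ch (unit_mi i) = D (unit_mi i).
  by rewrite /chain; case: ifP => // /forallP/(_ i); rewrite /unit_mi eqxx.
have ch0 : ch zn = f by rewrite /chain; case: ifP => // /negP[]; apply/forallP.
have hm x : cube x -> 0 < mid (y x) <= 1.
  move=> cx; rewrite mid_cdist_gt0//=; apply: mid_le1 => j; apply: ltW; [exact: cdist_gt0|exact: cdist_lt1].
have ge1 x : cube x -> 1 <= mid (y x) `^ (de - 1).
  move=> /hm /andP[m0 m1]; rewrite powR_expR// -[leLHS]expR0 ler_expR.
  have l0 : ln (mid (y x)) <= 0 by apply: ln_le0.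
  by nra.
have C1 i : exists C, 0 < C /\ \forall p \ae mu, cube (toV p) -> `|D (unit_mi i) (toV p)| <= C * (mid (y (toV p)) `^ (de - 1)).
  have h1 : (mabs (unit_mi i) <= 1)%N by rewrite mu1.
  have [|C C0 hC] := low_order H cc wD fL2 K0 A1 de01 HW HL2 h1 K10 A21.
    by move=> g; rewrite mu1; exact: hi.
  exists (2 * C); split; first exact: mulr_gt0.
  apply: filterS hC => p hp cp; have := hp cp; rewrite chu mu1 => h; apply: le_trans h _.
  by rewrite [X in _ <= X * _]mulrC -mulrA ler_pM2l//; have := ge1 _ cp; lra.
have [Cf hCf] := choice C1.
pose Cs := \sum_i Cf i.
have Csi i : Cf i <= Cs by rewrite /Cs (bigD1 i)//= lerDl sumr_ge0// => j _; exact/ltW/(hCf j).1.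
have Cs0 : 0 <= Cs by apply: sumr_ge0 => i _; exact/ltW/(hCf i).1.
have grad : \forall p \ae mu, cube (toV p) -> forall i, `|D (unit_mi i) (toV p)| <= Cs * mid (y (toV p)) `^ (de - 1).
  have hn (k : nat) : \forall p \ae mu, forall i : 'I_n.+2, i = k :> nat -> cube (toV p) ->
      `|D (unit_mi i) (toV p)| <= Cs * mid (y (toV p)) `^ (de - 1).
    have [kn|kn] := ltnP k n.+2; last first.
      by apply: aeW => p i ik; have := ltn_ord i; rewrite ik ltnNge kn.
    apply: filterS (hCf (Ordinal kn)).2 => p hp i ik cp.
    have -> : i = Ordinal kn by exact: val_inj.
    by apply: le_trans (hp cp) _; rewrite ler_wpM2r// powR_ge0.
  have := ae_foralln hn; apply: filterS => p hp cp i; exact: (hp i i erefl cp).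
have K20 : 0 < K1 + Cs by apply: ltr_wpDr.
have z0 : mabs zn = 0%N :> nat by rewrite /mabs big1.
have h0 : (mabs zn <= 1)%N by rewrite z0.
have [|C C0 hC] := low_order H cc wD fL2 K0 A1 de01 HW HL2 h0 K20 A21.
  move=> g; rewrite z0 => g0; have [g2|g1] := ltnP 1 (mabs g).
    apply: filterS (hi g g2) => p hp cp; apply: le_trans (hp cp) _.
    by rewrite !ler_wpM2r ?powR_ge0// ?exprn_ge0 ?(le_trans ler01 A21)// lerDl.
  have mg : mabs g = 1%N by apply/eqP; rewrite eqn_leq g1 g0.
  have [i gi] : exists i, g i != 0%N.
    apply: contrapT => hn; move: g0; rewrite /mabs big1// => i _.
    by apply/eqP; apply: contrapT => /negP gi; apply: hn; exists i.
  have -> : g = unit_mi i.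
    move: mg; rewrite /mabs (bigD1 i)//= => mg.
    have rest : (\sum_(j < n.+2 | j != i) g j = 0)%N by case: (g i) gi mg => // t _ []; rewrite addnC; case: (\sum_(_ < _ | _) _)%N.
    have hr j : j != i -> g j = 0%N by move=> ji; apply/eqP; move/eqP: rest; rewrite sum_nat_eq0 => /forallP/(_ j); rewrite ji.
    apply/funext => j; rewrite /unit_mi; have [->|ji] := eqVneq j i; last by rewrite hr.
    by move: mg; rewrite rest addn0.
  apply: filterS grad => p hp cp; rewrite chu mu1; apply: le_trans (hp cp i) _.
  rewrite factS fact0 muln1 mulr1 expr1; apply: ler_wpM2r; first exact: powR_ge0.
  apply: (@le_trans _ _ (K1 + Cs)); first by rewrite lerDr ltW.
  by rewrite ler_peMr// ltW.
exists (2 * C + Cs); first by rewrite ltr_wpDr// mulr_gt0.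
apply: filterS2 hC grad => p h1 h2 cp; split.
  have /andP[m0 m1] := hm _ cp.
  have := h1 cp; rewrite ch0 z0 subr0 => h; apply: le_trans h _.
  have : mid (y (toV p)) `^ de <= 1.
    have l0 : ln (mid (y (toV p))) <= 0 by apply: ln_le0.
    by rewrite powR_expR// -[leRHS]expR0 ler_expR; nra.
  by nra.
by move=> i; apply: le_trans (h2 cp i) _; rewrite ler_wpM2r ?powR_ge0// lerDr mulr_ge0// ltW.
Qed.

(** Only the second part of [weight_bounds] is used. It costs an inverse power of the box volume,
    which is harmless because the degree N will beat any fixed power of the mesh size. *)
Lemma patch_expansion : exists K2 ka0 : R, [/\ 0 < K2, 0 < ka0 &
  forall u v : 'I_n.+2 -> R, (forall i, [/\ 0 < u i, u i < v i, v i <= 1 & v i - u i <= ka0 * u i]) ->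
  forall N, (0 < N)%N -> exists k : {ffun 'I_n.+2 -> 'I_N} -> R,
  [/\ \sum_g `|k g| <= K2 / Num.sqrt (\prod_i (v i - u i)),
    \forall p \ae mu, (toV @^-1` box (xl c u v) (xr c u v)) p ->
      `|f (toV p) - monomials toV (xl c u v) (xr c u v) k p| <= K2 / Num.sqrt (\prod_i (v i - u i)) * 2^-1 ^+ N &
    forall i, \forall p \ae mu, (toV @^-1` box (xl c u v) (xr c u v)) p ->
      `|D (unit_mi i) (toV p) - dmonomials toV (xl c u v) (xr c u v) k i p| <=
        K2 / Num.sqrt (\prod_i (v i - u i)) / (v i - u i) * 2^-1 ^+ N]].
Proof.
have A0 : 0 < A by apply: lt_le_trans A1.
have [th [th0 thE th1]] := @theta_ex R.
have [L L0 hL] := f_mean H fL2.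
have T0 : 0 < 2 ^+ n.+3 * A by apply: mulr_gt0 => //; exact: exprn_gt0.
have P0 : 0 < 2 ^+ n.+2 :> R by exact: exprn_gt0.
exists (L + K * 2 ^+ n.+2), (th / (2 ^+ n.+3 * A)); split; first by rewrite addr_gt0// mulr_gt0.
  exact: divr_gt0.
move=> u v huv N N0.
have u0 i : 0 < u i by have [] := huv i.
have uv i : u i < v i by have [] := huv i.
have v1 i : v i <= 1 by have [] := huv i.
set l := xl c u v; set r := xr c u v.
have lr i : l i < r i by exact: xl_lt_xr.
have l0 i : 0 <= l i by apply: xl_ge0 => // j; exact: ltW.
have r1 i : r i <= 1 by apply: xr_le1 => // j; exact: ltW.
have rl i : r i - l i = v i - u i by exact: xr_xl.
have vE : boxvol l r = \prod_i (v i - u i) by exact: ybox_vol.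
have v0 := boxvol_gt0 lr.
rewrite -vE; set sv := Num.sqrt (boxvol l r).
have sv0 : 0 < sv by rewrite sqrtr_gt0.
have ve : boxvol l r = sv ^+ 2 by rewrite sqr_sqrtr// ltW.
have chu (i : 'I_n.+2) : ch (unit_mi i) = D (unit_mi i).
  by rewrite /chain; case: ifP => // /forallP/(_ i); rewrite /unit_mi eqxx.
have ch0 : ch zn = f by rewrite /chain; case: ifP => // /negP[]; apply/forallP.
have M0 : 0 <= K / sv by rewrite divr_ge0// ltW.
have hch a : (exists i, a i != 0%N) -> mu.-integrable (toV @^-1` box l r) (EFin \o (ch a \o toV)) /\
   \int[mu]_(p in toV @^-1` box l r) `|ch a (toV p)| <=
     K / sv * boxvol l r * \prod_i ((a i)`!%:R * (th / (r i - l i)) ^+ a i).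
  move=> [i ai]; have a0 : mabs a != 0%N by rewrite /mabs (bigD1 i)//= -lt0n addn_gt0 lt0n ai.
  have w0 : 0 < \prod_i (u i)^-1 ^+ a i by apply: prodr_gt0 => j _; rewrite exprn_gt0// invr_gt0.
  have Ww x : box l r x -> W a x <= \prod_i (u i)^-1 ^+ a i.
    move=> bx; have [cx hx] := ybox_in cc (fun i => ltW (u0 i)) v1 bx.
    apply: le_trans (HW.2 x a cx) _; apply: ler_prod => j _.
    have s0 : 0 < side (y x) j by exact: side_gt0.
    rewrite exprn_ge0 ?invr_ge0 ?(ltW s0)//=.
    have us : u j <= side (y x) j by have /andP[/ltW h _] := hx j; rewrite (le_trans h)// le_max lexx.
    have uj := u0 j; apply: lerXn2r; rewrite ?nnegrE ?invr_ge0 ?(ltW s0) ?(ltW uj)//.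
    by rewrite lef_pV2.
  have [i1 i2] := L1_weight H wD fL2 K0 A1 HL2 lr l0 r1 w0 Ww a0; split=> //.
  apply: le_trans i2 _; rewrite -/sv.
  have c0 : 0 <= K * \prod_i (u i)^-1 ^+ a i * sv by rewrite !mulr_ge0// ltW.
  apply: (@le_trans _ _ (K * \prod_i (u i)^-1 ^+ a i * sv * (A ^+ (0 + mabs a) * (0 + mabs a)`!%:R))).
    by rewrite le_eqVlt; apply/orP; left; apply/eqP; rewrite add0n; ring.
  apply: le_trans (ler_wpM2l c0 (fact_mult_le A1 a 0)) _.
  rewrite expr0 mul1r fact0 mul1r ve.
  have -> : K / sv * sv ^+ 2 = K * sv by field; rewrite gt_eqF.
  rewrite [K * _ * sv]mulrAC -[leLHS]mulrA; apply: ler_wpM2l; first by rewrite mulr_ge0// ltW.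
  rewrite -big_split/=; apply: ler_prod => j _; rewrite mulrCA -exprMn.
  have f0 : 0 <= (a j)`!%:R :> R by rewrite ler0n.
  have vu0 : 0 < v j - u j by rewrite subr_gt0.
  have t1 : 0 <= (u j)^-1 * (2 ^+ n.+3 * A) by rewrite mulr_ge0 ?invr_ge0 ?(ltW (u0 j))// ltW.
  have t2 : (u j)^-1 * (2 ^+ n.+3 * A) <= th / (r j - l j).
    have [_ _ _ h] := huv j.
    rewrite rl ler_pdivlMr//.
    have -> : (u j)^-1 * (2 ^+ n.+3 * A) * (v j - u j) = (v j - u j) * (2 ^+ n.+3 * A) / u j by ring.
    rewrite ler_pdivrMr ?(u0 j)//; apply: le_trans (ler_wpM2r (ltW T0) h) _.
    by rewrite mulrAC divfK ?gt_eqF// mulrC.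
  apply/andP; split; first by apply: mulr_ge0 => //; apply: exprn_ge0.
  apply: ler_wpM2l => //; apply: lerXn2r => //; rewrite nnegrE; exact: le_trans t1 t2.
have zE a : (fun j => zn j + a j)%N = a by apply/funext.
have ig a : mu.-integrable (toV @^-1` box l r) (EFin \o (ch (fun j => zn j + a j)%N \o toV)).
  rewrite zE; have [[i ai]|hn] := pselect (exists i, a i != 0%N); first by have [] := hch a (ex_intro _ i ai).
  have -> : a = zn by apply/funext => i; apply/eqP; apply: contrapT => /negP ai; apply: hn; exists i.
  by rewrite ch0; have [] := hL l r lr l0 r1.
have hM a : (exists i, a i != 0%N) -> \int[mu]_(p in toV @^-1` box l r) `|ch (fun j => zn j + a j)%N (toV p)| <=
     K / sv * boxvol l r * \prod_i ((a i)`!%:R * (th / (r i - l i)) ^+ a i).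
  by move=> ha; rewrite zE; have [] := hch a ha.
have th01 : 0 <= th <= 384^-1 by rewrite thE (ltW th0).
have [k [k1 k2 k3]] := osc_box H wD lr l0 r1 M0 th01 ig hM N0.
have K2E : K / sv * 2 ^+ n.+2 <= (L + K * 2 ^+ n.+2) / sv.
  by rewrite mulrAC ler_pM2r ?invr_gt0// lerDr ltW.
have h2N : 0 <= 2^-1 ^+ N :> R by rewrite exprn_ge0// invr_ge0.
exists k; split.
- apply: le_trans k1 _; rewrite ch0 mulrDl [K * _ / _]mulrAC lerD2r ler_pdivrMr// ve.
  have -> : L / sv * sv ^+ 2 = L * sv by field; rewrite gt_eqF.
  have [i1 i2] := hL l r lr l0 r1.
  by apply: le_trans i2; apply: le_normr_Rintegral => //; exact: (meas_box H).
- apply: filterS k2 => p hp /hp; rewrite ch0 => h; apply: le_trans h _.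
  by rewrite ler_wpM2r.
- move=> i; apply: filterS (k3 i) => p hp /hp.
  have -> : inc zn i = unit_mi i by apply/funext.
  rewrite chu => h; apply: le_trans h _; rewrite rl ler_wpM2r// mulrAC ler_wpM2r// invr_ge0 subr_ge0 ltW//.
Qed.

End Regularity4.

(** * Weak derivatives of network realizations *)

Section PiecewiseAffine.
Context {R : realType} {n : nat}.
Local Notation V := 'rV[R]_n.
Implicit Types g : V -> R.

(** Germs to the right suffice: affine maps and ReLU preserve them, and the right slope turns out to
    be the weak derivative. *)
Definition right_affine g := forall x i, exists s dl, 0 < dl /\
  forall t, 0 <= t <= dl -> g (x + t *: delta_mx 0 i) = g x + s * t.

Definition pwl g := [/\ continuous g, exists2 L, 0 <= L & lip_lines L g & right_affine g].

Lemma pwl_cst b : pwl (fun=> b).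
Proof.
split; first by move=> x; exact: cst_continuous.
  by exists 0 => // x i t; rewrite subrr normr0 mul0r.
by move=> x i; exists 0, 1; split=> // t _; rewrite mul0r addr0.
Qed.

Lemma pwl_coord (j : 'I_n) : pwl (fun x => x 0 j).
Proof.
split; first exact: coord_continuous.
  exists 1 => // x i t; rewrite !mxE addrAC subrr add0r normrM eqxx /= mul1r.
  by case: (j == i); rewrite ?normr1 ?mulr1// normr0 mulr0.
move=> x i; exists (j == i)%:R, 1; split=> // t _.
by rewrite !mxE eqxx /= mulrC.
Qed.

Lemma pwl_add g1 g2 : pwl g1 -> pwl g2 -> pwl (fun x => g1 x + g2 x).
Proof.
move=> [c1 [L1 L10 l1] r1] [c2 [L2 L20 l2] r2]; split.
- by move=> x; apply: continuousD; [exact: c1|exact: c2].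
- by exists (L1 + L2); [exact: addr_ge0|exact: lip_linesD].
- move=> x i; have [s1 [d1 [d10 h1]]] := r1 x i; have [s2 [d2 [d20 h2]]] := r2 x i.
  exists (s1 + s2), (Num.min d1 d2); split; first by rewrite lt_min d10.
  move=> t /andP[t0]; rewrite le_min => /andP[t1 t2].
  by rewrite h1 ?t0// h2 ?t0// mulrDl addrACA.
Qed.

Lemma pwl_scale a g : pwl g -> pwl (fun x => a * g x).
Proof.
move=> [c [L L0 l] r]; split.
- by move=> x; apply: continuousM; [exact: cst_continuous|exact: c].
- exists (`|a| * L); first by rewrite mulr_ge0.
  by move=> x i t; rewrite -mulrBr normrM -mulrA ler_wpM2l//; exact: l.
- move=> x i; have [s [dl [d0 h]]] := r x i; exists (a * s), dl; split=> // t /h ->.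
  by rewrite mulrDr mulrA.
Qed.

Lemma pwl_lin (I : Type) (r : seq I) (a : I -> R) (g : I -> V -> R) b :
  (forall j, pwl (g j)) -> pwl (fun x => \sum_(j <- r) a j * g j x + b).
Proof.
move=> hg; apply: pwl_add (pwl_cst b); elim: r => [|j r IH].
  by rewrite (_ : (fun _ => _) = (fun=> 0)); [exact: pwl_cst|apply/funext => x; rewrite big_nil].
rewrite (_ : (fun _ => _) = (fun x => a j * g j x + \sum_(j <- r) a j * g j x)).
  by apply: pwl_add => //; exact: pwl_scale.
by apply/funext => x; rewrite big_cons.
Qed.

Lemma max0E (u : R) : Num.max 0 u = (u + `|u|) / 2.
Proof. by case: (leP 0 u) => h; [rewrite ger0_norm// | rewrite ltr0_norm//]; lra. Qed.

Lemma pwl_relu g : pwl g -> pwl (fun x => Num.max 0 (g x)).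
Proof.
move=> [c [L L0 l] r]; split.
- rewrite (_ : (fun _ => _) = (fun x => (g x + `|g x|) * 2^-1)); last by apply/funext => x; rewrite max0E.
  move=> x; apply: (@continuousM _ _ (fun x => g x + `|g x|) (fun=> 2^-1)); last exact: cst_continuous.
  apply: (@continuousD _ _ _ g (fun x => `|g x|)); first exact: c.
  by apply: continuous_comp; [exact: c|exact: norm_continuous].
- exists L => // x i t; apply: le_trans (l x i t); rewrite !max0E.
  rewrite -mulrBl normrM [`|2^-1|]ger0_norm ?invr_ge0// ler_pdivrMr//.
  set u := g _; set v := g _; rewrite (_ : _ - _ = (u - v) + (`|u| - `|v|)); last by ring.
  apply: le_trans (ler_normD _ _) _; have := ler_dist_dist u v; lra.
- move=> x i; have [s [dl [d0 h]]] := r x i.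
  have [g0|g0|g0] := ltrgtP (g x) 0.
  + exists 0, (Num.min dl (- g x / (`|s| + 1))); have s1 : 0 < `|s| + 1 by rewrite ltr_wpDl.
    split; first by rewrite lt_min d0 divr_gt0// oppr_gt0.
    move=> t /andP[t0]; rewrite le_min => /andP[t1 t2]; rewrite h ?t0// mul0r addr0.
    move: t2; rewrite ler_pdivlMr// => t2.
    have : s * t <= `|s| * t by rewrite ler_wpM2r// ler_norm.
    by move=> st; rewrite !max_l//; lra.
  + exists s, (Num.min dl (g x / (`|s| + 1))); have s1 : 0 < `|s| + 1 by rewrite ltr_wpDl.
    split; first by rewrite lt_min d0 divr_gt0.
    move=> t /andP[t0]; rewrite le_min => /andP[t1 t2]; rewrite h ?t0//.
    move: t2; rewrite ler_pdivlMr// => t2.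
    have : - s * t <= `|s| * t by rewrite ler_wpM2r// -normrN ler_norm.
    by move=> st; rewrite !max_r//; lra.
  (* At a zero of g the sign of the right slope decides which branch of the ReLU is active. *)
  + exists (Num.max 0 s), dl; split=> // t /andP[t0 t1]; rewrite h ?t0// g0 !add0r.
    by rewrite maxr_pMl// mul0r.
Qed.

Lemma pwl_realize (n0 n2 : nat) (Phi : NN R n0 n2) (h : V -> 'cV[R]_n0) :
  (forall j, pwl (fun x => h x j 0)) -> forall k, pwl (fun x => realize Phi (h x) k 0).
Proof.
elim: n0 n2 / Phi h => [n0 n1 A b|n0 n1 n2 A b rest IH] h hh k /=.
  rewrite (_ : (fun x => _) = (fun x => \sum_j A k j * h x j 0 + b k 0)); first exact: pwl_lin.
  by apply/funext => x; rewrite !mxE.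
apply: (IH (fun x => relu_vec (A *m h x + b))) => j.
rewrite (_ : (fun x => _) = (fun x => Num.max 0 (\sum_i A j i * h x i 0 + b j 0))).
  by apply: pwl_relu; exact: pwl_lin.
by apply/funext => x; rewrite !mxE.
Qed.

Lemma pwl_realize1 (Phi : NN R n 1) : pwl (realize1 Phi).
Proof.
apply: (@pwl_realize _ _ Phi (fun x : V => x^T)) => j.
rewrite (_ : (fun x => _) = (fun x : V => x 0 j)); first exact: pwl_coord.
by apply/funext => x; rewrite mxE.
Qed.

End PiecewiseAffine.

Section WeakDerivative.
Context {R : realType} {d : measure_display} {P : measurableType d}.
Variables (mu : {measure set P -> \bar R}) (n : nat) (toV : P -> 'rV[R]_n).
Hypothesis H : leb_like mu toV.
Local Notation V := 'rV[R]_n.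
Local Notation e_ i := (delta_mx 0 i : V).

Lemma mderiv_unit (i : 'I_n) (phi : V -> R) : mderiv (unit_mi i) phi = partial i phi.
Proof.
rewrite /mderiv (_ : flatten _ = [:: i])//.
have -> : flatten [seq nseq (unit_mi i j) j | j <- enum 'I_n] = [seq j <- enum 'I_n | j == i].
  elim: (enum 'I_n) => //= j s ->; rewrite /unit_mi.
  by case: (j == i).
by rewrite filter_pred1_uniq ?enum_uniq ?mem_enum.
Qed.

Lemma continuous_bounded (g : V -> R) (a b : 'I_n -> R) : continuous g ->
  exists C, forall x : V, (forall i, a i <= x 0 i <= b i) -> `|g x| <= C.
Proof.
move=> cg; have := compact_bounded (continuous_compact (continuous_subspaceT cg) (@compact_box _ _ a b)).
move=> [N [_ hN]]; exists (N + 1) => x hx; apply: (hN (N + 1)); first by rewrite ltrDl.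
by exists x.
Qed.

Lemma Rintegral_shift i t (F : P -> R) (sh : P -> P) : measurable_fun setT F ->
  (forall G : P -> \bar R, measurable_fun setT G -> (forall p, 0 <= G p)%E -> (\int[mu]_p G (sh p) = \int[mu]_p G p)%E) ->
  measurable_fun setT sh -> (forall p, toV (sh p) = toV p + t *: e_ i) ->
  \int[mu]_p F (sh p) = \int[mu]_p F p.
Proof.
move=> mF hsh _ _; have mE : measurable_fun setT (EFin \o F) by exact/measurable_EFinP.
rewrite /Rintegral; congr fine; rewrite integralE [RHS]integralE; congr (_ - _)%E.
  transitivity (\int[mu]_p ((EFin \o F)^\+ (sh p)))%E; first by apply: eq_integral => p _; rewrite !funeposE.
  by rewrite (hsh _ (measurable_funepos mE)).
transitivity (\int[mu]_p ((EFin \o F)^\- (sh p)))%E; first by apply: eq_integral => p _; rewrite !funenegE.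
by rewrite (hsh _ (measurable_funeneg mE)).
Qed.

Lemma Rintegral_support (D E : set P) (F : P -> R) : measurable D -> measurable E ->
  (forall p, ~ D p -> F p = 0) -> (forall p, ~ E p -> F p = 0) ->
  \int[mu]_(p in D) F p = \int[mu]_(p in E) F p.
Proof.
move=> mD mE hD hE; rewrite /Rintegral; congr fine; rewrite integral_mkcond [RHS]integral_mkcond.
apply: eq_integral => p _; rewrite !patchE; case: ifPn => [|/negP] pD; case: ifPn => [|/negP] pE //.
  by rewrite hE// => h; apply: pE; rewrite inE.
by rewrite hD// => h; apply: pD; rewrite inE.
Qed.

Section TestFunction.
Variables (phi : V -> R) (K : set V) (i : 'I_n).
Hypothesis sphi : smooth phi.
Hypothesis cK : compact K.
Hypothesis subK : K `<=` @cube R n.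
Hypothesis phi0 : forall x, ~ K x -> phi x = 0.

Lemma phi_continuous : continuous phi.
Proof. by move=> x; apply: differentiable_continuous; exact: (sphi [::]). Qed.

Lemma partial_continuous : continuous (partial i phi).
Proof. by move=> x; apply: differentiable_continuous; exact: (sphi [:: i]). Qed.

Lemma partial0 x : ~ K x -> partial i phi x = 0.
Proof.
move=> Kx; rewrite /partial -(derive_cst (0 : R) x (e_ i)).
apply: near_eq_derive => //.
have oK : open (~` K).
  by rewrite openC; apply: compact_closed => //; exact: norm_hausdorff.
have := open_nbhs_nbhs (conj oK Kx); apply: filterS => y Ky.
exact: phi0.
Qed.

Lemma is_derive_line (x : V) (t : R) :
  is_derive t (1 : R) (fun s => phi (x + s *: e_ i)) (partial i phi (x + t *: e_ i)).
Proof.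
have E : (fun h : R => h^-1 *: (((fun s => phi (x + s *: e_ i)) \o shift t) (h *: (1 : R)) - phi (x + t *: e_ i))) =
         (fun h : R => h^-1 *: ((phi \o shift (x + t *: e_ i)) (h *: e_ i) - phi (x + t *: e_ i))).
  apply/funext => h; rewrite /= /shift /=; congr (_ *: (phi _ - _)).
  by rewrite scalerDl addrCA /GRing.scale /= mulr1.
have dphi : derivable phi (x + t *: e_ i) (e_ i) by apply: diff_derivable; exact: (sphi [::]).
apply: DeriveDef; first by rewrite /derivable E.
by rewrite /partial /derive E.
Qed.

Lemma quotient_bound C h x : (forall z, `|partial i phi z| <= C) -> 0 < h ->
  `|phi (x - h *: e_ i) - phi x| <= C * h.
Proof.
move=> hC h0; have [|z _ e] := @MVT_segment R (fun s => phi ((x - h *: e_ i) + s *: e_ i))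
   (fun s => partial i phi ((x - h *: e_ i) + s *: e_ i)) 0 h (ltW h0) (fun s _ => is_derive_line _ s).
  apply: continuous_subspaceT => s; apply: differentiable_continuous.
  by apply/derivable1_diffP; have [] := is_derive_line (x - h *: e_ i) s.
move: e; rewrite scale0r addr0 subrK subr0 => e; rewrite distrC e normrM (gtr0_norm h0).
by rewrite ler_wpM2r// ltW.
Qed.

Lemma quotient_cvg x : k.+1%:R * (phi (x - k.+1%:R^-1 *: e_ i) - phi x) @[k --> \oo] --> - partial i phi x.
Proof.
have dphi : derivable phi x (e_ i) by apply: diff_derivable; exact: (sphi [::]).
have h0 (k : nat) : - k.+1%:R^-1 != 0 :> R by rewrite oppr_eq0 invr_eq0 pnatr_eq0.
have hc : - k.+1%:R^-1 @[k --> \oo] --> (0 : R).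
  by rewrite -oppr0; apply: cvgN; exact: cvg_harmonic.
have := dphi => /cvgr_dnbhsP/(_ (fun k => - k.+1%:R^-1) (conj h0 hc)) hl.
rewrite -/(partial i phi x) in hl.
rewrite (_ : (fun k => _) = (fun k => - ((- k.+1%:R^-1)^-1 *: ((phi \o shift x) (- k.+1%:R^-1 *: e_ i) - phi x)))).
  exact: (cvgN hl).
apply/funext => k; rewrite /= /shift /= invrN invrK scaleNr opprK [- _ *: _ + x]addrC scaleNr.
by [].
Qed.

Lemma partial_bounded : exists C, forall z, `|partial i phi z| <= C.
Proof.
have [C hC] := continuous_bounded (fun=> 0) (fun=> 1) partial_continuous.
exists (Num.max 0 C) => z; have [Kz|Kz] := pselect (K z).
  rewrite le_max; apply/orP; right; apply: hC => j; have /andP[/ltW -> /ltW ->] := subK Kz j.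
  by [].
by rewrite partial0// normr0 le_max lexx.
Qed.

End TestFunction.

(** The box (-1, 2)^n leaves room for translating a support inside the cube by up to 1 along an
    axis. *)
Let bl : 'I_n -> R := fun=> -1.
Let br : 'I_n -> R := fun=> 2.
Let blr j : bl j < br j. Proof. by rewrite /bl /br; lra. Qed.
Let B := toV @^-1` box bl br.
Let mB : measurable B := meas_box H bl br.

Let integrable_cont (u : V -> R) : continuous u -> mu.-integrable B (EFin \o (u \o toV)).
Proof.
move=> cu; have [C hC] := continuous_bounded (fun=> -1) (fun=> 2) cu.
apply: (integrable_bounded H blr (C := C)); first by apply: measurable_funTS; exact: (meas_continuous H).
by move=> p Bp; apply: hC => j; have /andP[/ltW -> /ltW ->] := Bp j.
Qed.

Lemma loc_integrable_bounded (g : V -> R) C : measurable_fun setT (g \o toV) ->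
  (forall x, (@cube R n) x -> `|g x| <= C) -> loc_integrable mu toV (@cube R n) g.
Proof.
move=> mg hC; split; first exact: measurable_funTS.
move=> K cK subK.
have lr01 (j : 'I_n) : (fun=> 0 : R) j < (fun=> 1 : R) j by [].
have i1 : mu.-integrable (toV @^-1` box (fun=> 0) (fun=> 1)) (EFin \o (g \o toV)).
  by apply: (integrable_bounded H lr01 (C := C)); [exact: measurable_funTS|move=> p; exact: hC].
apply: integrableS i1 => //; [exact: (meas_box H)| |by move=> p /subK].
rewrite -[toV @^-1` K]setCK; apply: measurableC; rewrite preimage_setC; apply: (meas_open H).
by rewrite openC; apply: compact_closed => //; exact: norm_hausdorff.
Qed.

(* The right difference quotients are eventually constant at every point; translation invariance
   moves them onto the test function and dominated convergence gives the limit. *)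
Theorem pwl_weak_deriv (g : V -> R) i : pwl g -> exists G : V -> R,
  [/\ weak_deriv mu toV (@cube R n) g (unit_mi i) G, measurable_fun setT (G \o toV) &
   forall x : V, exists2 dl, 0 < dl & forall t, 0 <= t <= dl -> g (x + t *: e_ i) = g x + G x * t].
Proof.
move=> [cg [L L0 lg] rg].
have hx (x : V) : exists s, exists2 dl, 0 < dl & forall t, 0 <= t <= dl -> g (x + t *: e_ i) = g x + s * t.
  by have [s [dl [d0 h]]] := rg x i; exists s, dl.
have [G hG] := choice hx.
pose u (k : nat) (x : V) := k.+1%:R * (g (x + k.+1%:R^-1 *: e_ i) - g x).
have k0 (k : nat) : 0 < k.+1%:R^-1 :> R by rewrite invr_gt0 ltr0n.
have uc k : continuous (u k).
  move=> x; apply: (@continuousM _ _ (fun=> k.+1%:R) (fun x : V => g (x + k.+1%:R^-1 *: e_ i) - g x)); first exact: cst_continuous.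
  apply: (@continuousB _ _ _ (fun x : V => g (x + k.+1%:R^-1 *: e_ i)) g); last exact: cg.
  apply: continuous_comp; last exact: cg.
  by apply: continuousD; [exact: cvg_id|exact: cst_continuous].
have uG x : u k x @[k --> \oo] --> G x.
  have [dl d0 h] := hG x; apply: cvg_near_cst.
  have hc : k.+1%:R^-1 @[k --> \oo] --> (0 : R) by exact: cvg_harmonic.
  have [m _ hm] := cvgr_lt _ hc _ d0; exists m => // k mk; have hk : k.+1%:R^-1 < dl := hm k mk.
  rewrite /u h ?(ltW (k0 k)) ?(ltW hk)// addrAC subrr add0r mulrCA mulfV ?mulr1//.
have uL k x : `|u k x| <= L.
  rewrite /u normrM ger0_norm// mulrC -ler_pdivlMr ?ltr0n//; apply: le_trans (lg _ _ _) _.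
  by rewrite ger0_norm// ltW.
have mG : measurable_fun setT (G \o toV).
  apply: (@measurable_fun_cvg _ _ _ setT (fun k => u k \o toV)) => //.
    by move=> k; exact: (meas_continuous H).
  by move=> p _; exact: uG.
have GL x : `|G x| <= L.
  apply: (ler_cvg_to (cvg_norm (uG x)) (cvg_cst L)).
  by apply: nearW => k; exact: uL.
exists G; split => //; split.
- have [C hC] := continuous_bounded (fun=> 0) (fun=> 1) cg.
  apply: (@loc_integrable_bounded _ C); first exact: (meas_continuous H).
  by move=> x cx; apply: hC => j; have /andP[/ltW -> /ltW ->] := cx j.
- exact: (@loc_integrable_bounded _ L).
move=> phi [sphi [K [cK subK phi0]]].
rewrite mderiv_unit.
have cphi := phi_continuous sphi; have cpp := partial_continuous (i := i) sphi.
have pp0 := partial0 i cK phi0.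
pose w (k : nat) (x : V) := k.+1%:R * (phi (x - k.+1%:R^-1 *: e_ i) - phi x).
have [C hC] := partial_bounded i sphi cK subK phi0.
have cph k : continuous (fun x : V => phi (x - k.+1%:R^-1 *: e_ i)).
  move=> x; apply: continuous_comp; last exact: cphi.
  by apply: continuousB; [exact: cvg_id|exact: cst_continuous].
have wc k : continuous (w k).
  move=> x; apply: (@continuousM _ _ (fun=> k.+1%:R) (fun x : V => phi (x - k.+1%:R^-1 *: e_ i) - phi x)); first exact: cst_continuous.
  by apply: (@continuousB _ _ _ (fun x : V => phi (x - k.+1%:R^-1 *: e_ i)) phi); [exact: cph|exact: cphi].
have wC k x : `|w k x| <= C.
  rewrite /w normrM ger0_norm// mulrC -ler_pdivlMr ?ltr0n//.
  exact: quotient_bound.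
have A1 : \int[mu]_(p in B) (phi (toV p) * u k (toV p)) @[k --> \oo] --> \int[mu]_(p in B) (phi (toV p) * G (toV p)).
  apply: (@Rintegral_dominated _ _ _ mu n toV H bl br (phi \o toV) (fun k => u k \o toV) (G \o toV) L).
  - exact: integrable_cont.
  - by move=> k; apply: measurable_funTS; exact: (meas_continuous H).
  - exact: measurable_funTS.
  - by move=> k p _; exact: uL.
  - by move=> p _; exact: uG.
have A2 : \int[mu]_(p in B) (g (toV p) * w k (toV p)) @[k --> \oo] --> \int[mu]_(p in B) (g (toV p) * - partial i phi (toV p)).
  apply: (@Rintegral_dominated _ _ _ mu n toV H bl br (g \o toV) (fun k => w k \o toV) (fun p => - partial i phi (toV p)) C).
  - exact: integrable_cont.
  - by move=> k; apply: measurable_funTS; exact: (meas_continuous H).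
  - by apply: measurable_funTS; apply: measurableT_comp => //; exact: (meas_continuous H).
  - by move=> k p _; exact: wC.
  - by move=> p _; exact: quotient_cvg.
have cube_B p : (@cube R n) (toV p) -> B p.
  by move=> cp j; have /andP[? ?] := cp j; rewrite /bl /br; apply/andP; split; lra.
have A12 k : \int[mu]_(p in B) (phi (toV p) * u k (toV p)) = \int[mu]_(p in B) (g (toV p) * w k (toV p)).
  set h := k.+1%:R^-1 : R.
  have [sh [msh shE hsh]] := leb_shift H i h.
  pose F1 (x : V) := k.+1%:R * (g (x + h *: e_ i) * phi x).
  pose F2 (x : V) := k.+1%:R * (g x * phi x).
  pose F3 (x : V) := k.+1%:R * (g x * phi (x - h *: e_ i)).
  have cM (f1 f2 : V -> R) : continuous f1 -> continuous f2 -> continuous (fun x : V => (k.+1%:R * (f1 x * f2 x) : R)).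
    move=> c1 c2 x; apply: (@continuousM _ _ (fun=> k.+1%:R) (fun x => f1 x * f2 x)); first exact: cst_continuous.
    by apply: (@continuousM _ _ f1 f2); [exact: c1|exact: c2].
  have c1 : continuous F1.
    apply: cM => // x; apply: continuous_comp; last exact: cg.
    by apply: continuousD; [exact: cvg_id|exact: cst_continuous].
  have c2 : continuous F2 by exact: cM.
  have c3 : continuous F3 by apply: cM => //; exact: cph.
  have e1 : \int[mu]_(p in B) F1 (toV p) = \int[mu]_(p in B) F3 (toV p).
    have s1 : \int[mu]_(p in B) F1 (toV p) = \int[mu]_p F1 (toV p).
      apply: Rintegral_support => //; last by move=> p [].
      move=> p nB; rewrite /F1 phi0 ?mulr0// => Kp; apply: nB; apply: cube_B; exact: subK.
    have s3 : \int[mu]_(p in B) F3 (toV p) = \int[mu]_p F3 (toV p).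
      apply: Rintegral_support => //; last by move=> p [].
      move=> p nB; rewrite /F3 phi0 ?mulr0// => Kp; apply: nB => j.
      have /andP[] := subK _ Kp j; rewrite !mxE eqxx /=.
      have h1 : h <= 1 by rewrite invf_le1 ?ler1n// ltr0n.
      have := k0 k; rewrite -/h /bl /br; case: (j == i) => /=; rewrite ?mulr1 ?mulr0 => ? ? ?; apply/andP; split; lra.
    rewrite s1 s3 -(@Rintegral_shift i h (F3 \o toV) sh)//; last exact: (meas_continuous H).
    by apply: eq_Rintegral => p _; rewrite /F1 /F3 /= shE addrK.
  have -> : \int[mu]_(p in B) (phi (toV p) * u k (toV p)) = \int[mu]_(p in B) (F1 (toV p) - F2 (toV p)).
    by apply: eq_Rintegral => p _; rewrite /F1 /F2 /u -/h; ring.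
  have -> : \int[mu]_(p in B) (g (toV p) * w k (toV p)) = \int[mu]_(p in B) (F3 (toV p) - F2 (toV p)).
    by apply: eq_Rintegral => p _; rewrite /F3 /F2 /w -/h; ring.
  rewrite !RintegralB// ?e1//; exact: integrable_cont.
have key : \int[mu]_(p in B) (phi (toV p) * G (toV p)) = \int[mu]_(p in B) (g (toV p) * - partial i phi (toV p)).
  apply: (@cvg_unique _ (@Rhausdorff R) _ _ _ _ A1).
  by rewrite (_ : (fun k => _) = (fun k => \int[mu]_(p in B) (g (toV p) * w k (toV p)))) //; apply/funext => k; exact: A12.
have mcube : measurable (toV @^-1` @cube R n) := meas_box H (fun=> 0) (fun=> 1).
have toB (F : V -> R) C' : measurable_fun setT (F \o toV) -> (forall x, `|F x| <= C') -> (forall x, ~ K x -> F x = 0) ->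
    integ mu toV (@cube R n) F = (\int[mu]_(p in B) F (toV p))%:E.
  move=> mF hF F0.
  have iF : mu.-integrable B (EFin \o (F \o toV)).
    by apply: (integrable_bounded H blr (C := C')); [exact: measurable_funTS|move=> p _; exact: hF].
  have iFc : mu.-integrable (toV @^-1` @cube R n) (EFin \o (F \o toV)) by apply: integrableS iF => // p; exact: cube_B.
  rewrite -(@Rintegral_support (toV @^-1` @cube R n) B (F \o toV))//.
  - by rewrite /integ /Rintegral fineK//; exact: integrable_fin_num.
  - by move=> p ncp; apply: F0 => Kp; apply: ncp; exact: subK.
  - by move=> p nBp; apply: F0 => Kp; apply: nBp; apply: cube_B; exact: subK.
have [Cp hCp] : exists C', forall x, `|phi x| <= C'.
  have [C' hC'] := continuous_bounded (fun=> 0) (fun=> 1) cphi.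
  exists (Num.max 0 C') => z; have [Kz|Kz] := pselect (K z).
    by rewrite le_max; apply/orP; right; apply: hC' => j; have /andP[/ltW -> /ltW ->] := subK _ Kz j.
  by rewrite phi0// normr0 le_max lexx.
have [Cg hCg] := continuous_bounded (fun=> 0) (fun=> 1) cg.
have C0 : 0 <= C by apply: le_trans (hC 0).
rewrite (toB (fun x => g x * partial i phi x) (Num.max 0 Cg * C)); last first.
- by move=> x Kx; rewrite pp0// mulr0.
- move=> x; have [Kz|Kz] := pselect (K x); last by rewrite pp0// mulr0 normr0 mulr_ge0// le_max lexx.
  rewrite normrM; apply: ler_pM => //; rewrite le_max; apply/orP; right; apply: hCg => j.
  by have /andP[/ltW -> /ltW ->] := subK _ Kz j.
- by apply: (meas_continuous H) => x; apply: (@continuousM _ _ g (partial i phi)); [exact: cg|exact: cpp].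
rewrite (toB (fun x => G x * phi x) (L * Cp)); last first.
- by move=> x Kx; rewrite phi0// mulr0.
- by move=> x; rewrite normrM; apply: ler_pM.
- by apply: measurable_funM => //; exact: (meas_continuous H).
have -> : mabs (unit_mi i) = 1%N.
  by rewrite /mabs (bigD1 i)//= big1 ?addn0 /unit_mi ?eqxx// => j /negPf ->.
rewrite expr1 -EFinM; congr EFin; rewrite mulN1r.
have -> : \int[mu]_(p in B) (G (toV p) * phi (toV p)) = \int[mu]_(p in B) (phi (toV p) * G (toV p)).
  by apply: eq_Rintegral => p _; rewrite mulrC.
rewrite key.
have -> : \int[mu]_(p in B) (g (toV p) * - partial i phi (toV p)) = \int[mu]_(p in B) (-1 * (g (toV p) * partial i phi (toV p))).
  by apply: eq_Rintegral => p _; ring.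
rewrite RintegralZl// ?mulN1r ?opprK//.
apply: (@integrable_cont (fun x => g x * partial i phi x)) => x.
by apply: (@continuousM _ _ g (partial i phi)); [exact: cg|exact: cpp].
Qed.

End WeakDerivative.

(** * Gluing on a geometric mesh *)

Section Mesh.
Context {R : realType}.
Variables (s : R) (l : nat).
Hypothesis s0 : 0 < s.
Hypothesis s1 : s < 1.

Definition tk k : R := s ^+ k.
Definition ramp k (y : R) : R := Num.max 0 (Num.min 1 ((y - tk k.+1) / (tk k - tk k.+1))).
(** [step] increases with k and is forced to be 1 at k = l. Its successive differences [hat_k] are
    therefore nonnegative with sum 1, and the last one covers everything below t_l. *)
Definition step k y : R := if (k < l)%N then ramp k y else 1.
Definition hat_k k y : R := step k y - (if k is k'.+1 then step k' y else 0).

Lemma tk_gt0 k : 0 < tk k. Proof. exact: exprn_gt0. Qed.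
Lemma tkS k : tk k.+1 = s * tk k. Proof. by rewrite /tk exprS. Qed.
Lemma tk_lt k : tk k.+1 < tk k. Proof. by rewrite tkS gtr_pMl// tk_gt0. Qed.
Lemma tk_le j k : (j <= k)%N -> tk k <= tk j.
Proof. by move=> jk; apply: ler_wiXn2l => //; exact: ltW. Qed.
Lemma tk_le1 k : tk k <= 1. Proof. by rewrite -[leRHS](expr0 s); exact: (@tk_le 0). Qed.
Lemma tk_ltP j k : tk k < tk j -> (j < k)%N.
Proof. by move=> h; rewrite ltnNge; apply/negP => /tk_le; rewrite leNgt h. Qed.
Lemma tk_gap k : (k <= l)%N -> (1 - s) * tk l <= tk k - tk k.+1.
Proof. by move=> kl; rewrite tkS -{1}[tk k]mul1r -mulrBl ler_wpM2l ?subr_ge0 ?(ltW s1)// tk_le. Qed.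

Lemma ramp01 k y : 0 <= ramp k y <= 1.
Proof. by rewrite /ramp le_max lexx /= ge_max ler01 ge_min lexx. Qed.

Lemma ramp0 k y : y <= tk k.+1 -> ramp k y = 0.
Proof.
move=> h; rewrite /ramp max_l// ge_min; apply/orP; right.
by rewrite pmulr_lle0 ?invr_gt0 ?subr_gt0 ?tk_lt// subr_le0.
Qed.

Lemma ramp1 k y : tk k <= y -> ramp k y = 1.
Proof.
move=> h; rewrite /ramp min_l ?max_r//.
by rewrite ler_pdivlMr ?subr_gt0 ?tk_lt// mul1r lerD2r.
Qed.

Lemma step01 k y : 0 <= step k y <= 1.
Proof. by rewrite /step; case: ifP => _; rewrite ?ramp01// ler01 lexx. Qed.

Lemma step_mono k y : step k y <= step k.+1 y.
Proof.
rewrite /step; case: (ltnP k.+1 l) => [h|h]; last by case: ifP => // _; have /andP[] := ramp01 k y.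
rewrite (ltn_trans (ltnSn k) h); have [yt|yt] := leP y (tk k.+1).
  by rewrite ramp0//; have /andP[] := ramp01 k.+1 y.
by rewrite (ramp1 (ltW yt)); have /andP[] := ramp01 k y.
Qed.

Lemma hat_k01 k y : 0 <= hat_k k y <= 1.
Proof.
rewrite /hat_k; case: k => [|k]; first by rewrite subr0 step01.
rewrite subr_ge0 step_mono/=.
by have /andP[a _] := step01 k y; have /andP[_ b] := step01 k.+1 y; lra.
Qed.

Lemma sum_hat_k y : \sum_(k < l.+1) hat_k k y = 1.
Proof.
have H m : \sum_(k < m.+1) hat_k k y = step m y.
  elim: m => [|m IH]; first by rewrite big_ord_recr big_ord0/= add0r /hat_k subr0.
  by rewrite big_ord_recr/= IH /hat_k addrC subrK.
by rewrite H /step ltnn.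
Qed.

Lemma hat_k_support k y : (k <= l)%N -> hat_k k y != 0 -> (k = l \/ tk k.+1 < y) /\ (k = 0%N \/ y < tk k.-1).
Proof.
move=> kl hk; split.
  have [->|kl'] := eqVneq k l; [by left|right; rewrite ltNge; apply/negP => yk].
  have kl2 : (k < l)%N by rewrite ltn_neqAle kl'.
  move/eqP: hk; apply; have := hat_k01 k y; rewrite {1 2}/hat_k {1}/step kl2 ramp0// => /andP[h1 _].
  apply/eqP; rewrite eq_le; have /andP[-> _] := hat_k01 k y; rewrite andbT.
  rewrite /hat_k /step kl2 ramp0//; case: (k) => [|k']; first by rewrite subrr.
  by rewrite sub0r oppr_le0; case: ifP => // _; have /andP[] := ramp01 k' y.
case: k kl hk => [|k] kl hk; [by left|right; rewrite ltNge; apply/negP => yk].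
move/eqP: hk; apply; rewrite /hat_k [step k y]/step kl (ramp1 yk) /step.
by case: ifP => // _; rewrite ?ramp1 ?subrr// (le_trans (ltW (tk_lt k)) yk).
Qed.

Lemma hat_k_cell j k y : (j < l)%N -> (k <= l)%N -> tk j.+1 <= y <= tk j -> hat_k k y != 0 -> (j <= k <= j.+1)%N.
Proof.
move=> jl kl /andP[y1 y2] /(hat_k_support kl)[h1 h2]; apply/andP; split.
  by case: h1 => [->|h]; [exact: ltnW|rewrite -ltnS; apply: tk_ltP; exact: lt_le_trans h y2].
case: h2 => [->//|h]; have := tk_ltP (le_lt_trans y1 h).
by case: (k) => //= k'.
Qed.

Lemma clamp_lip (a b u v : R) : `|Num.max a (Num.min b u) - Num.max a (Num.min b v)| <= `|u - v|.
Proof.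
have key p q : p <= q -> `|Num.max a (Num.min b p) - Num.max a (Num.min b q)| <= `|p - q|.
  move=> pq; rewrite !(distrC _ (Num.max a (Num.min b q))) (distrC p) [leRHS]ger0_norm ?subr_ge0//.
  have [h1|h1] := leP b p; have [h2|h2] := leP b q; try lra.
  + by have [g|g] := leP a b; rewrite subrr normr0 subr_ge0.
  + by have [g1|g1] := leP a b; have [g2|g2] := leP a p; rewrite ler_norml; apply/andP; split; lra.
  + by have [g1|g1] := leP a q; have [g2|g2] := leP a p; rewrite ler_norml; apply/andP; split; lra.
by have [uv|/ltW uv] := leP u v; [exact: key|rewrite distrC (distrC u); exact: key].
Qed.

Lemma ramp_lip k y z : (k <= l)%N -> `|ramp k y - ramp k z| <= ((1 - s) * tk l)^-1 * `|y - z|.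
Proof.
move=> kl; have g0 : 0 < tk k - tk k.+1 by rewrite subr_gt0 tk_lt.
have g1 : 0 < (1 - s) * tk l by rewrite mulr_gt0 ?subr_gt0 ?tk_gt0.
apply: le_trans (clamp_lip _ _ _ _) _.
rewrite -mulrBl opprB addrA subrK normrM [`|_^-1|]ger0_norm ?invr_ge0 ?(ltW g0)// mulrC.
by rewrite ler_wpM2r// lef_pV2// tk_gap.
Qed.

Lemma hat_k_lip k y z : (k <= l)%N -> `|hat_k k y - hat_k k z| <= 2 * ((1 - s) * tk l)^-1 * `|y - z|.
Proof.
move=> kl; set S := ((1 - s) * tk l)^-1.
have S0 : 0 <= S by rewrite invr_ge0 mulr_ge0 ?subr_ge0 ?(ltW s1)// ltW// tk_gt0.
have st m : `|step m y - step m z| <= S * `|y - z|.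
  rewrite /step; case: ifP => [/ltnW ml|_]; first exact: ramp_lip.
  by rewrite subrr normr0 mulr_ge0.
rewrite /hat_k; have h := st k; case: (k) h => [|m] h.
  by rewrite !subr0 -mulrA; have h0 := mulr_ge0 S0 (normr_ge0 (y - z)); lra.
rewrite opprB addrACA addrA; have h2 := st m.
rewrite (_ : _ + _ - _ = (step m.+1 y - step m.+1 z) - (step m y - step m z)); last by ring.
by apply: le_trans (ler_normB _ _) _; rewrite -mulrA; lra.
Qed.

End Mesh.

Section BoxPolynomials.
Context {R : realType} {n : nat}.
Local Notation V := 'rV[R]_n.
Local Notation e_ i := (delta_mx 0 i : V).

Definition sc (l r : 'I_n -> R) (i : 'I_n) (u : R) : R := (u - l i) / (r i - l i).

Definition polyV (l r : 'I_n -> R) N (k : {ffun 'I_n -> 'I_N} -> R) (x : V) : R :=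
  \sum_g k g * \prod_i sc l r i (x 0 i) ^+ g i.

Definition dpolyV (l r : 'I_n -> R) N (k : {ffun 'I_n -> 'I_N} -> R) (i : 'I_n) (x : V) : R :=
  \sum_g k g * (r i - l i)^-1 * \prod_j (if j == i then deriv 'X^(g j) else 'X^(g j)).[sc l r j (x 0 j)].

Lemma continuous_bigsum (I : Type) (t : seq I) (F : I -> V -> R) : (forall i, continuous (F i)) ->
  continuous (fun x => \sum_(i <- t) F i x).
Proof.
move=> cF; elim: t => [|i t IH].
  by rewrite (_ : (fun _ => _) = (fun=> 0)); [move=> x; exact: cst_continuous|apply/funext => x; rewrite big_nil].
rewrite (_ : (fun _ => _) = (fun x => F i x + \sum_(j <- t) F j x)); last by apply/funext => x; rewrite big_cons.
by move=> x; apply: (@continuousD _ _ _ (F i) (fun x => \sum_(j <- t) F j x)); [exact: cF|exact: IH].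
Qed.

Lemma continuous_bigprod (I : Type) (t : seq I) (F : I -> V -> R) : (forall i, continuous (F i)) ->
  continuous (fun x => \prod_(i <- t) F i x).
Proof.
move=> cF; elim: t => [|i t IH].
  by rewrite (_ : (fun _ => _) = (fun=> 1)); [move=> x; exact: cst_continuous|apply/funext => x; rewrite big_nil].
rewrite (_ : (fun _ => _) = (fun x => F i x * \prod_(j <- t) F j x)); last by apply/funext => x; rewrite big_cons.
by move=> x; apply: (@continuousM _ _ (F i) (fun x => \prod_(j <- t) F j x)); [exact: cF|exact: IH].
Qed.

Lemma continuous_horner_sc l r i (q : {poly R}) : continuous (fun x : V => q.[sc l r i (x 0 i)]).
Proof.
move=> x; apply: (@continuous_comp _ _ _ (fun x : V => sc l r i (x 0 i)) (fun u => q.[u])); last exact: continuous_horner.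
apply: (@continuousM _ _ (fun x : V => x 0 i - l i) (fun=> (r i - l i)^-1)); last exact: cst_continuous.
by apply: (@continuousB _ _ _ (fun x : V => x 0 i) (fun=> l i)); [exact: coord_continuous|exact: cst_continuous].
Qed.

Lemma polyV_continuous l r N (k : {ffun 'I_n -> 'I_N} -> R) : continuous (polyV l r k).
Proof.
apply: (@continuous_bigsum _ (index_enum _) (fun g x => k g * \prod_i sc l r i (x 0 i) ^+ g i)) => g x.
apply: (@continuousM _ _ (fun=> k g)); first exact: cst_continuous.
apply: (@continuous_bigprod _ (index_enum _) (fun i x => sc l r i (x 0 i) ^+ g i)) => i.
rewrite (_ : (fun _ => _) = (fun x : V => ('X^(g i)).[sc l r i (x 0 i)])); first exact: continuous_horner_sc.
by apply/funext => y; rewrite hornerXn.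
Qed.

Lemma dpolyV_continuous l r N (k : {ffun 'I_n -> 'I_N} -> R) i : continuous (dpolyV l r k i).
Proof.
apply: (@continuous_bigsum _ (index_enum _) (fun g x => k g * (r i - l i)^-1 *
   \prod_j (if j == i then deriv 'X^(g j) else 'X^(g j)).[sc l r j (x 0 j)])) => g x.
apply: (@continuousM _ _ (fun=> k g * (r i - l i)^-1)); first exact: cst_continuous.
apply: (@continuous_bigprod _ (index_enum _) (fun j x => (if j == i then deriv 'X^(g j) else 'X^(g j)).[sc l r j (x 0 j)])) => j.
exact: continuous_horner_sc.
Qed.

Lemma is_derive_polyV l r N (k : {ffun 'I_n -> 'I_N} -> R) i (x : V) (t : R) :
  is_derive t (1 : R) (fun u => polyV l r k (x + u *: e_ i)) (dpolyV l r k i (x + t *: e_ i)).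
Proof.
have hx (u : R) j : (x + u *: e_ i) 0 j = x 0 j + (if j == i then u else 0).
  by rewrite !mxE eqxx /=; case: (j == i); rewrite ?mulr1 ?mulr0.
have hg (g : {ffun 'I_n -> 'I_N}) : is_derive t (1 : R) (fun u => k g * \prod_j sc l r j ((x + u *: e_ i) 0 j) ^+ g j)
   (k g * (r i - l i)^-1 * \prod_j (if j == i then deriv 'X^(g j) else 'X^(g j)).[sc l r j ((x + t *: e_ i) 0 j)]).
  pose cst := k g * \prod_(j | j != i) sc l r j (x 0 j) ^+ g j.
  have E : (fun u => k g * \prod_j sc l r j ((x + u *: e_ i) 0 j) ^+ g j) =
      (fun u => (cst *: ('X^(g i) \Po ((r i - l i)^-1 *: 'X + (sc l r i (x 0 i))%:P))).[u]).
    apply/funext => u; rewrite (bigD1 i)//= hx eqxx hornerZ horner_comp hornerD hornerZ hornerX hornerC hornerXn /cst.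
    have -> : \prod_(j < n | j != i) sc l r j ((x + u *: e_ i) 0 j) ^+ g j = \prod_(j | j != i) sc l r j (x 0 j) ^+ g j.
      by apply: eq_bigr => j /negPf ji; rewrite hx ji addr0.
    have -> : sc l r i (x 0 i + u) = (r i - l i)^-1 * u + sc l r i (x 0 i) by rewrite /sc; ring.
    by rewrite /= mulrA mulrAC.
  rewrite E; have := is_derive_poly (cst *: ('X^(g i) \Po ((r i - l i)^-1 *: 'X + (sc l r i (x 0 i))%:P))) t.
  move=> D; apply: is_derive_eq; rewrite (bigD1 i)//= hx eqxx derivZ deriv_comp derivD derivZ derivX derivC addr0.
  rewrite !hornerE horner_comp !hornerE /cst.
  have -> : \prod_(j < n | j != i) (if j == i then deriv 'X^(g j) else 'X^(g j)).[sc l r j ((x + t *: e_ i) 0 j)] =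
     \prod_(j | j != i) sc l r j (x 0 j) ^+ g j.
    by apply: eq_bigr => j /negPf ji; rewrite ji hx ji addr0 hornerXn.
  have -> : (r i - l i)^-1 * t + sc l r i (x 0 i) = sc l r i (x 0 i + t) by rewrite /sc; ring.
  by rewrite /= mulr1; move: (deriv _).[_] (\prod_(_ | _) _) => A B; ring.
rewrite /polyV /dpolyV; elim: (index_enum _) => [|g s IH].
  rewrite big_nil (_ : (fun _ => _) = cst 0); first exact: is_derive_cst.
  by apply/funext => u; rewrite big_nil.
rewrite big_cons (_ : (fun _ => _) = (fun u => k g * \prod_j sc l r j ((x + u *: e_ i) 0 j) ^+ g j) +
   (fun u => \sum_(g <- s) k g * \prod_j sc l r j ((x + u *: e_ i) 0 j) ^+ g j)).
  exact: is_deriveD.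
by apply/funext => u; rewrite big_cons.
Qed.

End BoxPolynomials.

Section Everywhere.
Context {R : realType} {d : measure_display} {P : measurableType d}.
Variables (mu : {measure set P -> \bar R}) (n : nat) (toV : P -> 'rV[R]_n.+2).
Hypothesis H : leb_like mu toV.
Local Notation V := 'rV[R]_n.+2.

(** Near any point of the closed box there is a small open box of positive measure inside it.
    Estimates of patch polynomials obtained through f, almost everywhere, thus hold at all points,
    as difference quotients along lines demand. *)
Lemma le_everywhere (l r : 'I_n.+2 -> R) (F : V -> R) C : (forall i, l i < r i) -> continuous F ->
  (\forall p \ae mu, (toV @^-1` box l r) p -> F (toV p) <= C) ->
  forall x : V, (forall i, l i <= x 0 i <= r i) -> F x <= C.
Proof.
move=> lr cF hF x hx; rewrite leNgt; apply/negP => Cx.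
have : nbhs x [set z | C < F z].
  have oC : nbhs (F x) [set u | C < u] by apply: open_nbhs_nbhs; split=> //; exact: open_gt.
  exact: cF oC.
move=> /nbhs_ballP[dl /= d0 hd].
pose l' i := Num.max (l i) (x 0 i - dl / 2); pose r' i := Num.min (r i) (x 0 i + dl / 2).
have d2 : 0 < dl / 2 by rewrite divr_gt0.
have lr' i : l' i < r' i.
  have /andP[h1 h2] := hx i; have h3 := lr i.
  by rewrite gt_max !lt_min h3 /=; apply/and3P; split; lra.
have [p Bp hp] := ae_box_ex H lr' hF.
have Bl : (toV @^-1` box l r) p.
  move=> i; have := Bp i; rewrite gt_max lt_min => /andP[/andP[h1 _] /andP[h2 _]].
  by rewrite h1 h2.
have := hp Bl; apply/negP; rewrite -ltNge; apply: hd; split=> // i0 i; rewrite (ord1 i0).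
have := Bp i; rewrite gt_max lt_min => /andP[/andP[_ h1] /andP[_ h2]].
by rewrite /ball /= ltr_distlC; apply/andP; split; lra.
Qed.

End Everywhere.

(** * The glued approximant and its slopes *)

Section Cells.
Context {R : realType} {d : measure_display} {P : measurableType d}.
Variables (mu : {measure set P -> \bar R}) (n : nat) (toV : P -> 'rV[R]_n.+2).
Hypothesis H : leb_like mu toV.
Local Notation V := 'rV[R]_n.+2.
Local Notation e_ i := (delta_mx 0 i : V).
Variables (c : V) (f : V -> R) (Df : 'I_n.+2 -> V -> R) (de Cr : R).
Hypothesis cc : is_corner c.
Hypothesis de01 : 0 < de <= 4^-1.
Hypothesis Cr0 : 0 < Cr.
Local Notation y := (cdist c).
Hypothesis hreg : \forall p \ae mu, cube (toV p) ->
  `|f (toV p)| <= Cr /\ forall i, `|Df i (toV p)| <= Cr * mid (y (toV p)) `^ (de - 1).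
Variables (s : R) (l M : nat).
Hypothesis s0 : 0 < s.
Hypothesis s1 : s < 1.
Hypothesis l0 : (0 < l)%N.
Local Notation t_ := (tk s).
Local Notation K := {ffun 'I_n.+2 -> 'I_l.+1}.
Local Notation J := {ffun 'I_n.+2 -> 'I_l}.
Variable kk : K -> {ffun 'I_n.+2 -> 'I_M} -> R.

(** A patch is the support of its hat, two cells wide. For index 0 the convention [0.-1 = 0] gives
    the upper end t_0 = 1. *)
Definition up (k : K) i : R := t_ (k i).+1.
Definition vp (k : K) i : R := t_ (k i).-1.
Definition pl k := xl c (up k) (vp k).
Definition pr k := xr c (up k) (vp k).
Definition Pk k := polyV (pl k) (pr k) (kk k).
Definition dPk k := dpolyV (pl k) (pr k) (kk k).

Variable e1 : R.
Hypothesis e10 : 0 < e1.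
Hypothesis hP : forall k, \forall p \ae mu, (toV @^-1` box (pl k) (pr k)) p -> `|f (toV p) - Pk k (toV p)| <= e1.
Hypothesis hdP : forall k i, \forall p \ae mu, (toV @^-1` box (pl k) (pr k)) p -> `|Df i (toV p) - dPk k i (toV p)| <= e1.

Definition uj (j : J) i : R := t_ (j i).+1.
Definition vj (j : J) i : R := t_ (j i).
Definition cl j := xl c (uj j) (vj j).
Definition cr j := xr c (uj j) (vj j).
Definition incell j (x : V) := forall i, cl j i <= x 0 i <= cr j i.
Definition nb (k : K) (j : J) := forall i, (j i <= k i <= (j i).+1)%N.
Definition Kj (j : J) : K := [ffun i => widen_ord (leqnSn l) (j i)].

Lemma nb_Kj j : nb (Kj j) j.
Proof. by move=> i; rewrite ffunE /= leqnn leqnSn. Qed.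

Lemma cl_lt j i : cl j i < cr j i.
Proof. by apply: xl_lt_xr => i'; exact: tk_lt. Qed.

Lemma cell_sub k j : nb k j -> box (cl j) (cr j) `<=` box (pl k) (pr k).
Proof.
move=> kj x bx i; have /andP[b1 b2] := bx i; have /andP[k1 k2] := kj i.
have h1 : t_ (k i).+1 <= t_ (j i).+1 by apply: tk_le => //.
have h2 : t_ (j i) <= t_ (k i).-1 by apply: tk_le => //; case: (k i : nat) k2.
move: b1 b2; rewrite /cl /cr /pl /pr /xl /xr /up /vp /uj /vj; case: ifP => _ b1 b2; apply/andP; split; lra.
Qed.

Lemma cell_cube j x : box (cl j) (cr j) x -> cube x /\ forall i, t_ (j i).+1 < y x i.
Proof.
move=> bx; have [|i|cx hx] := ybox_in cc _ _ bx.
- by move=> i; apply/ltW/tk_gt0.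
- exact: tk_le1.
by split=> // i; have /andP[] := hx i.
Qed.

Lemma abs_everywhere j (F G : V -> R) C : continuous F -> continuous G ->
  (\forall p \ae mu, (toV @^-1` box (cl j) (cr j)) p -> `|F (toV p) - G (toV p)| <= C) ->
  forall x, incell j x -> `|F x - G x| <= C.
Proof.
move=> cF cG h x; apply: (le_everywhere H (F := fun x => `|F x - G x|) (cl_lt j)) => // z.
apply: (@continuous_comp _ _ _ (fun z => F z - G z) (fun u : R => `|u|)); last exact: norm_continuous.
by apply: (@continuousB _ _ _ F G); [exact: cF|exact: cG].
Qed.

Lemma P_close k k' j x : nb k j -> nb k' j -> incell j x -> `|Pk k x - Pk k' x| <= 2 * e1.
Proof.
move=> kj kj'; apply: (@abs_everywhere j (Pk k) (Pk k')); [exact: polyV_continuous|exact: polyV_continuous|].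
apply: filterS2 (hP k) (hP k') => p h1 h2 Bp.
have := h1 (cell_sub kj Bp); have := h2 (cell_sub kj' Bp) => a b.
rewrite (_ : _ - _ = (f (toV p) - Pk k' (toV p)) - (f (toV p) - Pk k (toV p))); last by ring.
by apply: le_trans (ler_normB _ _) _; rewrite mulr_natl mulr2n lerD.
Qed.

Lemma dP_close k k' j i x : nb k j -> nb k' j -> incell j x -> `|dPk k i x - dPk k' i x| <= 2 * e1.
Proof.
move=> kj kj'; apply: (@abs_everywhere j (dPk k i) (dPk k' i)); [exact: dpolyV_continuous|exact: dpolyV_continuous|].
apply: filterS2 (hdP k i) (hdP k' i) => p h1 h2 Bp.
have := h1 (cell_sub kj Bp); have := h2 (cell_sub kj' Bp) => a b.
rewrite (_ : _ - _ = (Df i (toV p) - dPk k' i (toV p)) - (Df i (toV p) - dPk k i (toV p))); last by ring.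
by apply: le_trans (ler_normB _ _) _; rewrite mulr_natl mulr2n lerD.
Qed.

Lemma P_bound k j x : nb k j -> incell j x -> `|Pk k x| <= Cr + e1.
Proof.
move=> kj; rewrite -[Pk k x]subr0; apply: (@abs_everywhere j (Pk k) (fun=> 0)); first exact: polyV_continuous.
  by move=> z; exact: cst_continuous.
apply: filterS2 (hP k) hreg => p h1 h2 Bp; rewrite subr0.
have a := h1 (cell_sub kj Bp); have [b _] := h2 (cell_cube Bp).1.
have := ler_normB (f (toV p)) (f (toV p) - Pk k (toV p)); rewrite opprB addrC subrK => g.
by apply: le_trans g _; exact: lerD.
Qed.

Definition Ga j : R := Cr * mid (uj j) `^ (de - 1) + e1.

Lemma uj01 j i : 0 < uj j i <= 1.
Proof. by rewrite tk_gt0//= tk_le1. Qed.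

Lemma dP_bound k j i x : nb k j -> incell j x -> `|dPk k i x| <= Ga j.
Proof.
move=> kj; rewrite -[dPk k i x]subr0; apply: (@abs_everywhere j (dPk k i) (fun=> 0)); first exact: dpolyV_continuous.
  by move=> z; exact: cst_continuous.
apply: filterS2 (hdP k i) hreg => p h1 h2 Bp; rewrite subr0.
have a := h1 (cell_sub kj Bp); have [cx hx] := cell_cube Bp; have [_ /(_ i) b] := h2 cx.
have := ler_normB (Df i (toV p)) (Df i (toV p) - dPk k i (toV p)); rewrite opprB addrC subrK => g.
apply: le_trans g _; apply: lerD => //; apply: le_trans b _; rewrite ler_pM2l//.
have m0 : 0 < mid (uj j) by apply: mid_gt0 => i'; have /andP[] := uj01 j i'.
have mm : mid (uj j) <= mid (y (toV p)).
  by apply: le_mid => i'; [have /andP[/ltW] := uj01 j i'|have /andP[] := uj01 j i'|exact/ltW/hx].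
have m0' := lt_le_trans m0 mm; have /andP[d0 d1] := de01.
rewrite !powR_expR// ler_expR.
have ll : ln (mid (uj j)) <= ln (mid (y (toV p))) by rewrite ler_ln.
by nra.
Qed.

Lemma line_cell j i x t u : incell j x -> incell j (x + t *: e_ i) -> 0 <= u <= t -> incell j (x + u *: e_ i).
Proof.
move=> hx ht /andP[u0 ut] i'; have := hx i'; have := ht i'; rewrite !mxE eqxx /=.
by case: (i' == i) => /=; rewrite ?mulr1 ?mulr0 ?addr0// => /andP[? ?] /andP[? ?]; apply/andP; split; lra.
Qed.

Lemma line_mvt (F : V -> R) (dF : V -> R) i x t C : 0 <= t ->
  (forall u, is_derive u (1 : R) (fun v => F (x + v *: e_ i)) (dF (x + u *: e_ i))) ->
  (forall u, 0 <= u <= t -> `|dF (x + u *: e_ i)| <= C) ->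
  `|F (x + t *: e_ i) - F x| <= C * t.
Proof.
move=> t0 hF hC; have [|u] := @MVT_segment R (fun v => F (x + v *: e_ i)) (fun u => dF (x + u *: e_ i)) 0 t t0 (fun u _ => hF u).
  apply: continuous_subspaceT => u; apply: differentiable_continuous.
  by apply/derivable1_diffP; have [] := hF u.
rewrite in_itv /= => hu e; move: e; rewrite scale0r addr0 subr0 => ->.
by rewrite normrM (ger0_norm t0) ler_wpM2r// hC.
Qed.

Lemma P_incr k j i x t : nb k j -> 0 <= t -> incell j x -> incell j (x + t *: e_ i) ->
  `|Pk k (x + t *: e_ i) - Pk k x| <= Ga j * t.
Proof.
move=> kj t0 hx ht; apply: (line_mvt (dF := dPk k i)) => // [u|u hu]; first exact: is_derive_polyV.
by apply: dP_bound kj _; exact: line_cell hx ht hu.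
Qed.

Lemma PP_incr k k' j i x t : nb k j -> nb k' j -> 0 <= t -> incell j x -> incell j (x + t *: e_ i) ->
  `|(Pk k (x + t *: e_ i) - Pk k' (x + t *: e_ i)) - (Pk k x - Pk k' x)| <= 2 * e1 * t.
Proof.
move=> kj kj' t0 hx ht; apply: (line_mvt (F := fun x => Pk k x - Pk k' x) (dF := fun x => dPk k i x - dPk k' i x)) => // [u|u hu].
  exact: (is_deriveB (is_derive_polyV _ _ _ _ _ _) (is_derive_polyV _ _ _ _ _ _)).
by apply: dP_close kj kj' _; exact: line_cell hx ht hu.
Qed.

Definition zc (i : 'I_n.+2) (u : R) : R := if c 0 i == 0 then u else 1 - u.
Definition ph (k : K) (x : V) : R := \prod_i hat_k s l (k i) (zc i (x 0 i)).
Definition u0 (x : V) : R := \sum_k ph k x * Pk k x.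

Lemma ph_factor01 k i u : 0 <= hat_k s l k (zc i u) <= 1. Proof. exact: hat_k01. Qed.

Lemma ph01 k x : 0 <= ph k x <= 1.
Proof.
apply: (big_ind (fun z => 0 <= z <= 1)); [by rewrite ler01 lexx| |by move=> i _; exact: ph_factor01].
by move=> a b /andP[? ?] /andP[? ?]; rewrite mulr_ge0//= mulr_ile1.
Qed.

Lemma sum_ph x : \sum_k ph k x = 1.
Proof.
rewrite -(bigA_distr_bigA (fun i (k : 'I_l.+1) => hat_k s l k (zc i (x 0 i)))) /=.
by rewrite big1// => i _; exact: sum_hat_k.
Qed.

Lemma incell_z j x i : incell j x -> t_ (j i).+1 <= zc i (x 0 i) <= t_ (j i).
Proof.
move=> /(_ i); rewrite /cl /cr /xl /xr /uj /vj /zc; case: ifP => _ // /andP[? ?].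
by apply/andP; split; lra.
Qed.

Lemma ph_support k j x : incell j x -> ph k x != 0 -> nb k j.
Proof.
move=> hx; rewrite /ph prodf_seq_neq0 => /allP h i.
have := h i (mem_index_enum i); rewrite implyTb => hi.
apply: (hat_k_cell s0 s1 _ _ (incell_z i hx) hi); first exact: ltn_ord.
by rewrite -ltnS.
Qed.

Lemma u0_close j x : incell j x -> `|u0 x - Pk (Kj j) x| <= 2 * e1.
Proof.
move=> hx; have -> : u0 x - Pk (Kj j) x = \sum_k ph k x * (Pk k x - Pk (Kj j) x).
  by under eq_bigr do rewrite mulrBr; rewrite sumrB -mulr_suml sum_ph mul1r.
apply: le_trans (ler_norm_sum _ _ _) _.
have -> : 2 * e1 = \sum_k ph k x * (2 * e1) by rewrite -mulr_suml sum_ph mul1r.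
apply: ler_sum => k _.
have /andP[p0 _] := ph01 k x; rewrite normrM ger0_norm//.
have [->|pn0] := eqVneq (ph k x) 0; first by rewrite !mul0r.
by apply: ler_wpM2l => //; apply: (P_close (ph_support hx pn0) (nb_Kj j) hx).
Qed.

Definition Slip : R := 2 * ((1 - s) * t_ l)^-1.

Lemma Slip_ge0 : 0 <= Slip.
Proof. by rewrite mulr_ge0// invr_ge0 mulr_ge0 ?subr_ge0 ?(ltW s1)// ltW// tk_gt0. Qed.

Lemma ph_lip k i x t : 0 <= t -> `|ph k (x + t *: e_ i) - ph k x| <= Slip * t.
Proof.
move=> t0; rewrite /ph (bigD1 i)//= [X in _ - X](bigD1 i)//=.
have -> : \prod_(j | j != i) hat_k s l (k j) (zc j ((x + t *: e_ i) 0 j)) = \prod_(j | j != i) hat_k s l (k j) (zc j (x 0 j)).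
  by apply: eq_bigr => j /negPf ji; rewrite !mxE eqxx ji mulr0 addr0.
set B := \prod_(_ | _) _; rewrite -mulrBl normrM -[leRHS]mulr1.
apply: ler_pM => //.
  apply: le_trans (hat_k_lip s0 s1 _ _ _) _; first by rewrite -ltnS.
  rewrite /Slip ler_wpM2l ?Slip_ge0// !mxE !eqxx /= mulr1 /zc; case: ifP => _.
    by rewrite addrAC subrr add0r ger0_norm.
  by rewrite (_ : _ - _ = - t); [rewrite normrN ger0_norm|ring].
have /andP[B0 B1] : 0 <= B <= 1.
  apply: (big_ind (fun z => 0 <= z <= 1)); [by rewrite ler01 lexx| |by move=> j _; exact: ph_factor01].
  by move=> a b /andP[? ?] /andP[? ?]; rewrite mulr_ge0//= mulr_ile1.
by rewrite ger0_norm.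
Qed.

Definition Ku : R := #|{: K}|%:R * (2 * e1 * (Slip + 1)).

(** Since the hats sum to 1, the polynomial of one patch can be subtracted from all others. The
    steep slopes of the hats then multiply only differences of neighbouring polynomials, which are
    of size e1; counting all patches is crude but costs only a power of l. *)
Lemma u0_incr j i x t : 0 <= t -> incell j x -> incell j (x + t *: e_ i) ->
  `|u0 (x + t *: e_ i) - u0 x - (Pk (Kj j) (x + t *: e_ i) - Pk (Kj j) x)| <= Ku * t.
Proof.
move=> t0 hx ht; set x' := x + t *: e_ i in ht *.
pose Q k z := Pk k z - Pk (Kj j) z.
have -> : u0 x' - u0 x - (Pk (Kj j) x' - Pk (Kj j) x) = \sum_k (ph k x' * Q k x' - ph k x * Q k x).
  have h z : u0 z = Pk (Kj j) z + \sum_k ph k z * Q k z.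
    rewrite /Q; under eq_bigr do rewrite mulrBr.
    by rewrite sumrB -mulr_suml sum_ph mul1r addrC subrK.
  by rewrite !h sumrB; ring.
apply: le_trans (ler_norm_sum _ _ _) _.
apply: (@le_trans _ _ (\sum_(k : K) t * (2 * e1 * (Slip + 1)))); last first.
  by rewrite sumr_const -[leLHS]mulr_natl /Ku le_eqVlt; apply/orP; left; apply/eqP; ring.
apply: ler_sum => k _.
have E0 : 0 <= t * (2 * e1 * (Slip + 1)) by rewrite !mulr_ge0 ?addr_ge0 ?Slip_ge0// ltW.
have [kj|kj] := pselect (nb k j); last first.
  have p0 z : incell j z -> ph k z = 0.
    by move=> hz; apply/eqP; apply: contrapT => /negP /(ph_support hz).
  by rewrite !p0// !mul0r subrr normr0.
rewrite (_ : _ - _ = (ph k x' - ph k x) * Q k x' + ph k x * (Q k x' - Q k x)); last by ring.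
apply: le_trans (ler_normD _ _) _; rewrite !normrM.
have a1 := ph_lip k i x t0; have a2 := P_close kj (nb_Kj j) ht.
have a3 := PP_incr kj (nb_Kj j) t0 hx ht; have /andP[p0 p1] := ph01 k x.
have b1 : `|ph k x' - ph k x| * `|Q k x'| <= Slip * t * (2 * e1) by apply: ler_pM.
have b2 : `|ph k x| * `|Q k x' - Q k x| <= 1 * (2 * e1 * t) by apply: ler_pM => //; rewrite ger0_norm.
by apply: le_trans (lerD b1 b2) _; rewrite le_eqVlt; apply/orP; left; apply/eqP; ring.
Qed.

(** Clamps each distance y_i to values at least t_l. The composition [uh] is constant in y_i across
    the strip y_i < t_l, so polynomials are required only on patches away from the faces. *)
Definition xh (x : V) : V :=
  \row_i (if c 0 i == 0 then Num.max (x 0 i) (t_ l) else Num.min (x 0 i) (1 - t_ l)).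
Definition uh (x : V) : R := u0 (xh x).

Lemma y_zc x i : cube x -> y x i = zc i (x 0 i).
Proof.
move=> cx; have /andP[x0 x1] := cx i; rewrite /cdist /zc; case: ifPn => [/eqP ->|ci].
  by rewrite subr0 gtr0_norm.
by rewrite (c1_of cc ci) distrC gtr0_norm// subr_gt0.
Qed.

Lemma index1 (u : R) : 0 < u < 1 -> exists j : 'I_l, (u <= t_ l /\ j = l.-1 :> nat) \/ t_ j.+1 <= u <= t_ j /\ t_ l < u.
Proof.
move=> /andP[u0' u1]; have [ul|ul] := leP u (t_ l).
  have jl : (l.-1 < l)%N by rewrite prednK.
  by exists (Ordinal jl); left.
have ex : exists k, t_ k <= u by exists l; exact: ltW.
have [k hk min] := ex_minnP ex.
have kl : (k <= l)%N by apply: min; exact: ltW.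
case: k hk min kl => [|k] hk min kl; first by move: hk; rewrite /tk expr0 leNgt u1.
exists (Ordinal kl); right; rewrite /= hk; split=> //; apply: ltW; rewrite ltNge; apply/negP => /min.
by rewrite ltnn.
Qed.

(** A clamped coordinate is assigned to the last cell [l.-1], whose lower end is t_l. *)
Lemma cell_of x : cube x -> exists j : J, incell j (xh x) /\
  forall i, (y x i <= t_ l /\ j i = l.-1 :> nat) \/ t_ (j i).+1 <= y x i <= t_ (j i) /\ t_ l < y x i.
Proof.
move=> cx; have [j hj] := choice (fun i => index1 (cdist01 i cc cx)).
exists [ffun i => j i]; split; last by move=> i; rewrite ffunE.
move=> i; have := hj i; rewrite (y_zc i cx) /cl /cr /xl /xr /uj /vj /xh !mxE ffunE /zc.
have sl : t_ l <= t_ l.-1 by apply: tk_le => //; exact: leq_pred.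
case: ifPn => [c0|c0] [[h1 ->]|[/andP[h1 h2] h3]].
- by rewrite max_r// prednK// lexx.
- by rewrite max_l ?h1// ltW.
- rewrite prednK// min_r; last by lra.
  by rewrite lexx andbT; lra.
- by rewrite min_l; [apply/andP; split; lra|lra].
Qed.

Definition generic_pt (x : V) := forall i k, y x i != t_ k.

Lemma ae_generic : \forall p \ae mu, cube (toV p) -> generic_pt (toV p).
Proof.
have hn (m : nat) : \forall p \ae mu, forall i : 'I_n.+2, i = m :> nat -> cube (toV p) -> forall k, y (toV p) i != t_ k.
  have [mn|mn] := ltnP m n.+2; last first.
    by apply: aeW => p i im; have := ltn_ord i; rewrite im ltnNge mn.
  set i := Ordinal mn.
  have hk k : \forall p \ae mu, cube (toV p) -> y (toV p) i != t_ k.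
    pose ta := if c 0 i == 0 then t_ k else 1 - t_ k.
    pose S := toV @^-1` (@cube R n.+2) `&` (fun p => toV p 0 i) @^-1` [set ta].
    have mS : measurable S.
      apply: measurableI; first exact: (measurable_cube H).
      by rewrite -[X in measurable X]setTI; apply: (leb_meas H i).
    exists S; split => //.
      apply: (null_lines H (i := i) mS) => [p []//|p q t [_ /= hp] [_ /= hq] t0 e].
      by move: hq; rewrite e !mxE !eqxx /= mulr1 hp => hq; move: t0; rewrite lt_neqAle => /andP[/eqP ne _]; apply: ne; lra.
    move=> p /= /not_implyP[cp /negP]; rewrite negbK => /eqP e; split=> //=.
    by move: e; rewrite (y_zc i cp) /zc /ta; case: ifP => _ e; lra.
  have := ae_foralln hk; apply: filterS => p hp i' im cp k.
  have -> : i' = i by exact: val_inj.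
  exact: hp.
by have := ae_foralln hn; apply: filterS => p hp cp i k; exact: (hp i i erefl cp k).
Qed.

(** Off the mesh planes, a short move in the positive direction either leaves a clamped coordinate
    where it is or stays inside the cell, so [uh] is compared within a single cell. *)
Lemma move_cell x j i : cube x -> generic_pt x -> incell j (xh x) ->
  (y x i <= t_ l /\ j i = l.-1 :> nat) \/ t_ (j i).+1 <= y x i <= t_ (j i) /\ t_ l < y x i ->
  exists2 dl, 0 < dl & forall t, 0 <= t <= dl ->
    (y x i < t_ l /\ xh (x + t *: e_ i) = xh x) \/ [/\ t_ l < y x i, xh (x + t *: e_ i) = xh x + t *: e_ i & incell j (xh x + t *: e_ i)].
Proof.
move=> cx gx hj hi.
have hx (z : V) t i' : (z + t *: e_ i) 0 i' = z 0 i' + (if i' == i then t else 0).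
  by rewrite [LHS]mxE [X in _ + X]mxE [X in _ * X]mxE eqxx /=; case: (i' == i); rewrite ?mulr1 ?mulr0.
have other t i' : i' != i -> xh (x + t *: e_ i) 0 i' = xh x 0 i'.
  by move=> /negPf ii; rewrite !mxE ii !eqxx mulr0 addr0.
have own t : (x + t *: e_ i) 0 i = x 0 i + t by rewrite !mxE !eqxx mulr1.
have stay t : xh (x + t *: e_ i) 0 i = xh x 0 i -> xh (x + t *: e_ i) = xh x.
  by move=> h; apply/rowP => i'; have [->|/other ->] := eqVneq i' i.
have go t : xh (x + t *: e_ i) 0 i = x 0 i + t -> xh x 0 i = x 0 i -> xh (x + t *: e_ i) = xh x + t *: e_ i.
  move=> h h'; apply/rowP => i'; have [->|ii] := eqVneq i' i.
    by rewrite h hx h' eqxx.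
  by rewrite other// hx (negPf ii) addr0.
have goin t : 0 <= t -> xh x 0 i + t <= cr j i -> incell j (xh x + t *: e_ i).
  move=> t0 h i'; have := hj i'; rewrite hx.
  have [->|_] := eqVneq i' i; rewrite ?addr0// => /andP[h1 h2]; apply/andP; split=> //.
  by apply: le_trans h1 _; rewrite lerDl.
have g1 := gx i l; have g2 := gx i (j i); have g3 := gx i (j i).+1; have yz := y_zc i cx.
have xhE (z : V) : xh z 0 i = if c 0 i == 0 then Num.max (z 0 i) (t_ l) else Num.min (z 0 i) (1 - t_ l) by rewrite mxE.
have tj : t_ l <= t_ (j i).+1 by apply: tk_le => //; exact: ltn_ord.
have crE : cr j i = if c 0 i == 0 then t_ (j i) else 1 - t_ (j i).+1 by [].
case: hi => [[yl _]|[/andP[y1 y2] yl]].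
  have {}yl : y x i < t_ l by rewrite lt_neqAle g1.
  move: (yl); rewrite yz /zc => yl'; move: yl'; case: ifPn => ci yl'.
    exists (t_ l - x 0 i); first by rewrite subr_gt0.
    move=> t /andP[t0 t1]; left; split=> //; apply: stay; rewrite !xhE ci own !max_r//; lra.
  exists 1 => // t /andP[t0 t1]; left; split=> //; apply: stay; rewrite !xhE (negPf ci) own !min_r//; lra.
have {}y1 : t_ (j i).+1 < y x i by rewrite lt_neqAle eq_sym g3.
have {}y2 : y x i < t_ (j i) by rewrite lt_neqAle g2.
move: (y1) (y2); rewrite yz /zc => y1' y2'; move: y1' y2'; case: ifPn => ci y1' y2'.
  have e0 : xh x 0 i = x 0 i by rewrite xhE ci max_l//; lra.
  exists (t_ (j i) - x 0 i); first by rewrite subr_gt0.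
  move=> t /andP[t0 t1]; right; split; first by lra.
    by apply: go => //; rewrite xhE ci own max_l//; lra.
  by apply: goin => //; rewrite e0 crE ci; lra.
have e0 : xh x 0 i = x 0 i by rewrite xhE (negPf ci) min_l//; lra.
exists (1 - t_ (j i).+1 - x 0 i); first by lra.
move=> t /andP[t0 t1]; right; split; first by lra.
  by apply: go => //; rewrite xhE (negPf ci) own min_l//; lra.
by apply: goin => //; rewrite e0 crE (negPf ci); lra.
Qed.

Lemma uh_bound x : cube x -> `|uh x| <= Cr + 3 * e1.
Proof.
move=> cx; have [j [hj _]] := cell_of cx.
have a := u0_close hj; have b := P_bound (nb_Kj j) hj.
have := ler_normD (u0 (xh x) - Pk (Kj j) (xh x)) (Pk (Kj j) (xh x)); rewrite subrK => h.
by rewrite /uh; lra.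
Qed.

Lemma Ku_ge0 : 0 <= Ku.
Proof. by rewrite /Ku !mulr_ge0 ?addr_ge0 ?Slip_ge0// ltW. Qed.

(** Even a clamped y_i is at most the upper end [uj j i / s] of its cell. Hence mid changes by at
    most a factor s, and its power de - 1 >= -1 by at most 1/s. *)
Lemma mid_cell x (j : J) : cube x -> (forall i, (y x i <= t_ l /\ j i = l.-1 :> nat) \/ t_ (j i).+1 <= y x i <= t_ (j i) /\ t_ l < y x i) ->
  mid (uj j) `^ (de - 1) <= s^-1 * mid (y x) `^ (de - 1).
Proof.
move=> cx hj; have m0 := mid_cdist_gt0 cc cx.
have yu i : y x i <= uj j i / s.
  rewrite /uj tkS mulrC mulKf ?gt_eqF//; case: (hj i) => [[h1 h2]|[/andP[_ h2] _]]//.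
  by apply: le_trans h1 _; apply: tk_le => //; rewrite h2 leq_pred.
have mu1 : mid (y x) * s <= mid (uj j).
  have [i hi] := mid_att (fun i => ltW (cdist_gt0 cc cx i)).
  have m1 : mid (y x) <= 1 by apply: mid_le1 => i'; apply: ltW; [exact: cdist_gt0|exact: cdist_lt1].
  apply: (@mid_max _ _ _ i); first by rewrite mulr_ile1// ltW.
  by move=> i' /hi h; rewrite -ler_pdivlMr//; exact: le_trans h (yu i').
have mj0 : 0 < mid (uj j) by apply: lt_le_trans mu1; rewrite mulr_gt0.
have /andP[d0 d1] := de01.
rewrite !powR_expR// -[s^-1]lnK ?posrE ?invr_gt0// -expRD ler_expR lnV ?posrE//.
have l1 : ln (mid (y x)) + ln s <= ln (mid (uj j)) by rewrite -lnM ?posrE// ler_ln ?posrE// mulr_gt0.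
have l2 : ln s <= 0 by apply: ln_le0; exact: ltW.
by nra.
Qed.

Lemma uh_incr x i : cube x -> generic_pt x -> exists2 dl, 0 < dl & forall t, 0 <= t <= dl ->
  `|uh (x + t *: e_ i) - uh x| <= (Cr * s^-1 * mid (y x) `^ (de - 1) + e1 + Ku) * t.
Proof.
move=> cx gx; have [j [hj hij]] := cell_of cx; have [dl d0 h] := move_cell cx gx hj (hij i).
have G0 : Ga j <= Cr * s^-1 * mid (y x) `^ (de - 1) + e1.
  by rewrite /Ga lerD2r -mulrA ler_pM2l//; exact: mid_cell.
have p0 : 0 <= Ga j by rewrite /Ga addr_ge0 ?mulr_ge0 ?powR_ge0// ltW.
have K0 := Ku_ge0.
exists dl => // t ht; have /andP[t0 _] := ht; rewrite /uh; case: (h t ht) => [[_ ->]|[_ -> hin]].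
  by rewrite subrr normr0 mulr_ge0// addr_ge0// (le_trans p0).
have a := u0_incr t0 hj hin; have b := P_incr (nb_Kj j) t0 hj hin.
have := ler_normD (u0 (xh x + t *: e_ i) - u0 (xh x) - (Pk (Kj j) (xh x + t *: e_ i) - Pk (Kj j) (xh x)))
  (Pk (Kj j) (xh x + t *: e_ i) - Pk (Kj j) (xh x)); rewrite subrK => g.
apply: le_trans g _; apply: le_trans (lerD a b) _; rewrite -mulrDl ler_wpM2r//; lra.
Qed.

Lemma uh_core : \forall p \ae mu, cube (toV p) -> (forall i, t_ l < y (toV p) i) ->
  `|f (toV p) - uh (toV p)| <= 3 * e1 /\ forall i, exists2 dl, 0 < dl & forall t, 0 <= t <= dl ->
    `|uh (toV p + t *: e_ i) - uh (toV p) - Df i (toV p) * t| <= (Ku + 2 * e1) * t.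
Proof.
have hP' : \forall p \ae mu, forall k, (toV @^-1` box (pl k) (pr k)) p -> `|f (toV p) - Pk k (toV p)| <= e1.
  exact: filter_forall.
have hdP' : \forall p \ae mu, forall k i, (toV @^-1` box (pl k) (pr k)) p -> `|Df i (toV p) - dPk k i (toV p)| <= e1.
  by apply: filter_forall => k; apply: filter_forall => i; exact: hdP.
apply: filterS3 ae_generic hP' hdP' => p gx h1 h2 cx core.
have {}gx := gx cx; set x := toV p in gx cx core *.
have [j [hj hij]] := cell_of cx.
have xhx : xh x = x.
  apply/rowP => i; rewrite mxE; have := core i; rewrite (y_zc i cx) /zc.
  by case: ifP => _ h; [rewrite max_l// ltW|rewrite min_l//; lra].
have Bp : box (pl (Kj j)) (pr (Kj j)) x.
  apply: (cell_sub (nb_Kj j)) => i; have := hj i; rewrite xhx.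
  case: (hij i) => [[h3 _]|[/andP[h3 h4] _]]; first by have := lt_le_trans (core i) h3; rewrite ltxx.
  have {}h3 : t_ (j i).+1 < y x i by rewrite lt_neqAle eq_sym gx.
  have {}h4 : y x i < t_ (j i) by rewrite lt_neqAle gx.
  move: h3 h4; rewrite (y_zc i cx) /zc /cl /cr /xl /xr /uj /vj; case: ifP => _ h3 h4 _; apply/andP; split; lra.
have a := u0_close hj; rewrite xhx in a hj; have b := h1 _ Bp.
split.
  rewrite /uh xhx (_ : _ - _ = (f x - Pk (Kj j) x) - (u0 x - Pk (Kj j) x)); last by ring.
  by apply: le_trans (ler_normB _ _) _; lra.
move=> i; have hj' : incell j (xh x) by rewrite xhx.
have [dl d0 h] := move_cell cx gx hj' (hij i).
have [d' d'0 hd'] : exists2 d', 0 < d' & forall t, 0 <= t <= d' -> `|Pk (Kj j) (x + t *: e_ i) - Pk (Kj j) x - dPk (Kj j) i x * t| <= e1 * t.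
  have [d1 d2] := is_derive_polyV (pl (Kj j)) (pr (Kj j)) (kk (Kj j)) i x 0.
  rewrite /derive in d2; rewrite /derivable d2 scale0r addr0 in d1.
  move/cvgrPdist_le: d1 => /(_ e1 e10); rewrite /prop_near1 /dnbhs /within /= => /nbhs_ballP[d' /= d'0 hd'].
  exists (d' / 2); first by rewrite divr_gt0.
  move=> t /andP[t0 t2]; have [->|tn0] := eqVneq t 0; first by rewrite scale0r addr0 subrr mulr0 subrr normr0 mulr0.
  have tp : 0 < t by rewrite lt_neqAle eq_sym tn0.
  have bt : ball (0 : R) d' t by rewrite /ball /= sub0r normrN ger0_norm//; lra.
  have tA : (t%:A : R) = t by rewrite /GRing.scale /= mulr1.
  have := hd' t bt tn0; rewrite addr0 tA => h'.
  have -> : Pk (Kj j) (x + t *: e_ i) - Pk (Kj j) x - dPk (Kj j) i x * t =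
     - (dPk (Kj j) i x - t^-1 * (Pk (Kj j) (x + t *: e_ i) - Pk (Kj j) x)) * t by field.
  by rewrite normrM normrN (gtr0_norm tp) ler_wpM2r.
exists (Num.min dl d'); first by rewrite lt_min d0.
move=> t /andP[t0]; rewrite le_min => /andP[t1 t2].
have [|[h3 _]|[_ h3 hin]] := h t; first by rewrite t0.
  by have := lt_trans (core i) h3; rewrite ltxx.
rewrite /uh h3 xhx in hin *; have g1 := u0_incr t0 hj hin.
have g2 := hd' t; rewrite t0 t2 in g2; have {}g2 := g2 isT.
have g3 := h2 (Kj j) i Bp.
rewrite (_ : _ - _ = (u0 (x + t *: e_ i) - u0 x - (Pk (Kj j) (x + t *: e_ i) - Pk (Kj j) x)) +
   ((Pk (Kj j) (x + t *: e_ i) - Pk (Kj j) x - dPk (Kj j) i x * t) - (Df i x - dPk (Kj j) i x) * t)); last by ring.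
apply: le_trans (ler_normD _ _) _; rewrite (_ : (Ku + 2 * e1) * t = Ku * t + (e1 * t + e1 * t)); last by ring.
apply: lerD => //; apply: le_trans (ler_normB _ _) _; apply: lerD => //.
by rewrite normrM (ger0_norm t0) ler_wpM2r.
Qed.

End Cells.

(** * First layers: local coordinates and hat functions *)

Section BaseProgram.
Context {R : realType} {n : nat}.
Local Notation V := 'rV[R]_n.+2.
Variables (c : V) (s : R) (l : nat).
Hypothesis cc : is_corner c.
Hypothesis s0 : 0 < s.
Hypothesis s1 : s < 1.
Hypothesis l0 : (0 < l)%N.
Local Notation t_ := (tk s).
Local Notation gap k := (t_ k.-1 - t_ k.+1).

(** Left end, in the variable x_i, of the patch of index k, which is reflected when c_i = 1. [paff]
    maps the patch onto (0, 1). *)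
Definition pshift (i : 'I_n.+2) (k : nat) : R := if c 0 i == 0 then t_ k.+1 else 1 - t_ k.-1.
Definition paff i k (u : R) : R := (u - pshift i k) / gap k.
(** The clamp of y_i at t_l is built into the local coordinate: the image of the clamping point, cut
    to [0, 1], becomes the lower end of the range if c_i = 0 and the upper end [phi_] if c_i = 1. *)
Definition plo i k : R := if c 0 i == 0 then Num.max 0 (Num.min 1 (paff i k (t_ l))) else 0.
Definition phi_ i k : R := if c 0 i == 0 then 1 else Num.max 0 (Num.min 1 (paff i k (1 - t_ l))).
Definition sgf (i : 'I_n.+2) (k : 'I_l.+1) (u : R) : R := Num.max (plo i k) (Num.min (phi_ i k) (paff i k u)).
Definition alf (i : 'I_n.+2) (k : 'I_l.+1) (u : R) : R := hat_k s l k (zc c i u).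

Lemma gap_gt0 k : 0 < gap k.
Proof. by rewrite subr_gt0; apply: (lt_le_trans (tk_lt s0 s1 k)); apply: tk_le => //; exact: leq_pred. Qed.

Lemma clamp01P (v : R) : 0 <= Num.max 0 (Num.min 1 v) <= 1.
Proof. by rewrite le_max lexx /= ge_max ler01 ge_min lexx. Qed.

Lemma plo01 i k : 0 <= plo i k <= 1.
Proof. by rewrite /plo; case: ifP => _; rewrite ?clamp01P// lexx ler01. Qed.
Lemma phi01 i k : 0 <= phi_ i k <= 1.
Proof. by rewrite /phi_; case: ifP => _; rewrite ?clamp01P// lexx ler01. Qed.
Lemma plo_phi i k : plo i k <= phi_ i k.
Proof. by rewrite /plo /phi_; case: ifP => _; [have /andP[_] := clamp01P (paff i k (t_ l))|have /andP[] := clamp01P (paff i k (1 - t_ l))]. Qed.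

Lemma sgf01 i k u : 0 <= sgf i k u <= 1.
Proof.
have /andP[a b] := plo01 i k; have /andP[g h] := phi01 i k.
by rewrite /sgf le_max a /= ge_max b ge_min h.
Qed.

Lemma alf01 i k u : 0 <= alf i k u <= 1. Proof. exact: hat_k01. Qed.

Definition Sb : R := 2 * ((1 - s) * t_ l)^-1.

Lemma Sb_gt0 : 0 < Sb. Proof. by rewrite mulr_gt0// invr_gt0 mulr_gt0 ?subr_gt0 ?tk_gt0. Qed.

Lemma gap_ge k : (k <= l)%N -> (1 - s) * t_ l <= gap k.
Proof.
move=> kl; apply: le_trans (tk_gap s0 s1 kl) _; rewrite lerD2r; apply: tk_le => //; exact: leq_pred.
Qed.

Lemma alf_lip i k u v : `|alf i k u - alf i k v| <= Sb * `|u - v|.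
Proof.
apply: le_trans (hat_k_lip s0 s1 _ _ _) _; first by rewrite -ltnS.
rewrite /Sb /zc; case: ifP => _ //.
by rewrite (_ : 1 - u - (1 - v) = - (u - v)) ?normrN//; ring.
Qed.

Lemma sgf_lip i k u v : `|sgf i k u - sgf i k v| <= Sb * `|u - v|.
Proof.
apply: le_trans (clamp_lip _ _ _ _) _; rewrite /paff -mulrBl opprB addrA subrK normrM mulrC.
have g0 := gap_gt0 k; rewrite [`|_^-1|]ger0_norm ?invr_ge0 ?(ltW g0)//; apply: ler_wpM2r => //.
have h0 : 0 < (1 - s) * t_ l by rewrite mulr_gt0 ?subr_gt0 ?tk_gt0.
apply: (@le_trans _ _ ((1 - s) * t_ l)^-1); first by rewrite lef_pV2// gap_ge// -ltnS.
by rewrite /Sb ler_peMl ?ler1n// invr_ge0 ltW.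
Qed.

Lemma pow_lip (a b : R) j : 0 <= a <= 1 -> 0 <= b <= 1 -> `|a ^+ j - b ^+ j| <= j%:R * `|a - b|.
Proof.
move=> /andP[a0 a1] /andP[b0 b1]; elim: j => [|j IH]; first by rewrite !expr0 subrr normr0 mul0r.
rewrite !exprS (_ : _ - _ = a * (a ^+ j - b ^+ j) + (a - b) * b ^+ j); last by ring.
apply: le_trans (ler_normD _ _) _; rewrite !normrM (ger0_norm a0) (ger0_norm (exprn_ge0 j b0)) -[in leRHS]natr1 mulrDl mul1r.
apply: lerD; last by rewrite ler_piMr// exprn_ile1.
by apply: le_trans IH; rewrite ler_piMl.
Qed.

Lemma sgX_lip q i k j u v : (j <= 2 ^ q)%N -> `|sgf i k u ^+ j - sgf i k v ^+ j| <= (2 ^+ q + 1) * Sb * `|u - v|.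
Proof.
move=> jq; apply: le_trans (pow_lip j (sgf01 i k u) (sgf01 i k v)) _.
rewrite -mulrA; apply: ler_pM => //; last exact: sgf_lip.
by apply: (@le_trans _ _ (2 ^+ q)); [rewrite -natrX ler_nat|rewrite lerDl].
Qed.

Lemma alf_lip' q i k u v : `|alf i k u - alf i k v| <= (2 ^+ q + 1) * Sb * `|u - v|.
Proof.
apply: le_trans (alf_lip i k u v) _; apply: ler_wpM2r => //.
by rewrite ler_peMl ?(ltW Sb_gt0)// lerDr exprn_ge0.
Qed.

Lemma as_lip q i k j u v : (j <= 2 ^ q)%N ->
  `|alf i k u * sgf i k u ^+ j - alf i k v * sgf i k v ^+ j| <= (2 ^+ q + 1) * Sb * `|u - v|.
Proof.
move=> jq; rewrite (_ : _ - _ = alf i k u * (sgf i k u ^+ j - sgf i k v ^+ j) + (alf i k u - alf i k v) * sgf i k v ^+ j); last by ring.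
apply: le_trans (ler_normD _ _) _; rewrite !normrM.
have /andP[a0 a1] := alf01 i k u; have /andP[b0 b1] := sgf01 i k v.
have -> : (2 ^+ q + 1) * Sb * `|u - v| = 2 ^+ q * Sb * `|u - v| + Sb * `|u - v| by ring.
rewrite (ger0_norm a0) (ger0_norm (exprn_ge0 j b0)); apply: lerD; last first.
  by apply: le_trans (alf_lip i k u v); rewrite ler_piMr// exprn_ile1.
apply: le_trans (_ : `|sgf i k u ^+ j - sgf i k v ^+ j| <= _); first by rewrite ler_piMl.
apply: le_trans (pow_lip j (sgf01 i k u) (sgf01 i k v)) _.
by rewrite -mulrA; apply: ler_pM => //; [rewrite -natrX ler_nat|exact: sgf_lip].
Qed.

Lemma clamp_relu (a b v : R) : a <= b -> Num.max a (Num.min b v) = a + Num.max 0 (v - a) - Num.max 0 (v - b).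
Proof.
move=> ab; have [h1|h1] := leP b v.
  have e1 : Num.max 0 (v - a) = v - a by rewrite max_r// subr_ge0 (le_trans ab).
  have e2 : Num.max 0 (v - b) = v - b by rewrite max_r// subr_ge0.
  by rewrite e1 e2 max_r//; ring.
have e2 : Num.max 0 (v - b) = 0 by rewrite max_l// subr_le0 ltW.
rewrite e2; have [h2|h2] := leP a v.
  have -> : Num.max 0 (v - a) = v - a by rewrite max_r// subr_ge0.
  by ring.
have -> : Num.max 0 (v - a) = 0 by rewrite max_l// subr_le0 ltW.
by ring.
Qed.

(** Four neurons for each axis and patch index: by [clamp_relu] a clamp is a constant plus a
    difference of two ReLUs, so [m0], [m1] give the local coordinate and [m2], [m3] the ramp. *)
Let T1 : finType := ('I_n.+2 * 'I_l.+1 * 'I_4)%type.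
Let w1 (t : T1) : R := let: (i, k, m) := t in
  if (m < 2)%N then (gap k)^-1 else (if c 0 i == 0 then 1 else -1) / (t_ k - t_ k.+1).
Let b1 (t : T1) : R := let: (i, k, m) := t in
  match (m : nat) with
  | 0 => - (pshift i k / gap k) - plo i k
  | 1 => - (pshift i k / gap k) - phi_ i k
  | 2 => ((if c 0 i == 0 then 0 else 1) - t_ k.+1) / (t_ k - t_ k.+1)
  | _ => ((if c 0 i == 0 then 0 else 1) - t_ k.+1) / (t_ k - t_ k.+1) - 1
  end.
Let F1 (t : T1) (x : V) : R := Num.max 0 (w1 t * x 0 t.1.1 + b1 t).

Let F1_comp : computable F1 1 (2 * #|{: T1}|).
Proof. exact: (computable_input (i := fun t : T1 => t.1.1) (w := w1) (b := b1)). Qed.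

Definition m0 : 'I_4 := @Ordinal 4 0 isT.
Definition m1 : 'I_4 := @Ordinal 4 1 isT.
Definition m2 : 'I_4 := @Ordinal 4 2 isT.
Definition m3 : 'I_4 := @Ordinal 4 3 isT.

Lemma sgfE i k (x : V) : sgf i k (x 0 i) = plo i k + F1 (i, k, m0) x - F1 (i, k, m1) x.
Proof.
rewrite /sgf clamp_relu ?plo_phi// /F1 /=; congr (_ + Num.max 0 _ - Num.max 0 _); rewrite /paff; ring.
Qed.

Lemma rampE i (k : 'I_l.+1) (x : V) : ramp s k (zc c i (x 0 i)) = F1 (i, k, m2) x - F1 (i, k, m3) x.
Proof.
rewrite /ramp clamp_relu// add0r /F1 /= subr0.
have g0 : t_ k - t_ k.+1 != 0 by rewrite gt_eqF// subr_gt0 tk_lt.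
by rewrite /zc; case: ifP => _; congr (Num.max 0 _ - Num.max 0 _); field.
Qed.

Let T0 : finType := ('I_n.+2 * 'I_l.+1 * 'I_(2 ^ 0).+1 + 'I_n.+2 * 'I_l.+1)%type.
Let V0 (t : T0) (x : V) : R :=
  match t with
  | inl (i, k, j) => sgf i k (x 0 i) ^+ j
  | inr (i, k) => alf i k (x 0 i)
  end.

(** A hat is a difference of two ramps: at k = l the first is the constant 1 stored in [bb], at k =
    0 the second is absent. *)
Let cmb (t : T0) : seq (R * T1) :=
  match t with
  | inl (i, k, j) => if (j == 0 :> nat) then [::] else [:: (1, (i, k, m0)); (-1, (i, k, m1))]
  | inr (i, k) => (if (k < l)%N then [:: (1, (i, k, m2)); (-1, (i, k, m3))] else [::]) ++
      (if (k == 0 :> nat) then [::] else [:: (-1, (i, inord k.-1, m2)); (1, (i, inord k.-1, m3))])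
  end.
Let bb (t : T0) : R :=
  match t with
  | inl (i, k, j) => if (j == 0 :> nat) then 1 else plo i k
  | inr (i, k) => if (k < l)%N then 0 else 1
  end.

Let V0E t x : V0 t x = Num.max 0 (\sum_(w <- cmb t) w.1 * F1 w.2 x + bb t).
Proof.
case: t => [[[i k] j]|[i k]] /=.
  case: j => -[|[|//]] hj /=; first by rewrite big_nil add0r expr0 max_r.
  rewrite !big_cons big_nil /= expr1 addr0 mul1r mulN1r addrC addrA -sgfE max_r//.
  by have /andP[] := sgf01 i k (x 0 i).
have /andP[a0 _] := alf01 i k (x 0 i).
rewrite -[LHS](max_r a0); congr (Num.max 0 _).
rewrite /alf /hat_k big_cat /=.
have -> : (if (k : nat) is k'.+1 then step s l k' (zc c i (x 0 i)) else 0) = - \sum_(w <- if (k == 0 :> nat) then [::] else [:: (-1, (i, inord k.-1, m2)); (1, (i, inord k.-1, m3))]) w.1 * F1 w.2 x.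
  case: k a0 => -[|k] hk _ /=; first by rewrite big_nil oppr0.
  rewrite !big_cons big_nil /= addr0 mul1r mulN1r /step.
  have kl : (k < l)%N by rewrite -ltnS.
  have -> : (inord k : 'I_l.+1) = Ordinal (ltnW hk) by apply: val_inj; rewrite /= inordK// ltnW.
  by rewrite kl (rampE i (Ordinal (ltnW hk)) x); ring.
rewrite /step; case: ifP => kl.
  by rewrite !big_cons big_nil /= addr0 mul1r mulN1r rampE opprK addr0.
by rewrite big_nil add0r opprK addrC.
Qed.

Lemma base_program q : approximated ((2 ^+ q + 1) * Sb) V0 2 (8 * #|{: T1}| + 8 * #|{: T0}|) 0.
Proof.
have L0 : 0 <= (2 ^+ q + 1) * Sb by rewrite mulr_ge0 ?addr_ge0 ?exprn_ge0// ltW// Sb_gt0.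
exists V0; split.
- have sz t : (size (cmb t) <= 4)%N.
    case: t => [[[i k] j]|[i k]] /=; first by case: ifP.
    by rewrite size_cat; case: ifP => _; case: ifP.
  have := computable_layer F1_comp sz V0E.
  move=> h m rest; have [Phi [h1 h2 h3]] := h m rest; exists Phi; split=> //.
  by apply: leq_trans h3 _; rewrite leq_add2r leq_add// leq_mul2r ?orbT.
- by move=> [[[i k] j]|[i k]] x /=; rewrite ?alf01//; have /andP[a b] := sgf01 i k (x 0 i); rewrite exprn_ge0//= exprn_ile1.
- by move=> [[[i k] j]|[i k]] x /=; rewrite ?alf01//; have /andP[a b] := sgf01 i k (x 0 i); rewrite exprn_ge0//= exprn_ile1.
- have lip1 (g : R -> R) (i : 'I_n.+2) : (forall u v, `|g u - g v| <= (2 ^+ q + 1) * Sb * `|u - v|) ->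
    lip_lines ((2 ^+ q + 1) * Sb) (fun x : V => g (x 0 i)).
    move=> h x j t; apply: le_trans (h _ _) _; rewrite ler_wpM2l// !mxE eqxx /=.
    by rewrite addrAC subrr add0r; case: eqP => _; rewrite ?mulr1// mulr0 normr0.
  move=> [[[i k] j]|[i k]] /=.
    apply: (lip1 (fun u => sgf i k u ^+ j)) => u v; apply: sgX_lip.
    by apply: (@leq_trans 1); [rewrite -ltnS|rewrite expn_gt0].
  by apply: (lip1 (alf i k)) => u v; exact: alf_lip'.
- move=> t; split=> [x|x i u]; first by rewrite subrr normr0.
  by rewrite !subrr normr0 mulr_ge0 ?mulr0.
Qed.

End BaseProgram.

(** * The emulated sum of tensor products coincides with the glued approximant *)

Section Target.
Context {R : realType} {n : nat}.
Local Notation V := 'rV[R]_n.+2.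
Local Notation e_ i := (delta_mx 0 i : V).
Variables (c : V) (s : R) (l q : nat).
Hypothesis cc : is_corner c.
Hypothesis s0 : 0 < s.
Hypothesis s1 : s < 1.
Hypothesis l0 : (0 < l)%N.
Local Notation t_ := (tk s).
Local Notation M := (2 ^ q).+1.
Local Notation K := {ffun 'I_n.+2 -> 'I_l.+1}.
Variable kk : K -> {ffun 'I_n.+2 -> 'I_M} -> R.

Let xhat (i : 'I_n.+2) (u : R) : R := if c 0 i == 0 then Num.max u (t_ l) else Num.min u (1 - t_ l).

Lemma alf_xhat i (k : 'I_l.+1) u : alf c s i k u = hat_k s l k (zc c i (xhat i u)).
Proof.
have kl : (k <= l)%N by rewrite -ltnS.
have st m z : z <= t_ l -> step s l m z = step s l m (t_ l).
  move=> zl; rewrite /step; case: ifP => // ml.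
  have h : t_ l <= t_ m.+1 by apply: tk_le.
  by rewrite !ramp0// (le_trans zl).
have hk z : z <= t_ l -> hat_k s l k z = hat_k s l k (t_ l).
  by move=> zl; rewrite /hat_k st//; case: (k : nat) => // m; rewrite st.
rewrite /alf /zc /xhat; case: ifP => _; first by case: leP => // /hk.
by case: leP => // h; rewrite hk; [congr hat_k; ring|lra].
Qed.

(** On the support of the hat the restriction of the local coordinate to [0, 1] is inactive, and
    only the clamp at t_l remains. Elsewhere its value is multiplied by 0. *)
Lemma sgf_xhat i (k : 'I_l.+1) u : 0 < u < 1 -> alf c s i k u != 0 -> sgf c s i k u = paff c s i k (xhat i u).
Proof.
move=> /andP[u0 u1] /(hat_k_support s0 s1)[|h1 h2]; first by rewrite -ltnS.
have kl : (k <= l)%N by rewrite -ltnS.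
have g0 := gap_gt0 s0 s1 k.
have tl : t_ l <= t_ k.-1 by apply: tk_le => //; apply: leq_trans kl; exact: leq_pred.
have z1 : zc c i u <= t_ k.-1.
  case: h2 => [->|/ltW//]; rewrite /tk expr0 /zc; case: ifP => _; lra.
have z0 : k = l :> nat \/ (t_ l <= t_ k.+1 /\ t_ k.+1 < zc c i u).
  case: h1 => [->|h]; first by left.
  have [->|kl'] := eqVneq (k : nat) l; [by left|right; split=> //].
  by apply: tk_le => //; rewrite ltn_neqAle kl'.
have kll : k = l :> nat -> t_ k.+1 < t_ l by move=> ->; exact: tk_lt.
have aff_le a b : a <= b -> paff c s i k a <= paff c s i k b by move=> ab; rewrite /paff ler_wpM2r ?invr_ge0 ?(ltW g0)// lerD2r.
have aff1 a : a <= pshift c s i k + (t_ k.-1 - t_ k.+1) -> paff c s i k a <= 1.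
  by move=> h; rewrite /paff ler_pdivrMr// mul1r lerBlDl.
have aff0 a : pshift c s i k <= a -> 0 <= paff c s i k a by move=> h; apply: divr_ge0; [rewrite subr_ge0|exact: ltW].
have aff1' a : pshift c s i k + (t_ k.-1 - t_ k.+1) <= a -> 1 <= paff c s i k a.
  by move=> h; rewrite /paff ler_pdivlMr// mul1r lerBrDl.
have aff0' a : a <= pshift c s i k -> paff c s i k a <= 0 by move=> h; rewrite /paff pmulr_lle0 ?invr_gt0// subr_le0.
move: z0 z1 aff1 aff0 aff1' aff0'; rewrite /sgf /plo /phi_ /xhat /zc /pshift; case: ifP => ci z0 z1 aff1 aff0 aff1' aff0'.
  have pu : paff c s i k u <= 1 by apply: aff1; lra.
  have pl : paff c s i k (t_ l) <= 1 by apply: aff1; lra.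
  rewrite (min_r pu) (min_r pl).
  case: z0 => [kl'|[h3 h4]].
    have p0 : 0 <= paff c s i k (t_ l) by apply: aff0; have := kll kl'; lra.
    by rewrite (max_r p0); have [ul|ul] := leP u (t_ l); [rewrite max_l// aff_le|rewrite max_r// aff_le// ltW].
  have p0 : paff c s i k (t_ l) <= 0 by apply: aff0'; lra.
  have q0 : 0 <= paff c s i k u by apply: aff0; lra.
  by rewrite (max_l p0) (max_r q0) max_l//; lra.
have q0 : 0 <= paff c s i k u by apply: aff0; lra.
have pl : 0 <= paff c s i k (1 - t_ l) by apply: aff0; lra.
have [k1|k1] := leP (paff c s i k (1 - t_ l)) 1.
  rewrite (max_r pl); have [ul|ul] := leP u (1 - t_ l).
    by rewrite min_r ?aff_le// max_r.
  by rewrite min_l ?aff_le// ?(ltW ul)// max_r.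
rewrite (max_r ler01); case: z0 => [kl'|[h3 h4]].
  by have := aff1 (1 - t_ l); have := kll kl' => h h'; have := h' ltac:(lra); rewrite leNgt k1.
have pu : paff c s i k u <= 1 by apply: aff1; lra.
by rewrite (min_r pu) (max_r q0) min_l//; lra.
Qed.

Definition co (phi : {ffun 'I_n.+2 -> 'I_l.+1 * 'I_M}) : R := kk [ffun i => (phi i).1] [ffun i => (phi i).2].

Definition target (x : V) : R :=
  \sum_(phi : {ffun 'I_n.+2 -> 'I_l.+1 * 'I_M}) co phi *
    \prod_i (alf c s i (phi i).1 (x 0 i) * sgf c s i (phi i).1 (x 0 i) ^+ (phi i).2).

Lemma sum_pairs (F : K -> {ffun 'I_n.+2 -> 'I_M} -> R) :
  \sum_(phi : {ffun 'I_n.+2 -> 'I_l.+1 * 'I_M}) F [ffun i => (phi i).1] [ffun i => (phi i).2] = \sum_k \sum_g F k g.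
Proof.
rewrite pair_bigA /= (reindex (fun phi : {ffun 'I_n.+2 -> 'I_l.+1 * 'I_M} => ([ffun i => (phi i).1], [ffun i => (phi i).2]) : K * {ffun 'I_n.+2 -> 'I_M})) //=.
exists (fun kg : K * {ffun 'I_n.+2 -> 'I_M} => [ffun i => (kg.1 i, kg.2 i)]) => [phi _|[k g] _].
  by apply/ffunP => i; rewrite !ffunE; case: (phi i).
by congr pair; apply/ffunP => i; rewrite !ffunE.
Qed.

Lemma target_uh x : cube x -> target x = uh c s kk x.
Proof.
move=> cx; pose F (k : K) (g : {ffun 'I_n.+2 -> 'I_M}) := kk k g * \prod_i (alf c s i (k i) (x 0 i) * sgf c s i (k i) (x 0 i) ^+ g i).
rewrite /target (eq_bigr (fun phi : {ffun 'I_n.+2 -> 'I_l.+1 * 'I_M} => F [ffun i => (phi i).1] [ffun i => (phi i).2])); last first.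
  by move=> phi _; rewrite /F /co; congr (_ * _); apply: eq_bigr => i _; rewrite !ffunE.
rewrite sum_pairs /uh /u0; apply: eq_bigr => k _; rewrite /Pk /polyV mulr_sumr; apply: eq_bigr => g _.
rewrite /F mulrCA big_split /=; congr (_ * _).
have phE : \prod_i alf c s i (k i) (x 0 i) = ph c s k (xh c s l x).
  by apply: eq_bigr => i _; rewrite alf_xhat /xh mxE.
rewrite phE; have [->|ph0] := eqVneq (ph c s k (xh c s l x)) 0; first by rewrite !mul0r.
congr (_ * _); apply: eq_bigr => i _; congr (_ ^+ _).
rewrite sgf_xhat//; last first.
  by move: ph0; rewrite -phE prodf_seq_neq0 => /allP/(_ i (mem_index_enum i)).
rewrite /paff /sc /pl /pr xr_xl /up /vp /xh mxE; congr ((_ - _) / _).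
Qed.

(** The moduli of the output weights sum to at most the number of patches times [Bc]; this factor
    multiplies the common error of all emulated tensor products. *)
Lemma network m Bc : 0 <= Bc -> (forall k, \sum_g `|kk k g| <= Bc) -> (6 ^ (q + n.+3) <= 2 ^ m)%N ->
  exists Phi : NN R n.+2 1,
  [/\ nrmW ((2 ^+ q + 1) * Sb s l) (#|{: K}|%:R * Bc * (6 ^+ (q + n.+3) * (1 / 2) ^+ m)) (fun x => realize1 Phi x - target x),
    (nn_depth Phi <= (2 + (q + n.+4) * (m + 3)).+1)%N &
    (nn_size Phi <= 8 * (n.+2 * l.+1 * 4) + 8 * (n.+2 * l.+1 * 2 + n.+2 * l.+1) +
       24 * (m + 3) * ((q + 1) * (n.+2 * l.+1 * (2 ^ q + 2)) + n.+3 * ((l.+1 * (2 ^ q + 1)) ^ n.+2 + n.+2 * l.+1 * (2 ^ q + 1)))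
       + (l.+1 * M) ^ n.+2)%N].
Proof.
move=> Bc0 hBc qm.
have L0 : 0 <= (2 ^+ q + 1) * Sb s l by rewrite mulr_ge0 ?addr_ge0 ?exprn_ge0// ltW// Sb_gt0.
pose sg := @sgf R n c s l; pose al := @alf R n c s l.
have H1 i k u : 0 <= sg i k u <= 1 by exact: sgf01.
have H2 i k u : 0 <= al i k u <= 1 by exact: alf01.
have H3 i k j u v : (j <= 2 ^ q)%N -> `|sg i k u ^+ j - sg i k v ^+ j| <= (2 ^+ q + 1) * Sb s l * `|u - v| by exact: sgX_lip.
have H4 i k u v : `|al i k u - al i k v| <= (2 ^+ q + 1) * Sb s l * `|u - v| by exact: alf_lip'.
have H5 i k j u v : (j <= 2 ^ q)%N -> `|al i k u * sg i k u ^+ j - al i k v * sg i k v ^+ j| <= (2 ^+ q + 1) * Sb s l * `|u - v| by exact: as_lip.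
have := @approx_tensor R n.+1 l.+1 q m _ sg al L0 H1 H2 H3 H4 H5 _ _ (@base_program R n c s l s0 s1 q) qm.
move=> [F [cF F01 v01 lv aF]].
have [Phi [P1 P2 P3]] := computable_output co cF.
exists Phi; split.
- have := nrmW_sum (index_enum _) co aF.
  rewrite -mulr_suml => h.
  have e : (fun x => \sum_(i : {ffun 'I_n.+2 -> 'I_l.+1 * 'I_M}) co i *
     (F i x - \prod_j (alf c s j (i j).1 (x 0 j) * sgf c s j (i j).1 (x 0 j) ^+ (i j).2))) = (fun x => realize1 Phi x - target x).
    by apply/funext => x; rewrite P1 /target -sumrB; apply: eq_bigr => i _; rewrite mulrBr.
  have le1 : \sum_(i : {ffun 'I_n.+2 -> 'I_l.+1 * 'I_M}) `|co i| <= #|{: K}|%:R * Bc.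
    rewrite (sum_pairs (fun k g => `|kk k g|)).
    apply: (@le_trans _ _ (\sum_(k : K) Bc)); first by apply: ler_sum => k _.
    by rewrite sumr_const mulr_natl.
  have E0 : 0 <= 6 ^+ (q + n.+3) * (1 / 2) ^+ m :> R by rewrite mulr_ge0 ?exprn_ge0.
  have le2 := ler_wpM2r E0 le1.
  rewrite -e; have [h1 h2] := h; split.
    by move=> x; apply: le_trans (h1 x) le2.
  by apply: lip_linesW h2; exact: ler_wpM2l.
- by apply: leq_trans P2 _; rewrite ltnS.
- apply: leq_trans P3 _.
  by rewrite card_ffun !card_prod card_sum !card_prod !card_ord.
Qed.

End Target.

(** * Error estimates *)

Section DyadicIntegrals.
Context {R : realType}.
Variables (s de : R).
Hypothesis s0 : 0 < s.
Hypothesis s1 : s < 1.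
Hypothesis de01 : 0 < de <= 4^-1.
Local Notation t_ := (tk s).
Local Notation lam := (@lebesgue_measure R).

Definition zo (o : bool) (t : R) : R := if o then t else 1 - t.
Definition psi (o : bool) (l : nat) (t : R) : R := if 0 < zo o t <= t_ l then zo o t `^ (de - 1) else 0.
Definition rho : R := s `^ de.
Definition Cb : R := s `^ (de - 1) * (1 - s) / (1 - rho).

Lemma rho01 : 0 < rho < 1.
Proof.
have /andP[d0 d1] := de01; have ls : ln s < 0 by rewrite ln_lt0// s0 s1.
rewrite /rho powR_gt0//= powR_expR// -[ltRHS]expR0 ltr_expR.
by rewrite pmulr_rlt0.
Qed.

Lemma Cb_gt0 : 0 < Cb.
Proof.
have /andP[r0 r1] := rho01; rewrite /Cb divr_gt0 ?subr_gt0// mulr_gt0 ?powR_gt0 ?subr_gt0//.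
Qed.

Lemma psi_ge0 o l t : 0 <= psi o l t.
Proof. by rewrite /psi; case: ifP => _ //; exact: powR_ge0. Qed.

Let meas_zo o : measurable_fun setT (zo o).
Proof. by case: o; [exact: measurable_id|apply: measurable_funB]. Qed.

Lemma meas_psi o l : measurable_fun setT (psi o l).
Proof.
rewrite (_ : psi o l = (fun t => if (0 < zo o t) && (zo o t <= t_ l) then zo o t `^ (de - 1) else 0)); last by [].
apply: measurable_fun_ifT; last exact: measurable_cst.
  apply: measurable_and; first by apply: measurable_fun_ltr => //.
  by apply: measurable_fun_ler => //.
by apply: (measurableT_comp (measurable_powR _)) => //.
Qed.

Let Ik o k : set R := [set t | t_ k.+1 < zo o t <= t_ k].

Let IkE o k : Ik o k = if o then `]t_ k.+1, t_ k]%classic else `[1 - t_ k, 1 - t_ k.+1[%classic.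
Proof.
case: o; apply/seteqP; split => t; rewrite /Ik /zo /= in_itv //= => /andP[? ?]; apply/andP; split; lra.
Qed.

Let mIk o k : measurable (Ik o k).
Proof. by rewrite IkE; case: o. Qed.

Let lamIk o k : lam (Ik o k) = (t_ k - t_ k.+1)%:E.
Proof.
have h := tk_lt s0 s1 k; rewrite IkE; case: o; rewrite lebesgue_measure_itv /= lte_fin.
  by rewrite h EFinB.
by rewrite ltrD2l ltrN2 h -EFinB; congr EFin; ring.
Qed.

Let B : R := s `^ (de - 1).

Let tkB k : t_ k `^ (de - 1) = B ^+ k.
Proof.
have tk0 := tk_gt0 s0 k; rewrite /B !powR_expR// /tk exprn_expR// expRK -expRM_natl; congr expR; ring.
Qed.

Let Bs : B * s = rho.
Proof.
have e : s = expR (ln s) by rewrite lnK.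
rewrite /B /rho !powR_expR// [X in _ * X]e -expRD; congr expR; ring.
Qed.

(** On (t_(k+1), t_k] the function is at most B^(k+1) with B = s^(de - 1), and the interval has
    length (1 - s) s^k. The sum over k >= l is geometric with ratio B s = rho < 1. *)
Lemma psi_integral o l : (\int[lam]_t (psi o l t)%:E <= (Cb * rho ^+ l)%:E)%E.
Proof.
have /andP[d0 d1] := de01; have /andP[r0 r1] := rho01.
have B0 : 0 < B by rewrite powR_gt0.
pose fk k (t : R) : \bar R := ((B ^+ (l + k).+1)%:E * (\1_(Ik o (l + k)) t)%:E)%E.
have fk0 k t : (0 <= fk k t)%E by rewrite mule_ge0 ?lee_fin ?exprn_ge0// ltW.
have mfk k : measurable_fun setT (fk k).
  by apply: measurable_funeM; apply/measurable_EFinP; exact: measurable_indic.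
apply: (@le_trans _ _ (\int[lam]_t \sum_(k <oo) fk k t)%E).
  apply: ge0_le_integral => //.
  - by move=> t _; rewrite lee_fin psi_ge0.
  - by apply/measurable_EFinP; exact: meas_psi.
  - apply: (@ge0_emeasurable_sum _ _ _ setT fk predT) => [k t _ _|k _]; [exact: fk0|exact: mfk].
  move=> t _; rewrite /psi; case: ifP => [/andP[z0 zl]|_]; last by apply: nneseries_ge0 => k _ _; exact: fk0.
  have exm : exists m, t_ m < zo o t.
    have si : `|s| < 1 by rewrite gtr0_norm.
    have [m _ hm] := cvgr_lt _ (cvg_expr si) _ z0.
    by exists m; exact: (hm m (leqnn m)).
  have [m hm min] := ex_minnP exm.
  have lm : (l < m)%N by apply: (tk_ltP s0 s1); exact: lt_le_trans hm zl.
  case: m hm min lm => [//|m] hm min lm.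
  have zm : zo o t <= t_ m by rewrite leNgt; apply/negP => /min; rewrite ltnn.
  have lm' : (l <= m)%N by [].
  apply: (@le_trans _ _ (fk (m - l)%N t)).
    rewrite /fk subnKC// indicE mem_set ?mule1 ?lee_fin; last by rewrite /Ik /= hm zm.
    rewrite -tkB !powR_expR// ?tk_gt0// ler_expR.
    have : ln (t_ m.+1) <= ln (zo o t) by rewrite ler_ln ?posrE ?tk_gt0// ltW.
    by nra.
  apply: le_trans (@nneseries_lim_ge R (fun k => fk k t) xpredT 0 (m - l).+1 (fun k _ _ => fk0 k t)).
  by rewrite big_nat_recr//= leeDr// sume_ge0// => k _; exact: fk0.
rewrite integral_nneseries//.
have ik k : (\int[lam]_t fk k t = (Cb * (1 - rho) * rho ^+ (l + k))%:E)%E.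
  rewrite /fk ge0_integralZl_EFin//; last 2 first.
  - by apply/measurable_EFinP; exact: (measurable_indic (mIk o (l + k))).
  - by rewrite exprn_ge0// ltW.
  have -> : (\int[lam]_t (\1_(Ik o (l + k)) t)%:E = lam (Ik o (l + k)))%E.
    apply: etrans (integral_indic lam measurableT (mIk o (l + k))) _.
    by congr (lam _); exact: setIT.
  rewrite lamIk.
  rewrite -EFinM; congr EFin; rewrite tkS /tk /Cb divfK ?gt_eqF ?subr_gt0// -Bs exprMn exprS.
  by rewrite -/B; ring.
apply: lime_le; first by apply: is_cvg_nneseries => k _ _; apply: integral_ge0 => t _; exact: fk0.
apply: nearW => N; under eq_bigr do rewrite ik.
rewrite sumEFin lee_fin.
have geo : (1 - rho) * \sum_(0 <= k < N) rho ^+ (l + k) <= rho ^+ l.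
  under eq_bigr do rewrite exprD.
  rewrite -mulr_sumr mulrCA -[leRHS]mulr1; apply: ler_wpM2l; first by rewrite exprn_ge0// ltW.
  by rewrite big_mkord -[1 - rho]opprB mulNr -subrX1 opprB gerBl exprn_ge0// ltW.
rewrite -mulr_sumr -mulrA; apply: ler_wpM2l => //; exact/ltW/Cb_gt0.
Qed.

End DyadicIntegrals.

Section StripIntegral.
Context {R : realType} {d : measure_display} {P : measurableType d}.
Variables (mu : {measure set P -> \bar R}) (n : nat) (toV : P -> 'rV[R]_n.+2).
Hypothesis H : leb_like mu toV.
Local Notation V := 'rV[R]_n.+2.
Variables (c : V) (s de : R) (l : nat).
Hypothesis cc : is_corner c.
Hypothesis s0 : 0 < s.
Hypothesis s1 : s < 1.
Hypothesis de01 : 0 < de <= 4^-1.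
Local Notation t_ := (tk s).
Local Notation y := (cdist c).

(** A product of functions of one variable, equal to the product of the y_j^(de - 1) on the strip
    y_i <= t_l, so that its integral factors; the factor of index i alone produces the small
    rho^l. *)
Definition strip_f (i : 'I_n.+2) (x : V) : R := \prod_j psi s de (c 0 j == 0) (if j == i then l else 0%N) (x 0 j).

Lemma strip_f_ge0 i x : 0 <= strip_f i x.
Proof. by apply: prodr_ge0 => j _; exact: psi_ge0. Qed.

Lemma strip_fE i x : cube x -> y x i <= t_ l -> strip_f i x = \prod_j y x j `^ (de - 1).
Proof.
move=> cx yl; apply: eq_bigr => j _.
have z : zo (c 0 j == 0) (x 0 j) = y x j.
  have /andP[x0 x1] := cx j; rewrite /cdist /zo; case: ifPn => [/eqP ->|cj]; first by rewrite subr0 gtr0_norm.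
  by rewrite (c1_of cc cj) distrC gtr0_norm// subr_gt0.
have /andP[y0 y1] := cdist01 j cc cx.
rewrite /psi z y0 /=; case: eqP => [->|_]; first by rewrite yl.
by rewrite /tk expr0 ltW.
Qed.

(** Two coordinates are at most mid and the others at most 1, so mid^2 is at least the product of
    all y_j; the exponent de - 1 is negative. *)
Lemma mid_prod x : cube x -> (mid (y x) `^ (de - 1)) ^+ 2 <= \prod_j y x j `^ (de - 1).
Proof.
move=> cx; have y01 j : 0 < y x j < 1 by exact: cdist01.
have m0 := mid_cdist_gt0 cc cx.
have [j0 _ h0] := ex_le_mid ord0 y01; have [j1 j10 h1] := ex_le_mid j0 y01.
have /andP[d0 d1] := de01.
have e j : y x j `^ (de - 1) = expR ((de - 1) * ln (y x j)) by rewrite powR_expR//; have /andP[] := y01 j.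
under eq_bigr do rewrite e.
rewrite expR_prod powR_expR// -expRM_natl ler_expR -mulr_sumr mulrCA.
have l0 j : ln (y x j) <= 0 by apply: ln_le0; have /andP[_ /ltW] := y01 j.
have lm j : y x j <= mid (y x) -> ln (y x j) <= ln (mid (y x)).
  by move=> h; rewrite ler_ln ?posrE//; have /andP[] := y01 j.
have : \sum_j ln (y x j) <= 2 * ln (mid (y x)).
  rewrite (bigD1 j0)//= (bigD1 j1)//=.
  have : \sum_(i | (i != j0) && (i != j1)) ln (y x i) <= 0 by apply: sumr_le0.
  by have := lm _ h0; have := lm _ h1; lra.
by nra.
Qed.

Lemma meas_strip_f i : measurable_fun setT (strip_f i \o toV).
Proof.
apply: measurable_prod => j _.
by apply: (measurableT_comp (@meas_psi R s de _ _)) => //; exact: (leb_meas H j).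
Qed.

Lemma strip_f_integral i : (\int[mu]_p (strip_f i (toV p))%:E <= (Cb s de ^+ n.+2 * rho s de ^+ l)%:E)%E.
Proof.
pose ps j := psi s de (c 0 j == 0) (if j == i then l else 0%N).
pose cj j := fine (\int[@lebesgue_measure R]_t (ps j t)%:E)%E.
have hb j : (\int[@lebesgue_measure R]_t (ps j t)%:E <= (Cb s de * rho s de ^+ (if j == i then l else 0%N))%:E)%E.
  exact: psi_integral.
have h0 j : (0 <= \int[@lebesgue_measure R]_t (ps j t)%:E)%E.
  by apply: integral_ge0 => t _; rewrite lee_fin psi_ge0.
have fin j : (\int[@lebesgue_measure R]_t (ps j t)%:E)%E \is a fin_num.
  by rewrite ge0_fin_numE//; apply: le_lt_trans (hb j) (ltry _).
rewrite (leb_prod H (psi := ps) (c := cj)); last first.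
- by move=> j; rewrite fineK.
- by move=> j t; exact: psi_ge0.
- by move=> j; exact: meas_psi.
rewrite lee_fin.
have -> : Cb s de ^+ n.+2 * rho s de ^+ l = \prod_(j < n.+2) (Cb s de * rho s de ^+ (if j == i then l else 0%N)).
  rewrite big_split/= prodr_const cardT size_enum_ord; congr (_ * _).
  by rewrite (bigD1 i)//= eqxx big1 ?mulr1// => j /negPf ->.
apply: ler_prod => j _; rewrite -!lee_fin fineK// hb andbT.
exact: h0.
Qed.

Lemma error_integral (er : P -> R) E1 B2 : measurable_fun (toV @^-1` @cube R n.+2) er ->
  (\forall p \ae mu, cube (toV p) -> er p ^+ 2 <= E1 + B2 * \sum_i strip_f i (toV p)) -> 0 <= E1 -> 0 <= B2 ->
  (\int[mu]_(p in toV @^-1` @cube R n.+2) (er p ^+ 2)%:E <= (E1 + B2 * (n.+2%:R * (Cb s de ^+ n.+2 * rho s de ^+ l)))%:E)%E.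
Proof.
move=> mer her E10 B20; set Q := toV @^-1` @cube R n.+2.
have mQ : measurable Q := measurable_cube H.
have lr01 (j : 'I_n.+2) : (fun=> 0 : R) j < (fun=> 1 : R) j by [].
have muQ : mu Q = 1%:E.
  rewrite (_ : Q = toV @^-1` box (fun=> 0) (fun=> 1))// (measure_box H lr01) /boxvol.
  by rewrite big1// => i _; rewrite subr0.
have ms i : measurable_fun Q (fun p => (strip_f i (toV p))%:E).
  by apply/measurable_EFinP; apply: measurable_funTS; exact: meas_strip_f.
have msum : measurable_fun Q (fun p => (\sum_i (strip_f i (toV p))%:E)%E).
  exact: emeasurable_sum.
apply: (@le_trans _ _ (\int[mu]_(p in Q) (E1%:E + B2%:E * \sum_i (strip_f i (toV p))%:E))%E).
  apply: ae_ge0_le_integral => //.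
  - by move=> p _; rewrite lee_fin sqr_ge0.
  - by apply/measurable_EFinP; exact: measurable_funX.
  - move=> p _; apply: adde_ge0; rewrite ?lee_fin// mule_ge0 ?lee_fin// sume_ge0// => i _.
    by rewrite lee_fin strip_f_ge0.
  - by apply: emeasurable_funD => //; apply: measurable_funeM.
  by apply: filterS her => p hp Qp; rewrite sumEFin -EFinM -EFinD lee_fin; exact: hp.
rewrite ge0_integralD//; last 2 first.
- by move=> p _; rewrite mule_ge0 ?lee_fin// sume_ge0// => i _; rewrite lee_fin strip_f_ge0.
- by apply: measurable_funeM.
rewrite integral_cst// muQ mule1 EFinD leeD2l//.
rewrite ge0_integralZl_EFin//; last by move=> p _; apply: sume_ge0 => i _; rewrite lee_fin strip_f_ge0.
rewrite EFinM; apply: lee_wpmul2l; first by rewrite lee_fin.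
rewrite ge0_integral_sum//; last by move=> i p _; rewrite lee_fin strip_f_ge0.
apply: (@le_trans _ _ (\sum_(i < n.+2) (Cb s de ^+ n.+2 * rho s de ^+ l)%:E)%E).
  apply: lee_sum => i _; apply: le_trans (strip_f_integral i).
  apply: ge0_subset_integral => //.
  - by apply/measurable_EFinP; exact: meas_strip_f.
  - by move=> p _; rewrite lee_fin strip_f_ge0.
by rewrite sumEFin sumr_const card_ord lee_fin mulr_natl.
Qed.

End StripIntegral.

Section WeakDerivativeDifference.
Context {R : realType} {d : measure_display} {P : measurableType d}.
Variables (mu : {measure set P -> \bar R}) (n : nat) (toV : P -> 'rV[R]_n.+2).
Hypothesis H : leb_like mu toV.
Local Notation V := 'rV[R]_n.+2.
Local Notation Q := (@cube R n.+2).

Lemma meas_compact (A : set V) : compact A -> measurable (toV @^-1` A).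
Proof.
move=> cA; rewrite -[toV @^-1` A]setCK; apply: measurableC; rewrite preimage_setC; apply: (meas_open H).
by rewrite openC; apply: compact_closed => //; exact: norm_hausdorff.
Qed.

Lemma loc_integrableB (f g : V -> R) : loc_integrable mu toV Q f -> loc_integrable mu toV Q g ->
  loc_integrable mu toV Q (fun x => f x - g x).
Proof.
move=> [mf If] [mg Ig]; split; first exact: measurable_funB.
move=> A cA AQ; rewrite (_ : _ \o _ = (EFin \o (f \o toV)) \- (EFin \o (g \o toV)))%E.
  by apply: integrableB; [exact: meas_compact|exact: If|exact: Ig].
by apply/funext => p /=; rewrite EFinB.
Qed.

Lemma integrable_test (g u : V -> R) (A : set V) : loc_integrable mu toV Q g -> continuous u ->
  compact A -> A `<=` Q -> (forall x, ~ A x -> u x = 0) ->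
  mu.-integrable (toV @^-1` Q) (EFin \o (fun p => g (toV p) * u (toV p))).
Proof.
move=> [mg Ig] cu cA AQ u0.
have mA := meas_compact cA; have mQ : measurable (toV @^-1` Q) := measurable_cube H.
have [C hC] := continuous_bounded (fun=> 0) (fun=> 1) cu.
have : mu.-integrable (toV @^-1` A) (EFin \o (fun p => g (toV p) * u (toV p))).
  have ig := Ig _ cA AQ.
  apply: (@le_integrable _ _ _ mu _ mA _ (fun p => (C%:E * (EFin \o (g \o toV)) p)%E)).
  - apply/measurable_EFinP; apply: measurable_funM; last by apply: measurable_funTS; exact: (meas_continuous H).
    by apply: measurable_funS mg => // p; exact: AQ.
  - move=> p Ap; rewrite /comp -EFinM !abse_EFin lee_fin !normrM mulrC ler_wpM2r//.
    rewrite (@le_trans _ _ C) ?ler_norm//; apply: hC => j.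
    by have /andP[/ltW -> /ltW ->] := AQ _ Ap j.
  exact: integrableZl.
move=> /(integrable_mkcond _ mA) iA; apply/(integrable_mkcond _ mQ).
rewrite (_ : _ \_ _ = (EFin \o (fun p => g (toV p) * u (toV p))) \_ (toV @^-1` A))//.
apply/funext => p; rewrite !patchE.
have [pA|pA] := pselect (A (toV p)).
  by rewrite (mem_set (A := toV @^-1` Q) (AQ _ pA)) (mem_set (A := toV @^-1` A) pA).
by rewrite (memNset (A := toV @^-1` A) pA); case: ifP => // _; rewrite /= u0// mulr0.
Qed.

(** Splitting the integrals of differences requires them to be finite; local integrability on the
    compact support of the test function provides this. *)
Lemma weak_derivB (f g F G : V -> R) i : weak_deriv mu toV Q f (unit_mi i) F -> weak_deriv mu toV Q g (unit_mi i) G ->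
  weak_deriv mu toV Q (fun x => f x - g x) (unit_mi i) (fun x => F x - G x).
Proof.
move=> [lf lF hf] [lg lG hg]; split; [exact: loc_integrableB|exact: loc_integrableB|].
move=> phi tphi; have [sphi [A [cA AQ phi0]]] := tphi.
have mQ : measurable (toV @^-1` Q) := measurable_cube H.
have cp := phi_continuous sphi; have cpp := partial_continuous (i := i) sphi.
have pp0 := partial0 i cA phi0.
move: (hf _ tphi) (hg _ tphi); rewrite mderiv_unit /integ => e1 e2.
have i1 := integrable_test lf cpp cA AQ pp0; have i2 := integrable_test lg cpp cA AQ pp0.
have i3 := integrable_test lF cp cA AQ phi0; have i4 := integrable_test lG cp cA AQ phi0.
have spl (f1 f2 u : V -> R) : mu.-integrable (toV @^-1` Q) (EFin \o (fun p => f1 (toV p) * u (toV p))) ->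
    mu.-integrable (toV @^-1` Q) (EFin \o (fun p => f2 (toV p) * u (toV p))) ->
    (\int[mu]_(p in toV @^-1` Q) ((f1 (toV p) - f2 (toV p)) * u (toV p))%:E =
     \int[mu]_(p in toV @^-1` Q) (f1 (toV p) * u (toV p))%:E - \int[mu]_(p in toV @^-1` Q) (f2 (toV p) * u (toV p))%:E)%E.
  move=> j1 j2; rewrite -(integralB_EFin mQ j1 j2); apply: eq_integral => p _.
  by rewrite mulrBl EFinB.
have aux (s : R) (X Y : \bar R) : X \is a fin_num -> Y \is a fin_num -> (s%:E * X - s%:E * Y = s%:E * (X - Y))%E.
  by case: X Y => [a||] [b||]// _ _; rewrite -!EFinM -!EFinB mulrBr.
rewrite spl// spl// e1 e2; apply: aux; [exact: (integrable_fin_num mQ i3)|exact: (integrable_fin_num mQ i4)].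
Qed.

End WeakDerivativeDifference.

(** * H^1 error of the network *)

Section H1Error.
Context {R : realType} {d : measure_display} {P : measurableType d}.
Variables (mu : {measure set P -> \bar R}) (n : nat) (toV : P -> 'rV[R]_n.+2).
Hypothesis H : leb_like mu toV.
Local Notation V := 'rV[R]_n.+2.
Local Notation Q := (@cube R n.+2).
Local Notation e_ i := (delta_mx 0 i : V).
Variables (c : V) (f : V -> R) (Df : 'I_n.+2 -> V -> R) (de Cr : R).
Hypothesis cc : is_corner c.
Hypothesis de01 : 0 < de <= 4^-1.
Hypothesis Cr0 : 0 < Cr.
Local Notation y := (cdist c).
Hypothesis hreg : \forall p \ae mu, cube (toV p) ->
  `|f (toV p)| <= Cr /\ forall i, `|Df i (toV p)| <= Cr * mid (y (toV p)) `^ (de - 1).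
Variables (s : R) (l M : nat).
Hypothesis s0 : 0 < s.
Hypothesis s1 : s < 1.
Hypothesis l0 : (0 < l)%N.
Local Notation t_ := (tk s).
Local Notation K := {ffun 'I_n.+2 -> 'I_l.+1}.
Variable kk : K -> {ffun 'I_n.+2 -> 'I_M} -> R.
Variable e1 : R.
Hypothesis e10 : 0 < e1.
Hypothesis hP : forall k, \forall p \ae mu, (toV @^-1` box (pl c s k) (pr c s k)) p -> `|f (toV p) - Pk c s kk k (toV p)| <= e1.
Hypothesis hdP : forall k i, \forall p \ae mu, (toV @^-1` box (pl c s k) (pr c s k)) p -> `|Df i (toV p) - dPk c s kk k i (toV p)| <= e1.
Hypothesis wDf : forall i, weak_deriv mu toV Q f (unit_mi i) (Df i).
Hypothesis fL2 : L2 mu toV Q f.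
Variables (Phi : NN R n.+2 1) (L eta : R) (tg : V -> R).
Hypothesis L0 : 0 <= L.
Hypothesis eta0 : 0 <= eta.
Hypothesis htg : forall x, cube x -> tg x = uh c s kk x.
Hypothesis hPhi : nrmW L eta (fun x => realize1 Phi x - tg x).

Local Notation g := (realize1 Phi).
Variable kU : R.
Hypothesis hkU : Ku n s l e1 <= kU.

Lemma realize_bound x : cube x -> `|g x| <= Cr + 3 * e1 + eta.
Proof.
move=> cx; have h := uh_bound H cc hreg s0 s1 l0 hP cx.
have := hPhi.1 x; rewrite htg// => h2.
by have := ler_normD (g x - uh c s kk x) (uh c s kk x); rewrite subrK => h3; lra.
Qed.

(** Both slopes are read off at one small t > 0 for which the shifted point is still in the cube,
    where the emulated target coincides with [uh]. *)
Lemma slope_close x i G0 a B : cube x -> 0 <= B ->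
  (exists2 dl, 0 < dl & forall t, 0 <= t <= dl -> g (x + t *: e_ i) = g x + G0 * t) ->
  (exists2 dl, 0 < dl & forall t, 0 <= t <= dl -> `|uh c s kk (x + t *: e_ i) - uh c s kk x - a * t| <= B * t) ->
  `|a - G0| <= B + L * eta.
Proof.
move=> cx B0 [d1 d10 h1] [d2 d20 h2]; have /andP[x0 x1] := cx i.
have [t [t0 td1 td2 tx]] : exists t, [/\ 0 < t, t <= d1, t <= d2 & x 0 i + t < 1].
  exists (Num.min (Num.min d1 d2) ((1 - x 0 i) / 2)); split.
  - by rewrite !lt_min d10 d20/= divr_gt0// subr_gt0.
  - by rewrite !ge_min lexx.
  - by rewrite !ge_min lexx orbT.
  have : Num.min (Num.min d1 d2) ((1 - x 0 i) / 2) <= (1 - x 0 i) / 2 by rewrite ge_min lexx orbT.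
  lra.
have cxt : cube (x + t *: e_ i).
  move=> j; have /andP[j0 j1] := cx j; rewrite [(x + _) _ _]mxE [X in _ + X]mxE [X in _ * X]mxE eqxx /=.
  by case: eqVneq => [->|_]; rewrite ?mulr1 ?mulr0 ?addr0; apply/andP; split; lra.
have k1 := h1 t (introT andP (conj (ltW t0) td1)).
have k2 := h2 t (introT andP (conj (ltW t0) td2)).
have := hPhi.2 x i t; rewrite !htg// k1 (gtr0_norm t0) => k3.
have e : a * t - G0 * t = - (g x + G0 * t - uh c s kk (x + t *: e_ i) - (g x - uh c s kk x)) -
  (uh c s kk (x + t *: e_ i) - uh c s kk x - a * t) by ring.
have : `|(a - G0) * t| <= (B + L * eta) * t.
  rewrite mulrBl e (le_trans (ler_normB _ _))// normrN mulrDl addrC; exact: lerD.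
by rewrite normrM (gtr0_norm t0) ler_pM2r.
Qed.

Local Notation e2 := (kU + 3 * e1 + eta + L * eta).
Local Notation B0 := (2 * Cr / s + e2).

(** Where all y_i > t_l, the errors are at most e2. In a strip, function and network are estimated
    separately, as are their slopes, by multiples of mid^(de - 1), whose square is bounded by
    [strip_f]; [B0] gathers these multiples. *)
Lemma pointwise_error (G : 'I_n.+2 -> V -> R) :
  (forall i x, exists2 dl, 0 < dl & forall t, 0 <= t <= dl -> g (x + t *: e_ i) = g x + G i x * t) ->
  \forall p \ae mu, cube (toV p) ->
  (f (toV p) - g (toV p)) ^+ 2 <= e2 ^+ 2 + B0 ^+ 2 * \sum_i strip_f c s de l i (toV p) /\
  forall i, (Df i (toV p) - G i (toV p)) ^+ 2 <= e2 ^+ 2 + B0 ^+ 2 * \sum_i strip_f c s de l i (toV p).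
Proof.
move=> hG; have core := uh_core H cc s0 s1 l0 e10 hP hdP.
have gen := ae_generic H cc s.
have K0 : 0 <= kU := le_trans (Ku_ge0 n l s0 s1 e10) hkU.
have Le0 : 0 <= L * eta by exact: mulr_ge0.
have e20 : 0 <= e2 by have := ltW e10; have := eta0; lra.
have is1 : 1 <= s^-1 by rewrite invf_ge1// ltW.
have Cs0 : 0 < Cr / s by rewrite divr_gt0.
have Cs : Cr <= Cr / s by rewrite ler_peMr// ltW.
have B00 : 0 <= B0 by rewrite -mulrA; lra.
have sq (a b : R) : `|a| <= b -> a ^+ 2 <= b ^+ 2.
  by move=> ab; rewrite -real_normK ?num_real//; apply: lerXn2r => //; rewrite nnegrE// (le_trans _ ab).
apply: filterS3 core gen hreg => p hc hg hr cx; set x := toV p in hc hg hr cx *.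
have [fr dr] := hr cx.
have S0 : 0 <= \sum_i strip_f c s de l i x by apply: sumr_ge0 => i _; exact: strip_f_ge0.
have gv : `|g x - uh c s kk x| <= eta by have := hPhi.1 x; rewrite htg.
have [h|h] := boolP [forall i, t_ l < y x i].
  have [hv hd] := hc cx (fun i => forallP h i).
  have lft (a : R) : `|a| <= e2 -> a ^+ 2 <= e2 ^+ 2 + B0 ^+ 2 * \sum_i strip_f c s de l i x.
    by move=> /sq ha; apply: le_trans ha _; rewrite lerDl mulr_ge0// sqr_ge0.
  split=> [|i]; apply: lft.
    have := ler_distD (uh c s kk x) (f x) (g x); rewrite [`|uh _ _ _ _ - g x|]distrC => h3.
    by have := ltW e10; have := eta0; lra.
  have kp : 0 <= kU + 2 * e1 by have := ltW e10; have := eta0; lra.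
  have hd' : exists2 dl, 0 < dl & forall t, 0 <= t <= dl ->
      `|uh c s kk (x + t *: e_ i) - uh c s kk x - Df i x * t| <= (kU + 2 * e1) * t.
    have [dl d0 hdl] := hd i; exists dl => // t ht; apply: le_trans (hdl t ht) _.
    by apply: ler_wpM2r; [have /andP[] := ht|rewrite lerD2r].
  have := slope_close cx kp (hG i x) hd'; have := ltW e10; have := eta0; lra.
move: h; rewrite negb_forall => /existsP[i0]; rewrite -leNgt => yl.
set m := mid (y x) `^ (de - 1).
have m1 : 1 <= m.
  have /andP[d0 d1] := de01.
  rewrite /m powR_expR ?mid_cdist_gt0// -[leLHS]expR0 ler_expR.
  have l0' : ln (mid (y x)) <= 0.
    by apply: ln_le0; apply: mid_le1 => j; apply: ltW; [exact: cdist_gt0|exact: cdist_lt1].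
  by nra.
have mS : m ^+ 2 <= \sum_i strip_f c s de l i x.
  apply: le_trans (mid_prod cc de01 cx) _; rewrite -(strip_fE de cc cx yl).
  rewrite (bigD1 i0)//= lerDl; apply: sumr_ge0 => i _; exact: strip_f_ge0.
have lft (a : R) : `|a| <= B0 * m -> a ^+ 2 <= e2 ^+ 2 + B0 ^+ 2 * \sum_i strip_f c s de l i x.
  move=> /sq; rewrite exprMn => ha; apply: le_trans ha _.
  have : B0 ^+ 2 * m ^+ 2 <= B0 ^+ 2 * \sum_i strip_f c s de l i x by rewrite ler_wpM2l// sqr_ge0.
  by have := sqr_ge0 e2; lra.
have em : e2 <= e2 * m by rewrite ler_peMr.
have Bm : B0 * m = 2 * (Cr / s) * m + e2 * m by ring.
have Csm : Cr * m <= Cr / s * m by rewrite ler_wpM2r// (le_trans _ m1).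
have Cm : Cr <= Cr * m by rewrite ler_peMr// ltW.
split=> [|i]; apply: lft; rewrite Bm.
  have := realize_bound cx; have := ler_normB (f x) (g x); have := ltW e10.
  lra.
have CP : 0 <= Cr * s^-1 * m by rewrite !mulr_ge0// ltW// ?invr_gt0// (lt_le_trans ltr01).
have Bp : 0 <= Cr * s^-1 * m + e1 + kU by have := ltW e10; have := eta0; lra.
have [dl d0 hdl] := uh_incr H cc de01 Cr0 hreg s0 s1 l0 e10 hP hdP i cx (hg cx).
have k0 : exists2 dl, 0 < dl & forall t, 0 <= t <= dl ->
    `|uh c s kk (x + t *: e_ i) - uh c s kk x - 0 * t| <= (Cr * s^-1 * m + e1 + kU) * t.
  exists dl => // t ht; rewrite mul0r subr0; apply: le_trans (hdl t ht) _.
  by apply: ler_wpM2r; [have /andP[] := ht|rewrite lerD2l].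
have := slope_close cx Bp (hG i x) k0; rewrite sub0r normrN => k1.
have k2 : `|Df i x| <= Cr * m := dr i; have := ler_normB (Df i x) (G i x).
have := ltW e10; have := eta0; lra.
Qed.

Lemma H1_error eps :
  n.+3%:R * (e2 ^+ 2 + B0 ^+ 2 * (n.+2%:R * (Cb s de ^+ n.+2 * rho s de ^+ l))) <= eps ^+ 2 ->
  H1_le mu toV Q (fun x => f x - g x) eps.
Proof.
move=> he.
have [G hG] := choice (fun i => pwl_weak_deriv H i (pwl_realize1 Phi)).
have wG i : weak_deriv mu toV Q g (unit_mi i) (G i) by have [] := hG i.
have mG i : measurable_fun setT (G i \o toV) by have [] := hG i.
have sG i x : exists2 dl, 0 < dl & forall t, 0 <= t <= dl -> g (x + t *: e_ i) = g x + G i x * t by have [_ _] := hG i; exact.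
have mg : measurable_fun setT (g \o toV).
  by have [cg _ _] := pwl_realize1 Phi; exact: (meas_continuous H).
have mf : measurable_on toV Q (fun x => f x - g x).
  by apply: measurable_funB; [exact: fL2.1|exact: measurable_funTS].
have mDf i : measurable_on toV Q (fun x => Df i x - G i x).
  by apply: measurable_funB; [have [_ [] ] := wDf i|apply: measurable_funTS; exact: (mG i)].
have pe := pointwise_error sG.
set E := e2 ^+ 2 + _ in he.
have E20 : 0 <= e2 ^+ 2 by exact: sqr_ge0.
have B20 : 0 <= B0 ^+ 2 by exact: sqr_ge0.
have if_ : (integ mu toV Q (fun x => ((f x - g x) ^+ 2)%R) <= E%:E)%E.
  have := @error_integral _ _ _ _ _ _ H c s de l s0 s1 de01 (fun p => f (toV p) - g (toV p)) _ _ mf _ E20 B20.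
  by rewrite /integ; apply; apply: filterS pe => p h cx; exact: (h cx).1.
have iD i : (integ mu toV Q (fun x => ((Df i x - G i x) ^+ 2)%R) <= E%:E)%E.
  have := @error_integral _ _ _ _ _ _ H c s de l s0 s1 de01 (fun p => Df i (toV p) - G i (toV p)) _ _ (mDf i) _ E20 B20.
  by rewrite /integ; apply; apply: filterS pe => p h cx; exact: (h cx).2.
split; first by split=> //; exact: le_lt_trans if_ (ltry _).
exists (fun i x => Df i x - G i x); split=> [i|].
  exact: (weak_derivB H (wDf i) (wG i)).
apply: (@le_trans _ _ (E%:E + \sum_(i < n.+2) E%:E)%E); first by apply: leeD => //; apply: lee_sum.
rewrite sumEFin -EFinD lee_fin sumr_const card_ord; apply: le_trans he.
by rewrite -mulrS mulr_natl.
Qed.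

End H1Error.

(** * Choice of the parameters *)

Section Rates.
Context {R : realType}.

Lemma pow2_ge (x : R) : exists a : nat, x <= 2 ^+ a.
Proof.
exists (Num.truncn x).+1; apply: (@le_trans _ _ ((Num.truncn x).+1)%:R); first exact/ltW/truncnS_gt.
by rewrite -natrX ler_nat ltnW// ltn_expl.
Qed.

Lemma half_pow X Y M : (X + Y <= M)%N -> 2 ^+ X * 2^-1 ^+ M <= 2^-1 ^+ Y :> R.
Proof.
move=> h; have p : 0 < 2 ^+ X :> R by exact: exprn_gt0.
rewrite exprVn exprVn ler_pdivrMr ?exprn_gt0// mulrC ler_pdivlMr ?exprn_gt0//.
by rewrite -exprD ler_weXn2l// ler1n.
Qed.

(** Magnitudes are tracked by powers of two, which turns the comparison of error terms into linear
    inequalities between exponents. *)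
Definition dyadic_le (i : nat) (x : R) := 0 <= x <= 2 ^+ i.

Lemma dyadic_leM i j x y : dyadic_le i x -> dyadic_le j y -> dyadic_le (i + j) (x * y).
Proof. by move=> /andP[x0 x1] /andP[y0 y1]; rewrite /dyadic_le mulr_ge0//= exprD ler_pM. Qed.

Lemma dyadic_leX i k x : dyadic_le i x -> dyadic_le (i * k) (x ^+ k).
Proof. by move=> /andP[x0 x1]; rewrite /dyadic_le exprn_ge0//= exprM lerXn2r// nnegrE// exprn_ge0. Qed.

Lemma dyadic_le_half i x Y M : dyadic_le i x -> (i + Y <= M)%N -> x * 2^-1 ^+ M <= 2^-1 ^+ Y.
Proof.
move=> /andP[x0 x1] h; apply: le_trans (half_pow h); exact: ler_wpM2r.
Qed.

Lemma linear_budget1 (N u1 u2 u3 u4 U1 U2 U3 U4 : nat) : (0 < N)%N ->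
  (u1 <= U1 * N)%N -> (u2 <= U2 * N)%N -> (u3 <= U3 * N)%N -> (u4 <= U4 * N)%N ->
  (4 + u1 + u2 + (u4 + u3) + N.+1 <= ((6 + U1 + U2 + U4 + U3) * N).+1)%N.
Proof. by move=> *; rewrite !mulnDl; lia. Qed.

Lemma linear_budget2 (N q m A u1 u2 u3 u4 U1 U2 U3 U4 T : nat) : (0 < N)%N -> (q <= 2 * (A * N))%N ->
  (u1 <= U1 * N)%N -> (u2 <= U2 * N)%N -> (u3 <= U3 * N)%N -> (u4 <= U4 * N)%N -> (3 * m <= T * N)%N ->
  (3 + q + u2 + (u1 + (u4 + u3) + 3 * (q + m)) + N.+1 <= (2 + (8 * A + 4 + U2 + U1 + U4 + U3 + T)) * N)%N.
Proof. by move=> *; rewrite !mulnDl; have := mulnA 8 A N; lia. Qed.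

Variables (n : nat) (s K2 : R).
Hypothesis s0 : 0 < s.
Hypothesis s1 : s < 1.
Hypothesis K20 : 0 < K2.

Definition gap_inv (l : nat) : R := ((1 - s) * tk s l)^-1.
(** Every patch side is at least 1 / gap_inv. Of the n + 3 powers, n + 2 bound the inverse square
    root of the patch volume, crudely by the inverse volume, and one bounds the factor 1 / side of
    the gradient. Degree 2^q in each variable means truncation at (2^q).+1. *)
Definition e1_of (l q : nat) : R := K2 * gap_inv l ^+ n.+3 * 2^-1 ^+ (2 ^ q).+1.
Definition L_of (l q : nat) : R := (2 ^+ q + 1) * Sb s l.
Definition eta_of (l q m : nat) : R :=
  #|{: {ffun 'I_n.+2 -> 'I_l.+1}}|%:R * (K2 * gap_inv l ^+ n.+2) * (6 ^+ (q + n.+3) * (1 / 2) ^+ m).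

Lemma gap_inv_ge1 l : 1 <= gap_inv l.
Proof.
rewrite /gap_inv invf_ge1 ?mulr_gt0 ?subr_gt0 ?tk_gt0//.
apply: mulr_ile1; rewrite ?subr_ge0 ?(ltW s1) ?(ltW (tk_gt0 s0 l)) ?tk_le1//.
by rewrite gerBl ltW.
Qed.

(* The polynomial degree 2^q and the multiplication accuracy m = K4 N only have to beat fixed powers
   of the inverse mesh size, which is exponential in l = K1 N. *)
Lemma error_rates (K1 : nat) : exists K3 K4 : nat, (0 < K3)%N /\ forall N q, (0 < N)%N -> (K3 * N <= 2 ^ q <= 2 * (K3 * N))%N ->
  (6 ^ (q + n.+3) <= 2 ^ (K4 * N))%N /\
  Ku n s (K1 * N) (e1_of (K1 * N) q) + 3 * e1_of (K1 * N) q + eta_of (K1 * N) q (K4 * N) +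
    L_of (K1 * N) q * eta_of (K1 * N) q (K4 * N) <= 2^-1 ^+ N.
Proof.
have [a1 ha1] := pow2_ge s^-1; have [a2 ha2] := pow2_ge (1 - s)^-1; have [a3 ha3] := pow2_ge K2.
pose a := (a1 + a2 + a3)%N.
have le2 i j : (i <= j)%N -> 2 ^+ i <= 2 ^+ j :> R by move=> ij; rewrite ler_weXn2l// ler1n.
have hs : s^-1 <= 2 ^+ a by apply: le_trans ha1 _; apply: le2; rewrite /a; lia.
have hs1 : (1 - s)^-1 <= 2 ^+ a by apply: le_trans ha2 _; apply: le2; rewrite /a; lia.
have hK : dyadic_le a K2 by rewrite /dyadic_le ltW//=; apply: le_trans ha3 _; apply: le2; rewrite /a; lia.
(* 2^a bounds 1/s, 1/(1 - s) and K2. [K3] and [K4] collect the exponents of 2 in the patch error and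
   in the emulation error, all linear in N; the two budget lemmas add them up. *)
pose c1 := K1.+1; pose K3 := (6 + c1 * n.+2 + a * c1 + a + a * c1 * n.+3)%N.
pose K4 := (2 + (8 * K3 + 4 + a * c1 + c1 * n.+2 + a + a * c1 * n.+2 + 3 * n.+3))%N.
exists K3, K4; split; first by rewrite /K3 -!addnA.
move=> N q N0 /andP[q1 q2]; set l := (K1 * N)%N.
have l1 : (l.+1 <= c1 * N)%N by rewrite /l /c1 mulSn -add1n leq_add2r.
have ll : (l <= c1 * N)%N by exact: ltnW.
have t1 := gap_inv_ge1 l; have t0 : 0 <= gap_inv l by apply: le_trans t1.
have ht : dyadic_le (a * l.+1) (gap_inv l).
  rewrite /dyadic_le t0/= /gap_inv invfM mulnS exprD /tk -exprVn exprM.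
  by apply: ler_pM => //; rewrite ?invr_ge0 ?subr_ge0 ?exprn_ge0 ?invr_ge0 ?(ltW s0) ?(ltW s1)//; apply: lerXn2r; rewrite ?nnegrE ?invr_ge0 ?exprn_ge0// ltW.
set kc := #|{: {ffun 'I_n.+2 -> 'I_l.+1}}|.
have hkc : dyadic_le (l * n.+2) kc%:R.
  rewrite /dyadic_le ler0n /kc card_ffun !card_ord exprM -natrX -natrX ler_nat leq_exp2r//.
  exact: ltn_expl.
have kc1 : 1 <= kc%:R :> R by rewrite ler1n /kc card_ffun !card_ord expn_gt0.
have h22 i : dyadic_le i (2 ^+ i) by rewrite /dyadic_le lexx andbT; apply: exprn_ge0.
have qK : (q <= 2 * (K3 * N))%N by apply: leq_trans (ltnW (ltn_expl q (leqnn 2))) q2.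
have i1 (j : nat) : (l * j <= c1 * j * N)%N by rewrite mulnAC leq_mul2r ll orbT.
have i2 : (a * l.+1 <= a * c1 * N)%N by rewrite -mulnA leq_mul2l l1 orbT.
have i3 (j : nat) : (a * l.+1 * j <= a * c1 * j * N)%N by rewrite [(_ * j * N)%N]mulnAC leq_mul2r i2 orbT.
have i4 : (a <= a * N)%N by rewrite leq_pmulr.
have i5 : (3 * n.+3 <= 3 * n.+3 * N)%N by rewrite leq_pmulr.
have hM4 : (3 + q + a * l.+1 + (l * n.+2 + (a + a * l.+1 * n.+2) + 3 * (q + n.+3)) + N.+1 <= K4 * N)%N.
  exact: linear_budget2.
have m6 : (3 * (q + n.+3) <= K4 * N)%N by apply: leq_trans hM4; apply: leq_trans (leq_addr N.+1 _); apply: leq_trans (leq_addl _ _); exact: leq_addl.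
split.
  apply: (@leq_trans (8 ^ (q + n.+3))); first by rewrite leq_exp2r ?addnS.
  by rewrite (_ : 8 = 2 ^ 3)%N// -expnM leq_pexp2l.
have b1 : dyadic_le (a + a * l.+1 * n.+3) (K2 * gap_inv l ^+ n.+3).
  by apply: dyadic_leM => //; exact: dyadic_leX.
have b2 : dyadic_le (a + a * l.+1 * n.+2) (K2 * gap_inv l ^+ n.+2).
  by apply: dyadic_leM => //; exact: dyadic_leX.
have H0 i : 0 <= 2^-1 ^+ i :> R by rewrite exprVn invr_ge0; apply: exprn_ge0.
have E1 : Ku n s l (e1_of l q) + 3 * e1_of l q <= 2^-1 ^+ N.+1.
  have hX : dyadic_le (4 + l * n.+2 + a * l.+1 + (a + a * l.+1 * n.+3)) (2 ^+ 4 * kc%:R * gap_inv l * (K2 * gap_inv l ^+ n.+3)).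
    by apply: dyadic_leM => //; apply: dyadic_leM => //; apply: dyadic_leM.
  have hM : (4 + l * n.+2 + a * l.+1 + (a + a * l.+1 * n.+3) + N.+1 <= (2 ^ q).+1)%N.
    apply: (@leq_trans (K3 * N).+1) => //.
    exact: linear_budget1.
  apply: le_trans (dyadic_le_half hX hM).
  rewrite /Ku /Slip -/(gap_inv l) -/kc /e1_of.
  set X := K2 * gap_inv l ^+ n.+3; set h := 2^-1 ^+ (2 ^ q).+1; have /andP[X0 _] := b1.
  have : kc%:R * (2 * (X * h) * (2 * gap_inv l + 1)) + 3 * (X * h) = (kc%:R * (4 * gap_inv l + 2) + 3) * (X * h) by ring.
  move=> ->; rewrite -[leRHS]mulrA; apply: ler_wpM2r; first by apply: mulr_ge0 => //; exact: H0.
  have : (2 ^+ 4 : R) = 16 by rewrite -natrX.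
  move=> ->; have : kc%:R <= kc%:R * gap_inv l by rewrite ler_peMr// ler0n.
  by rewrite mulrDr; lra.
have E2 : eta_of l q (K4 * N) + L_of l q * eta_of l q (K4 * N) <= 2^-1 ^+ N.+1.
  have h6 : dyadic_le (3 * (q + n.+3)) (6 ^+ (q + n.+3)).
    apply: dyadic_leX; rewrite /dyadic_le; apply/andP; split => //.
    by rewrite -natrX ler_nat.
  have hX : dyadic_le (3 + q + a * l.+1 + (l * n.+2 + (a + a * l.+1 * n.+2) + 3 * (q + n.+3)))
      (2 ^+ 3 * 2 ^+ q * gap_inv l * (kc%:R * (K2 * gap_inv l ^+ n.+2) * 6 ^+ (q + n.+3))).
    apply: dyadic_leM; first by apply: dyadic_leM => //; apply: dyadic_leM.
    by apply: dyadic_leM => //; apply: dyadic_leM.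
  apply: le_trans (dyadic_le_half hX hM4).
  rewrite /eta_of -/kc mul1r; set X := kc%:R * _; set S := 6 ^+ _; set h := 2^-1 ^+ _.
  have : X * (S * h) + L_of l q * (X * (S * h)) = h * ((1 + L_of l q) * (X * S)) by ring.
  move=> ->; rewrite [leRHS]mulrC.
  apply: ler_wpM2l; first exact: H0.
  apply: ler_wpM2r; first by have /andP[] := dyadic_leM (dyadic_leM hkc b2) h6.
  rewrite /L_of /Sb -/(gap_inv l).
  have p1 : 1 <= 2 ^+ q :> R by apply: exprn_ege1; rewrite ler1n.
  have : (2 ^+ 3 : R) = 8 by rewrite -natrX.
  move=> ->; have : gap_inv l <= 2 ^+ q * gap_inv l by rewrite ler_peMl.
  have : (2 ^+ q + 1) * (2 * gap_inv l) = 2 * (2 ^+ q * gap_inv l) + 2 * gap_inv l by ring.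
  by move=> ->; rewrite -mulrA; lra.
have : 2^-1 ^+ N = 2^-1 ^+ N.+1 + 2^-1 ^+ N.+1 :> R.
  by rewrite exprS -mulrDl -[X in _ = (X + X) * _]mul1r -splitr mul1r.
by move=> ->; rewrite -addrA; exact: lerD.
Qed.

End Rates.

Section Family.
Context {R : realType} {d : measure_display} {P : measurableType d}.
Variables (mu : {measure set P -> \bar R}) (n : nat) (toV : P -> 'rV[R]_n.+2).
Hypothesis H : leb_like mu toV.
Local Notation V := 'rV[R]_n.+2.
Variables (c : V) (f : V -> R) (D : ('I_n.+2 -> nat) -> V -> R) (de Cr K2 ka0 : R).
Hypothesis cc : is_corner c.
Hypothesis wD : forall alpha, weak_deriv mu toV (@cube R n.+2) f alpha (D alpha).
Hypothesis fL2 : L2 mu toV (@cube R n.+2) f.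
Hypothesis de01 : 0 < de <= 4^-1.
Hypothesis Cr0 : 0 < Cr.
Hypothesis hreg : \forall p \ae mu, cube (toV p) ->
  `|f (toV p)| <= Cr /\ forall i, `|D (unit_mi i) (toV p)| <= Cr * mid (cdist c (toV p)) `^ (de - 1).
Hypothesis K20 : 0 < K2.
Hypothesis ka00 : 0 < ka0.
Hypothesis hpatch : forall u v : 'I_n.+2 -> R, (forall i, [/\ 0 < u i, u i < v i, v i <= 1 & v i - u i <= ka0 * u i]) ->
  forall N, (0 < N)%N -> exists k : {ffun 'I_n.+2 -> 'I_N} -> R,
  [/\ \sum_g `|k g| <= K2 / Num.sqrt (\prod_i (v i - u i)),
    \forall p \ae mu, (toV @^-1` box (xl c u v) (xr c u v)) p ->
      `|f (toV p) - monomials toV (xl c u v) (xr c u v) k p| <= K2 / Num.sqrt (\prod_i (v i - u i)) * 2^-1 ^+ N &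
    forall i, \forall p \ae mu, (toV @^-1` box (xl c u v) (xr c u v)) p ->
      `|D (unit_mi i) (toV p) - dmonomials toV (xl c u v) (xr c u v) k i p| <=
        K2 / Num.sqrt (\prod_i (v i - u i)) / (v i - u i) * 2^-1 ^+ N].
Local Notation Df := (fun i => D (unit_mi i)).

Lemma polyVE l r N (k : {ffun 'I_n.+2 -> 'I_N} -> R) p : polyV l r k (toV p) = monomials toV l r k p.
Proof.
apply: eq_bigr => g _; congr (_ * _); rewrite /polprod; apply: eq_bigr => i _.
by rewrite hornerXn.
Qed.

(** A patch from t_(k+1) to t_(k-1) has relative width 1/s^2 - 1, which must not exceed the width
    allowed by [hpatch]. With 1/s = 1 + ka and ka <= 1 this is 2 ka + ka^2 <= 3 ka. *)
Lemma mesh_ratio : exists s, [/\ 0 < s, s < 1 & s^-1 ^+ 2 - 1 <= ka0].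
Proof.
pose ka := Num.min ka0 1 / 3; exists (1 + ka)^-1.
have m0 : 0 < Num.min ka0 1 by rewrite lt_min ka00 ltr01.
have k0 : 0 < ka by rewrite divr_gt0.
have k1 : ka <= 1 by rewrite ler_pdivrMr// mul1r (@le_trans _ _ 1)// ?ge_min ?lexx ?orbT// ler1n.
have k3 : 3 * ka <= ka0 by rewrite /ka mulrC divfK// ge_min lexx.
have k2 : ka * ka <= ka by rewrite ler_piMl// ltW.
have p0 : 0 < 1 + ka by rewrite addr_gt0.
split; [by rewrite invr_gt0|by rewrite invf_lt1// ltrDl|].
have e : (1 + ka) * (1 + ka) = 1 + 2 * ka + ka * ka by ring.
by rewrite invrK expr2 e; lra.
Qed.

Section Mesh.
Variable s : R.
Hypothesis s0 : 0 < s.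
Hypothesis s1 : s < 1.
Hypothesis ska : s^-1 ^+ 2 - 1 <= ka0.
Local Notation t_ := (tk s).

Lemma mesh_patch l k : (k <= l)%N ->
  [/\ 0 < t_ k.+1, t_ k.+1 < t_ k.-1, t_ k.-1 <= 1, t_ k.-1 - t_ k.+1 <= ka0 * t_ k.+1 & (gap_inv s l)^-1 <= t_ k.-1 - t_ k.+1].
Proof.
move=> kl; have tp : 0 < t_ k.+1 by exact: tk_gt0.
have h := tk_le s0 s1 (leq_pred k); have h1 := tk_lt s0 s1 k.
split=> //; first exact: lt_le_trans h1 h; first exact: tk_le1.
  apply: (@le_trans _ _ ((s^-1 ^+ 2 - 1) * t_ k.+1)); last by rewrite ler_pM2r.
  rewrite mulrBl mul1r lerD2r; case: k {kl h h1} tp => [|k] tp /=.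
    rewrite /tk expr0 expr1 expr2 -mulrA mulVf ?gt_eqF// mulr1 invf_ge1//; exact: ltW.
  have e : s^-1 ^+ 2 * (s * (s * t_ k)) = t_ k by rewrite expr2; field; rewrite gt_eqF.
  by rewrite !tkS e.
rewrite /gap_inv invrK; have := tk_gap s0 s1 kl; lra.
Qed.

Lemma patch_family l q : exists kk : {ffun 'I_n.+2 -> 'I_l.+1} -> {ffun 'I_n.+2 -> 'I_(2 ^ q).+1} -> R, forall k,
  [/\ \sum_g `|kk k g| <= K2 * gap_inv s l ^+ n.+2,
    \forall p \ae mu, (toV @^-1` box (pl c s k) (pr c s k)) p -> `|f (toV p) - Pk c s kk k (toV p)| <= e1_of n s K2 l q &
    forall i, \forall p \ae mu, (toV @^-1` box (pl c s k) (pr c s k)) p -> `|Df i (toV p) - dPk c s kk k i (toV p)| <= e1_of n s K2 l q].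
Proof.
have g1 := gap_inv_ge1 s0 s1 l; have g0 : 0 < gap_inv s l by apply: lt_le_trans g1.
suff h (k : {ffun 'I_n.+2 -> 'I_l.+1}) : exists k' : {ffun 'I_n.+2 -> 'I_(2 ^ q).+1} -> R,
  [/\ \sum_g `|k' g| <= K2 * gap_inv s l ^+ n.+2,
    \forall p \ae mu, (toV @^-1` box (pl c s k) (pr c s k)) p -> `|f (toV p) - polyV (pl c s k) (pr c s k) k' (toV p)| <= e1_of n s K2 l q &
    forall i, \forall p \ae mu, (toV @^-1` box (pl c s k) (pr c s k)) p -> `|Df i (toV p) - dpolyV (pl c s k) (pr c s k) k' i (toV p)| <= e1_of n s K2 l q].
  by have [kk hkk] := choice h; exists kk.
have kl i : (k i <= l)%N by rewrite -ltnS.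
have hm i := mesh_patch (kl i).
have hu i : [/\ 0 < up s k i, up s k i < vp s k i, vp s k i <= 1 & vp s k i - up s k i <= ka0 * up s k i].
  by have [] := hm i.
have [k' [h1 h2 h3]] := hpatch hu (ltn0Sn (2 ^ q)).
have gi i : 0 < vp s k i - up s k i by have [_ h _ _] := hu i; rewrite subr_gt0.
have gg i : (vp s k i - up s k i)^-1 <= gap_inv s l.
  by have [_ _ _ _ h] := hm i; rewrite invf_ple ?posrE ?gi//; exact: h.
set X := \prod_i _ in h1 h2 h3.
have X0 : 0 < X by exact: prodr_gt0.
have X1 : X <= 1.
  apply: prodr_ile1 => i _; rewrite (ltW (gi i))/=; have [h _ h' _] := hu i; lra.
have XK : K2 / Num.sqrt X <= K2 * gap_inv s l ^+ n.+2.
  rewrite ler_pM2l//; apply: (@le_trans _ _ X^-1).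
    rewrite lef_pV2 ?posrE ?sqrtr_gt0// -[leLHS]sqr_sqrtr ?(ltW X0)// expr2 ler_piMl ?sqrtr_ge0//.
    by rewrite -sqrtr1 ler_wsqrtr.
  rewrite -prodfV; apply: (@le_trans _ _ (\prod_(i < n.+2) gap_inv s l)).
    by apply: ler_prod => i _; rewrite invr_ge0 (ltW (gi i))/=.
  by rewrite prodr_const card_ord.
have hh : 0 <= 2^-1 ^+ (2 ^ q).+1 :> R by apply: exprn_ge0; rewrite invr_ge0.
have KX : 0 <= K2 * gap_inv s l ^+ n.+2 by rewrite mulr_ge0 ?exprn_ge0// ltW.
exists k'; split=> [|/=|i /=]; first exact: le_trans XK.
  apply: filterS h2 => p h bp; rewrite polyVE.
  apply: le_trans (h bp) _.
  rewrite /e1_of [_ ^+ n.+3]exprSr; apply: ler_wpM2r => //; apply: le_trans XK _.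
  by rewrite mulrA ler_peMr.
apply: filterS (h3 i) => p h bp; rewrite -[dpolyV _ _ _ _ _]/(dmonomials toV (pl c s k) (pr c s k) k' i p).
apply: le_trans (h bp) _.
rewrite /e1_of [_ ^+ n.+3]exprSr; apply: ler_wpM2r => //; rewrite mulrA.
by apply: ler_pM => //; [rewrite divr_ge0 ?sqrtr_ge0// ltW|rewrite invr_ge0 ltW].
Qed.

Lemma network_family : exists (K1 K3 K4 : nat) (B : R), [/\ (0 < K1)%N, (0 < K3)%N, 0 < B & forall N q, (0 < N)%N ->
  (K3 * N <= 2 ^ q <= 2 * (K3 * N))%N -> exists Phi : NN R n.+2 1,
  [/\ forall eps, B * (2^-1 ^+ N) ^+ 2 <= eps ^+ 2 -> H1_le mu toV (@cube R n.+2) (fun x => f x - realize1 Phi x) eps,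
    forall x, cube x -> `|realize1 Phi x| <= Cr + 1,
    (nn_depth Phi <= (2 + (q + n.+4) * (K4 * N + 3)).+1)%N &
    (nn_size Phi <= 8 * (n.+2 * (K1 * N).+1 * 4) + 8 * (n.+2 * (K1 * N).+1 * 2 + n.+2 * (K1 * N).+1) +
       24 * (K4 * N + 3) * ((q + 1) * (n.+2 * (K1 * N).+1 * (2 ^ q + 2)) +
         n.+3 * (((K1 * N).+1 * (2 ^ q + 1)) ^ n.+2 + n.+2 * (K1 * N).+1 * (2 ^ q + 1)))
       + ((K1 * N).+1 * (2 ^ q).+1) ^ n.+2)%N]].
Proof.
(* The strips contribute rho^l to the squared error; rho^K1 <= 1/4 makes this at most (2^-N)^2 for l
   = K1 N. *)
have [K1 K10 hK1] : exists2 K1, (0 < K1)%N & rho s de ^+ K1 <= 2^-1 ^+ 2.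
  have /andP[r0 r1] := rho01 s0 s1 de01.
  have q0 : 0 < 2^-1 ^+ 2 :> R by rewrite exprn_gt0// invr_gt0.
  have nr : `|rho s de| < 1 by rewrite gtr0_norm.
  have [m _ hm] := cvgr_lt _ (cvg_expr nr) _ q0.
  by exists m.+1 => //; apply/ltW/(hm m.+1)/leqnSn.
have [K3 [K4 [K30 hrate]]] := error_rates n s0 s1 K20 K1.
pose B := n.+3%:R * (1 + (2 * Cr / s + 1) ^+ 2 * (n.+2%:R * Cb s de ^+ n.+2)).
have Cb0 := Cb_gt0 s0 s1 de01.
have Cs0 : 0 < Cr / s by rewrite divr_gt0.
exists K1, K3, K4, B; split=> //.
  apply: mulr_gt0; first by rewrite ltr0n.
  by rewrite ltr_wpDr// mulr_ge0 ?sqr_ge0// mulr_ge0// exprn_ge0// ltW.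
move=> N q N0 hq; have [m6 he] := hrate N q N0 hq.
set l := (K1 * N)%N in he *; set m := (K4 * N)%N in m6 he *.
have l0 : (0 < l)%N by rewrite muln_gt0 K10.
have [kk hkk] := patch_family l q.
have g1 := gap_inv_ge1 s0 s1 l; have g0 : 0 < gap_inv s l by apply: lt_le_trans g1.
have Bc0 : 0 <= K2 * gap_inv s l ^+ n.+2 by rewrite mulr_ge0 ?exprn_ge0// ltW.
have [Phi [hn hd hs]] := network c s0 s1 Bc0 (fun k => let: And3 h _ _ := hkk k in h) m6.
have e10 : 0 < e1_of n s K2 l q.
  by rewrite /e1_of; apply: mulr_gt0; [apply: mulr_gt0 => //|]; apply: exprn_gt0 => //; rewrite invr_gt0.
have L0 : 0 <= (2 ^+ q + 1) * Sb s l.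
  by rewrite mulr_ge0 ?addr_ge0 ?exprn_ge0// ltW// Sb_gt0.
have eta0 : 0 <= eta_of n s K2 l q m.
  rewrite /eta_of; apply: mulr_ge0; first by rewrite mulr_ge0.
  by apply: mulr_ge0; apply: exprn_ge0; rewrite ?divr_ge0.
have Ku0 := Ku_ge0 n l s0 s1 e10.
have Le0 : 0 <= L_of s l q * eta_of n s K2 l q m by rewrite mulr_ge0.
have htg x : cube x -> target c s kk x = uh c s kk x by move=> cx; exact: target_uh.
have hP k := let: And3 _ h _ := hkk k in h.
have hdP k := let: And3 _ _ h := hkk k in h.
have h1 : 2^-1 ^+ N <= 1 :> R by apply: exprn_ile1; rewrite ?invr_ge0// invf_le1// ler1n.
exists Phi; split=> //.
- move=> eps heps; apply: (H1_error H cc de01 Cr0 hreg s0 s1 l0 e10 hP hdP (fun i => wD (unit_mi i)) fL2 L0 eta0 htg hn (lexx _)).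
  apply: le_trans heps; rewrite -/(eta_of n s K2 l q m) -/(L_of s l q).
  set e2 := _ + _ + _ + _ in he *; set h := 2^-1 ^+ N in he h1 *.
  have e20 : 0 <= e2 by rewrite /e2; lra.
  have h0 : 0 <= h by apply: le_trans he.
  rewrite /B -[leRHS]mulrA; apply: ler_wpM2l; first exact: ler0n.
  rewrite [leRHS](mulrDl 1) mul1r; apply: lerD; first exact: lerXn2r.
  rewrite -[leRHS]mulrA; apply: ler_pM.
  - exact: sqr_ge0.
  - have /andP[r0 r1] := rho01 s0 s1 de01.
    by apply: mulr_ge0; [exact: ler0n|apply: mulr_ge0; apply: exprn_ge0; exact: ltW].
  - have h3 : 0 <= 2 * Cr / s by rewrite -mulrA mulr_ge0// ltW.
    apply: lerXn2r; rewrite ?nnegrE; [exact: addr_ge0|exact: addr_ge0|].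
    by rewrite lerD2l; exact: le_trans h1.
  rewrite -mulrA; apply: ler_wpM2l => //; apply: ler_wpM2l; first by rewrite exprn_ge0// ltW.
  have -> : h ^+ 2 = (2^-1 ^+ 2) ^+ N by rewrite /h -!exprM mulnC.
  have /andP[r0 r1] := rho01 s0 s1 de01.
  by rewrite /l exprM; apply: lerXn2r; rewrite ?nnegrE ?exprn_ge0 ?invr_ge0 ?(ltW r0).
- move=> x cx; have := realize_bound (f := f) (Df := Df) H cc hreg s0 s1 l0 hP htg hn cx.
  by rewrite -/(eta_of n s K2 l q m) => /le_trans; apply; lra.
Qed.

End Mesh.
End Family.

Section Asymptotics.
Context {R : realType}.
Variables (n K1 K3 K4 : nat) (B Cr : R).
Hypothesis K30 : (0 < K3)%N.
Hypothesis B0 : 0 < B.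
Hypothesis Cr0 : 0 < Cr.

Definition depth_bound (N q : nat) : nat := (2 + (q + n.+4) * (K4 * N + 3)).+1.
Definition size_bound (N q : nat) : nat :=
  (8 * (n.+2 * (K1 * N).+1 * 4) + 8 * (n.+2 * (K1 * N).+1 * 2 + n.+2 * (K1 * N).+1) +
   24 * (K4 * N + 3) * ((q + 1) * (n.+2 * (K1 * N).+1 * (2 ^ q + 2)) +
     n.+3 * (((K1 * N).+1 * (2 ^ q + 1)) ^ n.+2 + n.+2 * (K1 * N).+1 * (2 ^ q + 1)))
   + ((K1 * N).+1 * (2 ^ q).+1) ^ n.+2)%N.

(** The leading term is the number of layers per multiplication, of order N, times ((K1
    N)(2^q))^(n+2), of order N^(2(n+2)). *)
Lemma size_bound_le : exists K6 : nat, forall N q, (0 < N)%N -> (2 ^ q <= 2 * (K3 * N))%N ->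
  (size_bound N q <= K6 * N ^ (2 * n.+2).+1)%N.
Proof.
have aux z : (8 * (z * 4) + 8 * (z * 2 + z) = 56 * z)%N by lia.
pose c1 := K1.+1; pose c2 := (2 * K3 + 2)%N; pose c3 := (K4 + 3)%N.
pose A' := (n.+2 * c1 * c2 * c2)%N; pose B' := ((c1 * c2) ^ n.+2)%N; pose C' := (n.+2 * (c1 * c2))%N; pose X' := (n.+2 * c1)%N.
exists (56 * X' + 24 * c3 * (A' + n.+3 * (B' + C')) + B')%N => N q N0 q2; rewrite /size_bound.
set l1 := (K1 * N).+1; set m3 := (K4 * N + 3)%N; set Y := (N ^ (2 * n.+2))%N.
have hl : (l1 <= c1 * N)%N by rewrite /l1 /c1; lia.
have hm : (m3 <= c3 * N)%N by rewrite /m3 /c3 mulnDl leq_add2l leq_pmulr.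
have h2 : (2 ^ q + 2 <= c2 * N)%N.
  by rewrite /c2 mulnDl -mulnA; apply: leq_add => //; rewrite leq_pmulr.
have hq : (q + 1 <= c2 * N)%N by apply: leq_trans h2; have := ltn_expl q (leqnn 2); lia.
have hY k : (k <= 2 * n.+2)%N -> (N ^ k <= Y)%N by move=> hk; rewrite /Y leq_pexp2l.
have Y1 : (N <= Y)%N by rewrite -{1}(expn1 N); exact: hY.
have Y2 : (N * N <= Y)%N by rewrite mulnn; exact: hY.
have Y3 : (N * N * N <= Y)%N by rewrite -{1}(expn1 N) -!expnSr; apply: hY; lia.
have hX : (n.+2 * l1 <= X' * N)%N by rewrite /X' -mulnA leq_mul2l hl orbT.
have hXY : (n.+2 * l1 <= X' * (N * Y))%N.
  by apply: leq_trans hX _; rewrite leq_mul2l leq_pmulr ?orbT// /Y expn_gt0 N0.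
have hA : ((q + 1) * (n.+2 * l1 * (2 ^ q + 2)) <= A' * Y)%N.
  apply: leq_trans (leq_mul hq (leq_mul hX h2)) _.
  rewrite (_ : c2 * N * (X' * N * (c2 * N)) = A' * (N * N * N))%N; first by rewrite leq_mul2l Y3 orbT.
  by rewrite /A' /X'; ring.
have hLq : (l1 * (2 ^ q + 1) <= c1 * c2 * (N * N))%N.
  by rewrite -mulnACA; apply: leq_mul => //; apply: leq_trans h2; rewrite leq_add2l.
have hLq' : (l1 * (2 ^ q).+1 <= c1 * c2 * (N * N))%N by rewrite -addn1.
have NND : ((N * N) ^ n.+2 = Y)%N by rewrite mulnn -expnM.
have hB : ((l1 * (2 ^ q + 1)) ^ n.+2 <= B' * Y)%N by rewrite /B' -NND -expnMn leq_exp2r.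
have hB' : ((l1 * (2 ^ q).+1) ^ n.+2 <= B' * (N * Y))%N.
  apply: (@leq_trans (B' * Y)); first by rewrite /B' -NND -expnMn leq_exp2r.
  by rewrite leq_mul2l leq_pmull ?orbT.
have hC : (n.+2 * l1 * (2 ^ q + 1) <= C' * Y)%N.
  apply: (@leq_trans (C' * (N * N))); last by rewrite leq_mul2l Y2 orbT.
  by rewrite /C' -mulnA -mulnA leq_mul2l hLq orbT.
have hT : (24 * m3 * ((q + 1) * (n.+2 * l1 * (2 ^ q + 2)) + n.+3 * ((l1 * (2 ^ q + 1)) ^ n.+2 + n.+2 * l1 * (2 ^ q + 1))) <=
    24 * c3 * (A' + n.+3 * (B' + C')) * (N * Y))%N.
  apply: (@leq_trans (24 * (c3 * N) * (A' * Y + n.+3 * (B' * Y + C' * Y)))).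
    by apply: leq_mul; [rewrite leq_mul2l hm|apply: leq_add => //; rewrite leq_mul2l; apply/orP; right; exact: leq_add].
  by rewrite leq_eqVlt; apply/orP; left; apply/eqP; ring.
have h56 : (8 * (n.+2 * l1 * 4) + 8 * (n.+2 * l1 * 2 + n.+2 * l1) <= 56 * X' * (N * Y))%N.
  by rewrite aux -mulnA leq_mul2l hXY.
by apply: leq_trans (leq_add (leq_add h56 hT) hB') _; rewrite -!mulnDl expnS.
Qed.

(** The truncation plus one exceeds log_2(1/eps), so this part of N already gives 2^-N <= eps; the
    shift b with B <= 2^b absorbs the constant of the error bound. *)
Definition num_of (b : nat) (eps : R) : nat := (b + (Num.truncn (- ln eps / ln 2)).+1)%N.

Lemma ln2_gt0 : 0 < ln 2 :> R. Proof. by apply: ln_gt0; rewrite ltr1n. Qed.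

Lemma num_of_rate b eps : B <= 2 ^+ b -> 0 < eps < 1 -> B * (2^-1 ^+ num_of b eps) ^+ 2 <= eps ^+ 2.
Proof.
move=> hb /andP[e0 e1]; rewrite /num_of exprD; set k := (Num.truncn _).+1; set hb2 := 2^-1 ^+ b; set hk := 2^-1 ^+ k.
have b1 : 1 <= 2 ^+ b :> R by apply: exprn_ege1; rewrite ler1n.
have hk0 : 0 <= hk by apply: exprn_ge0; rewrite invr_ge0.
have hb0 : 0 <= hb2 by apply: exprn_ge0; rewrite invr_ge0.
have bb : 2 ^+ b * hb2 = 1 by rewrite /hb2 exprVn mulfV// gt_eqF// exprn_gt0.
have hb1 : hb2 <= 1 by rewrite -bb ler_peMl.
have he : hk <= eps.
  rewrite /hk exprVn -[leRHS]lnK ?posrE// exprn_expR// -expRN ler_expR lerNl -ler_pdivrMr ?ln2_gt0//.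
  by apply/ltW; exact: truncnS_gt.
have -> : B * (hb2 * hk) ^+ 2 = B * hb2 * hb2 * hk ^+ 2 by rewrite exprMn expr2; ring.
apply: (@le_trans _ _ (1 * hk ^+ 2)); last by rewrite mul1r lerXn2r// nnegrE// ltW.
apply: ler_wpM2r; first exact: sqr_ge0.
apply: (@le_trans _ _ (2 ^+ b * hb2 * hb2)); last by rewrite bb mul1r.
by rewrite -!mulrA ler_wpM2r// mulr_ge0.
Qed.

Lemma asymptotic_choice : exists (Nf qf : R -> nat) (K eps0 : R), [/\ 0 < eps0,
  forall eps, 0 < eps < 1 -> [/\ (0 < Nf eps)%N, (K3 * Nf eps <= 2 ^ qf eps <= 2 * (K3 * Nf eps))%N & B * (2^-1 ^+ Nf eps) ^+ 2 <= eps ^+ 2] &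
  forall eps, 0 < eps < eps0 -> [/\ eps < 1, Cr + 1 <= K * `|ln eps| ^+ (2 * n.+2),
    (size_bound (Nf eps) (qf eps))%:R <= K * `|ln eps| ^+ (2 * n.+2).+1 &
    (depth_bound (Nf eps) (qf eps))%:R <= K * `|ln eps| * ln `|ln eps| ]].
Proof.
have [b hb] := pow2_ge B; have [K6 hK6] := size_bound_le; have l2 := ln2_gt0.
(* 2^q is the least power of two above K3 N, hence at most 2 K3 N. *)
pose Nf := num_of b; pose qf eps := (trunc_log 2 (K3 * Nf eps)).+1.
have N0 eps : (0 < Nf eps)%N by rewrite /Nf /num_of addnS.
have hq eps : (K3 * Nf eps <= 2 ^ qf eps <= 2 * (K3 * Nf eps))%N.
  have KN : (0 < K3 * Nf eps)%N by rewrite muln_gt0 K30 N0.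
  have /andP[h1 h2] := trunc_log_bounds (leqnn 2) KN.
  by rewrite (ltnW h2)/= expnS leq_mul2l h1.
pose K5 : R := b%:R + (ln 2)^-1 + 1.
have K50 : 0 < K5 by rewrite /K5 ltr_wpDl// addr_ge0// invr_ge0 ltW.
pose K7 : R := (`|ln (2 * K3%:R * K5)| + 1) / ln 2.
have K70 : 0 <= K7 by rewrite /K7 divr_ge0 ?addr_ge0// ltW.
pose Ks : R := K6%:R * K5 ^+ (2 * n.+2).+1.
pose Kd : R := 3 + (K7 + n.+4%:R) * ((K4 + 3)%:R * K5).
have Ks0 : 0 <= Ks by rewrite mulr_ge0// exprn_ge0// ltW.
have Kd0 : 0 <= Kd by apply: addr_ge0 => //; apply: mulr_ge0; [exact: addr_ge0|apply: mulr_ge0 => //; exact: ltW].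
have S0 : 0 <= Ks + Kd by exact: addr_ge0.
have C0 : 0 <= Cr + 1 by rewrite addr_ge0// ltW.
(* Below exp(-e) one has |ln eps| > e, hence ln |ln eps| >= 1; constants and lower order terms are
   then absorbed by the stated rates. *)
exists Nf, qf, (Ks + Kd + (Cr + 1)), (expR (- expR 1)); split; first exact: expR_gt0.
  by move=> eps he; split=> //; exact: num_of_rate.
move=> eps /andP[e0 e1].
have L1 : expR 1 < - ln eps by rewrite ltrNr -(expRK (- expR 1)) ltr_ln ?posrE ?expR_gt0.
have ex1 : 1 <= expR 1 :> R by rewrite -expR0 ler_expR.
have eps1 : eps < 1 by apply: lt_le_trans e1 _; rewrite -expR0 ler_expR oppr_le0 expR_ge0.
have LE : `|ln eps| = - ln eps by rewrite ler0_norm// ltW// ln_lt0// e0.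
rewrite LE; set La := - ln eps in L1 *.
have La1 : 1 <= La by apply: le_trans (ltW L1).
have La0 : 0 < La by apply: lt_le_trans La1.
have lnLa : 1 <= ln La by rewrite -[leLHS]expRK ler_ln ?posrE ?expR_gt0// ltW.
have NK : (Nf eps)%:R <= K5 * La.
  rewrite /Nf /num_of addnS -natr1 natrD /K5 !mulrDl mul1r -/La.
  apply: lerD => //; apply: lerD; first by rewrite ler_peMr.
  by rewrite [leRHS]mulrC truncn_le divr_ge0// ltW.
have LX k : 1 <= La ^+ k by exact: exprn_ege1.
split=> //.
- apply: (@le_trans _ _ ((Ks + Kd + (Cr + 1)) * 1)); first by rewrite mulr1 lerDr.
  by apply: ler_wpM2l => //; exact: addr_ge0.
- apply: (@le_trans _ _ (Ks * La ^+ (2 * n.+2).+1)); last first.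
    by apply: ler_wpM2r; [exact: le_trans (LX _)|rewrite -addrA lerDl addr_ge0].
  have /andP[_ q2] := hq eps; have := hK6 _ _ (N0 eps) q2; rewrite -(ler_nat R) natrM natrX => /le_trans; apply.
  by rewrite /Ks -mulrA -exprMn; apply: ler_wpM2l => //; apply: lerXn2r; rewrite ?nnegrE ?ler0n// mulr_ge0// ltW.
apply: (@le_trans _ _ (Kd * La * ln La)); last first.
  apply: ler_wpM2r; first exact: le_trans lnLa.
  by apply: ler_wpM2r; [exact: ltW|rewrite [Ks + _]addrC -addrA lerDl addr_ge0].
have qK : (qf eps)%:R <= K7 * ln La.
  rewrite /K7 mulrAC ler_pdivlMr//.
  have -> : (qf eps)%:R * ln 2 = ln (2 ^+ qf eps) :> R by rewrite exprn_expR// expRK.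
  have /andP[_ q2] := hq eps.
  have KK0 : 0 < 2 * K3%:R * K5 by rewrite mulr_gt0// mulr_gt0// ltr0n.
  apply: (@le_trans _ _ (ln (2 * K3%:R * K5 * La))).
    rewrite ler_ln ?posrE ?exprn_gt0 ?mulr_gt0 ?ltr0n//.
    apply: (@le_trans _ _ (2 * (K3%:R * (Nf eps)%:R))); first by rewrite -natrX -natrM -natrM ler_nat.
    by rewrite -[leRHS]mulrA -!mulrA; apply: ler_wpM2l => //; apply: ler_wpM2l.
  rewrite lnM ?posrE// [leRHS]mulrDl [X in _ <= _ + X]mul1r lerD2r; apply: le_trans (ler_norm _) _.
  by rewrite ler_peMr.
rewrite /depth_bound -addSn natrD natrM.
have m3 : (K4 * Nf eps + 3)%:R <= (K4 + 3)%:R * K5 * La.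
  apply: (@le_trans _ _ ((K4 + 3)%:R * (Nf eps)%:R)); first by rewrite -natrM ler_nat mulnDl leq_add2l leq_pmulr.
  by rewrite -mulrA; apply: ler_wpM2l.
have q4 : (qf eps + n.+4)%:R <= (K7 + n.+4%:R) * ln La.
  by rewrite natrD mulrDl; apply: lerD => //; rewrite ler_peMr.
have L3 : 1 <= La * ln La by apply: mulr_ege1.
rewrite /Kd; apply: (@le_trans _ _ (3 * (La * ln La) + (K7 + n.+4%:R) * ln La * ((K4 + 3)%:R * K5 * La))); last first.
  by rewrite le_eqVlt; apply/orP; left; apply/eqP; ring.
apply: lerD; first by rewrite ler_peMr.
by apply: ler_pM.
Qed.

End Asymptotics.

(** * Assembly at one corner, for both dimensions at once *)

Section Corner.
Context {R : realType} {d : measure_display} {P : measurableType d}.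
Variables (mu : {measure set P -> \bar R}) (n : nat) (toV : P -> 'rV[R]_n.+2).
Hypothesis H : leb_like mu toV.
Local Notation V := 'rV[R]_n.+2.
Variables (E : finType) (edges : V -> E -> set V) (edir : E -> 'I_n.+2) (gmin : R).
Hypothesis n2 : (n <= 2)%N.
Hypothesis gmin0 : 0 <= gmin.
Hypothesis edgeE : forall c e x, is_corner c -> cube x -> r_e (edges c) e x = reE edir c e x.
Hypothesis im2 : forall (c x : V), is_corner c -> cube x -> E ->
  exists2 j, j != [arg max_(i > ord0) cdist c x i]%O & mid (cdist c x) <= cdist c x j.
Hypothesis wbounds : forall (c : V) de, is_corner c -> 0 < de <= 4^-1 -> weight_bounds c (weight c (gmin + de) de) de.

Theorem corner_approximation : Thm43_statement mu toV edges edir gmin.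
Proof.
(* The bound eh <= 1/2 is what lets [region_weight] decide the direction of an edge seen under a
   small angle. *)
move=> c cc; exists 2^-1; split=> [|eh /andP[eh0 eh1]]; first by rewrite invr_gt0.
move=> gc ge Cf Af Cf0 Af0 hgc hge f [fL2 [D [wD JD]]].
(* One exponent serves all bounds: at most 1/4, gc - gmin and every ge e - 1. The initial value 1 of
   the minimum covers the case without edges. *)
pose de := Num.min (Num.min 4^-1 (gc - gmin)) (\big[Num.min/1]_e (ge e - 1)).
have de01 : 0 < de <= 4^-1.
  apply/andP; split; last by rewrite /de !ge_min lexx.
  rewrite !lt_min subr_gt0 hgc invr_gt0 ltr0n/=; apply/bigmin_gtP; split=> // e _.
  by rewrite subr_gt0.
have d1 : gmin + de <= gc by rewrite -lerBrDl /de !ge_min lexx orbT.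
have d2 e : 1 + de <= ge e.
  by rewrite -lerBrDl /de ge_min; apply/orP; right; exact: bigmin_le_cond.
have hWB := wbounds cc de01; have /andP[d0 _] := de01.
have mD a : measurable_on toV (@cube R n.+2) (D a) by have [_ [mDa _] _] := wD a.
have C00 : 0 <= 2 / eh by rewrite divr_ge0// ltW.
have edE e x : cube x -> r_e (edges c) e x = reE edir c e x by exact: edgeE.
have hW r x a : reg_set (edges c) c eh r x -> 1 <= (2 / eh) ^+ mabs a * weight c (gmin + de) de a x * reg_wt edir c gc ge r a x.
  move=> hr; have cx := reg_set_cube hr.
  apply: (region_weight n2 cc cx edE (im2 cc cx)) => //; first by rewrite eh0 ltW.
  - exact: ltW.
  - by rewrite addr_ge0// ltW.
pose A := Num.max 1 (2 / eh * Af); pose K := #|{: region E}|.+1%:R * Cf.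
have A1 : 1 <= A by rewrite /A le_max lexx.
have A0 : 0 <= A := le_trans ler01 A1.
have K0 : 0 < K by rewrite mulr_gt0// ltr0n.
have HL2 l r a w : (forall i, l i < r i) -> (forall i, 0 <= l i) -> (forall i, r i <= 1) -> 0 <= w ->
    (forall x, box l r x -> weight c (gmin + de) de a x <= w) ->
    (\int[mu]_(p in toV @^-1` box l r) (D a (toV p) ^+ 2)%:E <= ((K * A ^+ mabs a * (mabs a)`!%:R * w) ^+ 2)%:E)%E.
  move=> lr l0 r1 w0 hw.
  have := weighted_L2 H eh0 cc edE Cf0 Af0 mD JD C00 hW lr l0 r1 w0 hw => h; apply: le_trans h _.
  have p1 : 0 <= (2 / eh) ^+ mabs a by apply: exprn_ge0.
  have p2 : 0 <= bnd Cf Af (mabs a) by apply: bnd_ge0.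
  have p3 : 0 <= Af ^+ mabs a by apply/exprn_ge0/ltW.
  rewrite lee_fin; apply: lerXn2r; rewrite ?nnegrE.
  - by apply: mulr_ge0 => //; apply: mulr_ge0 => //; exact: mulr_ge0.
  - by rewrite !mulr_ge0// ?exprn_ge0// ?ltW// (lt_le_trans ltr01).
  have hA : (2 / eh) ^+ mabs a * Af ^+ mabs a <= A ^+ mabs a.
    rewrite -exprMn; apply: lerXn2r; rewrite ?nnegrE ?(mulr_ge0 C00) ?(ltW Af0)//.
    by rewrite /A le_max lexx orbT.
  have hR : #|{: region E}|%:R <= #|{: region E}|.+1%:R :> R by rewrite ler_nat.
  rewrite /bnd /K.
  have -> : #|{: region E}|%:R * ((2 / eh) ^+ mabs a * w) * (Cf * Af ^+ mabs a * (mabs a)`!%:R) =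
    (#|{: region E}|%:R * Cf) * ((2 / eh) ^+ mabs a * Af ^+ mabs a) * ((mabs a)`!%:R * w) by ring.
  rewrite -[leRHS]mulrA; apply: ler_wpM2r; first by rewrite mulr_ge0.
  by apply: ler_pM => //; [rewrite mulr_ge0// ltW|rewrite mulr_ge0|rewrite ler_wpM2r// ltW].
have [Cr Cr0 hreg] := low_regularity H cc wD fL2 K0 A1 de01 hWB HL2.
have [K2 [ka0 [K20 ka00 hpatch]]] := patch_expansion H cc wD fL2 K0 A1 hWB HL2.
have [s [s0 s1 ska]] := mesh_ratio ka00.
have [K1 [K3 [K4 [B [K10 K30 B0 hfam]]]]] := network_family H cc wD fL2 de01 Cr0 hreg K20 hpatch s0 s1 ska.
have [Nf [qf [Kc [eps0 [e00 hN has]]]]] := asymptotic_choice n K1 K4 K30 B0 Cr0.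
have hPhi (eps : R) : exists Phi : NN R n.+2 1, 0 < eps < 1 ->
    [/\ H1_le mu toV (@cube R n.+2) (fun x => f x - realize1 Phi x) eps,
      forall x, cube x -> `|realize1 Phi x| <= Cr + 1,
      (nn_depth Phi <= depth_bound n K4 (Nf eps) (qf eps))%N &
      (nn_size Phi <= size_bound n K1 K4 (Nf eps) (qf eps))%N].
  (* Outside (0, 1) nothing is claimed, and the zero network fills in. *)
  have [he|he] := boolP (0 < eps < 1); last by exists (NNlast 0 0).
  have [h1 h2 h3] := hN eps he; have [Phi [p1 p2 p3 p4]] := hfam _ _ h1 h2.
  by exists Phi => _; split=> //; exact: p1.
have [Phi hP] := choice hPhi.
exists Phi; split=> [eps /hP[]//|].
exists Kc, eps0; split=> // eps he; have [e1 k1 k2 k3] := has eps he.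
have /hP[_ p2 p3 p4] : 0 < eps < 1 by have /andP[-> _] := he.
split=> [x /p2 h||]; first exact: le_trans h k1.
- by apply: le_trans k2; rewrite ler_nat.
- by apply: le_trans k3; rewrite ler_nat.
Qed.

End Corner.

(* Theorem 4.3, for d = 2 (one corner, no edges, gamma_c > 1) and
   d = 3 (one corner, its three adjacent edges, gamma_c > 3/2, gamma_e > 1). *)
Theorem theorem4p3 (R : realType) :
  Thm43_statement (@leb2 R) (@toV2 R) (@no_edges R) no_edir 1 /\
  Thm43_statement (@leb3 R) (@toV3 R) (@edges3 R) edir3 (3 / 2).
Proof.
split.
- apply: (corner_approximation (leb_like2 R)) => //.
  by move=> c de cc; exact: weight_bounds2.
- apply: (corner_approximation (leb_like3 R)) => //.
  + by move=> c e x cc cx; exact: edges3E.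
  + by move=> c x cc cx _; have [] := side3 cc cx.
  + by move=> c de cc; exact: weight_bounds3.
Qed.
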